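(* Let $a>0$. The distribution $A_a(x)=\frac{\sqrt a}2(1+\mathcal H)(\phi_a^+\mathbf 1_{0<x<\infty})$, where $\phi_a^+(x)+\int_0^aJ_0(2\sqrt{xy})\phi_a^+(y)\,dy=J_0(2\sqrt{ax})$, is the difference of boundary values $G_A(x+i0)-G_A(x-i0)$ of the function $$G_A(z)=\sqrt a\,\frac1{2\pi i}\int_0^\infty\frac12\Big(1+\frac1t\Big)e^{zt-a(t+\frac1t)}\,dt=\sqrt a\,\frac1{2\pi i}\Big(\sqrt{\tfrac a{a-z}}\;K_1(2\sqrt{a(a-z)})+K_0(2\sqrt{a(a-z)})\Big).$$ The distribution $-iB_a(x)=\frac{\sqrt a}2(-1+\mathcal H)(\phi_a^-\mathbf 1_{0<x<\infty})$, where $\phi_a^-(x)-\int_0^aJ_0(2\sqrt{xy})\phi_a^-(y)\,dy=J_0(2\sqrt{ax})$, is the difference of boundary values $G_B(x+i0)-G_B(x-i0)$ of the function $$G_B(z)=\sqrt a\,\frac1{2\pi i}\int_0^\infty\frac12\Big(1-\frac1t\Big)e^{zt-a(t+\frac1t)}\,dt=\sqrt a\,\frac1{2\pi i}\Big(\sqrt{\tfrac a{a-z}}\;K_1(2\sqrt{a(a-z)})-K_0(2\sqrt{a(a-z)})\Big).$$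
   Context: For a tempered distribution $D$ on $\mathbb R$ with closed support in $[0,+\infty)$ put $\widetilde D(\lambda)=\int_0^\infty e^{i\lambda x}D(x)\,dx$, $\Im(\lambda)>0$; $\mathcal H(D)$ is the unique tempered distribution supported in $[0,+\infty)$ with $\widetilde{\mathcal H(D)}(\lambda)=\frac i\lambda\widetilde D(\frac{-1}\lambda)$ (on $L^2(0,\infty;dx)$ this is $f\mapsto\int_0^\infty J_0(2\sqrt{xy})f(y)\,dy$). The functions $\phi_a^\pm$ are the entire solutions of the stated integral equations. The integrals defining $G_A,G_B$ converge for $\Re(z)<a$, and the expressions with the $K$-Bessel functions (principal branch of the square root) give their analytic continuation to $\mathbb C\setminus[a,+\infty)$. Boundary values $G(x\pm i0)=\lim_{\epsilon\to0^+}G(x\pm i\epsilon)$ are taken in the sense of distributions on $\mathbb R$. *)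

(* Defs.v *)
(* Stdlib reals with Coquelicot. *)
From Stdlib Require Export Reals Factorial ClassicalEpsilon.
From Coquelicot Require Export Coquelicot.
Open Scope R_scope.

(** * Complex functions *)

Definition Cexp (z : C) : C :=
  Cmult (RtoC (exp (Re z))) (cos (Im z), sin (Im z)).

(* Principal branch: the real part is nonnegative, and positive off the
   half-line (-oo, 0]; on that half-line the root lies on i[0, +oo). *)
Definition Csqrt (z : C) : C :=
  (sqrt ((Cmod z + Re z) / 2),
   if Rlt_dec (Im z) 0 then - sqrt ((Cmod z - Re z) / 2)
   else sqrt ((Cmod z - Re z) / 2)).

Definition complex_differentiable (f : C -> C) (z : C) : Prop :=
  ex_derive (K := C_AbsRing) (V := C_NormedModule) f z.

Definition entire (f : C -> C) : Prop := forall z : C, complex_differentiable f z.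

Definition CRInt (f : R -> C) (u v : R) : C :=
  RInt (V := C_R_CompleteNormedModule) f u v.

Definition is_CRInt_gen (f : R -> C) (Fa Fb : (R -> Prop) -> Prop) (v : C)
  : Prop := is_RInt_gen (V := C_R_NormedModule) f Fa Fb v.

Definition CRInt_gen (f : R -> C) (Fa Fb : (R -> Prop) -> Prop) : C :=
  RInt_gen (V := C_R_CompleteNormedModule) f Fa Fb.

(** * Bessel functions *)

Definition J0 (x : R) : R :=
  Series (fun n => (-1) ^ n / INR (fact n) ^ 2 * (x / 2) ^ (2 * n)).

(* K_nu(w) for Re w > 0, the only arguments used below; the integral
   diverges for other w. *)
Definition BesselK (nu : R) (w : C) : C :=
  CRInt_gen
    (fun t => Cmult (Cexp (Cmult (Copp w) (RtoC (cosh t))))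
                    (RtoC (cosh (nu * t))))
    (at_point 0) (Rbar_locally p_infty).

(** * Test functions and distributions on the line *)

Definition smooth (psi : R -> C) : Prop :=
  forall (n : nat) (x : R),
    ex_derive_n (fun t => Re (psi t)) n x /\
    ex_derive_n (fun t => Im (psi t)) n x.

Definition CDerive_n (psi : R -> C) (n : nat) (x : R) : C :=
  (Derive_n (fun t => Re (psi t)) n x, Derive_n (fun t => Im (psi t)) n x).

Definition supported_in_ball (M : R) (psi : R -> C) : Prop :=
  forall x : R, M < Rabs x -> psi x = RtoC 0.

Definition test_function (psi : R -> C) : Prop :=
  smooth psi /\ exists M : R, supported_in_ball M psi.

Definition schwartz (psi : R -> C) : Prop :=
  smooth psi /\
  forall k n : nat, exists M : R, forall x : R,
    Rabs x ^ k * Cmod (CDerive_n psi n x) <= M.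

(* A distribution is a functional of which only the values on the relevant
   class of test functions matter. *)
Definition functional := (R -> C) -> C.

Definition linear_on (P : (R -> C) -> Prop) (T : functional) : Prop :=
  forall (c : C) (psi chi : R -> C), P psi -> P chi ->
    T (fun x => Cplus (Cmult c (psi x)) (chi x))
    = Cplus (Cmult c (T psi)) (T chi).

(* Continuity is expressed by seminorm estimates; quantifying over all common
   upper bounds B of the seminorms stands for their maximum. *)
Definition distribution (T : functional) : Prop :=
  linear_on test_function T /\
  forall M : R, exists (N : nat) (K : R), forall psi : R -> C,
    smooth psi -> supported_in_ball M psi ->
    forall B : R,
      (forall (n : nat) (x : R), (n <= N)%nat ->
         Cmod (CDerive_n psi n x) <= B) ->
      Cmod (T psi) <= K * B.

Definition tempered_distribution (T : functional) : Prop :=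
  linear_on schwartz T /\
  exists (N : nat) (K : R), forall psi : R -> C, schwartz psi ->
    forall B : R,
      (forall (k n : nat) (x : R), (k <= N)%nat -> (n <= N)%nat ->
         Rabs x ^ k * Cmod (CDerive_n psi n x) <= B) ->
      Cmod (T psi) <= K * B.

(* The closed support is contained in [0, +oo): T vanishes on the test
   functions with compact support in (-oo, 0). *)
Definition supported_nonneg (T : functional) : Prop :=
  forall psi : R -> C, test_function psi ->
    (exists delta : R, 0 < delta /\
       forall x : R, - delta < x -> psi x = RtoC 0) ->
    T psi = RtoC 0.

(** * Laplace transform and the transform H *)

(* For T supported in [0, +oo) and Im lambda > 0, x |-> exp(i lambda x) is
   replaced by a Schwartz function equal to it on a neighbourhood of
   [0, +oo); the value does not depend on this choice. *)
Definition is_laplace (T : functional) (lambda v : C) : Prop :=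
  forall psi : R -> C, schwartz psi ->
    (exists delta : R, 0 < delta /\
       forall x : R, - delta < x ->
         psi x = Cexp (Cmult (Cmult Ci lambda) (RtoC x))) ->
    T psi = v.

Definition is_H (D E : functional) : Prop :=
  tempered_distribution E /\ supported_nonneg E /\
  forall lambda : C, 0 < Im lambda ->
    exists v : C,
      is_laplace D (Cdiv (RtoC (-1)) lambda) v /\
      is_laplace E lambda (Cmult (Cdiv Ci lambda) v).

Definition calH (D : functional) : functional :=
  epsilon (inhabits (fun _ => RtoC 0)) (is_H D).

(** * The distributions A_a and B_a *)

(* The distribution f(x) 1_{0 < x}. *)
Definition on_half_line (f : C -> C) : functional :=
  fun psi => CRInt_gen (fun x => Cmult (f (RtoC x)) (psi x))
               (at_point 0) (Rbar_locally p_infty).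

Definition phi_plus_equation (a : R) (phi : C -> C) : Prop :=
  forall x : R, 0 < x ->
    Cplus (phi (RtoC x))
      (CRInt (fun y => Cmult (RtoC (J0 (2 * sqrt (x * y)))) (phi (RtoC y)))
         0 a)
    = RtoC (J0 (2 * sqrt (a * x))).

Definition phi_minus_equation (a : R) (phi : C -> C) : Prop :=
  forall x : R, 0 < x ->
    Cminus (phi (RtoC x))
      (CRInt (fun y => Cmult (RtoC (J0 (2 * sqrt (x * y)))) (phi (RtoC y)))
         0 a)
    = RtoC (J0 (2 * sqrt (a * x))).

Definition dist_A (a : R) (phi : C -> C) : functional :=
  fun psi => Cmult (RtoC (sqrt a / 2))
    (Cplus (on_half_line phi psi) (calH (on_half_line phi) psi)).

(* From - i B_a = (sqrt a / 2) (-1 + H)(phi 1_{0 < x}). *)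
Definition dist_B (a : R) (phi : C -> C) : functional :=
  fun psi => Cmult (Cmult Ci (RtoC (sqrt a / 2)))
    (Cplus (Copp (on_half_line phi psi)) (calH (on_half_line phi) psi)).

(** * The functions G_A and G_B *)

Definition prefactor (a : R) : C :=
  Cmult (RtoC (sqrt a)) (Cdiv (RtoC 1) (Cmult (RtoC (2 * PI)) Ci)).

Definition slit_plane (a : R) (z : C) : Prop := ~ (Im z = 0 /\ a <= Re z).

Definition G_arg (a : R) (z : C) : C :=
  Cmult (RtoC 2) (Csqrt (Cmult (RtoC a) (Cminus (RtoC a) z))).

Definition G_ratio (a : R) (z : C) : C :=
  Csqrt (Cdiv (RtoC a) (Cminus (RtoC a) z)).

Definition G_A (a : R) (z : C) : C :=
  Cmult (prefactor a)
    (Cplus (Cmult (G_ratio a z) (BesselK 1 (G_arg a z)))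
           (BesselK 0 (G_arg a z))).

Definition G_B (a : R) (z : C) : C :=
  Cmult (prefactor a)
    (Cminus (Cmult (G_ratio a z) (BesselK 1 (G_arg a z)))
            (BesselK 0 (G_arg a z))).

Definition G_A_integrand (a : R) (z : C) (t : R) : C :=
  Cmult (RtoC (1 / 2 * (1 + 1 / t)))
    (Cexp (Cminus (Cmult z (RtoC t)) (RtoC (a * (t + 1 / t))))).

Definition G_B_integrand (a : R) (z : C) (t : R) : C :=
  Cmult (RtoC (1 / 2 * (1 - 1 / t)))
    (Cexp (Cminus (Cmult z (RtoC t)) (RtoC (a * (t + 1 / t))))).

(** * Boundary values *)

(* T is the limit of x |-> G(x + i s eps) as eps -> 0+, in the sense of
   distributions on R; s = 1 gives G(x + i0), s = -1 gives G(x - i0). *)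
Definition is_boundary_value (G : C -> C) (s : R) (T : functional) : Prop :=
  distribution T /\
  forall psi : R -> C, test_function psi ->
    filterlim
      (fun eps : R =>
         CRInt_gen
           (fun x => Cmult (G (Cplus (RtoC x) (Cmult Ci (RtoC (s * eps)))))
                           (psi x))
           (Rbar_locally m_infty) (Rbar_locally p_infty))
      (at_right 0) (@locally C_UniformSpace (T psi)).

Definition is_difference_of_boundary_values (G : C -> C) (T : functional)
  : Prop :=
  exists Gplus Gminus : functional,
    is_boundary_value G 1 Gplus /\
    is_boundary_value G (-1) Gminus /\
    forall psi : R -> C, test_function psi ->
      T psi = Cminus (Gplus psi) (Gminus psi).

(* On Re z < a the integral of g(z, .) over (0, +oo) converges, with
   G(z) = c * integral, and G is holomorphic on C \ [a, +oo). *)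
Definition continues_integral (a : R) (G : C -> C) (c : C)
  (g : C -> R -> C) : Prop :=
  (forall z : C, Re z < a -> exists v : C,
     is_CRInt_gen (g z) (at_right 0) (Rbar_locally p_infty) v /\
     G z = Cmult c v) /\
  (forall z : C, slit_plane a z -> complex_differentiable G z).

(* Main.v *)
Require Import Defs.
From Stdlib Require Import Lra Lia Psatz FunctionalExtensionality.

(** Both halves of the statement are one statement for a sign [e], with [e = 1]
    for [A] and [e = -1] for [B]. Writing [J u] for [J0 (2 sqrt u)], which is the
    entire function [bes 0], the reason for it is that each side is known explicitly.

    The integral equation is solved by [phi x = (1 + e d/dx) J (a (x - a))]
    ([phi_sol_equation]). This follows from an addition formula for
    [int_0^b J (x y) J (c (y - b)) dy], and uniqueness ([phi_unique]) because the
    resolvents for all shorter intervals turn the homogeneous equation into a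
    Volterra equation.

    The Laplace transform of [x |-> J (x y)] at [p] is [exp (- y / p) / p]. With the
    integral equation it gives the transform of [phi] on the half-line, from which
    [H] of it is seen to be [delta_a - e phi 1_(0, a)] ([H_phi_is_H]). As the transform
    is defined by a property, this needs uniqueness ([H_unique]): a tempered
    distribution on the half-line is determined by its values at
    [exp (- m x)], [m = 1, 2, ...], by Weierstrass approximation in the variable
    [exp (- x)]. So [e phi 1_(0, oo) + H (phi 1_(0, oo))] is
    [delta_a + e phi 1_(a, oo)] ([dist_value]).

    On the other side the substitution [t = r exp s] turns the Bessel functions [K]
    into the integral of [exp (z t) exp (- a (t + 1 / t)) (1 + e / t) / 2] along a ray
    ([g_fun_lim]), and by Cauchy's theorem along any path in the right half-plane
    on which it converges ([contour_change]). The positive axis gives the integral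
    in the statement, and rays through [G_ratio] give holomorphy in the slit plane
    ([G_continues]). The path from [0] to [1] and then vertically up or down gives
    a formula in the upper or lower half-plane. Inserting [t^(-3)] into it yields a
    third primitive of [G] which is Lipschitz up to the real line, so that the boundary
    values exist and are third derivatives of continuous functions ([G_boundary]).

    Finally, the difference of the two primitives on the real line is an integral
    over the line [Re t = 1], namely the inverse Laplace transform at [x - a] of
    [exp (- a / t) (1 + e / t) / (2 t^3)]. Expanding the exponential in powers of [1 / t]
    and using the inverse transform of a power ([epow_limit]) makes this the series
    of Bessel functions [jump_value] ([g_prim_jump]). Its third derivative is
    [delta_a + e phi 1_(a, oo)] once more ([jump_by_parts]), and the prefactors agree
    since [2 PI i] from the inversion formula cancels. *)

(** * Continuity and derivatives of complex-valued functions *)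

Lemma C_eq (z w : C) : Re z = Re w -> Im z = Im w -> z = w.
Proof. destruct z, w; simpl; congruence. Qed.

Lemma norm_Cmod (z : C) : @norm R_AbsRing C_R_NormedModule z = Cmod z.
Proof.
  unfold norm; simpl; unfold prod_norm, Cmod, norm; simpl; unfold abs; simpl.
  f_equal. rewrite !Rmult_1_r, <- !Rabs_mult, !Rabs_pos_eq by nra. reflexivity.
Qed.

Lemma Im_le_Cmod (z : C) : Rabs (Im z) <= Cmod z.
Proof. eapply Rle_trans; [apply Rmax_r | apply Rmax_Cmod]. Qed.

Lemma Cmod_le_ReIm (z : C) : Cmod z <= Rabs (Re z) + Rabs (Im z).
Proof.
  destruct z as [x y]; simpl. unfold Cmod; simpl.
  apply Rsqr_incr_0_var; [| pose proof (Rabs_pos x); pose proof (Rabs_pos y); lra].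
  rewrite Rsqr_sqrt by nra. unfold Rsqr.
  pose proof (Rabs_pos x); pose proof (Rabs_pos y).
  assert (x * x = Rabs x * Rabs x) by (rewrite <- Rabs_mult, Rabs_pos_eq; nra).
  assert (y * y = Rabs y * Rabs y) by (rewrite <- Rabs_mult, Rabs_pos_eq; nra).
  nra.
Qed.

Section Continuity.
Context {U : UniformSpace}.
Implicit Types (f g : U -> R) (F G : U -> C).

Lemma continuous_Rplus f g x : continuous f x -> continuous g x ->
  continuous (fun u => f u + g u) x.
Proof. apply (@continuous_plus U R_AbsRing R_NormedModule). Qed.

Lemma continuous_Rminus f g x : continuous f x -> continuous g x ->
  continuous (fun u => f u - g u) x.
Proof. apply (@continuous_minus U R_AbsRing R_NormedModule). Qed.

Lemma continuous_Ropp f x : continuous f x -> continuous (fun u => - f u) x.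
Proof. apply (@continuous_opp U R_AbsRing R_NormedModule). Qed.

Lemma continuous_Rmult f g x : continuous f x -> continuous g x ->
  continuous (fun u => f u * g u) x.
Proof. apply (@continuous_mult U R_AbsRing). Qed.

Lemma continuous_Rcomp (h : R -> R) f x : continuous h (f x) -> continuous f x ->
  continuous (fun u => h (f u)) x.
Proof. intros; apply (continuous_comp f h); assumption. Qed.

Lemma continuous_Rinv_comp f x : continuous f x -> f x <> 0 ->
  continuous (fun u => / f u) x.
Proof. intros; apply continuous_Rcomp; [apply continuous_Rinv|]; assumption. Qed.

Lemma continuous_exp_comp f x : continuous f x -> continuous (fun u => exp (f u)) x.
Proof.
  intros; apply continuous_Rcomp; [|assumption].
  apply (@ex_derive_continuous R_AbsRing R_NormedModule); auto_derive; auto.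
Qed.

Lemma continuous_cos_comp f x : continuous f x -> continuous (fun u => cos (f u)) x.
Proof. intros; apply continuous_Rcomp; [apply continuous_cos|assumption]. Qed.

Lemma continuous_sin_comp f x : continuous f x -> continuous (fun u => sin (f u)) x.
Proof. intros; apply continuous_Rcomp; [apply continuous_sin|assumption]. Qed.

Lemma continuous_pair F x : continuous (fun u => Re (F u)) x ->
  continuous (fun u => Im (F u)) x -> continuous F x.
Proof.
  intros H1 H2 P [e He].
  unfold filtermap.
  apply (filter_imp (fun u => ball (Re (F x)) e (Re (F u)) /\ ball (Im (F x)) e (Im (F u)))).
  - intros u [A B]; apply He; split; assumption.
  - apply filter_and; [apply (H1 (fun y => ball _ e y)) | apply (H2 (fun y => ball _ e y))];
    exists e; auto.
Qed.

Lemma continuous_Re F x : continuous F x -> continuous (fun u => Re (F u)) x.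
Proof.
  intros H P [e He]. apply (H (fun z => P (Re z))).
  exists e; intros y [A B]; apply He, A.
Qed.

Lemma continuous_Im F x : continuous F x -> continuous (fun u => Im (F u)) x.
Proof.
  intros H P [e He]. apply (H (fun z => P (Im z))).
  exists e; intros y [A B]; apply He, B.
Qed.

Lemma continuous_RtoC f x : continuous f x -> continuous (fun u => RtoC (f u)) x.
Proof. intros; apply continuous_pair; simpl; [assumption|apply continuous_const]. Qed.

Lemma continuous_Cplus F G x : continuous F x -> continuous G x ->
  continuous (fun u => (F u + G u)%C) x.
Proof.
  intros; apply continuous_pair; simpl; apply continuous_Rplus;
  auto using continuous_Re, continuous_Im.
Qed.

Lemma continuous_Copp F x : continuous F x -> continuous (fun u => (- F u)%C) x.
Proof.
  intros; apply continuous_pair; simpl; apply continuous_Ropp;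
  auto using continuous_Re, continuous_Im.
Qed.

Lemma continuous_Cminus F G x : continuous F x -> continuous G x ->
  continuous (fun u => (F u - G u)%C) x.
Proof. intros; apply continuous_Cplus; [|apply continuous_Copp]; assumption. Qed.

Lemma continuous_Cmult F G x : continuous F x -> continuous G x ->
  continuous (fun u => (F u * G u)%C) x.
Proof.
  intros; apply continuous_pair; simpl;
  [apply continuous_Rminus|apply continuous_Rplus]; apply continuous_Rmult;
  auto using continuous_Re, continuous_Im.
Qed.

Lemma continuous_Cexp F x : continuous F x -> continuous (fun u => Cexp (F u)) x.
Proof.
  intros; apply continuous_Cmult.
  - apply continuous_RtoC, continuous_exp_comp, continuous_Re; assumption.
  - apply continuous_pair; simpl; [apply continuous_cos_comp|apply continuous_sin_comp];
    apply continuous_Im; assumption.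
Qed.

Lemma Cmod2_pos (z : C) : z <> RtoC 0 -> 0 < fst z ^ 2 + snd z ^ 2.
Proof.
  intros H. destruct z as [u v]; simpl.
  destruct (Req_dec u 0), (Req_dec v 0); try nra.
  exfalso; apply H; subst; reflexivity.
Qed.

Lemma continuous_Cinv F x : continuous F x -> F x <> RtoC 0 ->
  continuous (fun u => (/ F u)%C) x.
Proof.
  intros H Hn. pose proof (Cmod2_pos _ Hn) as Hp.
  assert (Hc : continuous (fun u => fst (F u) ^ 2 + snd (F u) ^ 2) x).
  { simpl. apply continuous_Rplus; repeat apply continuous_Rmult;
    auto using continuous_Re, continuous_Im, continuous_const. }
  apply continuous_pair; simpl; unfold Rdiv; apply continuous_Rmult.
  - now apply continuous_Re.
  - apply (continuous_Rinv_comp (fun u => fst (F u) ^ 2 + snd (F u) ^ 2)); auto; lra.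
  - apply continuous_Ropp; now apply continuous_Im.
  - apply (continuous_Rinv_comp (fun u => fst (F u) ^ 2 + snd (F u) ^ 2)); auto; lra.
Qed.

Lemma continuous_Cpow F n x : continuous F x -> continuous (fun u => (F u ^ n)%C) x.
Proof.
  intros H; induction n as [|n IH]; simpl; [apply continuous_const|].
  apply continuous_Cmult; assumption.
Qed.

Lemma continuous_Cmod F x : continuous F x -> continuous (fun u => Cmod (F u)) x.
Proof.
  intros H. unfold Cmod. apply continuous_Rcomp; [apply continuous_sqrt|].
  simpl. apply continuous_Rplus; repeat apply continuous_Rmult;
  auto using continuous_Re, continuous_Im, continuous_const.
Qed.
End Continuity.

Lemma continuous_fst' (z : R * R) : continuous (fun z : R * R => fst z) z.
Proof. destruct z; apply continuous_fst. Qed.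

Lemma continuous_snd' (z : R * R) : continuous (fun z : R * R => snd z) z.
Proof. destruct z; apply continuous_snd. Qed.

Lemma continuous_Rpow {U : UniformSpace} (f : U -> R) n x :
  continuous f x -> continuous (fun u => f u ^ n) x.
Proof.
  intros H; induction n as [|n IH]; simpl; [apply continuous_const|].
  apply continuous_Rmult; assumption.
Qed.

(** Discharges continuity goals built from arithmetic, dispatching on the head symbol of the
    body, because plain [apply] would unfold complex operations into pairs. *)
Ltac cont_step := match goal with
  | H : continuous ?f ?x |- continuous ?f ?x => exact H
  | |- continuous (fun u => ?c) _ => apply continuous_const
  | |- continuous (fun u => u) _ => apply continuous_id
  | |- continuous (fun u => fst u) _ => apply continuous_fst'
  | |- continuous (fun u => snd u) _ => apply continuous_snd'
  | |- continuous (fun u => Cplus (@?f u) (@?g u)) _ => apply continuous_Cplus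
  | |- continuous (fun u => Cminus (@?f u) (@?g u)) _ => apply continuous_Cminus
  | |- continuous (fun u => Cmult (@?f u) (@?g u)) _ => apply continuous_Cmult
  | |- continuous (fun u => Cdiv (@?f u) (@?g u)) _ => unfold Cdiv
  | |- continuous (fun u => Copp (@?f u)) _ => apply continuous_Copp
  | |- continuous (fun u => RtoC (@?f u)) _ => apply continuous_RtoC
  | |- continuous (fun u => Cexp (@?f u)) _ => apply continuous_Cexp
  | |- continuous (fun u => Cpow (@?f u) _) _ => apply continuous_Cpow
  | |- continuous (fun u => Cmod (@?f u)) _ => apply continuous_Cmod
  | |- continuous (fun u => Cinv (@?f u)) _ => apply continuous_Cinv
  | |- continuous (fun u => Rplus (@?f u) (@?g u)) _ => apply continuous_Rplus
  | |- continuous (fun u => Rminus (@?f u) (@?g u)) _ => apply continuous_Rminus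
  | |- continuous (fun u => Rmult (@?f u) (@?g u)) _ => apply continuous_Rmult
  | |- continuous (fun u => Rdiv (@?f u) (@?g u)) _ => unfold Rdiv
  | |- continuous (fun u => Ropp (@?f u)) _ => apply continuous_Ropp
  | |- continuous (fun u => Rinv (@?f u)) _ => apply continuous_Rinv_comp
  | |- continuous (fun u => exp (@?f u)) _ => apply continuous_exp_comp
  | |- continuous (fun u => cos (@?f u)) _ => apply continuous_cos_comp
  | |- continuous (fun u => sin (@?f u)) _ => apply continuous_sin_comp
  | |- continuous (fun u => pow (@?f u) _) _ => apply continuous_Rpow
  | |- continuous (fun u => Re (@?f u)) _ => apply continuous_Re
  | |- continuous (fun u => Im (@?f u)) _ => apply continuous_Im
  | |- continuous (fun u => (@?f u, @?g u)) _ => apply continuous_pair; simpl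
  (* eta-reduced forms left by unification *)
  | |- continuous (Rplus ?c) _ => apply (continuous_Rplus (fun _ => c) (fun u => u))
  | |- continuous (Rminus ?c) _ => apply (continuous_Rminus (fun _ => c) (fun u => u))
  | |- continuous (Rmult ?c) _ => apply (continuous_Rmult (fun _ => c) (fun u => u))
  | |- continuous (Cplus ?c) _ => apply (continuous_Cplus (fun _ => c) (fun u => u))
  | |- continuous (Cmult ?c) _ => apply (continuous_Cmult (fun _ => c) (fun u => u))
  | |- continuous Ropp _ => apply (continuous_Ropp (fun u => u))
  | |- continuous Rinv _ => apply (continuous_Rinv_comp (fun u => u))
  | |- continuous Cinv _ => apply (continuous_Cinv (fun u => u))
  | |- continuous Copp _ => apply (continuous_Copp (fun u => u))
  | |- continuous exp _ => apply (continuous_exp_comp (fun u => u))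
  | |- continuous RtoC _ => apply (continuous_RtoC (fun u => u))
  | |- continuous Cexp _ => apply (continuous_Cexp (fun u => u))
  | |- continuous Re _ => apply (continuous_Re (fun u => u))
  | |- continuous Im _ => apply (continuous_Im (fun u => u))
  | |- continuous fst _ => apply continuous_fst'
  | |- continuous snd _ => apply continuous_snd'
  end.
Ltac cont := repeat cont_step.

(** The derivative of a complex-valued function of a real variable, taken
    componentwise so that the real calculus applies to it directly. *)
Definition cderiv (f : R -> C) (x : R) (l : C) : Prop :=
  is_derive (fun t => Re (f t)) x (Re l) /\ is_derive (fun t => Im (f t)) x (Im l).

Lemma cderiv_continuous f x l : cderiv f x l -> continuous f x.
Proof.
  intros [H1 H2]; apply continuous_pair;
  apply (@ex_derive_continuous R_AbsRing R_NormedModule); eexists; eassumption.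
Qed.

Lemma cderiv_eq f x l l' : cderiv f x l -> l = l' -> cderiv f x l'.
Proof. intros; subst; assumption. Qed.

Lemma cderiv_const c x : cderiv (fun _ => c) x (RtoC 0).
Proof.
  split; [exact (@is_derive_const R_AbsRing R_NormedModule (Re c) x)
         |exact (@is_derive_const R_AbsRing R_NormedModule (Im c) x)].
Qed.

Lemma cderiv_RtoC (f : R -> R) (x l : R) : is_derive f x l -> cderiv (fun t => RtoC (f t)) x (RtoC l).
Proof.
  intros H; split; [exact H |].
  exact (@is_derive_const R_AbsRing R_NormedModule (0 : R) x).
Qed.

Lemma cderiv_id x : cderiv (fun t => RtoC t) x (RtoC 1).
Proof. apply cderiv_RtoC, (@is_derive_id R_AbsRing). Qed.

Lemma cderiv_plus f g x l m : cderiv f x l -> cderiv g x m ->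
  cderiv (fun t => (f t + g t)%C) x (l + m)%C.
Proof. intros [A B] [A' B']; split; apply (@is_derive_plus R_AbsRing R_NormedModule); assumption. Qed.

Lemma cderiv_opp f x l : cderiv f x l -> cderiv (fun t => (- f t)%C) x (- l)%C.
Proof. intros [A B]; split; apply (@is_derive_opp R_AbsRing R_NormedModule); assumption. Qed.

Lemma cderiv_minus f g x l m : cderiv f x l -> cderiv g x m ->
  cderiv (fun t => (f t - g t)%C) x (l - m)%C.
Proof. intros; apply cderiv_plus; [|apply cderiv_opp]; assumption. Qed.

Lemma is_derive_Rmult (f g : R -> R) x l m : is_derive f x l -> is_derive g x m ->
  is_derive (fun t => f t * g t) x (l * g x + f x * m).
Proof. intros; apply (@is_derive_mult R_AbsRing); auto. intros; apply Rmult_comm. Qed.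

Lemma cderiv_mult f g x l m : cderiv f x l -> cderiv g x m ->
  cderiv (fun t => (f t * g t)%C) x (l * g x + f x * m)%C.
Proof.
  intros [A B] [A' B']; split; simpl.
  - eapply is_derive_ext with (f := fun t => Re (f t) * Re (g t) - Im (f t) * Im (g t)).
    { reflexivity. }
    evar_last. { apply (@is_derive_minus R_AbsRing R_NormedModule); apply is_derive_Rmult; eassumption. }
    unfold minus, plus, opp; simpl. unfold Re, Im. ring.
  - eapply is_derive_ext with (f := fun t => Re (f t) * Im (g t) + Im (f t) * Re (g t)).
    { reflexivity. }
    evar_last. { apply (@is_derive_plus R_AbsRing R_NormedModule); apply is_derive_Rmult; eassumption. }
    unfold plus; simpl. unfold Re, Im. ring.
Qed.

Lemma cderiv_scal c f x l : cderiv f x l -> cderiv (fun t => (c * f t)%C) x (c * l)%C.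
Proof.
  intros H. eapply cderiv_eq; [apply cderiv_mult; [apply cderiv_const | exact H]|]. cbv beta; ring.
Qed.

Lemma cderiv_Cexp f x l : cderiv f x l -> cderiv (fun t => Cexp (f t)) x (l * Cexp (f x))%C.
Proof.
  intros [A B]; split; unfold Cexp; simpl.
  - apply (is_derive_ext (fun t => exp (Re (f t)) * cos (Im (f t)))). { intros; simpl; ring. }
    evar_last. { apply is_derive_Rmult; [apply (is_derive_comp exp) | apply (is_derive_comp cos)]; 
      [apply is_derive_exp | exact A | apply is_derive_cos | exact B]. }
    unfold scal; simpl; unfold mult; simpl. unfold Re, Im; ring.
  - apply (is_derive_ext (fun t => exp (Re (f t)) * sin (Im (f t)))). { intros; simpl; ring. }
    evar_last. { apply is_derive_Rmult; [apply (is_derive_comp exp) | apply (is_derive_comp sin)]; 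
      [apply is_derive_exp | exact A | apply is_derive_sin | exact B]. }
    unfold scal; simpl; unfold mult; simpl. unfold Re, Im; ring.
Qed.

Lemma cderiv_inv f x l : cderiv f x l -> f x <> RtoC 0 ->
  cderiv (fun t => (/ f t)%C) x (- l / (f x * f x))%C.
Proof.
  intros [A B] Hn. pose proof (Cmod2_pos _ Hn) as Hp.
  assert (Hd : is_derive (fun t => fst (f t) ^ 2 + snd (f t) ^ 2) x
     (2 * fst (f x) * Re l + 2 * snd (f x) * Im l)).
  { apply (is_derive_ext (fun t => Re (f t) * Re (f t) + Im (f t) * Im (f t))).
    { intros; unfold Re, Im; simpl; ring. }
    evar_last. { apply (@is_derive_plus R_AbsRing R_NormedModule); apply is_derive_Rmult; eassumption. }
    unfold plus; simpl. unfold Re, Im; ring. }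
  assert (Hi := is_derive_inv _ _ _ Hd (Rgt_not_eq _ _ Hp)).
  destruct (f x) as [u v] eqn:E; destruct l as [l1 l2]; simpl in *.
  assert (u * (u * 1) + v * (v * 1) <> 0) by lra.
  assert ((u * u - v * v) * ((u * u - v * v) * 1) + (u * v + v * u) * ((u * v + v * u) * 1) <> 0).
  { replace (_ + _) with ((u * u + v * v) ^ 2) by ring. apply pow_nonzero; lra. }
  split; simpl.
  - evar_last. { apply is_derive_Rmult; [exact A | exact Hi]. }
    simpl; unfold Re; rewrite E; simpl. field; repeat split; auto; nra.
  - apply (is_derive_ext (fun t => - (Im (f t) * / (fst (f t) ^ 2 + snd (f t) ^ 2)))).
    { intros; unfold Rdiv, Im; simpl; ring. }
    evar_last. { apply (@is_derive_opp R_AbsRing R_NormedModule), is_derive_Rmult; [exact B | exact Hi]. }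
    unfold opp; simpl; unfold Im; rewrite E; simpl. field; repeat split; auto; nra.
Qed.

(** * Integrals of complex-valued functions *)

Lemma ex_CRInt f a b : a <= b -> (forall x, a <= x <= b -> continuous f x) ->
  ex_RInt (V := C_R_NormedModule) f a b.
Proof.
  intros Hab H. apply (@ex_RInt_continuous C_R_CompleteNormedModule).
  rewrite Rmin_left, Rmax_right by lra. exact H.
Qed.

Lemma ex_RInt_cont (f : R -> R) a b : a <= b -> (forall x, a <= x <= b -> continuous f x) ->
  ex_RInt f a b.
Proof.
  intros Hab H. apply (@ex_RInt_continuous R_CompleteNormedModule).
  rewrite Rmin_left, Rmax_right by lra. exact H.
Qed.

Lemma is_CRInt f a b : a <= b -> (forall x, a <= x <= b -> continuous f x) ->
  is_RInt (V := C_R_NormedModule) f a b (CRInt f a b).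
Proof.
  intros; apply (@RInt_correct C_R_CompleteNormedModule), ex_CRInt; assumption.
Qed.

Lemma CRInt_unique f a b v : is_RInt (V := C_R_NormedModule) f a b v -> CRInt f a b = v.
Proof. apply (@is_RInt_unique C_R_CompleteNormedModule). Qed.

Lemma CRInt_ext f g a b : a <= b -> (forall x, a < x < b -> f x = g x) ->
  CRInt f a b = CRInt g a b.
Proof.
  intros Hab H. apply (@RInt_ext C_R_CompleteNormedModule).
  rewrite Rmin_left, Rmax_right by lra. exact H.
Qed.

Lemma CRInt_pair (f : R -> C) a b :
  ex_RInt (fun x => Re (f x)) a b -> ex_RInt (fun x => Im (f x)) a b ->
  CRInt f a b = (RInt (fun x => Re (f x)) a b, RInt (fun x => Im (f x)) a b).
Proof.
  intros H1 H2. apply CRInt_unique.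
  apply (@is_RInt_fct_extend_pair R_NormedModule R_NormedModule);
  apply (@RInt_correct R_CompleteNormedModule); assumption.
Qed.

Lemma Re_CRInt f a b : a <= b -> (forall x, a <= x <= b -> continuous f x) ->
  Re (CRInt f a b) = RInt (fun x => Re (f x)) a b.
Proof.
  intros Hab H. rewrite CRInt_pair; [reflexivity | |]; apply ex_RInt_cont; auto;
  intros; [apply continuous_Re | apply continuous_Im]; auto.
Qed.

Lemma Im_CRInt f a b : a <= b -> (forall x, a <= x <= b -> continuous f x) ->
  Im (CRInt f a b) = RInt (fun x => Im (f x)) a b.
Proof.
  intros Hab H. rewrite CRInt_pair; [reflexivity | |]; apply ex_RInt_cont; auto;
  intros; [apply continuous_Re | apply continuous_Im]; auto.
Qed.

Lemma CRInt_FTC F f a b : a <= b ->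
  (forall x, a <= x <= b -> cderiv F x (f x)) ->
  (forall x, a <= x <= b -> continuous f x) ->
  CRInt f a b = (F b - F a)%C.
Proof.
  intros Hab HF Hf. apply C_eq.
  - rewrite Re_CRInt by assumption. apply (@is_RInt_unique R_CompleteNormedModule).
    apply (is_RInt_derive (fun x => Re (F x)));
    rewrite Rmin_left, Rmax_right by lra; intros; [apply HF | apply continuous_Re]; auto.
  - rewrite Im_CRInt by assumption. apply (@is_RInt_unique R_CompleteNormedModule).
    apply (is_RInt_derive (fun x => Im (F x)));
    rewrite Rmin_left, Rmax_right by lra; intros; [apply HF | apply continuous_Im]; auto.
Qed.

Lemma CRInt_Chasles f a b c : a <= b -> b <= c ->
  (forall x, a <= x <= c -> continuous f x) ->
  CRInt f a c = (CRInt f a b + CRInt f b c)%C.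
Proof.
  intros Hab Hbc H. symmetry. apply (@RInt_Chasles C_R_CompleteNormedModule);
  apply ex_CRInt; auto; intros; apply H; lra.
Qed.

Lemma CRInt_plus f g a b : a <= b ->
  (forall x, a <= x <= b -> continuous f x) -> (forall x, a <= x <= b -> continuous g x) ->
  CRInt (fun x => f x + g x)%C a b = (CRInt f a b + CRInt g a b)%C.
Proof.
  intros. apply (@RInt_plus C_R_CompleteNormedModule); apply ex_CRInt; auto.
Qed.

Lemma CRInt_minus f g a b : a <= b ->
  (forall x, a <= x <= b -> continuous f x) -> (forall x, a <= x <= b -> continuous g x) ->
  CRInt (fun x => f x - g x)%C a b = (CRInt f a b - CRInt g a b)%C.
Proof.
  intros. apply (@RInt_minus C_R_CompleteNormedModule); apply ex_CRInt; auto.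
Qed.

Lemma CRInt_scal c f a b : a <= b -> (forall x, a <= x <= b -> continuous f x) ->
  CRInt (fun x => c * f x)%C a b = (c * CRInt f a b)%C.
Proof.
  intros Hab H.
  assert (HR : ex_RInt (fun x => Re (f x)) a b)
    by (apply ex_RInt_cont; auto; intros; apply continuous_Re; auto).
  assert (HI : ex_RInt (fun x => Im (f x)) a b)
    by (apply ex_RInt_cont; auto; intros; apply continuous_Im; auto).
  apply CRInt_unique. rewrite (CRInt_pair f) by assumption.
  apply (@RInt_correct R_CompleteNormedModule) in HR.
  apply (@RInt_correct R_CompleteNormedModule) in HI.
  apply (@is_RInt_fct_extend_pair R_NormedModule R_NormedModule); simpl.
  - apply (@is_RInt_minus R_NormedModule);
    [apply (@is_RInt_scal R_NormedModule _ _ _ (fst c)) | apply (@is_RInt_scal R_NormedModule _ _ _ (snd c))];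
    assumption.
  - apply (@is_RInt_plus R_NormedModule);
    [apply (@is_RInt_scal R_NormedModule _ _ _ (fst c)) | apply (@is_RInt_scal R_NormedModule _ _ _ (snd c))];
    assumption.
Qed.

Lemma CRInt_bound f g a b : a <= b ->
  (forall x, a <= x <= b -> continuous f x) -> ex_RInt g a b ->
  (forall x, a <= x <= b -> Cmod (f x) <= g x) -> Cmod (CRInt f a b) <= RInt g a b.
Proof.
  intros Hab Hf Hg H. rewrite <- norm_Cmod.
  eapply (@norm_RInt_le C_R_NormedModule f g); eauto.
  - intros; rewrite norm_Cmod; auto.
  - apply is_CRInt; auto.
  - apply (@RInt_correct R_CompleteNormedModule); auto.
Qed.

Lemma CRInt_bound_const f M a b : a <= b ->
  (forall x, a <= x <= b -> continuous f x) ->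
  (forall x, a <= x <= b -> Cmod (f x) <= M) -> Cmod (CRInt f a b) <= (b - a) * M.
Proof.
  intros Hab Hf H. rewrite <- norm_Cmod.
  eapply (@norm_RInt_le_const C_R_NormedModule f); eauto.
  - intros; rewrite norm_Cmod; auto.
  - apply is_CRInt; auto.
Qed.

Lemma CRInt_comp f (g dg : R -> R) a b : a <= b -> g a <= g b ->
  (forall x, a <= x <= b -> continuous f (g x)) ->
  (forall x, a <= x <= b -> is_derive g x (dg x) /\ continuous dg x) ->
  CRInt (fun y => RtoC (dg y) * f (g y))%C a b = CRInt f (g a) (g b).
Proof.
  intros Hab Hg Hf H. apply CRInt_unique.
  apply (is_RInt_ext (fun y => scal (dg y) (f (g y) : C_R_NormedModule))).
  { intros x _. apply C_eq; simpl; unfold scal; simpl; unfold mult; simpl; unfold Re, Im; ring. }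
  apply (@is_RInt_comp C_R_CompleteNormedModule); rewrite Rmin_left, Rmax_right by lra; assumption.
Qed.

(** * Exchanging integrals over a rectangle *)

Lemma continuous_uncurry {V : UniformSpace} (f : R * R -> V) z :
  continuous f z -> continuous (fun z => f (fst z, snd z)) z.
Proof. apply (continuous_ext f). intros [u v]; reflexivity. Qed.

Lemma continuous_slice_l {V : UniformSpace} (f : R * R -> V) x y :
  continuous f (x, y) -> continuous (fun u => f (u, y)) x.
Proof.
  intros H. apply (continuous_comp_2 (fun u => u) (fun _ => y) (fun u v => f (u, v)) x);
  [apply continuous_id | apply continuous_const |].
  exact (continuous_uncurry f _ H).
Qed.

Lemma continuous_slice_r {V : UniformSpace} (f : R * R -> V) x y :
  continuous f (x, y) -> continuous (fun v => f (x, v)) y.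
Proof.
  intros H. apply (continuous_comp_2 (fun _ => x) (fun v => v) (fun u v => f (u, v)) y);
  [apply continuous_const | apply continuous_id |].
  exact (continuous_uncurry f _ H).
Qed.

Lemma continuous_continuity_2d (f : R * R -> R) x y :
  continuous f (x, y) -> continuity_2d_pt (fun u v => f (u, v)) x y.
Proof.
  intros H. apply continuity_2d_pt_filterlim. exact (continuous_uncurry f _ H).
Qed.

Lemma continuous_RInt_param (f : R * R -> R) c d x : (forall z, continuous f z) -> c <= d ->
  continuous (fun u => RInt (fun y => f (u, y)) c d) x.
Proof.
  intros Hf Hcd.
  apply continuity_pt_filterlim. intros e He.
  assert (He' : 0 < e / (d - c + 1)) by (apply Rdiv_lt_0_compat; lra).
  assert (H2 : forall y, c <= y <= d -> continuity_2d_pt (fun u v => f (u, v)) x y).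
  { intros y _. apply continuous_continuity_2d, Hf. }
  destruct (uniform_continuity_2d_1d' _ _ _ _ H2 (mkposreal _ He')) as [[de Hde] H];
  simpl in H.
  exists de; split; [assumption|]. intros u [_ Hu]. simpl in *. unfold Rdist in *.
  assert (E : forall w, ex_RInt (fun y => f (w, y)) c d).
  { intros; apply ex_RInt_cont; auto. intros; apply continuous_slice_r, Hf. }
  rewrite <- (RInt_minus (fun y => f (u, y)) (fun y => f (x, y))) by auto.
  apply Rle_lt_trans with ((d - c) * (e / (d - c + 1))).
  - apply (norm_RInt_le_const (V := R_NormedModule) (fun y => minus (f (u, y)) (f (x, y)))); auto.
    + intros y Hy. apply Rlt_le. unfold norm; simpl; unfold abs; simpl.
      apply (H y x y u); try lra; apply Rabs_lt_between in Hu; try lra.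
      rewrite Rminus_diag. rewrite Rabs_R0. auto.
    + apply (@RInt_correct R_CompleteNormedModule), (@ex_RInt_minus R_NormedModule); auto.
  - apply Rmult_lt_reg_r with (d - c + 1); [lra|]. field_simplify; [|lra]. nra.
Qed.

Section Fubini.
Variable f : R * R -> R.
Hypothesis Hf : forall z, continuous f z.

Lemma continuous_RInt_param' c d y : continuous (fun v => RInt (fun x => f (x, v)) c d) y.
Proof.
  assert (Hg : forall z : R * R, continuous (fun z : R * R => f (snd z, fst z)) z).
  { intros [u v]. apply (continuous_comp_2 (fun z : R * R => snd z) (fun z : R * R => fst z) (fun u v => f (u, v))).
    - apply continuous_snd'. - apply continuous_fst'.
    - apply continuous_uncurry, Hf. }
  destruct (Rle_dec c d) as [Hcd|Hcd].
  - apply (continuous_RInt_param (fun z => f (snd z, fst z))); auto.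
  - apply (continuous_ext (fun v => - RInt (fun x => f (x, v)) d c)).
    { intros v. refine (@opp_RInt_swap R_CompleteNormedModule (fun x => f (x, v)) d c _). apply ex_RInt_cont; [lra|].
      intros; apply continuous_slice_l, Hf. }
    apply continuous_Ropp.
    apply (continuous_RInt_param (fun z => f (snd z, fst z))); auto; lra.
Qed.

(** Both sides agree at [b = a]; in [b] they have the same derivative, by
    differentiation under the integral sign. *)
Lemma RInt_swap a b c d : a <= b -> c <= d ->
  RInt (fun x => RInt (fun y => f (x, y)) c d) a b =
  RInt (fun y => RInt (fun x => f (x, y)) a b) c d.
Proof.
  intros Hab Hcd.
  set (H := fun u => RInt (fun y => RInt (fun x => f (x, y)) a u) c d).
  assert (HX : forall y u v, ex_RInt (fun x => f (x, y)) u v).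
  { intros; apply (@ex_RInt_continuous R_CompleteNormedModule). intros; apply continuous_slice_l, Hf. }
  assert (HD : forall u y, is_derive (fun u => RInt (fun x => f (x, y)) a u) u (f (u, y))).
  { intros. apply (is_derive_RInt (fun x => f (x, y)) _ a); [| apply continuous_slice_l, Hf].
    apply filter_forall. intros; apply (@RInt_correct R_CompleteNormedModule), HX. }
  assert (DH : forall u, is_derive H u (RInt (fun y => f (u, y)) c d)).
  { intros u. unfold H.
    evar_last. { apply (is_derive_RInt_param (fun u y => RInt (fun x => f (x, y)) a u)).
      - apply filter_forall; intros; eexists; apply HD.
      - intros t _. apply continuity_2d_pt_ext with (fun u v => f (u, v)).
        { intros; symmetry; apply is_derive_unique, HD. }
        apply continuous_continuity_2d, Hf.
      - apply filter_forall; intros w. apply ex_RInt_cont; auto. intros y _.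
        apply continuous_RInt_param'. }
    apply RInt_ext; intros; apply is_derive_unique, HD. }
  transitivity (H b - H a).
  - apply (@is_RInt_unique R_CompleteNormedModule).
    apply (is_RInt_derive H (fun x => RInt (fun y => f (x, y)) c d)); intros; [apply DH|].
    apply continuous_RInt_param; auto.
  - unfold H at 2. rewrite (RInt_ext _ (fun _ => 0)).
    + rewrite RInt_const. unfold scal; simpl; unfold mult; simpl. unfold H; ring.
    + intros; apply (@RInt_point R_CompleteNormedModule).
Qed.
End Fubini.

(** Composing with these projections extends a function continuous on a rectangle to
    one continuous on the plane. *)
Definition clamp (a b x : R) : R := Rmax a (Rmin b x).

Lemma clamp_in a b x : a <= b -> a <= clamp a b x <= b.
Proof.
  intros; unfold clamp; split; [apply Rmax_l|]. apply Rmax_lub; [assumption|apply Rmin_l].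
Qed.

Lemma clamp_id a b x : a <= x <= b -> clamp a b x = x.
Proof. intros; unfold clamp. rewrite Rmin_right, Rmax_right; lra. Qed.

Lemma continuous_clamp {U : UniformSpace} a b (f : U -> R) x :
  a <= b -> continuous f x -> continuous (fun u => clamp a b (f u)) x.
Proof.
  intros Hab Hf. apply (continuous_Rcomp (clamp a b)); [|assumption].
  apply continuity_pt_filterlim. intros e He. exists e; split; [assumption|].
  intros y [_ Hy]. simpl in *. unfold Rdist in *. eapply Rle_lt_trans; [|exact Hy].
  unfold clamp, Rmax, Rmin. repeat destruct Rle_dec; unfold Rabs; repeat destruct Rcase_abs; lra.
Qed.

Definition cont_on_rect {V : UniformSpace} (f : R * R -> V) (a b c d : R) : Prop :=
  forall x y, a <= x <= b -> c <= y <= d -> continuous f (x, y).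

Lemma continuous_clamp2 {V : UniformSpace} (f : R * R -> V) a b c d z :
  a <= b -> c <= d -> cont_on_rect f a b c d ->
  continuous (fun z : R * R => f (clamp a b (fst z), clamp c d (snd z))) z.
Proof.
  intros Hab Hcd H.
  apply (continuous_comp_2 (fun z : R * R => clamp a b (fst z)) (fun z : R * R => clamp c d (snd z)) (fun u v => f (u, v))).
  - apply continuous_clamp; auto; apply continuous_fst'.
  - apply continuous_clamp; auto; apply continuous_snd'.
  - apply continuous_uncurry, H; apply clamp_in; assumption.
Qed.

Lemma RInt_swap_rect (f : R * R -> R) a b c d : a <= b -> c <= d -> cont_on_rect f a b c d ->
  ex_RInt (fun x => RInt (fun y => f (x, y)) c d) a b /\
  ex_RInt (fun y => RInt (fun x => f (x, y)) a b) c d /\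
  RInt (fun x => RInt (fun y => f (x, y)) c d) a b =
  RInt (fun y => RInt (fun x => f (x, y)) a b) c d.
Proof.
  intros Hab Hcd H.
  set (g := fun z : R * R => f (clamp a b (fst z), clamp c d (snd z))).
  assert (Hg : forall z, continuous g z) by (intros; apply continuous_clamp2; assumption).
  assert (E1 : forall x, Rmin a b < x < Rmax a b ->
     RInt (fun y => g (x, y)) c d = RInt (fun y => f (x, y)) c d).
  { rewrite Rmin_left, Rmax_right by lra. intros x Hx. apply RInt_ext.
    rewrite Rmin_left, Rmax_right by lra. intros y Hy. unfold g; simpl. rewrite !clamp_id; auto; lra. }
  assert (E2 : forall y, Rmin c d < y < Rmax c d ->
     RInt (fun x => g (x, y)) a b = RInt (fun x => f (x, y)) a b).
  { rewrite Rmin_left, Rmax_right by lra. intros x Hx. apply RInt_ext.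
    rewrite Rmin_left, Rmax_right by lra. intros y Hy. unfold g; simpl. rewrite !clamp_id; auto; lra. }
  split; [|split].
  - eapply ex_RInt_ext; [exact E1|]. apply ex_RInt_cont; auto; intros; now apply continuous_RInt_param.
  - eapply ex_RInt_ext; [exact E2|]. apply ex_RInt_cont; auto; intros; now apply continuous_RInt_param'.
  - rewrite <- (RInt_ext _ _ _ _ E1), <- (RInt_ext _ _ _ _ E2). now apply RInt_swap.
Qed.

Lemma CRInt_swap (f : R * R -> C) a b c d : a <= b -> c <= d -> cont_on_rect f a b c d ->
  CRInt (fun x => CRInt (fun y => f (x, y)) c d) a b =
  CRInt (fun y => CRInt (fun x => f (x, y)) a b) c d.
Proof.
  intros Hab Hcd H.
  assert (HR : cont_on_rect (fun z => Re (f z)) a b c d)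
    by (intros x y Hx Hy; apply continuous_Re; auto).
  assert (HI : cont_on_rect (fun z => Im (f z)) a b c d)
    by (intros x y Hx Hy; apply continuous_Im; auto).
  destruct (RInt_swap_rect _ _ _ _ _ Hab Hcd HR) as [R1 [R2 R3]].
  destruct (RInt_swap_rect _ _ _ _ _ Hab Hcd HI) as [I1 [I2 I3]].
  rewrite (CRInt_ext _ (fun x => (RInt (fun y => Re (f (x, y))) c d, RInt (fun y => Im (f (x, y))) c d))); auto.
  2: { intros x Hx. rewrite CRInt_pair; auto; apply ex_RInt_cont; auto; intros y Hy;
       [apply (continuous_slice_r (fun z => Re (f z)))|apply (continuous_slice_r (fun z => Im (f z)))];
       [apply HR | apply HI]; lra. }
  rewrite (CRInt_ext (fun y => CRInt _ a b) (fun y => (RInt (fun x => Re (f (x, y))) a b, RInt (fun x => Im (f (x, y))) a b))); auto.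
  2: { intros y Hy. rewrite CRInt_pair; auto; apply ex_RInt_cont; auto; intros x Hx;
       [apply (continuous_slice_l (fun z => Re (f z)))|apply (continuous_slice_l (fun z => Im (f z)))];
       [apply HR | apply HI]; lra. }
  rewrite !CRInt_pair by assumption. simpl. f_equal; assumption.
Qed.

Lemma continuous_CRInt_param (f : R * R -> C) a b c d y : a <= b -> c < d ->
  cont_on_rect f a b c d -> c < y < d ->
  continuous (fun v => CRInt (fun x => f (x, v)) a b) y.
Proof.
  intros Hab Hcd H Hy.
  set (g := fun z : R * R => f (clamp a b (fst z), clamp c d (snd z))).
  assert (Hg : forall z, continuous g z) by (intros; apply continuous_clamp2; auto; lra).
  apply continuous_ext_loc with
    (fun v => (RInt (fun x => Re (g (x, v))) a b, RInt (fun x => Im (g (x, v))) a b)).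
  - assert (He : 0 < Rmin (y - c) (d - y)) by (apply Rmin_glb_lt; lra).
    exists (mkposreal _ He). intros v Hv. change (Rabs (v - y) < Rmin (y - c) (d - y)) in Hv.
    assert (c < v < d).
    { pose proof (Rmin_l (y - c) (d - y)). pose proof (Rmin_r (y - c) (d - y)).
      apply Rabs_lt_between in Hv. lra. }
    rewrite <- (CRInt_pair (fun x => g (x, v))).
    + apply CRInt_ext; auto. intros x Hx; unfold g; simpl. rewrite !clamp_id; auto; lra.
    + apply ex_RInt_cont; auto; intros; apply (continuous_slice_l (fun z => Re (g z))), continuous_Re, Hg.
    + apply ex_RInt_cont; auto; intros; apply (continuous_slice_l (fun z => Im (g z))), continuous_Im, Hg.
  - apply continuous_pair; simpl.
    + apply (continuous_RInt_param' (fun z => Re (g z))); intros; apply continuous_Re, Hg.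
    + apply (continuous_RInt_param' (fun z => Im (g z))); intros; apply continuous_Im, Hg.
Qed.

(** The form [K dx + M dy] is closed, so its integral round the boundary of the
    rectangle vanishes. The addition formulas for Bessel functions, the Laplace
    transform of [J0] and Cauchy's theorem are instances. *)
Lemma rectangle_closed_form (K M L : R -> R -> C) a b c d : a <= b -> c <= d ->
  (forall x y, a <= x <= b -> c <= y <= d -> cderiv (fun y => K x y) y (L x y)) ->
  (forall x y, a <= x <= b -> c <= y <= d -> cderiv (fun x => M x y) x (L x y)) ->
  cont_on_rect (fun z => L (fst z) (snd z)) a b c d ->
  CRInt (fun x => K x d - K x c)%C a b = CRInt (fun y => M b y - M a y)%C c d.
Proof.
  intros Hab Hcd HK HM HL.
  rewrite (CRInt_ext _ (fun x => CRInt (fun y => L x y) c d)); auto.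
  2: { intros x Hx. symmetry; apply CRInt_FTC; auto; intros y Hy; [apply HK; lra|].
       apply (continuous_slice_r (fun z => L (fst z) (snd z))), HL; lra. }
  rewrite (CRInt_ext (fun y => M b y - M a y)%C (fun y => CRInt (fun x => L x y) a b)); auto.
  2: { intros y Hy. symmetry; apply (CRInt_FTC (fun x => M x y)); auto; intros x Hx; [apply HM; lra|].
       apply (continuous_slice_l (fun z => L (fst z) (snd z))), HL; lra. }
  apply (CRInt_swap (fun z => L (fst z) (snd z))); auto.
Qed.

(** * Limits along the real line *)

Definition lim_inf (f : R -> C) (v : C) : Prop :=
  forall e, 0 < e -> exists X0, forall X, X0 < X -> Cmod (f X - v)%C < e.

Lemma lim_inf_filterlim f v : lim_inf f v <-> filterlim f (Rbar_locally p_infty) (@locally C_UniformSpace v).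
Proof.
  split.
  - intros H P [[e He] HP]. destruct (H e He) as [X0 HX]. exists X0; intros X HX'.
    apply HP. apply C_NormedModule_mixin_compat1. apply HX, HX'.
  - intros H e He.
    assert (He2 : 0 < e / 2) by lra.
    destruct (H (fun z => ball v (mkposreal _ He2) z)) as [X0 HX].
    { exists (mkposreal _ He2); auto. }
    exists X0; intros X HX'. specialize (HX X HX'). simpl in HX.
    eapply Rle_lt_trans; [apply Cmod_le_ReIm|].
    destruct HX as [A B].
    change (Rabs (Re (f X) - Re v) < e/2) in A. change (Rabs (Im (f X) - Im v) < e/2) in B.
    simpl. unfold Re, Im in *. unfold Rminus in *. lra.
Qed.

Lemma lim_inf_unique f v w : lim_inf f v -> lim_inf f w -> v = w.
Proof.
  intros Hv Hw. destruct (Req_dec (Cmod (v - w)%C) 0) as [E|E].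
  - apply Cmod_eq_0 in E. replace v with (v - w + w)%C by ring. rewrite E; ring.
  - pose proof (Cmod_ge_0 (v - w)%C).
    destruct (Hv (Cmod (v - w)%C / 2)) as [X1 H1]; [lra|].
    destruct (Hw (Cmod (v - w)%C / 2)) as [X2 H2]; [lra|].
    set (X := Rmax X1 X2 + 1).
    pose proof (Rmax_l X1 X2). pose proof (Rmax_r X1 X2).
    specialize (H1 X ltac:(unfold X; lra)). specialize (H2 X ltac:(unfold X; lra)).
    assert (Cmod (v - w)%C <= Cmod (f X - v)%C + Cmod (f X - w)%C).
    { replace (v - w)%C with (- (f X - v) + (f X - w))%C by ring.
      eapply Rle_trans; [apply Cmod_triangle|]. rewrite Cmod_opp; lra. }
    lra.
Qed.

Lemma lim_inf_const c : lim_inf (fun _ => c) c.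
Proof.
  intros e He; exists 0; intros. replace (c - c)%C with (RtoC 0) by ring. now rewrite Cmod_0.
Qed.

Lemma lim_inf_plus f g v w : lim_inf f v -> lim_inf g w -> lim_inf (fun X => f X + g X)%C (v + w)%C.
Proof.
  intros Hv Hw e He.
  destruct (Hv (e / 2)) as [X1 H1]; [lra|]. destruct (Hw (e / 2)) as [X2 H2]; [lra|].
  exists (Rmax X1 X2). intros X HX. pose proof (Rmax_l X1 X2). pose proof (Rmax_r X1 X2).
  replace (f X + g X - (v + w))%C with ((f X - v) + (g X - w))%C by ring.
  eapply Rle_lt_trans; [apply Cmod_triangle|].
  specialize (H1 X ltac:(lra)). specialize (H2 X ltac:(lra)). lra.
Qed.

Lemma lim_inf_scal c f v : lim_inf f v -> lim_inf (fun X => c * f X)%C (c * v)%C.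
Proof.
  intros Hv e He. pose proof (Cmod_ge_0 c).
  destruct (Hv (e / (Cmod c + 1))) as [X1 H1]; [apply Rdiv_lt_0_compat; lra|].
  exists X1. intros X HX. specialize (H1 X HX).
  replace (c * f X - c * v)%C with (c * (f X - v))%C by ring. rewrite Cmod_mult.
  pose proof (Cmod_ge_0 (f X - v)%C).
  apply Rle_lt_trans with ((Cmod c + 1) * Cmod (f X - v)); [nra|].
  apply Rmult_lt_reg_l with (/ (Cmod c + 1)); [apply Rinv_0_lt_compat; lra|].
  rewrite <- Rmult_assoc, Rinv_l by lra. unfold Rdiv in H1. lra.
Qed.

Lemma lim_inf_minus f g v w : lim_inf f v -> lim_inf g w -> lim_inf (fun X => f X - g X)%C (v - w)%C.
Proof.
  intros Hv Hw. apply lim_inf_plus; [assumption|].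
  intros e He. destruct (Hw e He) as [X0 H]. exists X0; intros X HX.
  replace (- g X - - w)%C with (- (g X - w))%C by ring. rewrite Cmod_opp; auto.
Qed.

Lemma lim_inf_ext X0 f g v : (forall X, X0 < X -> f X = g X) -> lim_inf f v -> lim_inf g v.
Proof.
  intros E H e He. destruct (H e He) as [X1 H1]. exists (Rmax X0 X1). intros X HX.
  pose proof (Rmax_l X0 X1). pose proof (Rmax_r X0 X1).
  rewrite <- E by lra. apply H1; lra.
Qed.

Lemma lim_inf_squeeze f g v (r : R -> R) X0 : lim_inf f v ->
  (forall X, X0 < X -> Cmod (f X - g X)%C <= r X) -> is_lim r p_infty 0 -> lim_inf g v.
Proof.
  intros Hf H Hr e He.
  destruct (Hf (e / 2)) as [X1 H1]; [lra|].
  assert (He2 : 0 < e / 2) by lra.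
  apply is_lim_spec in Hr. destruct (Hr (mkposreal _ He2)) as [X2 H2]; simpl in H2.
  exists (Rmax X0 (Rmax X1 X2)). intros X HX.
  pose proof (Rmax_l X0 (Rmax X1 X2)). pose proof (Rmax_r X0 (Rmax X1 X2)).
  pose proof (Rmax_l X1 X2). pose proof (Rmax_r X1 X2).
  specialize (H X ltac:(lra)). specialize (H1 X ltac:(lra)). specialize (H2 X ltac:(lra)).
  replace (g X - v)%C with (- (f X - g X) + (f X - v))%C by ring.
  eapply Rle_lt_trans; [apply Cmod_triangle|]. rewrite Cmod_opp.
  apply Rabs_lt_between in H2. lra.
Qed.

Lemma lim_inf_bound f v M X0 : (forall X, X0 < X -> Cmod (f X) <= M) -> lim_inf f v -> Cmod v <= M.
Proof.
  intros H Hv. apply Rnot_lt_le; intros Hlt.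
  destruct (Hv (Cmod v - M)) as [X1 H1]; [lra|].
  set (X := Rmax X0 X1 + 1). pose proof (Rmax_l X0 X1). pose proof (Rmax_r X0 X1).
  specialize (H X ltac:(unfold X; lra)). specialize (H1 X ltac:(unfold X; lra)).
  assert (Cmod v <= Cmod (f X) + Cmod (f X - v)%C).
  { replace v with (f X + - (f X - v))%C at 1 by ring.
    eapply Rle_trans; [apply Cmod_triangle|]. rewrite Cmod_opp; lra. }
  lra.
Qed.

(** Absolute convergence of an improper integral whose modulus is dominated by
    the derivative of a function with a finite limit. *)
Lemma dominated_lim (f : R -> C) (b B : R -> R) (L : R) :
  (forall x, 0 <= x -> continuous f x) ->
  (forall x, 0 <= x -> is_derive B x (b x)) -> (forall x, 0 <= x -> continuous b x) ->
  (forall x, 0 <= x -> Cmod (f x) <= b x) -> is_lim B p_infty L ->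
  exists v, lim_inf (fun X => CRInt f 0 X) v.
Proof.
  intros Hf HB Hb H HL.
  assert (Hbd : forall X Y, 0 <= X -> X <= Y -> Cmod (CRInt f X Y) <= B Y - B X).
  { intros X Y HX HXY.
    replace (B Y - B X) with (RInt b X Y).
    - apply CRInt_bound; auto; intros; try apply ex_RInt_cont; auto; intros.
      + apply Hf; lra. + apply Hb; lra. + apply H; lra.
    - apply (@is_RInt_unique R_CompleteNormedModule).
      apply (is_RInt_derive B b); rewrite Rmin_left, Rmax_right by lra; intros; [apply HB | apply Hb]; lra. }
  destruct (proj1 (@filterlim_locally_cauchy R C_R_CompleteNormedModule (Rbar_locally p_infty) _
    (fun X => CRInt f 0 X))) as [v Hv].
  - intros [e He]. assert (He2 : 0 < e / 2) by lra.
    apply is_lim_spec in HL. destruct (HL (mkposreal _ He2)) as [X1 H1]; simpl in H1.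
    exists (fun X => Rmax 0 X1 < X). split; [exists (Rmax 0 X1); auto|].
    pose proof (Rmax_l 0 X1). pose proof (Rmax_r 0 X1).
    assert (W : forall u v, Rmax 0 X1 < u -> u <= v -> Cmod (CRInt f 0 v - CRInt f 0 u)%C < e).
    { intros u v Hu Huv.
      rewrite (CRInt_Chasles f 0 u v); try lra; [|intros; apply Hf; lra].
      replace (CRInt f 0 u + CRInt f u v - CRInt f 0 u)%C with (CRInt f u v) by ring.
      eapply Rle_lt_trans; [apply Hbd; lra|].
      pose proof (H1 u ltac:(lra)) as A1. pose proof (H1 v ltac:(lra)) as A2.
      apply Rabs_lt_between in A1. apply Rabs_lt_between in A2. lra. }
    intros u v Hu Hv. apply C_NormedModule_mixin_compat1.
    destruct (Rle_dec u v).
    + apply W; lra.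
    + change (minus (CRInt f 0 v) (CRInt f 0 u)) with (CRInt f 0 v - CRInt f 0 u)%C.
      rewrite <- Cmod_opp.
      replace (- (CRInt f 0 v - CRInt f 0 u))%C with (CRInt f 0 u - CRInt f 0 v)%C by ring.
      apply W; lra.
  - exists v. apply lim_inf_filterlim. exact Hv.
Qed.

Lemma is_lim_exp_decay k : 0 < k -> is_lim (fun x => exp (- (k * x))) p_infty 0.
Proof.
  intros Hk. apply is_lim_spec. intros [e He]; simpl.
  exists (/ (k * e)). intros x Hx.
  rewrite Rminus_0_r, Rabs_pos_eq by (left; apply exp_pos).
  rewrite exp_Ropp. 
  assert (0 < / (k * e)) by (apply Rinv_0_lt_compat; nra).
  assert (k * x > / e).
  { replace (/ e) with (k * / (k * e)) by (field; lra). apply Rmult_lt_compat_l; lra. }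
  assert (0 < / e) by (now apply Rinv_0_lt_compat).
  pose proof (exp_ineq1 (k * x) ltac:(lra)).
  rewrite <- (Rinv_inv e). apply Rinv_lt_contravar; [|lra]. 
  apply Rmult_lt_0_compat; [lra|apply exp_pos].
Qed.

Lemma exp_dominated_lim (f : R -> C) (A k : R) : 0 < k ->
  (forall x, 0 <= x -> continuous f x) ->
  (forall x, 0 <= x -> Cmod (f x) <= A * exp (- (k * x))) ->
  exists v, lim_inf (fun X => CRInt f 0 X) v.
Proof.
  intros Hk Hf H.
  apply (dominated_lim f (fun x => A * exp (- (k * x))) (fun x => - (A / k) * exp (- (k * x))) (- (A / k) * 0)); auto.
  - intros. auto_derive; auto. field. lra.
  - intros. cont.
  - apply (is_lim_scal_l (fun x => exp (- (k * x))) (- (A / k)) p_infty 0).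
    now apply is_lim_exp_decay.
Qed.

Lemma is_lim_inv_shift : is_lim (fun x => / (1 + x)) p_infty 0.
Proof.
  apply is_lim_spec. intros [e He]; simpl. exists (/ e). intros x Hx.
  assert (0 < / e) by (now apply Rinv_0_lt_compat).
  rewrite Rminus_0_r, Rabs_pos_eq by (left; apply Rinv_0_lt_compat; lra).
  rewrite <- (Rinv_inv e). apply Rinv_lt_contravar; [|lra]. apply Rmult_lt_0_compat; lra.
Qed.

Lemma square_dominated_lim (f : R -> C) (A : R) :
  (forall x, 0 <= x -> continuous f x) ->
  (forall x, 0 <= x -> Cmod (f x) <= A * / (1 + x) ^ 2) ->
  exists v, lim_inf (fun X => CRInt f 0 X) v.
Proof.
  intros Hf H.
  apply (dominated_lim f (fun x => A * / (1 + x) ^ 2) (fun x => - A * / (1 + x)) (- A * 0)); auto.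
  - intros. auto_derive; [lra|]. field. lra.
  - intros. simpl. cont. nra.
  - apply (is_lim_scal_l (fun x => / (1 + x)) (- A) p_infty 0), is_lim_inv_shift.
Qed.

Lemma CRInt_bound_square (f : R -> C) (A X : R) : 0 <= A -> 0 <= X ->
  (forall x, 0 <= x -> continuous f x) ->
  (forall x, 0 <= x -> Cmod (f x) <= A * / (1 + x) ^ 2) ->
  Cmod (CRInt f 0 X) <= A.
Proof.
  intros HA HX Hf H.
  eapply Rle_trans; [apply (CRInt_bound f (fun x => A * / (1 + x) ^ 2)); auto|].
  - intros; apply Hf; lra.
  - apply ex_RInt_cont; auto. intros. simpl. cont. nra.
  - intros; apply H; lra.
  - replace (RInt _ 0 X) with (- A * / (1 + X) - - A * / (1 + 0)).
    + rewrite Rplus_0_r, Rinv_1. assert (0 < / (1 + X)) by (apply Rinv_0_lt_compat; lra). nra.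
    + symmetry. apply (@is_RInt_unique R_CompleteNormedModule).
      apply (is_RInt_derive (fun x => - A * / (1 + x))); rewrite Rmin_left, Rmax_right by lra; intros.
      * auto_derive; [lra|]. field. lra.
      * simpl. cont. nra.
Qed.

(** * Improper integrals *)

Lemma is_CRInt_gen_half_line f v : (forall x, 0 <= x -> continuous f x) ->
  lim_inf (fun X => CRInt f 0 X) v ->
  is_CRInt_gen f (at_point 0) (Rbar_locally p_infty) v.
Proof.
  intros Hf H. apply lim_inf_filterlim in H. intros P HP.
  destruct (H P HP) as [X0 HX].
  exists (fun x => x = 0) (fun X => Rmax 0 X0 < X).
  - reflexivity. - exists (Rmax 0 X0); auto.
  - intros x X -> HX'. pose proof (Rmax_l 0 X0). pose proof (Rmax_r 0 X0).
    exists (CRInt f 0 X). split; [|apply HX; lra]. apply is_CRInt; [lra|]. intros; apply Hf; lra.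
Qed.

Lemma CRInt_gen_half_line f v : (forall x, 0 <= x -> continuous f x) ->
  lim_inf (fun X => CRInt f 0 X) v ->
  CRInt_gen f (at_point 0) (Rbar_locally p_infty) = v.
Proof.
  intros Hf H. apply (@is_RInt_gen_unique C_R_CompleteNormedModule); try apply Proper_StrongProper.
  - apply at_point_filter. - apply Rbar_locally_filter.
  - now apply is_CRInt_gen_half_line.
Qed.

Lemma CRInt_gen_line f M : 0 < M -> (forall x, - M <= x <= M -> continuous f x) ->
  (forall x, M < Rabs x -> f x = RtoC 0) ->
  CRInt_gen f (Rbar_locally m_infty) (Rbar_locally p_infty) = CRInt f (- M) M.
Proof.
  intros HM Hf H0.
  apply (@is_RInt_gen_unique C_R_CompleteNormedModule); try apply Proper_StrongProper;
  try apply Rbar_locally_filter.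
  intros P [e HP].
  exists (fun x => x < - M) (fun x => M < x).
  - exists (- M); auto. - exists M; auto.
  - intros x y Hx Hy. exists (CRInt f (- M) M). split; [|apply HP; apply ball_center].
    assert (Z : forall u v, is_RInt (V := C_R_NormedModule) (fun _ => RtoC 0) u v (RtoC 0)).
    { intros u v. evar_last. { apply (@is_RInt_const C_R_NormedModule). }
      apply C_eq; unfold scal; simpl; unfold mult; simpl; apply Rmult_0_r. }
    replace (CRInt f (- M) M) with (plus (plus (RtoC 0) (CRInt f (- M) M)) (RtoC 0) : C_R_NormedModule).
    2: { apply C_eq; unfold plus; simpl; unfold Re, Im; ring. }
    eapply (@is_RInt_Chasles C_R_NormedModule) with M; [eapply (@is_RInt_Chasles C_R_NormedModule) with (- M)|].
    + eapply is_RInt_ext; [|apply Z]. simpl in *. rewrite Rmin_left, Rmax_right by lra.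
      intros t Ht. symmetry; apply H0. unfold Rabs; destruct Rcase_abs; lra.
    + apply is_CRInt; auto; lra.
    + eapply is_RInt_ext; [|apply Z]. simpl in *. rewrite Rmin_left, Rmax_right by lra.
      intros t Ht. symmetry; apply H0. unfold Rabs; destruct Rcase_abs; lra.
Qed.

(** * The Bessel functions [u^(-m/2) J_m (2 sqrt u)] *)

Definition bes_coef (m k : nat) : R := (-1) ^ k / (INR (fact k) * INR (fact (k + m))).

Definition bes (m : nat) (u : R) : R := PSeries (bes_coef m) u.

Lemma bes_coef_neq0 m k : bes_coef m k <> 0.
Proof.
  unfold bes_coef. apply Rmult_integral_contrapositive_currified.
  - apply pow_nonzero; lra.
  - apply Rinv_neq_0_compat, Rmult_integral_contrapositive_currified; apply INR_fact_neq_0.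
Qed.

Lemma bes_coef_S m k : bes_coef m (S k) = - bes_coef m k / (INR (S k) * INR (S (k + m))).
Proof.
  unfold bes_coef. replace (S k + m)%nat with (S (k + m)) by lia.
  rewrite !fact_simpl, !mult_INR. simpl pow.
  field. repeat split; try apply INR_fact_neq_0; apply not_0_INR; lia.
Qed.

Lemma bes_CV_radius m : CV_radius (bes_coef m) = p_infty.
Proof.
  apply CV_radius_infinite_DAlembert; [apply bes_coef_neq0|].
  apply is_lim_seq_le_le with (fun _ => 0) (fun n => / INR (S n)).
  - intros n. split; [apply Rabs_pos|].
    rewrite bes_coef_S.
    replace (- bes_coef m n / (INR (S n) * INR (S (n + m))) / bes_coef m n)
      with (- (/ INR (S n) * / INR (S (n + m)))).
    2: { field. repeat split; try apply bes_coef_neq0; apply not_0_INR; lia. }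
    rewrite Rabs_Ropp.
    assert (0 < / INR (S n)) by (apply Rinv_0_lt_compat, lt_0_INR; lia).
    assert (0 < / INR (S (n + m)) <= 1).
    { split; [apply Rinv_0_lt_compat, lt_0_INR; lia|].
      rewrite <- Rinv_1. apply Rinv_le_contravar; [lra|]. rewrite S_INR. pose proof (pos_INR (n + m)); lra. }
    rewrite Rabs_pos_eq; nra.
  - apply is_lim_seq_const.
  - apply is_lim_seq_incr_1 with (u := fun n => / INR n).
    replace (Finite 0) with (Rbar_inv p_infty) by reflexivity.
    apply is_lim_seq_inv; [apply is_lim_seq_INR | discriminate].
Qed.

Lemma bes_ex_pseries m u : ex_pseries (bes_coef m) u.
Proof. apply CV_disk_correct, CV_disk_inside. now rewrite bes_CV_radius. Qed.

Lemma bes_at_0 m : bes m 0 = / INR (fact m).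
Proof.
  unfold bes. rewrite PSeries_0. unfold bes_coef; simpl. field. apply INR_fact_neq_0.
Qed.

Lemma is_derive_bes m u : is_derive (bes m) u (- bes (S m) u).
Proof.
  evar_last. { apply is_derive_PSeries. now rewrite bes_CV_radius. }
  unfold bes. rewrite <- PSeries_opp. apply PSeries_ext. intros k.
  unfold PS_derive, PS_opp. rewrite bes_coef_S. unfold opp; simpl. unfold bes_coef.
  replace (k + S m)%nat with (S (k + m)) by lia. rewrite fact_simpl, mult_INR.
  change (match k with 0%nat => 1 | S _ => INR k + 1 end) with (INR (S k)).
  change (match (k + m)%nat with 0%nat => 1 | S _ => INR (k + m) + 1 end) with (INR (S (k + m))).
  field. repeat split; try apply INR_fact_neq_0; apply not_0_INR; lia.
Qed.

Lemma is_derive_bes_comp m (f : R -> R) x l : is_derive f x l ->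
  is_derive (fun t => bes m (f t)) x (- l * bes (S m) (f x)).
Proof.
  intros H. evar_last. { apply (is_derive_comp (bes m)); [apply is_derive_bes | exact H]. }
  unfold scal; simpl; unfold mult; simpl; ring.
Qed.

(** The three-term recurrence of Bessel functions. *)
Lemma bes_rec m u : u * bes (S (S m)) u = INR (S m) * bes (S m) u - bes m u.
Proof.
  unfold bes. rewrite <- PSeries_incr_1, <- PSeries_scal, <- PSeries_minus.
  - apply PSeries_ext. intros [|k].
    + enough (E : 0 = INR (S m) * bes_coef (S m) 0 + - bes_coef m 0) by exact E.
      unfold bes_coef. rewrite !Nat.add_0_l, fact_simpl, mult_INR.
      replace (INR (fact 0)) with 1 by reflexivity. simpl pow.
      field. split; [apply INR_fact_neq_0 | apply not_0_INR; lia].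
    + enough (E : bes_coef (S (S m)) k = INR (S m) * bes_coef (S m) (S k) + - bes_coef m (S k)) by exact E.
      rewrite !bes_coef_S. unfold bes_coef.
      replace (k + S (S m))%nat with (S (S (k + m))) by lia.
      replace (k + S m)%nat with (S (k + m)) by lia.
      rewrite !fact_simpl, !mult_INR. rewrite !S_INR, plus_INR.
      pose proof (pos_INR k). pose proof (pos_INR m).
      field. repeat split; try apply INR_fact_neq_0; lra.
  - apply (@ex_pseries_scal R_AbsRing R_NormedModule); [apply Rmult_comm | apply bes_ex_pseries].
  - apply bes_ex_pseries.
Qed.

Lemma J0_bes u : 0 <= u -> J0 (2 * sqrt u) = bes 0 u.
Proof.
  intros Hu. unfold J0, bes, PSeries. apply Series_ext. intros n.
  unfold bes_coef. rewrite Nat.add_0_r.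
  replace (2 * sqrt u / 2) with (sqrt u) by field.
  rewrite pow_mult. replace (sqrt u ^ 2) with u.
  - field. apply INR_fact_neq_0.
  - simpl. rewrite Rmult_1_r. symmetry. now apply sqrt_sqrt.
Qed.

Lemma continuous_bes {U : UniformSpace} m (f : U -> R) x :
  continuous f x -> continuous (fun u => bes m (f u)) x.
Proof.
  intros H. apply continuous_Rcomp; [|assumption].
  apply (@ex_derive_continuous R_AbsRing R_NormedModule). eexists; apply is_derive_bes.
Qed.

Ltac cont ::= repeat first [ cont_step | match goal with
  | |- continuous (fun u => bes _ (@?f u)) _ => apply continuous_bes
  | |- continuous (bes ?m) _ => apply (continuous_bes m (fun u => u)) end ].

(** The mean value inequality in the form used for the energy estimate and for
    Gronwall's argument. *)
Lemma is_derive_ge0_le (f df : R -> R) a b : a <= b ->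
  (forall x, a <= x <= b -> is_derive f x (df x)) ->
  (forall x, a <= x <= b -> 0 <= df x) -> f a <= f b.
Proof.
  intros Hab Hd Hp. destruct (MVT_gen f a b df) as [c [Hc E]].
  - rewrite Rmin_left, Rmax_right by lra. intros; apply Hd; lra.
  - rewrite Rmin_left, Rmax_right by lra. intros. apply continuity_pt_filterlim.
    apply (@ex_derive_continuous R_AbsRing R_NormedModule). eexists; apply Hd; lra.
  - rewrite Rmin_left, Rmax_right in Hc by lra. specialize (Hp c Hc). nra.
Qed.

(** The energy [bes m ^ 2 + u * bes (m+1) ^ 2] decreases on the half-line. *)
Lemma bes_bound m u : 0 <= u -> Rabs (bes m u) <= 1.
Proof.
  intros Hu.
  assert (H : - (bes m 0 ^ 2 + 0 * bes (S m) 0 ^ 2) <= - (bes m u ^ 2 + u * bes (S m) u ^ 2)).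
  { apply (is_derive_ge0_le (fun u => - (bes m u ^ 2 + u * bes (S m) u ^ 2))
      (fun u => INR (2 * m + 1) * bes (S m) u ^ 2)); auto.
    - intros x Hx.
      pose proof (is_derive_bes m x) as D1. pose proof (is_derive_bes (S m) x) as D2.
      auto_derive.
      + repeat split; auto; eexists; eassumption.
      + rewrite (is_derive_unique (fun x : R => bes m x) _ _ D1), (is_derive_unique (fun x : R => bes (S m) x) _ _ D2).
        pose proof (bes_rec m x) as E. rewrite plus_INR, mult_INR. rewrite S_INR in E. simpl INR.
        match goal with |- ?l = ?r => replace l with (r + 2 * bes (S m) x *
          (x * bes (S (S m)) x - ((INR m + 1) * bes (S m) x - bes m x))) by ring end.
        rewrite E. ring.
    - intros x Hx. apply Rmult_le_pos; [apply pos_INR | apply pow2_ge_0]. }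
  rewrite bes_at_0 in H.
  assert (0 < / INR (fact m) <= 1).
  { split; [apply Rinv_0_lt_compat, lt_0_INR, lt_O_fact|].
    rewrite <- Rinv_1. apply Rinv_le_contravar; [lra|].
    replace 1 with (INR 1) by reflexivity. apply le_INR. pose proof (lt_O_fact m); lia. }
  assert (0 <= u * bes (S m) u ^ 2) by (apply Rmult_le_pos; auto; apply pow2_ge_0).
  assert (bes m u ^ 2 <= 1) by nra. apply Rabs_le; split; nra.
Qed.

(** * The integral equation *)

Lemma is_derive_ubes0 X y (f := fun y => y * bes 1 (X * y)) : is_derive f y (bes 0 (X * y)).
Proof.
  unfold f. evar_last.
  { apply is_derive_Rmult; [apply (@is_derive_id R_AbsRing)|].
    apply is_derive_bes_comp. apply (is_derive_scal (fun y => y) y X 1), (@is_derive_id R_AbsRing). }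
  pose proof (bes_rec 0 (X * y)) as E. simpl in E. unfold one; simpl. nra.
Qed.

Lemma is_derive_bes_lin m k X x : is_derive (fun s => bes m ((X + s) * k)) x (- k * bes (S m) ((X + x) * k)).
Proof.
  evar_last. { apply is_derive_bes_comp with (l := k). auto_derive; auto. ring. }
  reflexivity.
Qed.

(** The addition formula: the integral depends on [x - c] only, because moving
    [x] and [c] together changes the integrand by a [y]-derivative. *)
Lemma bes_addition b c x : 0 <= b -> 0 <= c ->
  CRInt (fun y => RtoC (bes 0 (x * y) * bes 0 (c * (y - b)))) 0 b = RtoC (b * bes 1 ((x - c) * b)).
Proof.
  intros Hb Hc.
  pose proof (rectangle_closed_form
    (fun y s => RtoC (bes 0 ((x + s) * y) * bes 0 ((c + s) * (y - b))))
    (fun y s => RtoC (- ((y * bes 1 ((x + s) * y)) * ((y - b) * bes 1 ((c + s) * (y - b))))))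
    (fun y s => RtoC (- (y * bes 1 ((x + s) * y) * bes 0 ((c + s) * (y - b)) +
                         bes 0 ((x + s) * y) * ((y - b) * bes 1 ((c + s) * (y - b))))))
    0 b (- c) 0 Hb ltac:(lra)) as H.
  assert (D2 : forall X y, is_derive (fun y => (y - b) * bes 1 (X * (y - b))) y (bes 0 (X * (y - b)))).
  { intros X y. evar_last. { apply (is_derive_comp (fun y => y * bes 1 (X * y)) (fun y => y - b)).
      apply is_derive_ubes0. auto_derive; auto. }
    unfold scal; simpl; unfold mult; simpl; ring. }
  rewrite (CRInt_ext (fun y => _ - _)%C (fun y => RtoC (bes 0 (x * y) * bes 0 (c * (y - b))) - RtoC (bes 0 ((x - c) * y)))%C) in H; auto.
  2: { intros y _. rewrite !Rplus_0_r, Rplus_opp_r, Rmult_0_l, bes_at_0. simpl. 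
       replace (x + - c) with (x - c) by ring. rewrite Rinv_1, Rmult_1_r. reflexivity. }
  rewrite CRInt_minus in H; auto; [| intros; cont ..].
  rewrite (CRInt_FTC (fun y => RtoC (y * bes 1 ((x - c) * y))) (fun y => RtoC (bes 0 ((x - c) * y)))) in H; auto.
  2: { intros; apply cderiv_RtoC, is_derive_ubes0. }
  2: { intros; cont. }
  rewrite (CRInt_ext (fun y => _ - _)%C (fun y => RtoC 0)) in H by (try lra; intros; rewrite Rminus_diag, !Rmult_0_l, Rmult_0_r, Ropp_0; ring).
  rewrite (CRInt_FTC (fun y => RtoC 0) (fun y => RtoC 0)) in H; try lra; try (intros; cont).
  2: { intros; apply cderiv_const. }
  replace (0 * bes 1 ((x - c) * 0)) with 0 in H by ring.
  assert (E : forall A B, (A - (B - 0) = 0 - 0 -> A = B)%C).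
  { intros A B E. replace A with (A - (B - 0) + B)%C by ring. rewrite E; ring. }
  apply E, H.
  - intros y s Hy Hs. apply cderiv_RtoC. evar_last. { apply is_derive_Rmult; apply is_derive_bes_lin. }
    cbv beta; ring.
  - intros y s Hy Hs. apply cderiv_RtoC. evar_last.
    { apply (@is_derive_opp R_AbsRing R_NormedModule), is_derive_Rmult; [apply is_derive_ubes0 | apply D2]. }
    unfold opp; simpl. cbv beta; ring.
  - intros y s Hy Hs. cont.
Qed.

(** The same device with one factor differentiated; here the boundary term at [y = b]
    is an exact derivative along the translation. *)
Lemma bes_addition_deriv b c x : 0 <= b -> 0 <= c ->
  CRInt (fun y => RtoC (bes 0 (x * y) * (c * bes 1 (c * (y - b))))) 0 b =
  RtoC (bes 0 ((x - c) * b) - bes 0 (x * b)).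
Proof.
  intros Hb Hc.
  pose proof (rectangle_closed_form
    (fun y s => RtoC (bes 0 ((x + s) * y) * ((c + s) * bes 1 ((c + s) * (y - b)))))
    (fun y s => RtoC (y * bes 1 ((x + s) * y) * bes 0 ((c + s) * (y - b))))
    (fun y s => RtoC (bes 0 ((x + s) * y) * bes 0 ((c + s) * (y - b)) -
                      y * bes 1 ((x + s) * y) * ((c + s) * bes 1 ((c + s) * (y - b)))))
    0 b (- c) 0 Hb ltac:(lra)) as H.
  rewrite (CRInt_ext (fun y => _ - _)%C (fun y => RtoC (bes 0 (x * y) * (c * bes 1 (c * (y - b)))))%C) in H; auto.
  2: { intros y _. rewrite !Rplus_0_r, Rplus_opp_r, !Rmult_0_l, Rmult_0_r. ring. }
  rewrite H.
  - rewrite (CRInt_FTC (fun s => RtoC (- bes 0 ((x + s) * b)))).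
    + rewrite Rplus_0_r. replace (x + - c) with (x - c) by ring.
      rewrite <- RtoC_minus. f_equal; ring.
    + lra.
    + intros s _. eapply cderiv_eq. { apply cderiv_RtoC.
      apply (@is_derive_opp R_AbsRing R_NormedModule), is_derive_bes_lin. }
      rewrite <- RtoC_minus. f_equal. unfold opp; simpl.
      replace ((c + s) * (b - b)) with 0 by ring. rewrite bes_at_0. simpl. field.
    + intros; cont.
  - intros y s Hy Hs. apply cderiv_RtoC. evar_last.
    { apply is_derive_Rmult; [apply is_derive_bes_lin|].
      apply is_derive_Rmult; [|apply is_derive_bes_lin].
      apply (@is_derive_plus R_AbsRing R_NormedModule); [apply @is_derive_const | apply (@is_derive_id R_AbsRing)]. }
    pose proof (bes_rec 0 ((c + s) * (y - b))) as E. simpl INR in E.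
    unfold plus, zero, one; simpl.
    match goal with |- ?l = ?r => replace l with (r + bes 0 ((x + s) * y) *
       ((1 * bes 1 ((c + s) * (y - b)) - bes 0 ((c + s) * (y - b))) -
       (c + s) * (y - b) * bes 2 ((c + s) * (y - b)))) by ring end.
    rewrite E. ring.
  - intros y s Hy Hs. apply cderiv_RtoC. evar_last.
    { apply is_derive_Rmult; [apply is_derive_ubes0 |].
      apply is_derive_bes_comp with (l := c + s). auto_derive; auto; ring. }
    cbv beta; ring.
  - intros y s Hy Hs. cont.
Qed.

(** The solution of [phi x + e * int_0^a J0(2 sqrt(xy)) phi y dy = J0(2 sqrt(ax))]
    for a sign [e]: it is [(1 + e d/dx) J0(2 sqrt(a(x-a)))]. *)
Definition phi_sol (e a x : R) : R := bes 0 (a * (x - a)) - e * (a * bes 1 (a * (x - a))).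

(** The two addition formulas produce the same two Bessel functions, and [e * e = 1]
    lets them recombine into [phi_sol]. The identity holds for every real [x], which
    is what makes [phi_sol] usable under the Laplace transform. *)
Lemma phi_sol_equation e a x : e * e = 1 -> 0 <= a ->
  CRInt (fun y => RtoC (bes 0 (x * y)) * RtoC (phi_sol e a y))%C 0 a =
  RtoC (e * (bes 0 (x * a) - phi_sol e a x)).
Proof.
  intros He Ha. unfold phi_sol.
  rewrite (CRInt_ext _ (fun y => RtoC (bes 0 (x * y) * bes 0 (a * (y - a))) -
    RtoC e * RtoC (bes 0 (x * y) * (a * bes 1 (a * (y - a)))))%C); auto.
  2: { intros. rewrite <- !RtoC_mult, <- RtoC_minus. f_equal; ring. }
  rewrite CRInt_minus; auto; try (intros; cont).
  rewrite CRInt_scal; auto; try (intros; cont).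
  rewrite bes_addition, bes_addition_deriv by assumption.
  rewrite <- !RtoC_mult, <- RtoC_minus. f_equal. 
  replace ((x - a) * a) with (a * (x - a)) by ring.
  replace (a * bes 1 (a * (x - a))) with (e * e * (a * bes 1 (a * (x - a)))) at 1 by (rewrite He; ring).
  ring.
Qed.

Lemma phi_sol_bound e b y : e * e = 1 -> 0 <= b <= y -> Rabs (phi_sol e b y) <= 1 + b.
Proof.
  intros He Hb. unfold phi_sol.
  assert (0 <= b * (y - b)) by nra.
  pose proof (bes_bound 0 _ H). pose proof (bes_bound 1 _ H).
  eapply Rle_trans; [apply Rabs_triang|]. rewrite Rabs_Ropp, !Rabs_mult.
  assert (Rabs e = 1). { assert (e = 1 \/ e = -1) as [->| ->] by nra; unfold Rabs; destruct Rcase_abs; lra. }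
  rewrite H2, (Rabs_pos_eq b) by lra. nra.
Qed.

Lemma continuous_phi_sol {U : UniformSpace} e a (f : U -> R) x :
  continuous f x -> continuous (fun u => phi_sol e a (f u)) x.
Proof. intros; unfold phi_sol; cont. Qed.

Ltac cont ::= repeat first [ cont_step | match goal with
  | |- continuous (fun u => bes _ (@?f u)) _ => apply continuous_bes
  | |- continuous (bes ?m) _ => apply (continuous_bes m (fun u => u))
  | |- continuous (phi_sol ?e ?a) _ => apply (continuous_phi_sol e a (fun u => u))
  | |- continuous (fun u => phi_sol _ _ (@?f u)) _ => apply continuous_phi_sol end ].

(** Gronwall: the integral [g b] of [Cmod f] from [b] to [a] makes [g b * exp (K * b)]
    nondecreasing, and it vanishes at [b = a]. *)
Lemma volterra_zero (f : R -> C) a K : 0 <= a -> 0 <= K -> (forall x, continuous f x) ->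
  (forall b, 0 < b <= a -> Cmod (f b) <= K * RInt (fun y => Cmod (f y)) b a) ->
  forall b, 0 < b <= a -> f b = RtoC 0.
Proof.
  intros Ha HK Hf H b Hb.
  assert (Hc : forall x, continuous (fun y => Cmod (f y)) x) by (intros; cont; auto).
  set (g := fun b => RInt (fun y => Cmod (f y)) b a).
  assert (Dg : forall x, is_derive g x (- Cmod (f x))).
  { intros x. unfold g. evar_last.
    { apply (is_derive_RInt' (V := R_NormedModule) (fun y => Cmod (f y)) (fun b => RInt (fun y => Cmod (f y)) b a) x a); [|apply Hc].
      apply filter_forall. intros; apply (@RInt_correct R_CompleteNormedModule), (@ex_RInt_continuous R_CompleteNormedModule); auto. }
    reflexivity. }
  assert (G : g b * exp (K * b) <= g a * exp (K * a)).
  { apply (is_derive_ge0_le (fun b => g b * exp (K * b)) (fun b => (K * g b - Cmod (f b)) * exp (K * b))); try lra.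
    - intros x Hx. evar_last.
      { apply is_derive_Rmult; [apply Dg|]. apply (is_derive_comp exp (fun b => K * b)); [apply is_derive_exp|].
        auto_derive; auto. }
      unfold scal; simpl; unfold mult; simpl. ring.
    - intros x Hx. apply Rmult_le_pos; [|left; apply exp_pos]. specialize (H x ltac:(lra)). unfold g; lra. }
  replace (g a) with 0 in G by (symmetry; apply (@RInt_point R_CompleteNormedModule)).
  pose proof (exp_pos (K * b)). specialize (H b Hb). fold (g b) in H.
  pose proof (Cmod_ge_0 (f b)).
  apply Cmod_eq_0. assert (g b <= 0) by nra. nra.
Qed.

(** Uniqueness: pairing a homogeneous solution [f] on [(0, a)] with the solutions
    for all shorter intervals [(0, b)] turns the equation into the Volterra
    equation [f b = - e * int_b^a phi_sol e b y * f y dy]. *)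
Lemma homogeneous_zero e a (f : R -> C) : e * e = 1 -> 0 <= a -> (forall x, continuous f x) ->
  (forall x, 0 < x -> f x = (- RtoC e * CRInt (fun y => RtoC (bes 0 (x * y)) * f y) 0 a)%C) ->
  forall x, 0 < x -> f x = RtoC 0.
Proof.
  intros He Ha Hf H.
  assert (Z : forall b, 0 < b <= a -> f b = RtoC 0).
  { apply (volterra_zero f a (1 + a)); auto; try lra. intros b Hb.
    assert (E : f b = (- RtoC e * CRInt (fun y => RtoC (phi_sol e b y) * f y) b a)%C).
    { assert (S : CRInt (fun x => RtoC (phi_sol e b x) * f x)%C 0 b =
        (- RtoC e * CRInt (fun y => RtoC (e * (bes 0 (b * y) - phi_sol e b y)) * f y) 0 a)%C).
      { rewrite (CRInt_ext _ (fun x => - RtoC e * CRInt (fun y => RtoC (phi_sol e b x) * (RtoC (bes 0 (x * y)) * f y)) 0 a)%C); try lra.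
        2: { intros x Hx. rewrite CRInt_scal; auto; try (intros; cont; auto). rewrite (H x) at 1 by lra. ring. }
        assert (HF : cont_on_rect (fun z : R * R => RtoC (phi_sol e b (fst z)) * (RtoC (bes 0 (fst z * snd z)) * f (snd z)))%C 0 b 0 a).
        { intros x y _ _. cont. apply (continuous_comp (fun z : R * R => snd z) f); [cont | apply Hf]. }
        assert (0 <= b) by lra.
        rewrite CRInt_scal; try lra.
        2: { intros x Hx.
             pose proof (continuous_CRInt_param (fun z => RtoC (phi_sol e b (snd z)) * (RtoC (bes 0 (snd z * fst z)) * f (fst z)))%C 0 a (-1) (b+1) x) as P.
             apply P; try lra. intros u v _ _. cont. apply (continuous_comp (fun z : R * R => fst z) f); [cont | apply Hf]. }
        f_equal.
        rewrite (CRInt_swap (fun z => RtoC (phi_sol e b (fst z)) * (RtoC (bes 0 (fst z * snd z)) * f (snd z)))%C); auto.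
        apply CRInt_ext; auto. intros y Hy. simpl.
        rewrite (CRInt_ext _ (fun x => f y * (RtoC (bes 0 (y * x)) * RtoC (phi_sol e b x)))%C); auto.
        2: { intros x Hx. rewrite (Rmult_comm x y). ring. }
        rewrite CRInt_scal; auto; [| intros; cont].
        rewrite phi_sol_equation by (auto; lra). rewrite (Rmult_comm y b). ring. }
      rewrite (CRInt_ext (fun y => RtoC (e * _) * _)%C (fun y => RtoC e * (RtoC (bes 0 (b * y)) * f y) - RtoC e * (RtoC (phi_sol e b y) * f y))%C) in S; auto.
      2: { intros; rewrite RtoC_mult, RtoC_minus; ring. }
      rewrite CRInt_minus in S; auto; try (intros; cont; auto).
      rewrite !CRInt_scal in S; auto; try (intros; cont; auto).
      rewrite (CRInt_Chasles (fun y : R => RtoC (phi_sol e b y) * f y)%C 0 b a) in S; try lra; try (intros; cont; auto).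
      pose proof (H b ltac:(lra)) as Hb'.
      assert (E2 : forall z, (RtoC e * (RtoC e * z) = z)%C) by (intros z; rewrite Cmult_assoc, <- RtoC_mult, He; ring).
      set (A := CRInt (fun y => RtoC (bes 0 (b * y)) * f y)%C 0 a) in *.
      set (B := CRInt (fun y => RtoC (phi_sol e b y) * f y)%C 0 b) in *.
      set (D := CRInt (fun y => RtoC (phi_sol e b y) * f y)%C b a) in *.
      replace (- RtoC e * (RtoC e * A - RtoC e * (B + D)))%C
        with (- (RtoC e * (RtoC e * A)) + (RtoC e * (RtoC e * (B + D))))%C in S by ring.
      rewrite !E2 in S. rewrite Hb'. f_equal.
      replace A with (B + D - (- A + (B + D)))%C by ring. rewrite <- S. ring. }
    rewrite E, Cmod_mult.
    replace (Cmod (- RtoC e)) with 1.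
    2: { rewrite Cmod_opp, Cmod_R. assert (e = 1 \/ e = -1) as [->| ->] by nra; unfold Rabs; destruct Rcase_abs; lra. }
    rewrite Rmult_1_l.
    replace ((1 + a) * RInt (fun y : R => Cmod (f y)) b a) with (RInt (fun y : R => (1 + a) * Cmod (f y)) b a).
    2: { apply (@RInt_scal R_CompleteNormedModule). apply ex_RInt_cont; try lra. intros; cont; auto. }
    apply CRInt_bound; try lra; try (intros; cont; auto).
    - apply ex_RInt_cont; try lra. intros; cont; auto.
    - rewrite Cmod_mult, Cmod_R. apply Rmult_le_compat_r; [apply Cmod_ge_0|].
      eapply Rle_trans; [apply phi_sol_bound; lra|lra]. }
  intros x Hx. rewrite (H x Hx).
  rewrite (CRInt_ext _ (fun _ => RtoC 0)); auto.
  - rewrite (CRInt_FTC (fun _ => RtoC 0)); auto; try ring.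
    + intros; apply cderiv_const. + intros; cont.
  - intros y Hy. rewrite Z by lra. ring.
Qed.

Lemma entire_continuous f : entire f -> forall x : R, continuous (fun x : R => f (RtoC x)) x.
Proof.
  intros H x. apply (continuous_comp (fun x : R => RtoC x) f); [cont|].
  pose proof (@ex_derive_continuous C_AbsRing C_NormedModule f (RtoC x) (H (RtoC x))) as Hc.
  intros P HP. specialize (Hc P HP). destruct Hc as [d Hd].
  assert (Hs : 0 < d / 2) by (destruct d; simpl; lra).
  exists (mkposreal _ Hs). intros y Hy. apply Hd.
  unfold ball; simpl. unfold AbsRing_ball; simpl. unfold abs; simpl.
  eapply Rle_lt_trans; [apply Cmod_le_ReIm|].
  destruct Hy as [A B].
  change (Rabs (Re y - x) < d / 2) in A. change (Rabs (Im y - 0) < d / 2) in B.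
  change (Rabs (Re y - x) + Rabs (Im y - 0) < d). lra.
Qed.

Lemma phi_unique e a phi : e * e = 1 -> 0 < a -> entire phi ->
  (forall x, 0 < x -> (phi (RtoC x) + RtoC e *
     CRInt (fun y => RtoC (J0 (2 * sqrt (x * y))) * phi (RtoC y)) 0 a)%C = RtoC (J0 (2 * sqrt (a * x)))) ->
  forall x, 0 < x -> phi (RtoC x) = RtoC (phi_sol e a x).
Proof.
  intros He Ha Hphi H.
  pose proof (entire_continuous _ Hphi) as Hc.
  assert (Z : forall x, 0 < x -> (phi (RtoC x) - RtoC (phi_sol e a x) = RtoC 0)%C).
  { apply (homogeneous_zero e a (fun x => phi (RtoC x) - RtoC (phi_sol e a x))%C); auto; try lra.
    { intros; cont; auto. }
    intros x Hx. specialize (H x Hx).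
    rewrite J0_bes in H by nra.
    rewrite (CRInt_ext _ (fun y => RtoC (bes 0 (x * y)) * phi (RtoC y))%C) in H; try lra.
    2: { intros y Hy. rewrite J0_bes by nra. reflexivity. }
    rewrite (CRInt_ext _ (fun y => RtoC (bes 0 (x * y)) * phi (RtoC y) - RtoC (bes 0 (x * y)) * RtoC (phi_sol e a y))%C); try lra.
    2: { intros; ring. }
    rewrite CRInt_minus; try lra; try (intros; cont; auto).
    rewrite phi_sol_equation by (auto; lra).
    set (I := CRInt _ 0 a) in *.
    replace (phi (RtoC x)) with (phi (RtoC x) + RtoC e * I - RtoC e * I)%C by ring.
    rewrite H. rewrite RtoC_mult, RtoC_minus, (Rmult_comm x a).
    replace (- RtoC e * (I - RtoC e * (bes 0 (a * x) - phi_sol e a x)))%C with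
     (- RtoC e * I + RtoC e * RtoC e * (bes 0 (a * x) - phi_sol e a x))%C by ring.
    rewrite <- RtoC_mult, He. ring. }
  intros x Hx. specialize (Z x Hx).
  replace (phi (RtoC x)) with (phi (RtoC x) - RtoC (phi_sol e a x) + RtoC (phi_sol e a x))%C by ring.
  rewrite Z; ring.
Qed.

(** * The Laplace transform of the solution *)

Lemma Cmod_Cexp z : Cmod (Cexp z) = exp (Re z).
Proof.
  unfold Cexp. rewrite Cmod_mult, Cmod_R, Rabs_pos_eq by (left; apply exp_pos).
  unfold Cmod; simpl. replace (_ + _) with 1.
  - rewrite sqrt_1; ring.
  - pose proof (sin2_cos2 (Im z)) as H. unfold Rsqr in H. lra.
Qed.

Lemma Cexp_0 : Cexp (RtoC 0) = RtoC 1.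
Proof. unfold Cexp; simpl. rewrite exp_0, cos_0, sin_0. apply C_eq; simpl; ring. Qed.

Lemma Cexp_plus z w : Cexp (z + w)%C = (Cexp z * Cexp w)%C.
Proof.
  unfold Cexp; simpl. rewrite exp_plus, cos_plus, sin_plus.
  apply C_eq; simpl; unfold Re, Im; ring.
Qed.

Lemma Cexp_opp_mult z : (Cexp (- z) * Cexp z)%C = RtoC 1.
Proof. rewrite <- Cexp_plus, <- Cexp_0. f_equal. ring. Qed.

Lemma Re_le_Cmod z : Re z <= Cmod z.
Proof. pose proof (re_le_Cmod z). pose proof (Rle_abs (Re z)). lra. Qed.

Lemma Cmod_Cexp_le z : Cmod (Cexp z) <= exp (Cmod z).
Proof. rewrite Cmod_Cexp. pose proof (Re_le_Cmod z) as [H|H].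
  - left; now apply exp_increasing. - rewrite H; apply Rle_refl. Qed.

Lemma exp_le x y : x <= y -> exp x <= exp y.
Proof. intros [H| ->]; [left; now apply exp_increasing | apply Rle_refl]. Qed.

Lemma continuous_bounded (f : R -> C) a b : a <= b -> (forall x, a <= x <= b -> continuous f x) ->
  exists M, 0 <= M /\ forall x, a <= x <= b -> Cmod (f x) <= M.
Proof.
  intros Hab H. destruct (continuity_ab_maj (fun x => Cmod (f x)) a b Hab) as [m [Hm _]].
  - intros c Hc. apply continuity_pt_filterlim. apply (continuous_Cmod f). auto.
  - exists (Cmod (f m)); split; [apply Cmod_ge_0 | assumption].
Qed.

Lemma is_lim_exp_scal A k : 0 < k -> is_lim (fun x => A * exp (- (k * x))) p_infty 0.
Proof.
  intros Hk. replace (Finite 0) with (Rbar_mult A 0) by (simpl; f_equal; ring).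
  apply is_lim_scal_l, is_lim_exp_decay, Hk.
Qed.

Lemma linear_exp_bound k X : 0 < k -> 0 <= X -> (1 + X) * exp (- (k * X)) <= (1 + 2 / k) * exp (- (k / 2 * X)).
Proof.
  intros Hk HX. replace (- (k * X)) with (- (k / 2 * X) + - (k / 2 * X)) by field.
  rewrite exp_plus, <- Rmult_assoc. apply Rmult_le_compat_r; [left; apply exp_pos|].
  rewrite exp_Ropp. apply Rmult_le_reg_r with (exp (k / 2 * X)); [apply exp_pos|].
  rewrite Rmult_assoc, Rinv_l by (apply Rgt_not_eq, exp_pos).
  assert (0 <= k / 2 * X) by (apply Rmult_le_pos; lra).
  pose proof (exp_ineq1_le (k / 2 * X)).
  assert (0 < 2 / k) by (apply Rdiv_lt_0_compat; lra).
  apply Rle_trans with ((1 + 2 / k) * (1 + k / 2 * X)).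
  - replace ((1 + 2 / k) * (1 + k / 2 * X)) with (1 + X + (2 / k + k / 2 * X)) by (field; lra). lra.
  - apply Rmult_le_compat_l; lra.
Qed.

Lemma C_neq0_Re z : 0 < Re z -> z <> RtoC 0.
Proof. intros H E. rewrite E in H. simpl in H. lra. Qed.

(** The Laplace transform [exp(- y/p) / p] of [J0 (2 sqrt (x y))]: the form
    [exp(s/p - p x) (bes 0 (x s) dx + (x/p) bes 1 (x s) ds)] is closed. *)
Lemma bes_laplace p Y : 0 < Re p -> 0 <= Y -> exists A, 0 <= A /\ forall X y, 0 <= X -> 0 <= y <= Y ->
  Cmod (CRInt (fun x => Cexp (- (p * RtoC x)) * RtoC (bes 0 (x * y))) 0 X - / p * Cexp (- (RtoC y * / p)))%C
    <= A * exp (- (Re p / 2 * X)).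
Proof.
  intros Hp HY. pose proof (C_neq0_Re _ Hp) as Hp0.
  set (q := (/ p)%C).
  assert (Hq : 0 < Cmod q).
  { unfold q. rewrite Cmod_inv by auto. now apply Rinv_0_lt_compat, Cmod_gt_0. }
  set (B := exp (Y * Cmod q) * (Cmod q + Cmod q * exp (Y * Cmod q) * Y) * (1 + 2 / Re p)).
  exists B. 
  assert (P2 : 0 <= 2 / Re p) by (apply Rlt_le, Rdiv_lt_0_compat; lra).
  split.
  { unfold B. pose proof (exp_pos (Y * Cmod q)). repeat apply Rmult_le_pos; try lra.
    repeat apply Rplus_le_le_0_compat; repeat apply Rmult_le_pos; lra. }
  intros X y HX Hy. set (L := CRInt _ 0 X).
  pose proof (rectangle_closed_form
    (fun x s => Cexp (RtoC s * q - p * RtoC x) * RtoC (bes 0 (x * s)))%C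
    (fun x s => q * (Cexp (RtoC s * q - p * RtoC x) * RtoC (x * bes 1 (s * x))))%C
    (fun x s => Cexp (RtoC s * q - p * RtoC x) * (q * RtoC (bes 0 (x * s)) - RtoC (x * bes 1 (x * s))))%C
    0 X 0 y HX (proj1 Hy)) as H.
  assert (pq : (p * q = 1)%C) by (unfold q; field; auto).
  assert (E : (Cexp (RtoC y * q) * L - q
     = - (q * Cexp (- (p * RtoC X))) + CRInt (fun s => q * (Cexp (RtoC s * q - p * RtoC X) * RtoC (X * bes 1 (s * X)))) 0 y)%C).
  { rewrite (CRInt_ext (fun s : R => _ - _)%C (fun s => q * (Cexp (RtoC s * q - p * RtoC X) * RtoC (X * bes 1 (s * X))))%C 0 y) in H.
    2: tauto.
    2: { intros s Hs. rewrite Rmult_0_l. ring. }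
    rewrite <- H; clear H.
    - rewrite CRInt_minus; auto; try (intros; cont).
      unfold L. rewrite <- CRInt_scal; auto; try (intros; cont).
      rewrite (CRInt_ext (fun x : R => Cexp (RtoC y * q - p * RtoC x) * _)%C (fun x => Cexp (RtoC y * q) * (Cexp (- (p * RtoC x)) * RtoC (bes 0 (x * y))))%C); auto.
      2: { intros x Hx. unfold Cminus. rewrite Cexp_plus. ring. }
      rewrite (CRInt_FTC (fun x => - (q * Cexp (- (p * RtoC x))))%C (fun x => Cexp (RtoC 0 * q - p * RtoC x) * RtoC (bes 0 (x * 0)))%C); auto.
      + rewrite Cmult_0_r. replace (- RtoC 0)%C with (RtoC 0) by ring. rewrite Cexp_0. ring.
      + intros x Hx. eapply cderiv_eq.
        { apply cderiv_opp, cderiv_scal, cderiv_Cexp, cderiv_opp, cderiv_scal, cderiv_id. }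
        rewrite Rmult_0_r, bes_at_0. replace (/ INR (fact 0)) with 1 by (simpl; field).
        replace (RtoC 0 * q - p * RtoC x)%C with (- (p * RtoC x))%C by ring.
        transitivity ((p * q) * Cexp (- (p * x)))%C; [ring|]. rewrite pq; ring.
      + intros; cont.
    - intros x s Hx Hs. eapply cderiv_eq.
      { apply cderiv_mult; [apply cderiv_Cexp, cderiv_minus; [apply cderiv_mult; [apply cderiv_id | apply cderiv_const] | apply cderiv_const]|].
        apply cderiv_RtoC, is_derive_bes_comp with (l := x). auto_derive; auto. ring. }
      cbv beta. rewrite !RtoC_mult, RtoC_opp. ring.
    - intros x s Hx Hs. eapply cderiv_eq.
      { apply cderiv_scal, cderiv_mult; [apply cderiv_Cexp, cderiv_minus; [apply cderiv_const | apply cderiv_scal, cderiv_id]|].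
        apply cderiv_RtoC, is_derive_ubes0. }
      cbv beta. rewrite (Rmult_comm s x), !RtoC_mult.
      match goal with |- ?l = ?r => replace l with (r + (1 - p * q) * (Cexp (s * q - p * x) * (x * bes 1 (x * s))))%C by ring end.
      rewrite pq. ring.
    - intros x s Hx Hs. cont. }
  assert (E2 : (L - q * Cexp (- (RtoC y * q)) = Cexp (- (RtoC y * q)) * (Cexp (RtoC y * q) * L - q))%C).
  { transitivity ((Cexp (- (RtoC y * q)) * Cexp (RtoC y * q)) * L - q * Cexp (- (RtoC y * q)))%C; [|ring].
    rewrite Cexp_opp_mult. ring. }
  rewrite E2, E. rewrite Cmod_mult.
  assert (Hqy : forall s, 0 <= s <= Y -> Cmod (RtoC s * q) <= Y * Cmod q).
  { intros s Hs. rewrite Cmod_mult, Cmod_R, Rabs_pos_eq by lra. apply Rmult_le_compat_r; lra. }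
  assert (B1 : Cmod (Cexp (- (RtoC y * q))) <= exp (Y * Cmod q)).
  { eapply Rle_trans; [apply Cmod_Cexp_le|]. apply exp_le. rewrite Cmod_opp. apply Hqy; lra. }
  assert (EX : forall z, Cmod (Cexp (z - p * RtoC X)%C) <= exp (Cmod z) * exp (- (Re p * X))).
  { intros z. rewrite Cmod_Cexp, <- exp_plus. apply exp_le. simpl.
    pose proof (Re_le_Cmod z). unfold Re in *. lra. }
  assert (B2 : Cmod (CRInt (fun s => q * (Cexp (RtoC s * q - p * RtoC X) * RtoC (X * bes 1 (s * X)))) 0 y)%C
      <= (y - 0) * (Cmod q * (exp (Y * Cmod q) * exp (- (Re p * X)) * X))).
  { apply CRInt_bound_const; try lra; [intros; cont|]. intros s Hs.
    rewrite !Cmod_mult, Cmod_R, Rabs_mult, (Rabs_pos_eq X) by lra.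
    apply Rmult_le_compat_l; [lra|]. apply Rmult_le_compat.
    - apply Cmod_ge_0.
    - apply Rmult_le_pos; [lra|apply Rabs_pos].
    - eapply Rle_trans; [apply EX|]. apply Rmult_le_compat_r; [left; apply exp_pos|].
      apply exp_le, Hqy; lra.
    - assert (Rabs (bes 1 (s * X)) <= 1) by (apply bes_bound; nra). nra. }
  assert (B3 : Cmod (- (q * Cexp (- (p * RtoC X))))%C <= Cmod q * exp (- (Re p * X))).
  { rewrite Cmod_opp, Cmod_mult. apply Rmult_le_compat_l; [lra|].
    replace (- (p * X))%C with (0 - p * X)%C by ring.
    eapply Rle_trans; [apply EX|]. rewrite Cmod_0, exp_0. lra. }
  pose proof (linear_exp_bound _ X Hp HX) as B4.
  set (ey := exp (Y * Cmod q)) in *. assert (0 < ey) by apply exp_pos.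
  set (ex := exp (- (Re p * X))) in *. assert (0 < ex) by apply exp_pos.
  set (ex2 := exp (- (Re p / 2 * X))) in *.
  apply Rle_trans with (ey * (Cmod q * ex + (y - 0) * (Cmod q * (ey * ex * X)))).
  { apply Rmult_le_compat; auto; try apply Cmod_ge_0.
    eapply Rle_trans; [apply Cmod_triangle|]. apply Rplus_le_compat; assumption. }
  unfold B. rewrite !Rmult_assoc. apply Rmult_le_compat_l; [lra|].
  assert (0 <= Cmod q * ey * Y) by (apply Rmult_le_pos; [apply Rmult_le_pos|]; lra).
  apply Rle_trans with ((Cmod q + Cmod q * ey * Y) * ((1 + X) * ex)).
  - assert (0 <= Cmod q * ey * ex * X) by (repeat apply Rmult_le_pos; lra).
    assert ((y - 0) * (Cmod q * (ey * ex * X)) <= Cmod q * ey * Y * (X * ex)).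
    { replace ((y - 0) * (Cmod q * (ey * ex * X))) with (y * (Cmod q * ey * ex * X)) by ring.
      replace (Cmod q * ey * Y * (X * ex)) with (Y * (Cmod q * ey * ex * X)) by ring.
      apply Rmult_le_compat_r; lra. }
    assert (0 <= Cmod q * ex * X) by (repeat apply Rmult_le_pos; lra).
    assert (0 <= Cmod q * ey * Y * ex) by (apply Rmult_le_pos; lra).
    nra.
  - rewrite <- !Rmult_assoc in *. rewrite (Rmult_assoc _ (1 + X)), (Rmult_assoc _ (1 + 2 / Re p)).
    apply Rmult_le_compat_l; [nra|]. assumption.
Qed.

(** The integral equation rewrites [phi_sol] through [bes 0 (x y)] with [0 <= y <= a],
    so that [bes_laplace] can be used under the [y]-integral with an error uniform in
    [y]. *)
Lemma phi_sol_laplace e a p : e * e = 1 -> 0 < a -> 0 < Re p ->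
  lim_inf (fun X => CRInt (fun x => Cexp (- (p * RtoC x)) * RtoC (phi_sol e a x)) 0 X)%C
    (/ p * (Cexp (- (RtoC a * / p)) -
       RtoC e * CRInt (fun y => RtoC (phi_sol e a y) * Cexp (- (RtoC y * / p))) 0 a))%C.
Proof.
  intros He Ha Hp. destruct (bes_laplace p a Hp ltac:(lra)) as [A [HA H]].
  destruct (continuous_bounded (fun y => RtoC (phi_sol e a y)) 0 a) as [M [HM Hb]]; [lra | intros; cont |].
  eapply lim_inf_squeeze with (X0 := 0) (r := fun X => (A + a * (M * A)) * exp (- (Re p / 2 * X)));
    [apply lim_inf_const | | apply is_lim_exp_scal; lra].
  intros X HX.
  set (L := fun y => CRInt (fun x => Cexp (- (p * RtoC x)) * RtoC (bes 0 (x * y)))%C 0 X).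
  assert (HL : forall y, 0 <= y <= a -> continuous L y).
  { intros y Hy. apply (continuous_CRInt_param (fun z => Cexp (- (p * RtoC (fst z))) * RtoC (bes 0 (fst z * snd z)))%C 0 X (-1) (a + 1)); try lra.
    intros u v _ _. cont. }
  assert (E : CRInt (fun x => Cexp (- (p * RtoC x)) * RtoC (phi_sol e a x))%C 0 X =
     (L a - RtoC e * CRInt (fun y => RtoC (phi_sol e a y) * L y) 0 a)%C).
  { rewrite (CRInt_ext _ (fun x => Cexp (- (p * RtoC x)) * RtoC (bes 0 (x * a)) -
      RtoC e * CRInt (fun y => Cexp (- (p * RtoC x)) * (RtoC (bes 0 (x * y)) * RtoC (phi_sol e a y))) 0 a)%C); try lra.
    2: { intros x Hx. rewrite CRInt_scal; [|lra|intros; cont].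
         rewrite phi_sol_equation by (auto; lra).
         rewrite RtoC_mult, RtoC_minus.
         transitivity (Cexp (- (p * x)) * (bes 0 (x * a) - (e * e)%C * (bes 0 (x * a) - phi_sol e a x)))%C; [|ring].
         rewrite <- RtoC_mult, He. ring. }
    assert (HF : cont_on_rect (fun z : R * R => Cexp (- (p * RtoC (fst z))) * (RtoC (bes 0 (fst z * snd z)) * RtoC (phi_sol e a (snd z))))%C 0 X 0 a)
      by (intros x y _ _; cont).
    assert (HC : forall x, 0 <= x <= X -> continuous (fun x => CRInt (fun y => Cexp (- (p * RtoC x)) * (RtoC (bes 0 (x * y)) * RtoC (phi_sol e a y))) 0 a)%C x).
    { intros x Hx.
      apply (continuous_CRInt_param (fun z => Cexp (- (p * RtoC (snd z))) * (RtoC (bes 0 (snd z * fst z)) * RtoC (phi_sol e a (fst z))))%C 0 a (-1) (X + 1)); try lra.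
      intros u v _ _. cont. }
    rewrite CRInt_minus; try lra; try (intros; cont; auto).
    rewrite CRInt_scal; try lra; auto.
    rewrite (CRInt_swap (fun z : R * R => Cexp (- (p * RtoC (fst z))) * (RtoC (bes 0 (fst z * snd z)) * RtoC (phi_sol e a (snd z))))%C) by (auto; lra).
    apply (f_equal (fun z => L a - RtoC e * z)%C). apply CRInt_ext; [lra|]. intros y Hy. simpl. unfold L.
    rewrite <- CRInt_scal; try lra; try (intros; cont).
    apply CRInt_ext; [lra|]. intros x Hx. ring. }
  rewrite E.
  replace (_ - _)%C with (- (L a - / p * Cexp (- (RtoC a * / p))) +
     RtoC e * CRInt (fun y => RtoC (phi_sol e a y) * (L y - / p * Cexp (- (RtoC y * / p)))) 0 a)%C.
  2: { rewrite (CRInt_ext (fun y : R => RtoC (phi_sol e a y) * (L y - _))%C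
         (fun y => RtoC (phi_sol e a y) * L y - / p * (RtoC (phi_sol e a y) * Cexp (- (RtoC y * / p))))%C); try lra.
       2: { intros; ring. }
       rewrite CRInt_minus; try lra; try (intros; cont; auto).
       rewrite CRInt_scal; try lra; try (intros; cont; auto). ring. }
  eapply Rle_trans; [apply Cmod_triangle|]. rewrite Cmod_opp, Cmod_mult, Cmod_R.
  replace (Rabs e) with 1.
  2: { assert (e = 1 \/ e = -1) as [->| ->] by nra; unfold Rabs; destruct Rcase_abs; lra. }
  rewrite Rmult_1_l, Rmult_plus_distr_r. apply Rplus_le_compat.
  { apply (H X a); lra. }
  eapply Rle_trans.
  { apply CRInt_bound_const with (M := M * (A * exp (- (Re p / 2 * X)))); [lra | intros; cont; auto |].
    intros y Hy. rewrite Cmod_mult. apply Rmult_le_compat; auto; try apply Cmod_ge_0. apply (H X y); lra. }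
  apply Req_le; ring.
Qed.

(** * The transform of the solution *)

Lemma smooth_continuous psi x : smooth psi -> continuous psi x.
Proof.
  intros H. destruct (H 1%nat x) as [A B]. simpl in A, B.
  apply continuous_pair; apply (@ex_derive_continuous R_AbsRing R_NormedModule); assumption.
Qed.

Lemma on_half_line_value e a phi psi v : (forall x : R, continuous (fun x : R => phi (RtoC x)) x) ->
  (forall x, 0 < x -> phi (RtoC x) = RtoC (phi_sol e a x)) ->
  (forall x, continuous psi x) ->
  lim_inf (fun X => CRInt (fun x => RtoC (phi_sol e a x) * psi x)%C 0 X) v ->
  on_half_line phi psi = v.
Proof.
  intros Hc Hphi Hpsi H. unfold on_half_line. apply CRInt_gen_half_line.
  - intros; cont; auto.
  - apply (lim_inf_ext 0) with (2 := H). intros X HX. apply CRInt_ext; [lra|].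
    intros x Hx. now rewrite Hphi by lra.
Qed.

(** [delta_a - e * phi * 1_(0,a)], the image of [phi * 1_(0,oo)] under [H]. *)
Definition H_phi (e a : R) : functional := fun psi =>
  (psi a - RtoC e * CRInt (fun y => RtoC (phi_sol e a y) * psi y) 0 a)%C.

Lemma H_phi_tempered e a : 0 < a -> tempered_distribution (H_phi e a).
Proof.
  intros Ha. split.
  - intros c psi chi [Hpsi _] [Hchi _]. unfold H_phi.
    rewrite (CRInt_ext _ (fun y => c * (RtoC (phi_sol e a y) * psi y) + RtoC (phi_sol e a y) * chi y)%C); try lra.
    2: { intros; ring. }
    pose proof (fun x => smooth_continuous psi x Hpsi). pose proof (fun x => smooth_continuous chi x Hchi).
    rewrite CRInt_plus; try lra; try (intros; cont; auto).
    rewrite CRInt_scal; try lra; try (intros; cont; auto). ring.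
  - destruct (continuous_bounded (fun y => RtoC (phi_sol e a y)) 0 a) as [M [HM Hb]]; [lra | intros; cont |].
    exists 0%nat, (1 + Rabs e * (a * M)). intros psi [Hpsi _] B HB.
    pose proof (fun x => smooth_continuous psi x Hpsi).
    assert (HB' : forall x, Cmod (psi x) <= B).
    { intros x. specialize (HB 0%nat 0%nat x (le_n _) (le_n _)). simpl in HB. rewrite Rmult_1_l in HB.
      unfold CDerive_n in HB. simpl in HB. unfold Re, Im in HB. rewrite <- surjective_pairing in HB. exact HB. }
    unfold H_phi, Cminus. eapply Rle_trans; [apply Cmod_triangle|].
    rewrite Cmod_opp, Cmod_mult, Cmod_R.
    replace ((1 + Rabs e * (a * M)) * B) with (B + Rabs e * ((a - 0) * (M * B))) by ring.
    apply Rplus_le_compat; [apply HB'|]. apply Rmult_le_compat_l; [apply Rabs_pos|].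
    apply CRInt_bound_const; try lra; [intros; cont; auto|].
    intros x Hx. rewrite Cmod_mult. apply Rmult_le_compat; auto; apply Cmod_ge_0.
Qed.

Lemma H_phi_supported e a : 0 < a -> supported_nonneg (H_phi e a).
Proof.
  intros Ha psi _ [d [Hd H]]. unfold H_phi. rewrite H by lra.
  rewrite (CRInt_ext _ (fun _ => RtoC 0)); try lra.
  - rewrite (CRInt_FTC (fun _ => RtoC 0)); try lra; try ring.
    + intros; apply cderiv_const. + intros; cont.
  - intros y Hy. rewrite H by lra. ring.
Qed.

(** At [-1 / lambda] the exponential is [exp (- p x)] with [p = i / lambda], and [1 /
    p = - i lambda] turns [exp (- y / p)] back into [exp (i lambda y)]; so
    [phi_sol_laplace] is the defining relation of the transform. *)
Lemma H_phi_is_H e a phi : e * e = 1 -> 0 < a ->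
  (forall x : R, continuous (fun x : R => phi (RtoC x)) x) ->
  (forall x, 0 < x -> phi (RtoC x) = RtoC (phi_sol e a x)) ->
  is_H (on_half_line phi) (H_phi e a).
Proof.
  intros He Ha Hc Hphi. split; [now apply H_phi_tempered|]. split; [now apply H_phi_supported|].
  intros l Hl. set (p := (Ci / l)%C).
  assert (Hl0 : l <> RtoC 0) by (intros E; rewrite E in Hl; simpl in Hl; lra).
  assert (Hp : 0 < Re p).
  { pose proof (Cmod2_pos _ Hl0). unfold p. destruct l as [u v]; simpl in *.
    replace (_ - _) with (v / (u * (u * 1) + v * (v * 1))) by (field; lra).
    now apply Rdiv_lt_0_compat. }
  assert (HCi : Ci <> RtoC 0) by (intros E; injection E; lra).
  assert (Ci2 : (Ci * Ci = - RtoC 1)%C) by (apply C_eq; simpl; ring).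
  assert (Hip : (/ p = - (Ci * l))%C).
  { unfold p. transitivity (l / Ci)%C; [field; auto|].
    transitivity ((- (Ci * Ci) * l) / Ci)%C; [rewrite Ci2; field; auto | field; auto]. }
  pose proof (phi_sol_laplace e a p He Ha Hp) as L.
  eexists. split.
  - intros psi [Hs _] [d [Hd H]].
    eapply on_half_line_value; eauto; [intros; now apply smooth_continuous|].
    apply (lim_inf_ext 0) with (2 := L). intros X HX. apply CRInt_ext; [lra|].
    intros x Hx. rewrite H by lra.
    replace (Ci * (RtoC (-1) / l) * RtoC x)%C with (- (p * RtoC x))%C by (unfold p; field; auto). ring.
  - intros psi [Hs _] [d [Hd H]]. unfold H_phi. rewrite H by lra.
    fold p. 
    match goal with |- _ = (p * (/ p * ?z))%C => replace (p * (/ p * z))%C with z end.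
    2: { field. now apply C_neq0_Re. }
    rewrite Hip.
    replace (Ci * l * RtoC a)%C with (- (RtoC a * - (Ci * l)))%C by ring.
    apply (f_equal (fun z => _ - RtoC e * z)%C).
    apply CRInt_ext; [lra|]. intros y Hy. rewrite H by lra.
    replace (Ci * l * RtoC y)%C with (- (RtoC y * - (Ci * l)))%C by ring. reflexivity.
Qed.

(** * Towers of derivatives *)

(** A function presented together with all its derivatives; this keeps iterated
    derivatives explicit. *)
Definition tower (F : nat -> R -> R) : Prop := forall n x, is_derive (F n) x (F (S n) x).

Lemma tower_Derive_n F n x : tower F -> Derive_n (F 0%nat) n x = F n x.
Proof.
  intros H. revert x; induction n as [|n IH]; intros x; simpl; [reflexivity|].
  rewrite (Derive_ext _ (F n)) by apply IH. apply is_derive_unique, H.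
Qed.

Lemma tower_ex_derive_n F n x : tower F -> ex_derive_n (F 0%nat) n x.
Proof.
  intros H. destruct n as [|n]; simpl; [exact I|].
  apply ex_derive_ext with (F n); [intros; symmetry; now apply tower_Derive_n|].
  eexists; apply H.
Qed.

Lemma smooth_tower (f : R -> R) : (forall n x, ex_derive_n f n x) -> tower (Derive_n f).
Proof. intros H n x. apply Derive_correct. exact (H (S n) x). Qed.

Lemma tower_continuous F n x : tower F -> continuous (F n) x.
Proof. intros H. apply (@ex_derive_continuous R_AbsRing R_NormedModule). eexists; apply H. Qed.

Lemma tower_minus F G : tower F -> tower G -> tower (fun n x => F n x - G n x).
Proof. intros HF HG n x. apply (@is_derive_minus R_AbsRing R_NormedModule); [apply HF | apply HG]. Qed.

Lemma tower_affine F s c : tower F -> tower (fun n x => s ^ n * F n (s * x + c)).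
Proof.
  intros H n x. evar_last.
  { apply (is_derive_scal (fun x => F n (s * x + c))). apply (is_derive_comp (F n) (fun x => s * x + c)).
    - apply H. - auto_derive; auto. }
  unfold scal; simpl; unfold mult; simpl. ring.
Qed.

(** The [n]-th derivative of a product, with one derivation distributed at a time
    instead of by binomial coefficients. *)
Fixpoint leibniz (n : nat) (F G : nat -> R -> R) (x : R) : R :=
  match n with
  | O => F O x * G O x
  | S n => leibniz n (fun k => F (S k)) G x + leibniz n F (fun k => G (S k)) x
  end.

Lemma tower_leibniz F G : tower F -> tower G -> tower (fun n => leibniz n F G).
Proof.
  intros HF HG n. revert F G HF HG; induction n as [|n IH]; intros F G HF HG x.
  - simpl. apply is_derive_Rmult; [apply HF | apply HG].
  - change (leibniz (S (S n)) F G x) with (leibniz (S n) (fun k => F (S k)) G x + leibniz (S n) F (fun k => G (S k)) x).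
    apply (@is_derive_plus R_AbsRing R_NormedModule (leibniz n (fun k => F (S k)) G) (leibniz n F (fun k => G (S k)))); apply IH; auto;
    intros k; [apply HF | apply HG].
Qed.

Lemma leibniz_bound n F G x A B : 0 <= A -> 0 <= B ->
  (forall k, (k <= n)%nat -> Rabs (F k x) <= A) -> (forall k, (k <= n)%nat -> Rabs (G k x) <= B) ->
  Rabs (leibniz n F G x) <= 2 ^ n * (A * B).
Proof.
  intros HA HB. revert F G; induction n as [|n IH]; intros F G HF HG; simpl.
  - rewrite Rabs_mult, Rmult_1_l. apply Rmult_le_compat; auto using Rabs_pos.
  - eapply Rle_trans; [apply Rabs_triang|].
    assert (Rabs (leibniz n (fun k => F (S k)) G x) <= 2 ^ n * (A * B)).
    { apply IH; intros; [apply HF | apply HG]; lia. }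
    assert (Rabs (leibniz n F (fun k => G (S k)) x) <= 2 ^ n * (A * B)).
    { apply IH; intros; [apply HF | apply HG]; lia. }
    lra.
Qed.

Lemma leibniz_zero_l n F G x : (forall k, F k x = 0) -> leibniz n F G x = 0.
Proof.
  revert F G; induction n as [|n IH]; intros F G H; simpl; [rewrite H; ring|].
  rewrite !IH; auto; ring.
Qed.

Lemma leibniz_zero_r n F G x : (forall k, G k x = 0) -> leibniz n F G x = 0.
Proof.
  revert F G; induction n as [|n IH]; intros F G H; simpl; [rewrite H; ring|].
  rewrite !IH; auto; ring.
Qed.

(** * A smooth cutoff *)

Lemma pow_exp_bound j k : 0 < k -> exists A, 0 <= A /\ forall y, 0 <= y -> y ^ j <= A * exp (k * y).
Proof.
  revert k; induction j as [|j IH]; intros k Hk.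
  - exists 1. split; [lra|]. intros y Hy. simpl.
    assert (0 <= k * y) by (apply Rmult_le_pos; lra). pose proof (exp_ineq1_le (k * y)). lra.
  - destruct (IH (k / 2)) as [A [HA H]]; [lra|]. exists (A * (2 / k)).
    assert (0 < 2 / k) by (apply Rdiv_lt_0_compat; lra).
    split; [apply Rmult_le_pos; lra|].
    intros y Hy. specialize (H y Hy). simpl.
    replace (k * y) with (k / 2 * y + k / 2 * y) by field. rewrite exp_plus.
    pose proof (exp_ineq1_le (k / 2 * y)).
    assert (y <= 2 / k * exp (k / 2 * y)).
    { apply Rle_trans with (2 / k * (1 + k / 2 * y)).
      - replace (2 / k * (1 + k / 2 * y)) with (2 / k + y) by (field; lra). lra.
      - apply Rmult_le_compat_l; lra. }
    assert (0 <= y ^ j) by (apply pow_le; auto).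
    pose proof (exp_pos (k / 2 * y)).
    rewrite Rmult_comm. eapply Rle_trans; [apply Rmult_le_compat; [assumption|assumption|exact H|eassumption]|].
    apply Req_le; ring.
Qed.

(** Powers of [1 / x] are included because they appear in the derivatives of [exp (- 1
    / x)]. *)
Definition flat (k : nat) (x : R) : R := if Rle_dec x 0 then 0 else (/ x) ^ k * exp (- / x).

Lemma flat_neg k x : x <= 0 -> flat k x = 0.
Proof. intros; unfold flat; destruct Rle_dec; [reflexivity | lra]. Qed.

Lemma flat_pos k x : 0 < x -> flat k x = (/ x) ^ k * exp (- / x).
Proof. intros; unfold flat; destruct Rle_dec; [lra | reflexivity]. Qed.

Lemma is_derive_flat k x : is_derive (flat k) x (- INR k * flat (S k) x + flat (S (S k)) x).
Proof.
  destruct (Rtotal_order x 0) as [Hx|[Hx|Hx]].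
  - rewrite !flat_neg by lra. replace (- INR k * 0 + 0) with 0 by ring.
    apply (is_derive_ext_loc (fun _ => 0)); [|apply @is_derive_const].
    exists (mkposreal (- x) ltac:(lra)). intros y Hy. change (Rabs (y - x) < - x) in Hy.
    apply Rabs_lt_between in Hy. rewrite flat_neg; auto; lra.
  - subst x. rewrite !flat_neg by lra. replace (- INR k * 0 + 0) with 0 by ring.
    destruct (pow_exp_bound (S (S k)) 1) as [A [HA H]]; [lra|].
    apply is_derive_Reals. intros e He. 
    assert (Hd : 0 < e / (A + 1)) by (apply Rdiv_lt_0_compat; lra).
    exists (mkposreal _ Hd). intros h Hh0 Hh; simpl in Hh.
    rewrite Rplus_0_l, (flat_neg k 0), !Rminus_0_r by lra.
    destruct (Rlt_dec 0 h) as [Hp|Hn].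
    2: { rewrite flat_neg by lra. unfold Rdiv; rewrite Rmult_0_l, Rabs_R0. lra. }
    rewrite flat_pos, Rabs_pos_eq in * by lra.
    assert (0 < / h) by (now apply Rinv_0_lt_compat).
    specialize (H (/ h) ltac:(lra)). rewrite Rmult_1_l in H. simpl in H.
    assert (0 <= (/ h) ^ k * exp (- / h)).
    { apply Rmult_le_pos; [apply pow_le; lra | left; apply exp_pos]. }
    rewrite Rabs_pos_eq by (apply Rmult_le_pos; lra).
    assert (B : (/ h) ^ k * exp (- / h) * / h <= A * h).
    { apply Rmult_le_reg_r with (exp (/ h) * / h); [apply Rmult_lt_0_compat; [apply exp_pos|assumption]|].
      replace ((/ h) ^ k * exp (- / h) * / h * (exp (/ h) * / h)) with
        (/ h * (/ h * (/ h) ^ k) * (exp (- / h) * exp (/ h))) by ring.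
      rewrite <- exp_plus, Rplus_opp_l, exp_0.
      replace (A * h * (exp (/ h) * / h)) with (A * exp (/ h)) by (field; lra). lra. }
    unfold Rdiv in *. eapply Rle_lt_trans; [exact B|].
    apply Rle_lt_trans with ((A + 1) * h); [nra|].
    apply Rmult_lt_reg_l with (/ (A + 1)); [apply Rinv_0_lt_compat; lra|].
    rewrite <- Rmult_assoc, Rinv_l by lra. lra.
  - rewrite !flat_pos by lra.
    apply (is_derive_ext_loc (fun y => (/ y) ^ k * exp (- / y))).
    { exists (mkposreal x Hx). intros y Hy. change (Rabs (y - x) < x) in Hy.
      apply Rabs_lt_between in Hy. rewrite flat_pos; auto; lra. }
    evar_last. { apply is_derive_Rmult.
      - apply (is_derive_pow (fun y => / y)). apply is_derive_inv; [apply (@is_derive_id R_AbsRing)|lra].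
      - apply (is_derive_comp exp (fun y => - / y)); [apply is_derive_exp|].
        apply (@is_derive_opp R_AbsRing R_NormedModule), is_derive_inv; [apply (@is_derive_id R_AbsRing)|lra]. }
    unfold scal, opp, one; simpl; unfold mult; simpl.
    destruct k as [|k]; simpl; field; lra.
Qed.

Fixpoint flat_tower (n k : nat) (x : R) : R :=
  match n with
  | O => flat k x
  | S n => - INR k * flat_tower n (S k) x + flat_tower n (S (S k)) x
  end.

Lemma tower_flat k : tower (fun n => flat_tower n k).
Proof.
  intros n. revert k; induction n as [|n IH]; intros k x.
  - apply is_derive_flat.
  - change (flat_tower (S (S n)) k x) with (- INR k * flat_tower (S n) (S k) x + flat_tower (S n) (S (S k)) x).
    apply (@is_derive_plus R_AbsRing R_NormedModule (fun x => - INR k * flat_tower n (S k) x) (flat_tower n (S (S k)))).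
    + apply (is_derive_scal (flat_tower n (S k))), IH.
    + apply IH.
Qed.

Lemma flat_tower_neg n k x : x <= 0 -> flat_tower n k x = 0.
Proof.
  intros Hx. revert k; induction n as [|n IH]; intros k; simpl; [now apply flat_neg|].
  rewrite !IH. ring.
Qed.

(** The product of two translated and reflected copies of [exp (- 1 / x)], supported
    in [[-1, -1/2]], with its derivatives. *)
Definition bump (n : nat) : R -> R :=
  leibniz n (fun n x => 1 ^ n * flat_tower n 0 (1 * x + 1))
         (fun n x => (-1) ^ n * flat_tower n 0 (-1 * x + - (1 / 2))).

Lemma tower_bump : tower bump.
Proof.
  apply tower_leibniz.
  - apply (tower_affine (fun n => flat_tower n 0)), tower_flat.
  - apply (tower_affine (fun n => flat_tower n 0)), tower_flat.
Qed.

Lemma bump_left n x : x <= -1 -> bump n x = 0.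
Proof. intros; apply leibniz_zero_l; intros; rewrite flat_tower_neg by lra; ring. Qed.

Lemma bump_right n x : - (1 / 2) <= x -> bump n x = 0.
Proof. intros; apply leibniz_zero_r; intros; rewrite flat_tower_neg by lra; ring. Qed.

Definition bump_mass : R := RInt (bump 0) (-1) (- (1 / 2)).

Lemma bump_mass_pos : 0 < bump_mass.
Proof.
  apply RInt_gt_0; [lra| |].
  - intros x Hx. unfold bump; simpl. rewrite !flat_pos by lra. simpl.
    rewrite !Rmult_1_l. apply Rmult_lt_0_compat; apply exp_pos.
  - intros. apply tower_continuous, tower_bump.
Qed.

(** A smooth step from 0 to 1 across [[-1, -1/2]] with its derivatives. Multiplying by
    it turns an exponential decaying at [+oo] into a Schwartz function without
    changing it near the half-line. *)
Definition cutoff (n : nat) (x : R) : R :=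
  match n with
  | O => RInt (bump 0) (-1) x / bump_mass
  | S n => bump n x / bump_mass
  end.

Lemma bump_ex_RInt n u v : ex_RInt (bump n) u v.
Proof. apply (@ex_RInt_continuous R_CompleteNormedModule). intros; apply tower_continuous, tower_bump. Qed.

Lemma tower_cutoff : tower cutoff.
Proof.
  intros [|n] x; simpl; unfold Rdiv.
  - apply (is_derive_ext (fun x => / bump_mass * RInt (bump 0) (-1) x)); [intros; apply Rmult_comm|].
    rewrite Rmult_comm. apply is_derive_scal.
    apply (is_derive_RInt (bump 0) _ (-1)).
    + apply filter_forall. intros; apply (@RInt_correct R_CompleteNormedModule), bump_ex_RInt.
    + apply tower_continuous, tower_bump.
  - apply (is_derive_ext (fun x => / bump_mass * bump n x)); [intros; apply Rmult_comm|].
    rewrite Rmult_comm. apply is_derive_scal, tower_bump.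
Qed.

Lemma cutoff_left n x : x <= -1 -> cutoff n x = 0.
Proof.
  intros Hx. destruct n as [|n]; simpl.
  - rewrite (RInt_ext _ (fun _ => 0)).
    + rewrite RInt_const. unfold scal; simpl; unfold mult; simpl. field. pose proof bump_mass_pos; lra.
    + rewrite Rmin_right, Rmax_left by lra. intros; apply bump_left; lra.
  - rewrite bump_left by lra. field. pose proof bump_mass_pos; lra.
Qed.

Lemma cutoff_right x : - (1 / 2) <= x -> cutoff 0 x = 1.
Proof.
  intros Hx. simpl.
  rewrite <- (RInt_Chasles (bump 0) (-1) (- (1 / 2)) x) by apply bump_ex_RInt.
  rewrite (RInt_ext (bump 0) (fun _ => 0) (- (1/2)) x).
  - rewrite RInt_const. unfold plus, scal; simpl; unfold mult; simpl. fold bump_mass. field.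
    pose proof bump_mass_pos; lra.
  - rewrite Rmin_left, Rmax_right by lra. intros; apply bump_right; lra.
Qed.

Lemma Rcontinuous_bounded (f : R -> R) a b : a <= b -> (forall x, continuous f x) ->
  exists M, 0 <= M /\ forall x, a <= x <= b -> Rabs (f x) <= M.
Proof.
  intros Hab H. destruct (continuous_bounded (fun x => RtoC (f x)) a b Hab) as [M [HM HB]].
  - intros; cont. apply H.
  - exists M; split; auto. intros x Hx. rewrite <- Cmod_R. auto.
Qed.

Lemma bounded_upto (P : nat -> R -> Prop) N :
  (forall n A B, P n A -> A <= B -> P n B) -> (forall n, exists A, P n A) ->
  exists A, 0 <= A /\ forall n, (n <= N)%nat -> P n A.
Proof.
  intros Hm H. induction N as [|N [A [HA IH]]].
  - destruct (H 0%nat) as [A HA]. exists (Rmax 0 A). split; [apply Rmax_l|].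
    intros n Hn. replace n with 0%nat by lia. eapply Hm; [exact HA | apply Rmax_r].
  - destruct (H (S N)) as [B HB]. exists (Rmax A B). split; [eapply Rle_trans; [exact HA | apply Rmax_l]|].
    intros n Hn. destruct (Nat.eq_dec n (S N)) as [->|].
    + eapply Hm; [exact HB | apply Rmax_r].
    + eapply Hm; [apply IH; lia | apply Rmax_l].
Qed.

Lemma cutoff_bounded N : exists A, 0 <= A /\ forall n, (n <= N)%nat -> forall x, Rabs (cutoff n x) <= A.
Proof.
  apply (bounded_upto (fun n A => forall x, Rabs (cutoff n x) <= A)).
  - intros n A B H HAB x. eapply Rle_trans; [apply H | exact HAB].
  - intros n. destruct (Rcontinuous_bounded (cutoff n) (-1) (- (1 / 2))) as [M [HM H]]; [lra | intros; apply tower_continuous, tower_cutoff |].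
    exists (Rmax M 1). intros x. pose proof (Rmax_l M 1). pose proof (Rmax_r M 1).
    destruct (Rlt_dec x (-1)); [rewrite cutoff_left by lra; rewrite Rabs_R0; lra|].
    destruct (Rlt_dec (- (1 / 2)) x).
    + destruct n as [|n]; [rewrite cutoff_right by lra; rewrite Rabs_R1; lra|].
      simpl. rewrite bump_right by lra. unfold Rdiv; rewrite Rmult_0_l, Rabs_R0; lra.
    + eapply Rle_trans; [apply H; lra | lra].
Qed.

(** * Schwartz functions from towers *)

Lemma Derive_n_zero n x : Derive_n (fun _ => 0) n x = 0.
Proof. destruct n; [reflexivity|]. apply Derive_n_const. Qed.

Lemma tower_smooth F : tower F -> smooth (fun x => RtoC (F 0%nat x)).
Proof.
  intros H n x. split; simpl.
  - now apply (tower_ex_derive_n F).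
  - apply ex_derive_n_const.
Qed.

Lemma tower_CDerive_n F n x : tower F -> CDerive_n (fun x => RtoC (F 0%nat x)) n x = RtoC (F n x).
Proof.
  intros H. unfold CDerive_n; simpl. unfold RtoC. f_equal.
  - now apply (tower_Derive_n F).
  - apply Derive_n_zero.
Qed.

Lemma tower_schwartz F : tower F -> (forall k n, exists M, forall x, Rabs x ^ k * Rabs (F n x) <= M) ->
  schwartz (fun x => RtoC (F 0%nat x)).
Proof.
  intros HF H. split; [now apply tower_smooth|].
  intros k n. destruct (H k n) as [M HM]. exists M. intros x.
  rewrite tower_CDerive_n, Cmod_R by assumption. apply HM.
Qed.

Lemma weight_bound j k : 0 < k -> exists A, 0 <= A /\ forall x, -1 <= x -> Rabs x ^ j * exp (- (k * x)) <= A.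
Proof.
  intros Hk. destruct (pow_exp_bound j k Hk) as [A [HA H]].
  exists (A * exp (k * 2)). split; [apply Rmult_le_pos; [assumption | left; apply exp_pos]|].
  intros x Hx. apply Rle_trans with ((A * exp (k * (x + 2))) * exp (- (k * x))).
  - apply Rmult_le_compat_r; [left; apply exp_pos|].
    eapply Rle_trans; [|apply (H (x + 2)); lra]. apply pow_incr. split; [apply Rabs_pos|].
    unfold Rabs; destruct Rcase_abs; lra.
  - rewrite Rmult_assoc, <- exp_plus. apply Req_le. f_equal. f_equal. ring.
Qed.

Lemma cut_weight j n k G A B W x : 0 <= A -> 0 <= B -> 0 <= W ->
  (forall i, (i <= n)%nat -> Rabs (cutoff i x) <= A) ->
  (forall i, (i <= n)%nat -> -1 <= x -> Rabs (G i x) <= B * exp (- (k * x))) ->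
  (-1 <= x -> Rabs x ^ j * exp (- (k * x)) <= W) ->
  Rabs x ^ j * Rabs (leibniz n cutoff G x) <= 2 ^ n * A * W * B.
Proof.
  intros HA HB HW H1 H2 H3.
  assert (0 <= 2 ^ n) by (apply pow_le; lra).
  assert (0 <= Rabs x ^ j) by (apply pow_le, Rabs_pos).
  destruct (Rle_dec (-1) x) as [Hx|Hx].
  - pose proof (exp_pos (- (k * x))).
    apply Rle_trans with (Rabs x ^ j * (2 ^ n * (A * (B * exp (- (k * x)))))).
    + apply Rmult_le_compat_l; [assumption|]. apply leibniz_bound; auto.
      apply Rmult_le_pos; lra.
    + replace (Rabs x ^ j * (2 ^ n * (A * (B * exp (- (k * x)))))) with
        ((2 ^ n * A * B) * (Rabs x ^ j * exp (- (k * x)))) by ring.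
      replace (2 ^ n * A * W * B) with ((2 ^ n * A * B) * W) by ring.
      apply Rmult_le_compat_l; auto. repeat apply Rmult_le_pos; auto.
  - rewrite leibniz_zero_l, Rabs_R0, Rmult_0_r by (intros; apply cutoff_left; lra).
    repeat apply Rmult_le_pos; auto.
Qed.

Lemma cut_schwartz k G : 0 < k -> tower G ->
  (forall n, exists B, forall x, -1 <= x -> Rabs (G n x) <= B * exp (- (k * x))) ->
  schwartz (fun x => RtoC (cutoff 0 x * G 0%nat x)).
Proof.
  intros Hk HG H. apply (tower_schwartz (fun n => leibniz n cutoff G)).
  - apply tower_leibniz; [apply tower_cutoff | assumption].
  - intros j n. destruct (cutoff_bounded n) as [A [HA HAb]].
    destruct (bounded_upto (fun n B => forall x, -1 <= x -> Rabs (G n x) <= B * exp (- (k * x))) n) as [B [HB HBb]]; auto.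
    { intros m B B' HB Hle x Hx. eapply Rle_trans; [apply HB; auto|]. apply Rmult_le_compat_r; [left; apply exp_pos | assumption]. }
    destruct (weight_bound j k Hk) as [W [HW HWb]].
    exists (2 ^ n * A * W * B). intros x. apply (cut_weight j n k); auto.
Qed.

Lemma CDerive_n_out psi M n x : supported_in_ball M psi -> M < Rabs x -> CDerive_n psi n x = RtoC 0.
Proof.
  intros H Hx. unfold CDerive_n.
  assert (L : locally x (fun y => psi y = RtoC 0)).
  { exists (mkposreal (Rabs x - M) ltac:(lra)). intros y Hy.
    change (Rabs (y - x) < Rabs x - M) in Hy. apply H.
    pose proof (Rabs_triang_inv x y). rewrite Rabs_minus_sym in Hy. lra. }
  rewrite (Derive_n_ext_loc (fun t => Re (psi t)) (fun _ => 0)).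
  2: { revert L; apply filter_imp; intros y ->; reflexivity. }
  rewrite (Derive_n_ext_loc (fun t => Im (psi t)) (fun _ => 0)).
  2: { revert L; apply filter_imp; intros y ->; reflexivity. }
  now rewrite !Derive_n_zero.
Qed.

Lemma smooth_towers psi : smooth psi ->
  tower (Derive_n (fun t => Re (psi t))) /\ tower (Derive_n (fun t => Im (psi t))).
Proof. intros H; split; apply smooth_tower; intros n x; apply H. Qed.

Lemma continuous_CDerive_n psi n x : smooth psi -> continuous (CDerive_n psi n) x.
Proof.
  intros H. destruct (smooth_towers _ H) as [A B].
  apply continuous_pair; apply (tower_continuous _ n x); assumption.
Qed.

Lemma test_CDerive_bounded psi n : test_function psi -> exists A, 0 <= A /\ forall x, Cmod (CDerive_n psi n x) <= A.
Proof.
  intros [Hs [M HM]].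
  destruct (continuous_bounded (CDerive_n psi n) (- Rabs M) (Rabs M)) as [A [HA H]].
  - pose proof (Rabs_pos M); lra.
  - intros; now apply continuous_CDerive_n.
  - exists A; split; auto. intros x. destruct (Rle_dec (Rabs x) (Rabs M)) as [Hx|Hx].
    + apply H. now apply Rabs_le_between.
    + rewrite (CDerive_n_out psi M), Cmod_0 by (auto; pose proof (Rle_abs M); lra). assumption.
Qed.

Lemma test_schwartz psi : test_function psi -> schwartz psi.
Proof.
  intros Ht. pose proof Ht as [Hs [M HM]]. split; [assumption|]. intros k n.
  destruct (test_CDerive_bounded psi n Ht) as [A [HA H]].
  exists (Rabs M ^ k * A). intros x.
  destruct (Rle_dec (Rabs x) (Rabs M)) as [Hx|Hx].
  - apply Rmult_le_compat; auto; [apply pow_le, Rabs_pos | apply Cmod_ge_0 |].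
    apply pow_incr; split; [apply Rabs_pos | assumption].
  - rewrite (CDerive_n_out psi M), Cmod_0, Rmult_0_r by (auto; pose proof (Rle_abs M); lra).
    apply Rmult_le_pos; auto. apply pow_le, Rabs_pos.
Qed.

Lemma tower_test F M : tower F -> (forall x, M < Rabs x -> F 0%nat x = 0) ->
  test_function (fun x => RtoC (F 0%nat x)).
Proof.
  intros HF H. split; [now apply tower_smooth|]. exists M. intros x Hx. now rewrite H.
Qed.

(** * Weierstrass approximation *)

(** The mean of [g] under the binomial law with parameters [n] and [u], that is
    a Bernstein polynomial in [u], computed by conditioning on the first trial. *)
Fixpoint binomial_mean (n : nat) (u : R) (g : nat -> R) : R :=
  match n with
  | O => g O
  | S n => u * binomial_mean n u (fun k => g (S k)) + (1 - u) * binomial_mean n u g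
  end.

Lemma binomial_mean_le n u g h : 0 <= u <= 1 -> (forall k, (k <= n)%nat -> g k <= h k) ->
  binomial_mean n u g <= binomial_mean n u h.
Proof.
  intros Hu. revert g h; induction n as [|n IH]; intros g h H; simpl; [apply H; lia|].
  apply Rplus_le_compat; apply Rmult_le_compat_l; try lra; apply IH; intros; apply H; lia.
Qed.

Lemma binomial_mean_lin n u c d g h : binomial_mean n u (fun k => c * g k + d * h k) =
  c * binomial_mean n u g + d * binomial_mean n u h.
Proof.
  revert g h; induction n as [|n IH]; intros g h; simpl; [reflexivity|].
  rewrite (IH g h), (IH (fun k => g (S k)) (fun k => h (S k))). ring.
Qed.

Lemma binomial_mean_const n u c : binomial_mean n u (fun _ => c) = c.
Proof. induction n as [|n IH]; simpl; [reflexivity|]. rewrite IH; ring. Qed.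

Lemma binomial_variance n u c : binomial_mean n u (fun k => (INR k + c) ^ 2) =
  (INR n * u + c) ^ 2 + INR n * u * (1 - u).
Proof.
  revert c; induction n as [|n IH]; intros c; [simpl; ring|].
  change (binomial_mean (S n) u (fun k => (INR k + c) ^ 2)) with
    (u * binomial_mean n u (fun k => (INR (S k) + c) ^ 2) + (1 - u) * binomial_mean n u (fun k => (INR k + c) ^ 2)).
  replace (fun k => (INR (S k) + c) ^ 2) with (fun k => (INR k + (c + 1)) ^ 2).
  - rewrite !IH, S_INR. ring.
  - apply functional_extensionality; intros k. rewrite S_INR. ring.
Qed.

(** Bernstein's proof: where [k / n] is far from [u], the oscillation of [f] is
    bounded by a multiple of [(k - n u)^2], whose mean is the binomial variance. *)
Lemma weierstrass (f : R -> R) e : (forall x, continuous f x) -> 0 < e ->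
  exists n, forall u, 0 <= u <= 1 ->
    Rabs (f u - binomial_mean n u (fun k => f (INR k / INR n))) <= e.
Proof.
  intros Hf He.
  destruct (Rcontinuous_bounded f 0 1) as [M [HM HB]]; [lra | assumption |].
  assert (He2 : 0 < e / 2) by lra.
  assert (H2 : forall x, 0 <= x <= 1 -> continuity_2d_pt (fun u v => f u) x 0).
  { intros x _. apply (continuous_continuity_2d (fun z => f (fst z))).
    apply (continuous_comp (fun z : R * R => fst z) f); [cont | apply Hf]. }
  destruct (uniform_continuity_2d_1d _ _ _ _ H2 (mkposreal _ He2)) as [[d Hd] HU]; simpl in HU.
  assert (HU' : forall x y, 0 <= x <= 1 -> 0 <= y <= 1 -> Rabs (y - x) < d -> Rabs (f y - f x) < e / 2).
  { intros x y Hx Hy Hxy. apply (HU x 0 y 0); auto; lra. }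
  destruct (archimed_cor1 (e * d ^ 2 / (4 * (M + 1)))) as [n [Hn Hn0]].
  { apply Rdiv_lt_0_compat; [|lra]. apply Rmult_lt_0_compat; [lra|apply pow_lt; lra]. }
  exists n. intros u Hu.
  assert (HN : 0 < INR n) by (now apply lt_0_INR).
  set (g := fun k => f (INR k / INR n)).
  set (h := fun k => (INR k + - (INR n * u)) ^ 2).
  set (K := 2 * M / (d ^ 2 * INR n ^ 2)).
  assert (Hd2 : 0 < d ^ 2) by (apply pow_lt; lra).
  assert (HK : 0 <= K).
  { unfold K. apply Rmult_le_pos; [lra|]. left; apply Rinv_0_lt_compat, Rmult_lt_0_compat; [assumption|apply pow_lt; lra]. }
  assert (P : forall k, (k <= n)%nat -> Rabs (g k - f u) <= e / 2 + K * h k).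
  { intros k Hk. unfold g, h.
    assert (Hkn : 0 <= INR k / INR n <= 1).
    { split; [apply Rmult_le_pos; [apply pos_INR | left; now apply Rinv_0_lt_compat]|].
      apply Rmult_le_reg_r with (INR n); [assumption|]. field_simplify; [|lra]. now apply le_INR. }
    assert (Hh : 0 <= (INR k + - (INR n * u)) ^ 2) by (apply pow2_ge_0).
    destruct (Rlt_dec (Rabs (INR k / INR n - u)) d) as [Hl|Hl].
    - specialize (HU' u (INR k / INR n) Hu Hkn Hl). nra.
    - assert (1 <= (INR k + - (INR n * u)) ^ 2 / (d ^ 2 * INR n ^ 2)).
      { replace ((INR k + - (INR n * u)) ^ 2 / (d ^ 2 * INR n ^ 2)) with ((INR k / INR n - u) ^ 2 / d ^ 2).
        2: { field. split; lra. }
        apply Rmult_le_reg_r with (d ^ 2); [assumption|].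
        unfold Rdiv. rewrite Rmult_assoc, Rinv_l, Rmult_1_l, Rmult_1_r by lra.
        rewrite <- (pow2_abs (INR k * / INR n - u)). apply pow_incr. unfold Rdiv in Hl. lra. }
      assert (Rabs (f (INR k / INR n) - f u) <= 2 * M).
      { unfold Rminus. eapply Rle_trans; [apply Rabs_triang|]. rewrite Rabs_Ropp.
        pose proof (HB u Hu). pose proof (HB _ Hkn). lra. }
      replace (K * (INR k + - (INR n * u)) ^ 2) with (2 * M * ((INR k + - (INR n * u)) ^ 2 / (d ^ 2 * INR n ^ 2)))
        by (unfold K; field; split; lra).
      nra. }
  assert (V : binomial_mean n u h <= INR n / 4).
  { unfold h. rewrite binomial_variance. assert (u * (1 - u) <= / 4) by (pose proof (pow2_ge_0 (u - / 2)); simpl in *; lra).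
    replace (INR n * u + - (INR n * u)) with 0 by ring. nra. }
  assert (T : e / 2 + K * (INR n / 4) <= e).
  { replace (K * (INR n / 4)) with (M / (2 * d ^ 2) * / INR n) by (unfold K; field; split; lra).
    assert (M / (2 * d ^ 2) * / INR n <= M / (2 * d ^ 2) * (e * d ^ 2 / (4 * (M + 1)))).
    { apply Rmult_le_compat_l; [|lra]. apply Rmult_le_pos; [assumption|]. left; apply Rinv_0_lt_compat; lra. }
    replace (M / (2 * d ^ 2) * (e * d ^ 2 / (4 * (M + 1)))) with (e / 8 * (M / (M + 1))) in H by (field; lra).
    assert (M / (M + 1) <= 1).
    { apply Rmult_le_reg_r with (M + 1); [lra|]. field_simplify; lra. }
    nra. }
  assert (U1 : binomial_mean n u g <= f u + (e / 2 + K * binomial_mean n u h)).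
  { replace (f u + (e / 2 + K * binomial_mean n u h)) with
      (1 * binomial_mean n u (fun _ => f u + e / 2) + K * binomial_mean n u h) by (rewrite binomial_mean_const; ring).
    rewrite <- binomial_mean_lin. apply binomial_mean_le; auto. intros k Hk.
    specialize (P k Hk). apply Rabs_le_between in P. lra. }
  assert (U2 : f u - (e / 2 + K * binomial_mean n u h) <= binomial_mean n u g).
  { replace (f u - (e / 2 + K * binomial_mean n u h)) with
      (1 * binomial_mean n u (fun _ => f u - e / 2) + (- K) * binomial_mean n u h) by (rewrite binomial_mean_const; ring).
    rewrite <- binomial_mean_lin. apply binomial_mean_le; auto. intros k Hk.
    specialize (P k Hk). apply Rabs_le_between in P. lra. }
  assert (K * binomial_mean n u h <= K * (INR n / 4)) by (apply Rmult_le_compat_l; assumption).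
  apply Rabs_le. lra.
Qed.

(** * Exponential polynomials *)

(** Linear combinations of [exp (- m x)] with [m >= 1]: these are the polynomials
    without constant term in [exp (- x)], and the functions on which a Laplace
    transform known at the positive integers gives the value of a distribution. *)
Inductive exp_poly : (R -> R) -> Prop :=
| exp_poly_zero : exp_poly (fun _ => 0)
| exp_poly_cons c m f : exp_poly f -> exp_poly (fun x => c * exp (- (INR (S m) * x)) + f x).

Lemma exp_poly_lin f g c : exp_poly f -> exp_poly g -> exp_poly (fun x => c * f x + g x).
Proof.
  intros Hf Hg. induction Hf as [|d m f Hf IH].
  - replace (fun x => c * 0 + g x) with g; [assumption|]. apply functional_extensionality; intros; ring.
  - replace (fun x => c * (d * exp (- (INR (S m) * x)) + f x) + g x) with
      (fun x => (c * d) * exp (- (INR (S m) * x)) + (c * f x + g x)).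
    + now constructor. + apply functional_extensionality; intros; ring.
Qed.

Lemma exp_poly_shift f c : exp_poly f -> exp_poly (fun x => c * exp (- x) * f x).
Proof.
  intros Hf. induction Hf as [|d m f Hf IH].
  - replace (fun x => c * exp (- x) * 0) with (fun _ : R => 0); [constructor|].
    apply functional_extensionality; intros; ring.
  - replace (fun x => c * exp (- x) * (d * exp (- (INR (S m) * x)) + f x)) with
      (fun x => (c * d) * exp (- (INR (S (S m)) * x)) + c * exp (- x) * f x).
    + now constructor.
    + apply functional_extensionality; intros x. rewrite (S_INR (S m)).
      replace (- ((INR (S m) + 1) * x)) with (- x + - (INR (S m) * x)) by ring. rewrite exp_plus. ring.
Qed.

Lemma exp_poly_binomial c n g : exp_poly (fun x => c * exp (- x) * binomial_mean n (c * exp (- x)) g).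
Proof.
  revert g; induction n as [|n IH]; intros g; simpl.
  - replace (fun x => c * exp (- x) * g 0%nat) with (fun x => (c * g 0%nat) * exp (- (INR 1 * x)) + 0).
    + constructor; constructor.
    + apply functional_extensionality; intros x. simpl. rewrite Rmult_1_l. ring.
  - set (A := fun x => c * exp (- x) * binomial_mean n (c * exp (- x)) (fun k => g (S k))).
    set (B := fun x => c * exp (- x) * binomial_mean n (c * exp (- x)) g).
    replace (fun x => _) with (fun x => 1 * (c * exp (- x) * A x) + (-1 * (c * exp (- x) * B x) + B x)).
    + apply exp_poly_lin; [apply exp_poly_shift, IH|]. apply exp_poly_lin; [apply exp_poly_shift|]; apply IH.
    + apply functional_extensionality; intros x. unfold A, B. ring.
Qed.

Lemma exp_poly_tower f N : exp_poly f ->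
  exists G, tower G /\ (forall n, exp_poly (G n)) /\ G N = f.
Proof.
  intros Hf. induction Hf as [|c m f Hf [G [HG [HP HN]]]].
  - exists (fun _ _ => 0). split; [|split]; auto.
    + intros n x. apply @is_derive_const. + intros; constructor.
  - assert (Hm : - INR (S m) <> 0) by (apply Ropp_neq_0_compat, not_0_INR; lia).
    exists (fun n x => (c * (- INR (S m)) ^ n / (- INR (S m)) ^ N) * exp (- (INR (S m) * x)) + G n x).
    split; [|split].
    + intros n x. evar_last. { apply (@is_derive_plus R_AbsRing R_NormedModule); [|apply HG].
        apply (is_derive_scal (fun x => exp (- (INR (S m) * x)))). 
        apply (is_derive_comp exp (fun x => - (INR (S m) * x))); [apply is_derive_exp|].
        apply (@is_derive_opp R_AbsRing R_NormedModule), is_derive_scal, (@is_derive_id R_AbsRing). }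
      unfold plus, scal, opp, one; cbn -[INR]; unfold mult; cbn -[INR]. field. now apply pow_nonzero.
    + intros; constructor; auto.
    + apply functional_extensionality; intros x. rewrite HN. f_equal. field. now apply pow_nonzero.
Qed.

Lemma exp_poly_decay f : exp_poly f -> exists A, 0 <= A /\ forall x, -1 <= x -> Rabs (f x) <= A * exp (- (1 * x)).
Proof.
  intros Hf. induction Hf as [|c m f Hf [A [HA H]]].
  - exists 0. split; [lra|]. intros. rewrite Rabs_R0. lra.
  - exists (Rabs c * exp (INR m) + A).
    split. { apply Rplus_le_le_0_compat; auto. apply Rmult_le_pos; [apply Rabs_pos | left; apply exp_pos]. }
    intros x Hx. eapply Rle_trans; [apply Rabs_triang|]. rewrite Rmult_plus_distr_r.
    apply Rplus_le_compat; [|apply H; assumption].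
    rewrite Rabs_mult, Rmult_assoc, (Rabs_pos_eq (exp _)) by (left; apply exp_pos).
    apply Rmult_le_compat_l; [apply Rabs_pos|]. rewrite <- exp_plus. apply exp_le.
    rewrite S_INR. pose proof (pos_INR m). nra.
Qed.

(** Integration from [+oo] preserves an exponential bound. *)
Lemma decay_primitive (f g : R -> R) c A : (forall x, is_derive f x (g x)) ->
  (forall x, -1 <= x -> Rabs (g x) <= c * exp (- (1 * x))) ->
  (forall x, -1 <= x -> Rabs (f x) <= A * exp (- (1 * x))) -> 0 <= A -> 0 <= c ->
  forall x, -1 <= x -> Rabs (f x) <= c * exp (- (1 * x)).
Proof.
  intros Hd Hg Hf HA Hc x Hx.
  assert (Dexp : forall s t, is_derive (fun x => s * exp (- (1 * x))) t (- (s * exp (- (1 * t))))).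
  { intros s t. auto_derive; auto. ring. }
  assert (S : forall s, s = 1 \/ s = -1 -> s * f x <= c * exp (- (1 * x))).
  { intros s Hs. apply Rnot_lt_le; intros Hlt.
    pose proof (is_lim_exp_scal (A + c) 1 ltac:(lra)) as L. apply is_lim_spec in L.
    destruct (L (mkposreal (s * f x - c * exp (- (1 * x))) ltac:(lra))) as [X0 HX]; simpl in HX.
    set (y := Rmax X0 x + 1). pose proof (Rmax_l X0 x). pose proof (Rmax_r X0 x).
    specialize (HX y ltac:(unfold y; lra)). apply Rabs_lt_between in HX.
    assert (s * f x - c * exp (- (1 * x)) <= s * f y - c * exp (- (1 * y))) as I.
    { apply (is_derive_ge0_le (fun x => s * f x - c * exp (- (1 * x))) (fun x => s * g x + c * exp (- (1 * x)))); [unfold y; lra| |].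
      - intros t Ht. evar_last. { apply (@is_derive_minus R_AbsRing R_NormedModule); [apply is_derive_scal, Hd | apply Dexp]. }
        unfold minus, plus, opp, scal; simpl; unfold mult; simpl. ring.
      - intros t Ht. specialize (Hg t ltac:(lra)). apply Rabs_le_between in Hg.
        destruct Hs as [-> | ->]; lra. }
    specialize (Hf y ltac:(unfold y; lra)). apply Rabs_le_between in Hf.
    pose proof (exp_pos (- (1 * y))).
    destruct Hs as [-> | ->]; nra. }
  apply Rabs_le. pose proof (S 1 ltac:(auto)). pose proof (S (-1) ltac:(auto)). lra.
Qed.

(** * Uniqueness of the transform *)

(** The difference of two candidates for a transform has these properties; values of
    the Laplace transform at [i m] for integers [m >= 1] already determine a
    distribution supported in the half-line. The constant [K] is required nonnegative
    so that the bound may be enlarged. *)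
Record annihilates_exponentials (W : functional) : Prop := {
  ann_linear : linear_on schwartz W;
  ann_bound : exists (N : nat) (K : R), 0 <= K /\ forall psi : R -> C, schwartz psi ->
    forall B : R, (forall (k n : nat) (x : R), (k <= N)%nat -> (n <= N)%nat ->
         Rabs x ^ k * Cmod (CDerive_n psi n x) <= B) -> Cmod (W psi) <= K * B;
  ann_supported : supported_nonneg W;
  ann_exp : forall m, W (fun x => RtoC (cutoff 0 x * exp (- (INR (S m) * x)))) = RtoC 0 }.

Lemma exp_tower k : tower (fun n x => (- k) ^ n * exp (- (k * x))).
Proof.
  intros n x. evar_last.
  { apply is_derive_scal, (is_derive_comp exp (fun x => - (k * x))); [apply is_derive_exp|].
    apply (@is_derive_opp R_AbsRing R_NormedModule), is_derive_scal, (@is_derive_id R_AbsRing). }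
  unfold scal, opp, one; simpl; unfold mult; simpl. ring.
Qed.

Lemma cut_exp_schwartz k : 0 < k -> schwartz (fun x => RtoC (cutoff 0 x * exp (- (k * x)))).
Proof.
  intros Hk.
  replace (fun x => RtoC (cutoff 0 x * exp (- (k * x)))) with
    (fun x => RtoC (cutoff 0 x * ((- k) ^ 0 * exp (- (k * x))))).
  2: { apply functional_extensionality; intros x. simpl. now rewrite Rmult_1_l. }
  apply (cut_schwartz k (fun n x => (- k) ^ n * exp (- (k * x)))); auto; [apply exp_tower|].
  intros n. exists (Rabs ((- k) ^ n)). intros x _. rewrite Rabs_mult, (Rabs_pos_eq (exp _)); [lra|left; apply exp_pos].
Qed.

Lemma cut_exp_poly_schwartz f : exp_poly f -> schwartz (fun x => RtoC (cutoff 0 x * f x)).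
Proof.
  intros Hf. destruct (exp_poly_tower f 0 Hf) as [G [HG [HP <-]]].
  apply (cut_schwartz 1); auto; [lra|]. intros n. destruct (exp_poly_decay _ (HP n)) as [A [_ H]]. eauto.
Qed.

Lemma linear_zero P T : linear_on P T -> P (fun _ => RtoC 0) -> T (fun _ => RtoC 0) = RtoC 0.
Proof.
  intros HL H0. pose proof (HL (RtoC 1) _ _ H0 H0) as E. cbv beta in E.
  replace (RtoC 1 * RtoC 0 + RtoC 0)%C with (RtoC 0) in E by ring.
  set (t := T (fun _ => RtoC 0)) in *.
  transitivity ((RtoC 1 * t + t) - t)%C; [ring |]. rewrite <- E. ring.
Qed.

Lemma zero_test : test_function (fun _ => RtoC 0).
Proof.
  apply (tower_test (fun _ _ => 0) 0); auto. intros n x. apply @is_derive_const.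
Qed.

Lemma annihilates_exp_poly W f : annihilates_exponentials W -> exp_poly f ->
  W (fun x => RtoC (cutoff 0 x * f x)) = RtoC 0.
Proof.
  intros HW Hf. induction Hf as [|c m f Hf IH].
  - replace (fun x => RtoC (cutoff 0 x * 0)) with (fun _ : R => RtoC 0).
    + apply (linear_zero schwartz); [apply HW|]. apply test_schwartz, zero_test.
    + apply functional_extensionality; intros; now rewrite Rmult_0_r.
  - replace (fun x => _) with (fun x => RtoC c * RtoC (cutoff 0 x * exp (- (INR (S m) * x))) + RtoC (cutoff 0 x * f x))%C.
    + rewrite (ann_linear _ HW).
      * rewrite IH, (ann_exp _ HW). ring.
      * apply cut_exp_schwartz. apply lt_0_INR; lia.
      * now apply cut_exp_poly_schwartz.
    + apply functional_extensionality; intros x. rewrite <- RtoC_mult, <- RtoC_plus. f_equal. ring.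
Qed.

Lemma Derive_n_out (f : R -> R) M n x : (forall x, M < Rabs x -> f x = 0) -> M < Rabs x -> Derive_n f n x = 0.
Proof.
  intros H Hx.
  assert (E : CDerive_n (fun x => RtoC (f x)) n x = RtoC 0).
  { apply (CDerive_n_out _ M); auto. intros y Hy. now rewrite H. }
  injection E; auto.
Qed.

(** In the variable [u = exp (- (x + 1))], a polynomial close to the [N]-th
    derivative of [f] divided by [u] gives, after [N] integrations from [+oo], an
    exponential polynomial close to [f] together with its first [N] derivatives. *)
Lemma exp_poly_approx (f : R -> R) M N e : tower (Derive_n f) -> (forall x, M < Rabs x -> f x = 0) -> 0 < e ->
  exists G, tower G /\ (forall n, exp_poly (G n)) /\
    forall n, (n <= N)%nat -> forall x, -1 <= x -> Rabs (Derive_n f n x - G n x) <= e * exp (- (1 * x)).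
Proof.
  intros HT Hf He.
  set (F := fun n => Derive_n f n).
  assert (Hout : forall n x, M < Rabs x -> F n x = 0) by (intros; now apply (Derive_n_out f M)).
  set (g := fun u => if Rle_dec u 0 then 0 else F N (-1 - ln u) * / u).
  assert (Hg : forall u : R, continuous g u).
  { intros u. destruct (Rlt_dec 0 u) as [Hu|Hu].
    - apply continuous_ext_loc with (fun u => F N (-1 - ln u) * / u).
      { exists (mkposreal u Hu). intros v Hv. change (Rabs (v - u) < u) in Hv. apply Rabs_lt_between in Hv.
        unfold g. destruct Rle_dec; [lra | reflexivity]. }
      apply continuous_Rmult; [|cont; apply Rgt_not_eq, Hu].
      apply (continuous_Rcomp (F N)); [apply tower_continuous; exact HT|].
      apply continuous_Rminus; [cont|]. apply (@ex_derive_continuous R_AbsRing R_NormedModule). eexists; apply is_derive_ln; assumption.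
    - apply continuous_ext_loc with (fun _ : R => 0); [|apply continuous_const].
      exists (mkposreal (exp (- (1 + Rabs M))) (exp_pos _)). intros v Hv.
      change (Rabs (v - u) < exp (- (1 + Rabs M))) in Hv. apply Rabs_lt_between in Hv.
      unfold g. destruct Rle_dec as [|Hv0]; [reflexivity|].
      rewrite Hout; [symmetry; apply Rmult_0_l|]. assert (ln v < - (1 + Rabs M)).
      { rewrite <- (ln_exp (- (1 + Rabs M))). apply ln_increasing; lra. }
      pose proof (Rle_abs M). pose proof (Rle_abs (-1 - ln v)). lra. }
  assert (He' : 0 < e * exp 1) by (apply Rmult_lt_0_compat; [assumption | apply exp_pos]).
  destruct (weierstrass g (e * exp 1) Hg He') as [n Hn].
  set (c := exp (-1)).
  set (p := fun x => c * exp (- x) * binomial_mean n (c * exp (- x)) (fun k => g (INR k / INR n))).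
  assert (Hp : forall x, -1 <= x -> Rabs (F N x - p x) <= e * exp (- (1 * x))).
  { intros x Hx. set (u := c * exp (- x)).
    assert (Eu : u = exp (-1 - x)) by (unfold u, c; rewrite <- exp_plus; f_equal; ring).
    assert (Hu : 0 < u <= 1).
    { rewrite Eu. split; [apply exp_pos|]. rewrite <- exp_0. apply exp_le. lra. }
    specialize (Hn u ltac:(lra)).
    replace (g u) with (F N x * / u) in Hn.
    2: { unfold g. destruct Rle_dec; [lra|]. rewrite Eu at 2. rewrite ln_exp. f_equal. f_equal. ring. }
    unfold p. fold u.
    set (b := binomial_mean _ _ _) in *.
    replace (F N x - u * b) with (u * (F N x * / u - b)) by (field; lra).
    rewrite Rabs_mult, Rabs_pos_eq by lra.
    replace (e * exp (- (1 * x))) with (u * (e * exp 1)).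
    - apply Rmult_le_compat_l; lra.
    - rewrite Eu. replace (exp (-1 - x) * (e * exp 1)) with (e * (exp (-1 - x) * exp 1)) by ring.
      rewrite <- exp_plus. f_equal. f_equal. ring. }
  destruct (exp_poly_tower p N (exp_poly_binomial c n _)) as [G [HG [HGP HGN]]].
  exists G. split; [assumption|]. split; [assumption|].
  assert (Q : forall i, (i <= N)%nat -> forall x, -1 <= x -> Rabs (F (N - i)%nat x - G (N - i)%nat x) <= e * exp (- (1 * x))).
  { induction i as [|i IH]; intros Hi.
    - rewrite Nat.sub_0_r, HGN. exact Hp.
    - destruct (exp_poly_decay _ (HGP (N - S i)%nat)) as [A [HA HAb]].
      destruct (Rcontinuous_bounded (F (N - S i)%nat) (- Rabs M) (Rabs M)) as [B [HB HBb]].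
      { pose proof (Rabs_pos M); lra. } { intros; apply tower_continuous; exact HT. }
      apply (decay_primitive (fun x => F (N - S i)%nat x - G (N - S i)%nat x) (fun x => F (N - i)%nat x - G (N - i)%nat x) e (B * exp (Rabs M) + A)).
      + intros x. replace (N - i)%nat with (S (N - S i)) by lia.
        apply (@is_derive_minus R_AbsRing R_NormedModule); [apply HT | apply HG].
      + apply IH; lia.
      + intros x Hx. unfold Rminus at 1. eapply Rle_trans; [apply Rabs_triang|].
        rewrite Rabs_Ropp, Rmult_plus_distr_r. apply Rplus_le_compat; [|now apply HAb].
        destruct (Rle_dec (Rabs x) (Rabs M)) as [Hl|Hl].
        * apply Rle_trans with B; [apply HBb; now apply Rabs_le_between|].
          rewrite Rmult_assoc, <- exp_plus. rewrite <- (Rmult_1_r B) at 1. apply Rmult_le_compat_l; [assumption|].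
          apply Rle_trans with (exp 0); [rewrite exp_0; lra|]. apply exp_le. pose proof (Rle_abs x). lra.
        * rewrite Hout, Rabs_R0 by (pose proof (Rle_abs M); lra).
          apply Rmult_le_pos; [apply Rmult_le_pos; [assumption|]|]; left; apply exp_pos.
      + apply Rplus_le_le_0_compat; [apply Rmult_le_pos; [assumption | left; apply exp_pos] | assumption].
      + lra. }
  intros m Hm. replace m with (N - (N - m))%nat by lia. apply Q. lia.
Qed.

(** By [exp_poly_approx] the cut-off function is a limit, in the seminorms which bound
    [W], of cut-off exponential polynomials. *)
Lemma annihilates_cut_real W (f : R -> R) M : annihilates_exponentials W ->
  tower (Derive_n f) -> (forall x, M < Rabs x -> f x = 0) ->
  W (fun x => RtoC (cutoff 0 x * f x)) = RtoC 0.
Proof.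
  intros HW HT Hf. destruct (ann_bound _ HW) as [N [K [HK HB]]].
  destruct (cutoff_bounded N) as [A [HA HAb]].
  destruct (bounded_upto (fun j V => forall x, -1 <= x -> Rabs x ^ j * exp (- (1 * x)) <= V) N) as [V [HV HVb]].
  { intros j a b H Hab x Hx. eapply Rle_trans; [apply H; assumption | assumption]. }
  { intros j. destruct (weight_bound j 1 ltac:(lra)) as [V [_ HV]]. eauto. }
  set (Q := 2 ^ N * A * V).
  assert (H2 : forall n, (n <= N)%nat -> 1 <= 2 ^ n <= 2 ^ N).
  { intros n Hn. split; [apply pow_R1_Rle; lra | apply Rle_pow; [lra | assumption]]. }
  assert (HQ : 0 <= Q). { unfold Q. repeat apply Rmult_le_pos; auto. apply pow_le; lra. }
  assert (S : forall e, 0 < e -> Cmod (W (fun x => RtoC (cutoff 0 x * f x))) <= K * (Q * e)).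
  { intros e He. destruct (exp_poly_approx f M N e HT Hf He) as [G [HG [HGP HGb]]].
    assert (HD : tower (fun n x => Derive_n f n x - G n x)) by (now apply tower_minus).
    assert (Hdec : forall n, exists B, forall x, -1 <= x -> Rabs (Derive_n f n x - G n x) <= B * exp (- (1 * x))).
    { intros n. destruct (exp_poly_approx f M n e HT Hf He) as [G' [HG' [HGP' HGb']]].
      destruct (exp_poly_decay _ (HGP n)) as [B1 [_ HB1]]. destruct (exp_poly_decay _ (HGP' n)) as [B2 [_ HB2]].
      exists (e + (B2 + B1)). intros x Hx.
      replace (Derive_n f n x - G n x) with ((Derive_n f n x - G' n x) + (G' n x + - G n x)) by ring.
      eapply Rle_trans; [apply Rabs_triang|]. rewrite !Rmult_plus_distr_r.
      apply Rplus_le_compat; [apply HGb'; auto|].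
      eapply Rle_trans; [apply Rabs_triang|]. rewrite Rabs_Ropp. apply Rplus_le_compat; auto. }
    assert (HS : schwartz (fun x => RtoC (cutoff 0 x * (f x - G 0%nat x)))).
    { apply (cut_schwartz 1 (fun n x => Derive_n f n x - G n x)); auto; lra. }
    assert (E : W (fun x => RtoC (cutoff 0 x * f x)) = W (fun x => RtoC (cutoff 0 x * (f x - G 0%nat x)))).
    { replace (fun x => RtoC (cutoff 0 x * f x)) with
        (fun x => RtoC 1 * RtoC (cutoff 0 x * (f x - G 0%nat x)) + RtoC (cutoff 0 x * G 0%nat x))%C.
      - rewrite (ann_linear _ HW); auto; [|apply cut_exp_poly_schwartz, HGP].
        rewrite (annihilates_exp_poly W (G 0%nat)) by auto. ring.
      - apply functional_extensionality; intros x. rewrite <- RtoC_mult, <- RtoC_plus. f_equal. ring. }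
    rewrite E. apply HB; [assumption|]. intros j n x Hj Hn.
    assert (ED : CDerive_n (fun x => RtoC (cutoff 0 x * (f x - G 0%nat x))) n x =
       RtoC (leibniz n cutoff (fun n x => Derive_n f n x - G n x) x))
      by exact (tower_CDerive_n (fun n => leibniz n cutoff (fun n x => Derive_n f n x - G n x)) n x (tower_leibniz _ _ tower_cutoff HD)).
    rewrite ED, Cmod_R.
    apply Rle_trans with (2 ^ n * A * V * e).
    - apply (cut_weight j n 1); auto; try lra.
      + intros; apply HAb; lia. + intros; apply HGb; auto; lia.
    - unfold Q. apply Rmult_le_compat_r; [lra|]. apply Rmult_le_compat_r; [assumption|].
      apply Rmult_le_compat_r; [assumption|]. now apply H2. }
  apply Cmod_eq_0. apply Rle_antisym; [|apply Cmod_ge_0].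
  apply le_epsilon. intros e He. rewrite Rplus_0_l.
  assert (HKQ : 0 <= K * Q) by (now apply Rmult_le_pos).
  eapply Rle_trans; [apply (S (e / (K * Q + 1))); apply Rdiv_lt_0_compat; lra|].
  replace (K * (Q * (e / (K * Q + 1)))) with (e * (K * Q / (K * Q + 1))) by (field; lra).
  rewrite <- (Rmult_1_r e) at 2. apply Rmult_le_compat_l; [lra|].
  apply Rmult_le_reg_r with (K * Q + 1); [lra|]. unfold Rdiv; rewrite Rmult_assoc, Rinv_l; lra.
Qed.

(** The part of [f] removed by the cutoff lives in the negative half-line, where [W]
    vanishes. *)
Lemma annihilates_real W (f : R -> R) M : annihilates_exponentials W ->
  tower (Derive_n f) -> (forall x, M < Rabs x -> f x = 0) ->
  W (fun x => RtoC (f x)) = RtoC 0.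
Proof.
  intros HW HT Hf.
  pose proof (tower_leibniz _ _ tower_cutoff HT) as HCT.
  pose proof (tower_minus _ _ HT HCT) as HDT.
  assert (T1 : test_function (fun x => RtoC (cutoff 0 x * f x))).
  { apply (tower_test (fun n => leibniz n cutoff (Derive_n f)) M HCT). intros x Hx. simpl. rewrite Hf by assumption. ring. }
  assert (T2 : test_function (fun x => RtoC (f x - cutoff 0 x * f x))).
  { apply (tower_test _ M HDT). intros x Hx. simpl. rewrite Hf by assumption. ring. }
  replace (fun x => RtoC (f x)) with
    (fun x => RtoC 1 * RtoC (cutoff 0 x * f x) + RtoC (f x - cutoff 0 x * f x))%C.
  - rewrite (ann_linear _ HW) by (now apply test_schwartz).
    rewrite (annihilates_cut_real W f M) by auto.
    rewrite (ann_supported _ HW _ T2); [ring|].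
    exists (1 / 2). split; [lra|]. intros x Hx. rewrite cutoff_right by lra. f_equal. ring.
  - apply functional_extensionality; intros x. rewrite <- RtoC_mult, <- RtoC_plus. f_equal. ring.
Qed.

Lemma annihilates_test W psi : annihilates_exponentials W -> test_function psi -> W psi = RtoC 0.
Proof.
  intros HW [Hs [M HM]]. destruct (smooth_towers psi Hs) as [TR TI].
  assert (ZR : forall x, M < Rabs x -> Re (psi x) = 0) by (intros x Hx; now rewrite HM).
  assert (ZI : forall x, M < Rabs x -> Im (psi x) = 0) by (intros x Hx; now rewrite HM).
  replace psi with (fun x => Ci * RtoC (Im (psi x)) + RtoC (Re (psi x)))%C.
  - rewrite (ann_linear _ HW).
    + rewrite !(annihilates_real W _ M) by auto. ring.
    + apply test_schwartz. exact (tower_test _ M TI ZI).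
    + apply test_schwartz. exact (tower_test _ M TR ZR).
  - apply functional_extensionality; intros x. apply C_eq; simpl; ring.
Qed.

Lemma Ceq_dist0 (u v : C) : (u - v = 0)%C -> u = v.
Proof. intros H. replace u with (u - v + v)%C by ring. rewrite H; ring. Qed.

(** The Laplace transform at [i m] tests against [exp (- m x)], and the defining
    relation gives both candidates the same value there. *)
Lemma H_unique D E1 E2 psi : is_H D E1 -> is_H D E2 -> test_function psi -> E1 psi = E2 psi.
Proof.
  intros [[L1 [N1 [K1 B1]]] [S1 H1]] [[L2 [N2 [K2 B2]]] [S2 H2]] Hpsi.
  apply Ceq_dist0. apply (annihilates_test (fun psi => E1 psi - E2 psi)%C); [|assumption].
  constructor.
  - intros c f g Hf Hg. rewrite L1, L2 by assumption. ring.
  - exists (max N1 N2), (Rabs K1 + Rabs K2).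
    split; [pose proof (Rabs_pos K1); pose proof (Rabs_pos K2); lra|].
    intros f Hf B HB.
    assert (HB0 : 0 <= B).
    { eapply Rle_trans; [|apply (HB 0%nat 0%nat 0); lia]. simpl. rewrite Rmult_1_l. apply Cmod_ge_0. }
    assert (Cmod (E1 f) <= K1 * B) by (apply B1; auto; intros; apply HB; lia).
    assert (Cmod (E2 f) <= K2 * B) by (apply B2; auto; intros; apply HB; lia).
    unfold Cminus. eapply Rle_trans; [apply Cmod_triangle|]. rewrite Cmod_opp.
    pose proof (Rle_abs K1). pose proof (Rle_abs K2). nra.
  - intros f Hf Hd. rewrite S1, S2 by assumption. ring.
  - intros m. set (k := INR (S m)). assert (Hk : 0 < k) by (apply lt_0_INR; lia).
    set (l := (Ci * RtoC k)%C).
    assert (Hl : 0 < Im l) by (unfold l; simpl; lra).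
    destruct (H1 l Hl) as [v1 [D1 Z1]]. destruct (H2 l Hl) as [v2 [D2 Z2]].
    assert (Q : forall q : R, exists d, 0 < d /\ forall x, - d < x ->
       RtoC (cutoff 0 x * exp (- (q * x))) = Cexp (RtoC (- (q * x)))).
    { intros q. exists (1 / 2). split; [lra|]. intros x Hx. rewrite cutoff_right by lra.
      rewrite Rmult_1_l. apply C_eq; unfold Cexp; simpl; rewrite cos_0, sin_0; ring. }
    assert (Ev : v1 = v2).
    { assert (Hik : 0 < / k) by (now apply Rinv_0_lt_compat).
      destruct (Q (/ k)) as [d [Hd Hq]].
      assert (EE : forall x : R, Cexp (Ci * (RtoC (-1) / l) * RtoC x) = Cexp (RtoC (- (/ k * x)))).
      { intros x. f_equal. unfold l. rewrite RtoC_opp, RtoC_mult, RtoC_inv by lra.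
        field. split; [intros E; injection E; lra | intros E; injection E; lra]. }
      rewrite <- (D1 _ (cut_exp_schwartz (/ k) Hik)); [rewrite <- (D2 _ (cut_exp_schwartz (/ k) Hik)); [reflexivity|]|];
      exists d; split; auto; intros x Hx; rewrite EE; auto. }
    destruct (Q k) as [d [Hd Hq]].
    assert (EE : forall x : R, Cexp (Ci * l * RtoC x) = Cexp (RtoC (- (k * x)))).
    { intros x. f_equal. unfold l. apply C_eq; simpl; ring. }
    rewrite (Z1 _ (cut_exp_schwartz k Hk)), (Z2 _ (cut_exp_schwartz k Hk)).
    + rewrite Ev; ring.
    + exists d; split; auto; intros x Hx; rewrite EE; auto.
    + exists d; split; auto; intros x Hx; rewrite EE; auto.
Qed.

Lemma calH_phi e a phi psi : e * e = 1 -> 0 < a ->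
  (forall x : R, continuous (fun x : R => phi (RtoC x)) x) ->
  (forall x, 0 < x -> phi (RtoC x) = RtoC (phi_sol e a x)) -> test_function psi ->
  calH (on_half_line phi) psi = H_phi e a psi.
Proof.
  intros He Ha Hc Hphi Ht. pose proof (H_phi_is_H e a phi He Ha Hc Hphi) as HH.
  apply (H_unique (on_half_line phi)); auto.
  unfold calH. apply epsilon_spec. now exists (H_phi e a).
Qed.

(** The tail integral over [(a, oo)] of a compactly supported function is the
    integral over [(a, a + L)] for every large [L]. *)
Lemma dist_value e a phi psi L : e * e = 1 -> 0 < a -> 0 <= L ->
  (forall x : R, continuous (fun x : R => phi (RtoC x)) x) ->
  (forall x, 0 < x -> phi (RtoC x) = RtoC (phi_sol e a x)) -> test_function psi ->
  supported_in_ball (a + L) psi ->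
  (RtoC e * on_half_line phi psi + calH (on_half_line phi) psi)%C =
  (psi a + RtoC e * CRInt (fun x => RtoC (phi_sol e a x) * psi x) a (a + L))%C.
Proof.
  intros He Ha HL Hc Hphi Ht HM.
  pose proof (fun x => smooth_continuous psi x (proj1 Ht)) as Hcpsi.
  rewrite (calH_phi e a) by assumption.
  rewrite (on_half_line_value e a phi psi (CRInt (fun x => RtoC (phi_sol e a x) * psi x)%C 0 (a + L))); auto.
  - rewrite (CRInt_Chasles _ 0 a (a + L)); try lra; [|intros; cont; auto].
    unfold H_phi. ring.
  - apply (lim_inf_ext (a + L) (fun _ => CRInt (fun x => RtoC (phi_sol e a x) * psi x)%C 0 (a + L))); [|apply lim_inf_const].
    intros X HX. rewrite (CRInt_Chasles _ 0 (a + L) X); try lra; [|intros; cont; auto].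
    rewrite (CRInt_ext _ (fun _ => RtoC 0) (a + L) X); try lra.
    + rewrite (CRInt_FTC (fun _ => RtoC 0) (fun _ => RtoC 0)); try lra; try ring.
      * intros; apply cderiv_const. * intros; cont.
    + intros x Hx. rewrite HM; [ring|]. rewrite Rabs_pos_eq; lra.
Qed.

(** * Contour integrals along segments *)

(** Holomorphy is used only through the chain rule along real paths. *)
Record holo (D : C -> Prop) (f f' : C -> C) : Prop := {
  holo_path : forall (g : R -> C) x l, D (g x) -> cderiv g x l ->
    cderiv (fun x => f (g x)) x (f' (g x) * l)%C;
  holo_cont : forall t : C, D t -> continuous f t;
  holo_cont' : forall t : C, D t -> continuous f' t }.

Lemma holo_const D c : holo D (fun _ => c) (fun _ => RtoC 0).
Proof.
  constructor; intros; try (cont).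
  eapply cderiv_eq; [apply cderiv_const | ring].
Qed.

Lemma holo_id D : holo D (fun t => t) (fun _ => RtoC 1).
Proof.
  constructor; intros; try (cont).
  eapply cderiv_eq; [eassumption | cbv beta; ring].
Qed.

Lemma holo_plus D f f' g g' : holo D f f' -> holo D g g' ->
  holo D (fun t => f t + g t)%C (fun t => f' t + g' t)%C.
Proof.
  intros Hf Hg. constructor.
  - intros h x l Hx Hl. eapply cderiv_eq; [apply cderiv_plus; [eapply Hf | eapply Hg]; eassumption | cbv beta; ring].
  - intros t Ht. cont; [now apply Hf | now apply Hg].
  - intros t Ht. cont; [now apply (holo_cont' _ _ _ Hf) | now apply (holo_cont' _ _ _ Hg)].
Qed.

Lemma holo_mult D f f' g g' : holo D f f' -> holo D g g' ->
  holo D (fun t => f t * g t)%C (fun t => f' t * g t + f t * g' t)%C.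
Proof.
  intros Hf Hg. constructor.
  - intros h x l Hx Hl. eapply cderiv_eq; [apply cderiv_mult; [eapply Hf | eapply Hg]; eassumption | cbv beta; ring].
  - intros t Ht. cont; [now apply Hf | now apply Hg].
  - intros t Ht. cont; [now apply (holo_cont' _ _ _ Hf) | now apply Hg | now apply Hf | now apply (holo_cont' _ _ _ Hg)].
Qed.

Lemma holo_inv D f f' : holo D f f' -> (forall t, D t -> f t <> RtoC 0) ->
  holo D (fun t => / f t)%C (fun t => - f' t * (/ f t * / f t))%C.
Proof.
  intros Hf Hn. constructor.
  - intros h x l Hx Hl. eapply cderiv_eq; [apply cderiv_inv; [eapply Hf; eassumption | auto] |].
    cbv beta. field. auto.
  - intros t Ht. cont; [now apply Hf | auto].
  - intros t Ht. cont; try (now apply (holo_cont' _ _ _ Hf)); try (now apply Hf); auto.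
Qed.

Lemma holo_exp D f f' : holo D f f' -> holo D (fun t => Cexp (f t)) (fun t => f' t * Cexp (f t))%C.
Proof.
  intros Hf. constructor.
  - intros h x l Hx Hl. eapply cderiv_eq; [apply cderiv_Cexp; eapply Hf; eassumption | cbv beta; ring].
  - intros t Ht. cont; now apply Hf.
  - intros t Ht. cont; [now apply (holo_cont' _ _ _ Hf) | now apply Hf].
Qed.

Definition pt (p q : C) (s : R) : C := (p + RtoC s * (q - p))%C.

Definition seg (f : C -> C) (p q : C) : C := CRInt (fun s => f (pt p q s) * (q - p))%C 0 1.

Definition convex (D : C -> Prop) : Prop :=
  forall p q s, D p -> D q -> 0 <= s <= 1 -> D (pt p q s).

Lemma continuous_pt {U : UniformSpace} (p q : U -> C) (s : U -> R) x :
  continuous p x -> continuous q x -> continuous s x -> continuous (fun u => pt (p u) (q u) (s u)) x.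
Proof. intros; unfold pt; cont. Qed.

Lemma continuous_on_seg (f : C -> C) (p q : C) (x : R) : continuous f (pt p q x) -> continuous (fun s => f (pt p q s)) x.
Proof. intros H. apply (continuous_comp (fun s => pt p q s) f); [apply continuous_pt; cont | assumption]. Qed.

Lemma cderiv_pt_s p q s : cderiv (fun s => pt p q s) s (q - p)%C.
Proof.
  unfold pt. eapply cderiv_eq.
  - apply cderiv_plus; [apply cderiv_const|]. apply cderiv_mult; [apply cderiv_id | apply cderiv_const].
  - cbv beta; ring.
Qed.

(** Cauchy's theorem: [(s, u) |-> pt p (pt q0 q1 u) s] maps the unit square onto the
    triangle and pulls [f t dt] back to a closed form. *)
Lemma triangle D f f' p q0 q1 : convex D -> holo D f f' -> D p -> D q0 -> D q1 ->
  (seg f p q0 + seg f q0 q1 = seg f p q1)%C.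
Proof.
  intros HD Hf Hp H0 H1.
  pose proof (rectangle_closed_form
    (fun s u => f (pt p (pt q0 q1 u) s) * (pt q0 q1 u - p))%C
    (fun s u => RtoC s * (q1 - q0) * f (pt p (pt q0 q1 u) s))%C
    (fun s u => f' (pt p (pt q0 q1 u) s) * (RtoC s * (q1 - q0)) * (pt q0 q1 u - p) +
                f (pt p (pt q0 q1 u) s) * (q1 - q0))%C
    0 1 0 1 Rle_0_1 Rle_0_1) as H.
  assert (HQ : forall s u, 0 <= s <= 1 -> 0 <= u <= 1 -> D (pt p (pt q0 q1 u) s)) by (intros; apply HD; auto).
  assert (E0 : pt q0 q1 0 = q0) by (unfold pt; ring).
  assert (E1 : pt q0 q1 1 = q1) by (unfold pt; ring).
  assert (HS : forall q, D q -> forall x, 0 <= x <= 1 -> continuous (fun s => f (pt p q s) * (q - p))%C x).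
  { intros q Hq x Hx. cont. apply continuous_on_seg. apply Hf. now apply HD. }
  rewrite CRInt_minus in H; try lra.
  2: { rewrite E1. apply HS, H1. }
  2: { rewrite E0. apply HS, H0. }
  rewrite E0, E1 in H. fold (seg f p q0) (seg f p q1) in H.
  rewrite (CRInt_ext (fun u : R => RtoC 1 * _ * _ - _)%C (fun u => f (pt q0 q1 u) * (q1 - q0))%C) in H; try lra.
  2: { intros u Hu. replace (pt p (pt q0 q1 u) 1) with (pt q0 q1 u) by (unfold pt; ring). ring. }
  fold (seg f q0 q1) in H. rewrite <- H; [ring| | |].
  - intros s u Hs Hu. eapply cderiv_eq.
    + apply cderiv_mult.
      * apply (holo_path _ _ _ Hf) with (g := fun u => pt p (pt q0 q1 u) s); [apply HQ; auto|].
        unfold pt at 1. apply cderiv_plus; [apply cderiv_const|].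
        apply cderiv_mult; [apply cderiv_const|].
        apply cderiv_minus; [apply cderiv_pt_s | apply cderiv_const].
      * apply cderiv_minus; [apply cderiv_pt_s | apply cderiv_const].
    + cbv beta. ring.
  - intros s u Hs Hu. eapply cderiv_eq.
    + apply cderiv_mult.
      * apply cderiv_mult; [apply cderiv_id | apply cderiv_const].
      * apply (holo_path _ _ _ Hf) with (g := fun s => pt p (pt q0 q1 u) s); [apply HQ; auto|].
        apply cderiv_pt_s.
    + cbv beta. ring.
  - intros s u Hs Hu. simpl.
    assert (continuous (fun z : R * R => pt p (pt q0 q1 (snd z)) (fst z)) (s, u)).
    { apply continuous_pt; [cont | apply continuous_pt; cont | cont]. }
    assert (continuous (fun z : R * R => pt q0 q1 (snd z)) (s, u)) by (apply continuous_pt; cont).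
    cont.
    + apply (continuous_comp (fun z : R * R => pt p (pt q0 q1 (snd z)) (fst z)) f'); [assumption|].
      apply (holo_cont' _ _ _ Hf). now apply HQ.
    + apply (continuous_comp (fun z : R * R => pt p (pt q0 q1 (snd z)) (fst z)) f); [assumption|].
      apply Hf. now apply HQ.
Qed.

Lemma seg_bound D f f' p q B : convex D -> holo D f f' -> D p -> D q ->
  (forall s, 0 <= s <= 1 -> Cmod (f (pt p q s)) <= B) -> Cmod (seg f p q) <= B * Cmod (q - p)%C.
Proof.
  intros HD Hf Hp Hq H. unfold seg.
  replace (B * Cmod (q - p)) with ((1 - 0) * (B * Cmod (q - p))) by ring.
  apply CRInt_bound_const; [lra| |].
  - intros x Hx. cont. apply continuous_on_seg, Hf. now apply HD.
  - intros x Hx. rewrite Cmod_mult. apply Rmult_le_compat_r; [apply Cmod_ge_0 | auto].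
Qed.

Lemma seg_line f c d u v : u <= v -> (forall s, u <= s <= v -> continuous f (c + d * RtoC s)%C) ->
  seg f (c + d * RtoC u)%C (c + d * RtoC v)%C = CRInt (fun s => d * f (c + d * RtoC s))%C u v.
Proof.
  intros Huv Hf.
  pose proof (CRInt_comp (fun s : R => d * f (c + d * RtoC s))%C (fun s => u + s * (v - u)) (fun _ => v - u) 0 1) as H. cbv beta in H.
  replace (u + 0 * (v - u)) with u in H by ring. replace (u + 1 * (v - u)) with v in H by ring.
  rewrite <- H; try lra.
  - apply CRInt_ext; [lra|]. intros s Hs. unfold pt.
    replace (c + d * RtoC u + RtoC s * (c + d * RtoC v - (c + d * RtoC u)))%C with (c + d * RtoC (u + s * (v - u)))%C.
    + rewrite RtoC_minus. ring.
    + rewrite RtoC_plus, RtoC_mult, RtoC_minus. ring.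
  - intros s Hs. cont. apply (continuous_comp (fun s : R => c + d * RtoC s)%C f); [cont|].
    apply Hf. nra.
  - intros s Hs. split; [auto_derive; auto; ring | cont].
Qed.

Definition right_half (t : C) : Prop := 0 < Re t.

Lemma pt_Re p q s : Re (pt p q s) = (1 - s) * Re p + s * Re q.
Proof. unfold pt; simpl. unfold Re; ring. Qed.

Lemma pt_Re_ge p q s c : 0 <= s <= 1 -> c <= Re p -> c <= Re q -> c <= Re (pt p q s).
Proof. intros. rewrite pt_Re. nra. Qed.

Lemma right_half_convex : convex right_half.
Proof. intros p q s Hp Hq Hs. unfold right_half in *. rewrite pt_Re. nra. Qed.

Lemma right_half_neq0 t : right_half t -> t <> RtoC 0.
Proof. apply C_neq0_Re. Qed.

Lemma Re_mult_pt w p q s c : 0 <= s <= 1 -> c <= Re (w * p)%C -> c <= Re (w * q)%C -> c <= Re (w * pt p q s)%C.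
Proof.
  intros Hs H1 H2. replace (w * pt p q s)%C with (pt (w * p) (w * q) s)%C by (unfold pt; ring).
  now apply pt_Re_ge.
Qed.

Lemma Cmod_inv_le t c : 0 < c -> c <= Re t -> Cmod (/ t)%C <= / c.
Proof.
  intros Hc H. rewrite Cmod_inv by (apply C_neq0_Re; lra).
  apply Rinv_le_contravar; [assumption|]. pose proof (Re_le_Cmod t); lra.
Qed.

(** * The kernel and the Bessel functions K *)

(** With [zeta = a - z] this is the integrand of [G_A] for [e = 1] and of [G_B] for [e
    = -1], continued to complex [t]. *)
Definition ker (e a : R) (zeta t : C) : C :=
  (RtoC (1 / 2) * (RtoC 1 + RtoC e * / t) * Cexp (- (zeta * t + RtoC a * / t)))%C.

Lemma ker_holo e a zeta : exists f', holo right_half (ker e a zeta) f'.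
Proof.
  eexists. unfold ker.
  pose proof (holo_inv right_half _ _ (holo_id _) right_half_neq0) as Hi.
  eapply (holo_mult _ (fun t => RtoC (1 / 2) * (RtoC 1 + RtoC e * / t))%C _ (fun t => Cexp (- (zeta * t + RtoC a * / t)))%C _).
  - apply holo_mult; [apply holo_const|]. apply holo_plus; [apply holo_const|].
    apply holo_mult; [apply holo_const | exact Hi].
  - apply holo_exp.
    replace (fun t => - (zeta * t + RtoC a * / t))%C with (fun t => RtoC (-1) * (zeta * t + RtoC a * / t))%C.
    + apply holo_mult; [apply holo_const|]. apply holo_plus; apply holo_mult; try apply holo_const; [apply holo_id | exact Hi].
    + apply functional_extensionality; intros; ring.
Qed.

Lemma Re_inv_pos t : 0 < Re t -> 0 < Re (/ t)%C.
Proof.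
  intros Ht. pose proof (Cmod2_pos t (C_neq0_Re t Ht)).
  destruct t as [u v]; simpl in *. now apply Rdiv_lt_0_compat.
Qed.

Lemma sign_abs e : e * e = 1 -> Rabs e = 1.
Proof. intros He. assert (e = 1 \/ e = -1) as [->| ->] by nra; unfold Rabs; destruct Rcase_abs; lra. Qed.

Lemma ker_factor_bound e t c : e * e = 1 -> 0 < c -> c <= Re t ->
  Cmod (RtoC (1 / 2) * (RtoC 1 + RtoC e * / t))%C <= / 2 * (1 + / c).
Proof.
  intros He Hc Ht. rewrite Cmod_mult, Cmod_R, (Rabs_pos_eq (1 / 2)) by lra.
  pose proof (Cmod_inv_le t c Hc Ht).
  assert (Cmod (RtoC 1 + RtoC e * / t)%C <= 1 + / c).
  { eapply Rle_trans; [apply Cmod_triangle|]. rewrite Cmod_1, Cmod_mult, Cmod_R, sign_abs by assumption. lra. }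
  lra.
Qed.

Lemma ker_bound e a zeta t c : e * e = 1 -> 0 < a -> 0 < c -> c <= Re t ->
  Cmod (ker e a zeta t) <= / 2 * (1 + / c) * exp (- Re (zeta * t)%C).
Proof.
  intros He Ha Hc Ht. unfold ker. rewrite Cmod_mult. apply Rmult_le_compat; try apply Cmod_ge_0.
  - now apply ker_factor_bound.
  - rewrite Cmod_Cexp. apply exp_le.
    assert (0 < Re (/ t)%C) by (apply Re_inv_pos; lra).
    assert (Re (- (zeta * t + RtoC a * / t))%C = - Re (zeta * t)%C - a * Re (/ t)%C) by (simpl; unfold Re; ring).
    assert (0 < a * Re (/ t)%C) by (now apply Rmult_lt_0_compat). lra.
Qed.

Lemma Csqrt_sqr u : (Csqrt u * Csqrt u = u)%C.
Proof.
  destruct u as [x y]. unfold Csqrt.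
  set (m := Cmod (x, y)).
  assert (Hm : m * m = x * x + y * y).
  { unfold m, Cmod; simpl. rewrite sqrt_sqrt; [ring | nra]. }
  assert (Hx : Rabs x <= m) by (apply (re_le_Cmod (x, y))).
  apply Rabs_le_between in Hx. simpl Re; simpl Im.
  assert (H1 : 0 <= (m + x) / 2) by lra. assert (H2 : 0 <= (m - x) / 2) by lra.
  pose proof (sqrt_sqrt _ H1) as S1. pose proof (sqrt_sqrt _ H2) as S2.
  assert (S3 : sqrt ((m + x) / 2) * sqrt ((m - x) / 2) = Rabs y / 2).
  { rewrite <- sqrt_mult by assumption.
    replace ((m + x) / 2 * ((m - x) / 2)) with (Rsqr (Rabs y / 2)).
    - apply sqrt_Rsqr. pose proof (Rabs_pos y); lra.
    - unfold Rsqr. replace (Rabs y / 2 * (Rabs y / 2)) with (Rabs y * Rabs y / 4) by field.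
      rewrite <- Rabs_mult, Rabs_pos_eq by nra. nra. }
  apply C_eq; simpl; destruct Rlt_dec as [Hy|Hy].
  - rewrite S1. replace (- sqrt ((m - x) / 2) * - sqrt ((m - x) / 2)) with (sqrt ((m - x) / 2) * sqrt ((m - x) / 2)) by ring. lra.
  - lra.
  - rewrite Rabs_left in S3 by assumption. nra.
  - rewrite Rabs_pos_eq in S3 by lra. nra.
Qed.

Lemma Csqrt_Re_pos u : ~ (Im u = 0 /\ Re u <= 0) -> 0 < Re (Csqrt u).
Proof.
  intros H. destruct u as [x y]. simpl in *.
  apply sqrt_lt_R0. enough (0 < Cmod (x, y) + x) by lra.
  assert (Hm : Cmod (x, y) * Cmod (x, y) = x * x + y * y).
  { unfold Cmod; simpl. rewrite sqrt_sqrt; [ring | nra]. }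
  pose proof (re_le_Cmod (x, y)) as Hx. simpl in Hx. pose proof (Cmod_ge_0 (x, y)).
  destruct (Rlt_dec 0 x); [lra|].
  destruct (Req_dec y 0) as [->|Hy]; [exfalso; apply H; lra|].
  assert (0 < y * y) by (destruct (Rdichotomy _ _ Hy); nra). nra.
Qed.

(** In the slit plane the arguments of the Bessel functions are
    [G_arg = 2 zeta r = 2 a / r], where [r = G_ratio] and [zeta = a - z]. *)
Lemma G_ratio_spec a z : 0 < a -> slit_plane a z ->
  0 < Re (G_ratio a z) /\ 0 < Re ((RtoC a - z) * G_ratio a z)%C /\
  G_arg a z = (RtoC 2 * ((RtoC a - z) * G_ratio a z))%C /\
  ((RtoC a - z) * G_ratio a z * G_ratio a z = RtoC a)%C.
Proof.
  intros Ha Hz. unfold G_arg, G_ratio. set (zeta := (RtoC a - z)%C).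
  assert (Hzeta : ~ (Im zeta = 0 /\ Re zeta <= 0)).
  { unfold zeta, slit_plane in *. simpl. intros [A B]. apply Hz; split; unfold Re, Im in *; lra. }
  assert (Hz0 : zeta <> RtoC 0) by (intros E; apply Hzeta; rewrite E; simpl; lra).
  assert (P1 : 0 < Re (Csqrt (RtoC a * zeta)%C)).
  { apply Csqrt_Re_pos. intros [A B]. apply Hzeta. destruct zeta as [u v]; simpl in *. split; nra. }
  assert (P2 : 0 < Re (Csqrt (RtoC a / zeta)%C)).
  { apply Csqrt_Re_pos. intros [A B]. apply Hzeta. pose proof (Cmod2_pos _ Hz0) as Hp. destruct zeta as [u v]; simpl in *.
    set (d := u * (u * 1) + v * (v * 1)) in *.
    assert (0 < / d) by (now apply Rinv_0_lt_compat). unfold Rdiv in *.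
    assert (0 < a * / d) by (now apply Rmult_lt_0_compat).
    split; nra. }
  pose proof (Csqrt_sqr (RtoC a * zeta)%C) as Q1. pose proof (Csqrt_sqr (RtoC a / zeta)%C) as Q2.
  set (s := Csqrt (RtoC a * zeta)%C) in *. set (r := Csqrt (RtoC a / zeta)%C) in *.
  (* [s * r] squares to [a * a]; the value [- a] is excluded by the signs of the real parts *)
  assert (Q3 : ((s * r - RtoC a) * (s * r + RtoC a) = RtoC 0)%C).
  { transitivity ((s * s) * (r * r) - RtoC a * RtoC a)%C; [ring|]. rewrite Q1, Q2. field. assumption. }
  assert (Ha0 : RtoC a <> RtoC 0) by (intros E; injection E; lra).
  assert (Hr0 : r <> RtoC 0) by (now apply C_neq0_Re).
  assert (Q4 : (s * r = RtoC a)%C).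
  { apply Ceq_dist0. destruct (Req_dec (Cmod (s * r - RtoC a)%C) 0) as [E|E]; [now apply Cmod_eq_0|].
    exfalso. assert (Q5 : (s * r + RtoC a = RtoC 0)%C).
    { apply Cmod_eq_0. apply (f_equal Cmod) in Q3. rewrite Cmod_mult, Cmod_0 in Q3. 
      apply Rmult_integral in Q3. tauto. }
    assert (Es : s = (RtoC (- a) * / r)%C).
    { transitivity ((s * r + RtoC a - RtoC a) / r)%C; [field; assumption|]. rewrite Q5, RtoC_opp. field. assumption. }
    pose proof (Re_inv_pos r P2). rewrite Es in P1. rewrite re_scal_l in P1. nra. }
  assert (Q6 : (zeta * r = s)%C).
  { transitivity ((RtoC a * zeta) * r / RtoC a)%C; [field; assumption|]. rewrite <- Q1.
    transitivity (s * (s * r) / RtoC a)%C; [field; assumption|]. rewrite Q4. field. assumption. }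
  rewrite Q6. repeat split; auto.
Qed.

Lemma cosh_bounds t : 0 <= t -> 1 <= cosh t /\ exp t / 2 <= cosh t.
Proof.
  intros Ht. unfold cosh. pose proof (exp_pos t). pose proof (exp_pos (- t)).
  assert (exp t * exp (- t) = 1) by (rewrite <- exp_plus, Rplus_opp_r, exp_0; reflexivity).
  pose proof (exp_ineq1_le t). assert (exp (- t) <= 1) by nra.
  assert (0 <= (exp t - 1) * (1 - exp (- t))) by (apply Rmult_le_pos; lra). split; nra.
Qed.

Lemma exp_square_bound y : 0 <= y -> y * y * exp (- y) <= 4.
Proof.
  intros Hy. replace (- y) with (- (y / 2) + - (y / 2)) by field. rewrite exp_plus.
  pose proof (exp_ineq1_le (y / 2)). pose proof (exp_pos (y / 2)).
  assert (E : exp (y / 2) * exp (- (y / 2)) = 1) by (rewrite <- exp_plus, Rplus_opp_r, exp_0; reflexivity).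
  pose proof (exp_pos (- (y / 2))).
  assert (0 <= y / 2 * exp (- (y / 2)) <= 1) by nra. nra.
Qed.

Lemma continuous_cosh {U : UniformSpace} (f : U -> R) x : continuous f x -> continuous (fun u => cosh (f u)) x.
Proof. intros H. unfold cosh. cont. Qed.

(** Since [u exp (- k u)] is [O(1 / u)], the integrand is [O(exp (- t))]. *)
Lemma BesselK_lim nu w : 0 < Re w -> (nu = 0 \/ nu = 1) ->
  lim_inf (fun S => CRInt (fun t => Cexp (- w * RtoC (cosh t)) * RtoC (cosh (nu * t)))%C 0 S) (BesselK nu w).
Proof.
  intros Hw Hnu.
  assert (Hc : forall x, 0 <= x -> continuous (fun t => Cexp (- w * RtoC (cosh t)) * RtoC (cosh (nu * t)))%C x).
  { intros x _. apply continuous_Cmult; [apply continuous_Cexp|]; cont; apply continuous_cosh; cont. }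
  set (k := Re w) in *.
  destruct (exp_dominated_lim _ (8 / (k * k)) 1 ltac:(lra) Hc) as [v Hv].
  - intros x Hx. rewrite Cmod_mult, Cmod_Cexp, Cmod_R.
    destruct (cosh_bounds x Hx) as [C1 C2].
    assert (Rabs (cosh (nu * x)) <= cosh x).
    { destruct Hnu as [-> | ->].
      - rewrite Rmult_0_l, cosh_0, Rabs_R1. assumption.
      - rewrite Rmult_1_l, Rabs_pos_eq; lra. }
    replace (Re (- w * RtoC (cosh x))%C) with (- (k * cosh x)) by (unfold k; simpl; unfold Re; ring).
    set (u := cosh x) in *.
    pose proof (exp_square_bound (k * u) ltac:(apply Rmult_le_pos; lra)) as B.
    pose proof (exp_pos (- (k * u))).
    apply Rle_trans with (exp (- (k * u)) * u); [apply Rmult_le_compat_l; lra|].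
    rewrite Rmult_1_l, (exp_Ropp x). pose proof (exp_pos x).
    apply Rmult_le_reg_r with (exp x * (k * k)); [apply Rmult_lt_0_compat; [assumption|nra]|].
    replace (8 / (k * k) * / exp x * (exp x * (k * k))) with 8 by (field; split; lra).
    replace (exp (- (k * u)) * u * (exp x * (k * k))) with ((k * k * u * exp (- (k * u))) * exp x) by ring.
    assert (exp x <= 2 * u) by lra.
    assert (0 <= k * k * u * exp (- (k * u))) by (clearbody u; repeat apply Rmult_le_pos; lra).
    apply Rle_trans with ((k * k * u * exp (- (k * u))) * (2 * u)); [apply Rmult_le_compat_l; assumption|].
    replace ((k * k * u * exp (- (k * u))) * (2 * u)) with (2 * (k * u * (k * u) * exp (- (k * u)))) by ring. lra.
  - replace (BesselK nu w) with v; [assumption|]. symmetry. unfold BesselK. now apply CRInt_gen_half_line.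
Qed.

Lemma CRInt_symmetric (F : R -> C) S : 0 <= S -> (forall x, continuous F x) ->
  CRInt F (- S) S = CRInt (fun s => F s + F (- s)%R)%C 0 S.
Proof.
  intros HS HF.
  assert (HF' : forall x, continuous (fun s => F (- s)) x).
  { intros x. apply (continuous_comp (fun s : R => - s) F); [cont | apply HF]. }
  rewrite (CRInt_Chasles F (- S) 0 S) by (auto; lra).
  rewrite CRInt_plus by auto.
  rewrite Cplus_comm. f_equal.
  pose proof (is_CRInt F (- S) 0 ltac:(lra) ltac:(auto)) as H1.
  assert (H2 : is_RInt (V := C_R_NormedModule) F (- 0) (- S) (opp (CRInt F (- S) 0))).
  { rewrite Ropp_0. now apply (@is_RInt_swap C_R_NormedModule). }
  apply (@is_RInt_comp_opp C_R_NormedModule) in H2.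
  apply (@is_RInt_opp C_R_NormedModule) in H2.
  symmetry. apply CRInt_unique. evar_last.
  { eapply is_RInt_ext; [|exact H2]. intros x _. apply C_eq; unfold opp; simpl; apply Ropp_involutive. }
  apply C_eq; unfold opp; simpl; apply Ropp_involutive.
Qed.

(** [G_A] and [G_B] without their common prefactor; the sign [e = 1] or [e = -1] lets
    one argument serve both. *)
Definition g_fun (e a : R) (z : C) : C :=
  (G_ratio a z * BesselK 1 (G_arg a z) + RtoC e * BesselK 0 (G_arg a z))%C.

(** The substitution [t = r exp s] on the ray through [r = G_ratio] turns [zeta t + a
    / t] into [G_arg * cosh s]; the even part in [s] of the rest gives the factors
    [cosh s] and [1]. *)
Lemma g_fun_lim e a z : 0 < a -> slit_plane a z ->
  lim_inf (fun X => seg (ker e a (RtoC a - z)) (G_ratio a z / RtoC X) (G_ratio a z * RtoC X))%C (g_fun e a z).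
Proof.
  intros Ha Hz. destruct (G_ratio_spec a z Ha Hz) as [Hr [Hzr [Hw Hzrr]]].
  set (r := G_ratio a z) in *. set (zeta := (RtoC a - z)%C) in *. set (h := (zeta * r)%C) in *.
  assert (Hr0 : r <> RtoC 0) by (now apply C_neq0_Re).
  assert (Har : (RtoC a * / r = h)%C) by (rewrite <- Hzrr; field; assumption).
  assert (Hwp : 0 < Re (G_arg a z)) by (rewrite Hw, re_scal_l; lra).
  pose proof (BesselK_lim 1 _ Hwp ltac:(auto)) as L1. pose proof (BesselK_lim 0 _ Hwp ltac:(auto)) as L0.
  pose proof (lim_inf_plus _ _ _ _ (lim_inf_scal r _ _ L1) (lim_inf_scal (RtoC e) _ _ L0)) as L.
  fold (g_fun e a z) in L. change (lim_inf _ _) with (lim_inf (fun X => r * CRInt (fun t => Cexp (- G_arg a z * RtoC (cosh t)) * RtoC (cosh (1 * t))) 0 X + RtoC e * CRInt (fun t => Cexp (- G_arg a z * RtoC (cosh t)) * RtoC (cosh (0 * t))) 0 X)%C (g_fun e a z)) in L.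
  assert (E : forall S, 0 < S -> (r * CRInt (fun t => Cexp (- G_arg a z * RtoC (cosh t)) * RtoC (cosh (1 * t))) 0 S + RtoC e * CRInt (fun t => Cexp (- G_arg a z * RtoC (cosh t)) * RtoC (cosh (0 * t))) 0 S)%C
     = seg (ker e a zeta) (r / RtoC (exp S))%C (r * RtoC (exp S))%C).
  { intros S HS. destruct (ker_holo e a zeta) as [f' Hf].
    assert (Hp : forall s : R, 0 < s -> right_half (RtoC 0 + r * RtoC s)%C).
    { intros s Hs. unfold right_half. rewrite Cplus_0_l, re_scal_r; now apply Rmult_lt_0_compat. }
    assert (EX : exp (- S) <= exp S) by (apply exp_le; lra).
    replace (r / RtoC (exp S))%C with (RtoC 0 + r * RtoC (exp (- S)))%C.
    2: { rewrite exp_Ropp, RtoC_inv by (apply Rgt_not_eq, exp_pos). unfold Cdiv; ring. }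
    replace (r * RtoC (exp S))%C with (RtoC 0 + r * RtoC (exp S))%C by ring.
    rewrite (seg_line (ker e a zeta)); auto.
    2: { intros s Hs. apply Hf, Hp. pose proof (exp_pos (- S)); lra. }
    rewrite <- (CRInt_comp (fun s : R => r * ker e a zeta (RtoC 0 + r * RtoC s))%C exp exp (- S) S); auto; try lra.
    2: { intros s _. cont. apply (continuous_comp (fun s : R => RtoC 0 + r * RtoC s)%C (ker e a zeta)); [cont|].
         apply Hf, Hp, exp_pos. }
    2: { intros s _. split; [apply is_derive_exp | cont]. }
    set (F := fun s => (RtoC (1 / 2) * (r * RtoC (exp s) + RtoC e) * Cexp (- G_arg a z * RtoC (cosh s)))%C).
    assert (EF : forall s : R, (RtoC (exp s) * (r * ker e a zeta (RtoC 0 + r * RtoC (exp s))) = F s)%C).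
    { intros s. unfold F, ker.
      assert (Hs : RtoC (exp s) <> RtoC 0) by (intros E; injection E; pose proof (exp_pos s); lra).
      rewrite Cplus_0_l.
      replace (- (zeta * (r * RtoC (exp s)) + RtoC a * / (r * RtoC (exp s))))%C with (- G_arg a z * RtoC (cosh s))%C.
      - field. auto.
      - rewrite Hw. unfold cosh. rewrite RtoC_div, RtoC_plus, exp_Ropp, RtoC_inv by (try lra; apply Rgt_not_eq, exp_pos).
        transitivity (- (h * RtoC (exp s) + (RtoC a * / r) * / RtoC (exp s)))%C; [rewrite Har; field; auto | unfold h; field; auto]. }
    rewrite (CRInt_ext (fun s : R => RtoC (exp s) * (r * ker e a zeta (RtoC 0 + r * RtoC (exp s))))%C F) by (try lra; intros s _; apply EF).
    assert (HcF : forall x, continuous F x).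
    { intros x. unfold F. apply continuous_Cmult; [cont|]. apply continuous_Cexp. cont. apply continuous_cosh; cont. }
    rewrite CRInt_symmetric by (auto; lra).
    assert (HcK : forall nu x, continuous (fun t => Cexp (- G_arg a z * RtoC (cosh t)) * RtoC (cosh (nu * t)))%C x).
    { intros nu x. apply continuous_Cmult; [apply continuous_Cexp|]; cont; apply continuous_cosh; cont. }
    rewrite <- !CRInt_scal by (auto; lra).
    rewrite <- CRInt_plus; [| lra | intros; apply continuous_Cmult; [cont | auto] ..].
    apply CRInt_ext; [lra|]. intros s Hs. unfold F.
    rewrite Rmult_1_l, Rmult_0_l, cosh_0.
    replace (cosh (- s)) with (cosh s) by (unfold cosh; rewrite Ropp_involutive; field).
    set (E := Cexp _). unfold cosh. rewrite RtoC_div, RtoC_plus by lra.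
    rewrite RtoC_div by lra. field. }
  intros d Hd. destruct (L d Hd) as [S0 HS0]. exists (exp (Rmax 0 S0)). intros X HX.
  pose proof (Rmax_l 0 S0). pose proof (Rmax_r 0 S0).
  assert (HX0 : 0 < X) by (pose proof (exp_pos (Rmax 0 S0)); lra).
  assert (HS : Rmax 0 S0 < ln X) by (rewrite <- (ln_exp (Rmax 0 S0)); apply ln_increasing; [apply exp_pos | assumption]).
  specialize (HS0 (ln X) ltac:(lra)). rewrite E in HS0 by lra. rewrite exp_ln in HS0 by assumption. exact HS0.
Qed.

(** * Changing the contour *)

Lemma Re_inv_ge u c K : 0 < c -> c <= Re u -> Cmod u <= K -> c / K ^ 2 <= Re (/ u)%C.
Proof.
  intros Hc Hu HK. pose proof (Cmod2_pos u (C_neq0_Re u ltac:(lra))) as Hp.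
  assert (Hm : Cmod u ^ 2 = fst u ^ 2 + snd u ^ 2).
  { unfold Cmod. apply pow2_sqrt. lra. }
  pose proof (Re_le_Cmod u).
  assert (HK2 : Cmod u ^ 2 <= K ^ 2) by (apply pow_incr; split; [apply Cmod_ge_0 | assumption]).
  replace (Re (/ u)%C) with (Re u / Cmod u ^ 2) by (rewrite Hm; destruct u; simpl; reflexivity).
  unfold Rdiv. apply Rmult_le_compat; try lra.
  - left; apply Rinv_0_lt_compat. lra.
  - apply Rinv_le_contravar; [|assumption]. rewrite Hm; assumption.
Qed.

Lemma is_lim_two_exp A1 k1 A2 k2 : 0 < k1 -> 0 < k2 ->
  is_lim (fun X => A1 * exp (- (k1 * X)) + A2 * exp (- (k2 * X))) p_infty 0.
Proof.
  intros H1 H2. evar_last. { apply is_lim_plus'; apply is_lim_exp_scal; assumption. }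
  simpl. now rewrite Rplus_0_r.
Qed.

(** Near [0] the factor [exp (- a / t)] makes the kernel negligible on segments
    shrinking to [0] inside a sector. *)
Lemma inner_arc e a zeta p q : e * e = 1 -> 0 < a -> right_half p -> right_half q ->
  exists A k, 0 < k /\ forall X, 1 <= X ->
    Cmod (seg (ker e a zeta) (p / RtoC X) (q / RtoC X))%C <= A * exp (- (k * X)).
Proof.
  intros He Ha Hp Hq. unfold right_half in *.
  set (c := Rmin (Re p) (Re q)). set (K := Cmod p + Cmod q).
  assert (Hc : 0 < c) by (apply Rmin_glb_lt; assumption).
  pose proof (Rmin_l (Re p) (Re q)) as Hc1. pose proof (Rmin_r (Re p) (Re q)) as Hc2. fold c in Hc1, Hc2.
  assert (HK : 0 < K) by (unfold K; pose proof (Re_le_Cmod p); pose proof (Re_le_Cmod q); lra).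
  set (k := a * (c / K ^ 2)).
  assert (Hk : 0 < k). { unfold k. apply Rmult_lt_0_compat; [assumption|]. apply Rdiv_lt_0_compat; [assumption|]. apply pow_lt; assumption. }
  set (B := / 2 * (1 + / c) * exp (Cmod zeta * K)).
  assert (Hic : 0 < / c) by (now apply Rinv_0_lt_compat).
  assert (HB : 0 <= B). { unfold B. apply Rmult_le_pos; [lra | left; apply exp_pos]. }
  exists (B * (1 + 2 / k) * Cmod (q - p)%C), (k / 2). split; [lra|].
  intros X HX. destruct (ker_holo e a zeta) as [f' Hf].
  assert (HX0 : RtoC X <> RtoC 0) by (intros E; injection E; lra).
  assert (HiX : 0 < / X <= 1). { split; [apply Rinv_0_lt_compat; lra|]. rewrite <- Rinv_1. apply Rinv_le_contravar; lra. }
  assert (HR : forall w, 0 < Re w -> right_half (w / RtoC X)%C).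
  { intros w Hw. unfold right_half, Cdiv. rewrite <- RtoC_inv, re_scal_r by lra. apply Rmult_lt_0_compat; lra. }
  eapply Rle_trans.
  { apply (seg_bound right_half _ f' _ _ (B * ((1 + X) * exp (- (k * X))))); auto using right_half_convex.
    intros s Hs. set (u := pt p q s).
    assert (Hu : c <= Re u) by (apply pt_Re_ge; auto).
    assert (HuK : Cmod u <= K).
    { unfold u, pt, K. replace (p + RtoC s * (q - p))%C with (RtoC (1 - s) * p + RtoC s * q)%C by (rewrite RtoC_minus; ring).
      eapply Rle_trans; [apply Cmod_triangle|]. rewrite !Cmod_mult, !Cmod_R, !Rabs_pos_eq by lra.
      pose proof (Cmod_ge_0 p). pose proof (Cmod_ge_0 q). nra. }
    assert (Hu0 : u <> RtoC 0) by (apply C_neq0_Re; lra).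
    replace (pt (p / RtoC X) (q / RtoC X) s)%C with (u / RtoC X)%C by (unfold u, pt; field; assumption).
    unfold ker. replace (/ (u / RtoC X))%C with (RtoC X * / u)%C by (field; auto).
    rewrite Cmod_mult. unfold B.
    replace (/ 2 * (1 + / c) * exp (Cmod zeta * K) * ((1 + X) * exp (- (k * X)))) with
      ((/ 2 * ((1 + / c) * (1 + X))) * (exp (Cmod zeta * K) * exp (- (k * X)))) by ring.
    apply Rmult_le_compat; try apply Cmod_ge_0.
    - rewrite Cmod_mult, Cmod_R, Rabs_pos_eq by lra. replace (1 / 2) with (/ 2) by field.
      apply Rmult_le_compat_l; [lra|].
      eapply Rle_trans; [apply Cmod_triangle|]. rewrite Cmod_1, !Cmod_mult, !Cmod_R, sign_abs, Rabs_pos_eq by (auto; lra).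
      pose proof (Cmod_inv_le u c Hc Hu). nra.
    - rewrite Cmod_Cexp, <- exp_plus. apply exp_le.
      assert (E : Re (- (zeta * (u / RtoC X) + RtoC a * (RtoC X * / u)))%C = - (/ X * Re (zeta * u)%C) - a * X * Re (/ u)%C).
      { replace (- (zeta * (u / RtoC X) + RtoC a * (RtoC X * / u)))%C with
          (RtoC (- / X) * (zeta * u) + RtoC (- (a * X)) * / u)%C
          by (rewrite !RtoC_opp, RtoC_mult, RtoC_inv by lra; field; auto).
        change (Re (RtoC (- / X) * (zeta * u))%C + Re (RtoC (- (a * X)) * / u)%C = - (/ X * Re (zeta * u)%C) - a * X * Re (/ u)%C).
        rewrite !re_scal_l. ring. }
      rewrite E. pose proof (Re_inv_ge u c K Hc Hu HuK) as I.
      pose proof (re_le_Cmod (zeta * u)%C) as J. apply Rabs_le_between in J. rewrite Cmod_mult in J.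
      assert (Cmod zeta * Cmod u <= Cmod zeta * K) by (apply Rmult_le_compat_l; [apply Cmod_ge_0 | assumption]).
      pose proof (Cmod_ge_0 zeta). assert (0 <= Cmod zeta * K) by (apply Rmult_le_pos; lra).
      assert (k * X <= a * X * Re (/ u)%C).
      { unfold k. replace (a * (c / K ^ 2) * X) with (a * X * (c / K ^ 2)) by ring.
        apply Rmult_le_compat_l; [|assumption]. apply Rmult_le_pos; lra. }
      assert (- (/ X * Re (zeta * u)%C) <= Cmod zeta * K) by nra. lra. }
  replace (q / RtoC X - p / RtoC X)%C with (RtoC (/ X) * (q - p))%C by (rewrite RtoC_inv by lra; field; assumption).
  rewrite Cmod_mult, Cmod_R, Rabs_pos_eq by lra.
  pose proof (linear_exp_bound k X Hk ltac:(lra)) as LB.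
  pose proof (Cmod_ge_0 (q - p)%C). pose proof (exp_pos (- (k * X))).
  assert (/ X * Cmod (q - p)%C <= Cmod (q - p)%C) by nra.
  replace (B * (1 + 2 / k) * Cmod (q - p) * exp (- (k / 2 * X))) with
    ((B * ((1 + 2 / k) * exp (- (k / 2 * X)))) * Cmod (q - p)) by ring.
  apply Rmult_le_compat; auto.
  - apply Rmult_le_pos; [assumption|]. apply Rmult_le_pos; lra.
  - apply Rmult_le_pos; lra.
  - apply Rmult_le_compat_l; assumption.
Qed.

(** The two ends of the path may be moved: near [0] by [inner_arc], and near infinity
    because [Re (zeta t)] grows linearly along both ends, hence along the segment
    joining them. *)
Lemma contour_change e a z p (Q : R -> C) c m K L : e * e = 1 -> 0 < a -> slit_plane a z ->
  right_half p -> 0 < c -> 0 < m -> 0 <= K -> 0 <= L ->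
  (forall X, 1 <= X -> c <= Re (Q X)) ->
  (forall X, 1 <= X -> m * X - K <= Re ((RtoC a - z) * Q X)%C) ->
  (forall X, 1 <= X -> Cmod (Q X) <= L * (1 + X)) ->
  lim_inf (fun X => seg (ker e a (RtoC a - z)) (p / RtoC X) (Q X))%C (g_fun e a z).
Proof.
  intros He Ha Hz Hp Hc Hm HK HL HQ1 HQ2 HQ3.
  destruct (G_ratio_spec a z Ha Hz) as [Hr [Hzr _]].
  pose proof (g_fun_lim e a z Ha Hz) as G.
  set (r := G_ratio a z) in *. set (zeta := (RtoC a - z)%C) in *.
  destruct (inner_arc e a zeta r p He Ha Hr Hp) as [A1 [k1 [Hk1 I1]]].
  destruct (ker_holo e a zeta) as [f' Hf].
  set (c' := Rmin c (Re r)). set (m' := Rmin m (Re (zeta * r)%C)).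
  assert (Hc' : 0 < c') by (apply Rmin_glb_lt; assumption).
  assert (Hm' : 0 < m') by (apply Rmin_glb_lt; assumption).
  pose proof (Rmin_l c (Re r)) as C1. pose proof (Rmin_r c (Re r)) as C2. fold c' in C1, C2.
  pose proof (Rmin_l m (Re (zeta * r)%C)) as M1. pose proof (Rmin_r m (Re (zeta * r)%C)) as M2. fold m' in M1, M2.
  set (L' := L + Cmod r).
  assert (HL' : 0 <= L') by (unfold L'; pose proof (Cmod_ge_0 r); lra).
  set (B := / 2 * (1 + / c') * exp K * L').
  assert (HB : 0 <= B).
  { unfold B. assert (0 < / c') by (now apply Rinv_0_lt_compat). apply Rmult_le_pos; [|assumption].
    apply Rmult_le_pos; [lra | left; apply exp_pos]. }
  eapply lim_inf_squeeze with (X0 := 1) (1 := G); [|apply (is_lim_two_exp A1 k1 (B * (1 + 2 / m')) (m' / 2)); lra].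
  intros X HX.
  assert (HX0 : RtoC X <> RtoC 0) by (intros E; injection E; lra).
  assert (HR : forall w, 0 < Re w -> right_half (w / RtoC X)%C).
  { intros w Hw. unfold right_half, Cdiv. rewrite <- RtoC_inv, re_scal_r by lra. apply Rmult_lt_0_compat; [assumption|]. apply Rinv_0_lt_compat; lra. }
  assert (HRX : right_half (r * RtoC X)%C) by (unfold right_half; rewrite re_scal_r; apply Rmult_lt_0_compat; lra).
  assert (HQX : right_half (Q X)) by (unfold right_half; specialize (HQ1 X); lra).
  assert (T : (seg (ker e a zeta) (r / RtoC X) (r * RtoC X) - seg (ker e a zeta) (p / RtoC X) (Q X) =
     seg (ker e a zeta) (r / RtoC X) (p / RtoC X) + seg (ker e a zeta) (Q X) (r * RtoC X))%C).
  { rewrite <- (triangle right_half _ f' (r / RtoC X) (p / RtoC X) (r * RtoC X))%C by auto using right_half_convex.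
    rewrite <- (triangle right_half _ f' (p / RtoC X) (Q X) (r * RtoC X))%C by auto using right_half_convex.
    ring. }
  rewrite T. eapply Rle_trans; [apply Cmod_triangle|]. apply Rplus_le_compat; [apply I1; lra|].
  eapply Rle_trans.
  { apply (seg_bound right_half _ f' _ _ (/ 2 * (1 + / c') * (exp K * exp (- (m' * X))))); auto using right_half_convex.
    intros s Hs.
    assert (P1 : c' <= Re (pt (Q X) (r * RtoC X) s)).
    { apply pt_Re_ge; auto; [specialize (HQ1 X); lra|]. rewrite re_scal_r. nra. }
    eapply Rle_trans; [apply (ker_bound _ _ _ _ c'); assumption|].
    apply Rmult_le_compat_l; [assert (0 < / c') by (now apply Rinv_0_lt_compat); lra|].
    rewrite <- exp_plus. apply exp_le.
    assert (m' * X - K <= Re (zeta * pt (Q X) (r * RtoC X) s)%C); [|lra].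
    apply Re_mult_pt; auto.
    - specialize (HQ2 X ltac:(lra)). nra.
    - replace (zeta * (r * RtoC X))%C with ((zeta * r) * RtoC X)%C by ring. rewrite re_scal_r. nra. }
  assert (HD : Cmod (r * RtoC X - Q X)%C <= L' * (1 + X)).
  { unfold Cminus. eapply Rle_trans; [apply Cmod_triangle|]. rewrite Cmod_opp, Cmod_mult, Cmod_R, Rabs_pos_eq by lra.
    specialize (HQ3 X ltac:(lra)). unfold L'. pose proof (Cmod_ge_0 r). nra. }
  pose proof (linear_exp_bound m' X Hm' ltac:(lra)) as LB.
  assert (0 < / c') by (now apply Rinv_0_lt_compat).
  apply Rle_trans with (/ 2 * (1 + / c') * (exp K * exp (- (m' * X))) * (L' * (1 + X))).
  - apply Rmult_le_compat_l; [|assumption]. apply Rmult_le_pos; [lra|]. apply Rmult_le_pos; left; apply exp_pos.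
  - replace (/ 2 * (1 + / c') * (exp K * exp (- (m' * X))) * (L' * (1 + X))) with
      (B * ((1 + X) * exp (- (m' * X)))) by (unfold B; ring).
    rewrite Rmult_assoc. apply Rmult_le_compat_l; assumption.
Qed.

(** * Dependence on the parameter of exponential integrals *)

Lemma Cexp_lip u v m : Re u <= m -> Re v <= m -> Cmod (Cexp u - Cexp v)%C <= Cmod (u - v)%C * exp m.
Proof.
  intros Hu Hv.
  assert (E : (Cexp u - Cexp v = CRInt (fun s => (u - v) * Cexp (pt v u s)) 0 1)%C).
  { rewrite (CRInt_FTC (fun s => Cexp (pt v u s))); [unfold pt; f_equal; f_equal; try ring; f_equal; ring | lra | |].
    - intros s _. apply cderiv_Cexp, cderiv_pt_s.
    - intros s _. apply continuous_Cmult; [cont|]. apply continuous_Cexp, continuous_pt; cont. }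
  rewrite E. replace (Cmod (u - v) * exp m) with ((1 - 0) * (Cmod (u - v) * exp m)) by ring.
  apply CRInt_bound_const; [lra| |].
  - intros s _. apply continuous_Cmult; [cont|]. apply continuous_Cexp, continuous_pt; cont.
  - intros s Hs. rewrite Cmod_mult, Cmod_Cexp. apply Rmult_le_compat_l; [apply Cmod_ge_0|].
    apply exp_le. rewrite pt_Re. nra.
Qed.

Lemma Cexp_quad h : Cmod (Cexp h - RtoC 1 - h)%C <= Cmod h * Cmod h * exp (Cmod h).
Proof.
  assert (E : (Cexp h - RtoC 1 - h = CRInt (fun s => h * (Cexp (RtoC s * h) - RtoC 1)) 0 1)%C).
  { rewrite (CRInt_FTC (fun s => Cexp (RtoC s * h) - RtoC s * h)%C); [| lra | |].
    - rewrite Cmult_1_l, Cmult_0_l, Cexp_0. ring.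
    - intros s _. eapply cderiv_eq.
      + apply cderiv_minus; [apply cderiv_Cexp|]; apply cderiv_mult; [apply cderiv_id | apply cderiv_const | apply cderiv_id | apply cderiv_const].
      + cbv beta. ring.
    - intros; cont. }
  rewrite E. replace (Cmod h * Cmod h * exp (Cmod h)) with ((1 - 0) * (Cmod h * (Cmod h * exp (Cmod h)))) by ring.
  apply CRInt_bound_const; [lra | intros; cont |].
  intros s Hs. rewrite Cmod_mult. apply Rmult_le_compat_l; [apply Cmod_ge_0|].
  rewrite <- Cexp_0. pose proof (Cmod_ge_0 h).
  assert (Hsh : Cmod (RtoC s * h)%C <= Cmod h) by (rewrite Cmod_mult, Cmod_R, Rabs_pos_eq by lra; nra).
  eapply Rle_trans; [apply (Cexp_lip _ _ (Cmod h))|].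
  - pose proof (Re_le_Cmod (RtoC s * h)%C). lra.
  - simpl. assumption.
  - apply Rmult_le_compat_r; [left; apply exp_pos|].
    replace (RtoC s * h - RtoC 0)%C with (RtoC s * h)%C by ring. assumption.
Qed.

(** Differentiation in [z] multiplies the weight [M] by the path [t]. *)
Definition exp_int (t M : R -> C) (X : R) (z : C) : C :=
  CRInt (fun s => Cexp (z * t s) * M s)%C 0 X.

(** A quadratic error estimate uniform in the truncation [X]. The factor [exp (2 eta
    |t|)] in the hypothesis absorbs both [|t|^2] and [exp |h t|]. *)
Lemma exp_int_quad (t M : R -> C) X z eta B k : 0 <= X -> 0 < eta -> 0 < k -> 0 <= B ->
  (forall s, continuous t s) -> (forall s, continuous M s) ->
  (forall s, 0 <= s <= X -> Cmod (Cexp (z * t s) * M s)%C * exp (2 * eta * Cmod (t s)) <= B * exp (- (k * s))) ->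
  forall h, Cmod h <= eta ->
  Cmod (exp_int t M X (z + h) - exp_int t M X z - h * exp_int t (fun s => t s * M s) X z)%C <=
    (4 * B / (eta * eta * k)) * (Cmod h * Cmod h).
Proof.
  intros HX Heta Hk HB Ht HM H h Hh. unfold exp_int.
  rewrite <- CRInt_minus by (auto; intros; cont; auto).
  rewrite <- CRInt_scal by (auto; intros; cont; auto).
  rewrite <- CRInt_minus by (auto; intros; cont; auto).
  rewrite (CRInt_ext _ (fun s => (Cexp (h * t s) - RtoC 1 - h * t s) * (Cexp (z * t s) * M s))%C); auto.
  2: { intros s Hs. replace ((z + h) * t s)%C with (z * t s + h * t s)%C by ring. rewrite Cexp_plus. ring. }
  set (A := 4 / (eta * eta) * B * (Cmod h * Cmod h)).
  assert (HA : 0 <= A).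
  { unfold A. assert (0 <= 4 / (eta * eta)) by (apply Rlt_le, Rdiv_lt_0_compat; nra). pose proof (Cmod_ge_0 h).
    apply Rmult_le_pos; [apply Rmult_le_pos; assumption | nra]. }
  apply Rle_trans with (RInt (fun s => A * exp (- (k * s))) 0 X).
  - apply CRInt_bound; auto.
    + intros; cont; auto.
    + apply ex_RInt_cont; auto. intros; cont.
    + intros s Hs. rewrite Cmod_mult.
      pose proof (Cexp_quad (h * t s)%C) as Q. rewrite Cmod_mult in Q.
      set (m := Cmod (Cexp (z * t s) * M s)%C) in *. set (T := Cmod (t s)) in *. set (y := Cmod h) in *.
      assert (0 <= m) by apply Cmod_ge_0. assert (0 <= T) by apply Cmod_ge_0. assert (0 <= y) by apply Cmod_ge_0.
      specialize (H s Hs). fold m T in H.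
      pose proof (exp_square_bound (eta * T) ltac:(apply Rmult_le_pos; lra)) as ES.
      assert (E2 : exp (y * T) <= exp (eta * T)) by (apply exp_le; nra).
      assert (E3 : eta * eta * (T * T) <= 4 * exp (eta * T)).
      { rewrite exp_Ropp in ES. apply Rmult_le_reg_r with (/ exp (eta * T)); [apply Rinv_0_lt_compat, exp_pos|].
        replace (4 * exp (eta * T) * / exp (eta * T)) with 4 by (field; apply Rgt_not_eq, exp_pos). lra. }
      pose proof (exp_pos (eta * T)).
      assert (E4 : T * T <= 4 / (eta * eta) * exp (eta * T)).
      { apply Rmult_le_reg_l with (eta * eta); [nra|].
        replace (eta * eta * (4 / (eta * eta) * exp (eta * T))) with (4 * exp (eta * T)) by (field; lra). lra. }
      assert (E5 : exp (eta * T) * exp (eta * T) = exp (2 * eta * T)) by (rewrite <- exp_plus; f_equal; ring).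
      apply Rle_trans with ((y * y * (4 / (eta * eta) * exp (eta * T) * exp (eta * T))) * m).
      * apply Rmult_le_compat_r; [assumption|]. eapply Rle_trans; [exact Q|].
        replace (y * T * (y * T) * exp (y * T)) with (y * y * (T * T * exp (y * T))) by ring.
        apply Rmult_le_compat_l; [nra|]. apply Rmult_le_compat; try assumption; [nra | left; apply exp_pos].
      * replace (y * y * (4 / (eta * eta) * exp (eta * T) * exp (eta * T)) * m) with
          (4 / (eta * eta) * (y * y) * (m * (exp (eta * T) * exp (eta * T)))) by ring.
        rewrite E5. unfold A. replace (4 / (eta * eta) * B * (y * y) * exp (- (k * s))) with
          (4 / (eta * eta) * (y * y) * (B * exp (- (k * s)))) by ring.
        apply Rmult_le_compat_l; [|assumption]. apply Rmult_le_pos; [|nra]. apply Rlt_le, Rdiv_lt_0_compat; nra.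
  - replace (RInt (fun s => A * exp (- (k * s))) 0 X) with (- (A / k) * exp (- (k * X)) - - (A / k) * exp (- (k * 0))).
    + rewrite Rmult_0_r, Ropp_0, exp_0. pose proof (exp_pos (- (k * X))).
      replace (4 * B / (eta * eta * k) * (Cmod h * Cmod h)) with (A / k) by (unfold A; field; lra).
      assert (0 <= A / k) by (apply Rmult_le_pos; [assumption | left; now apply Rinv_0_lt_compat]). nra.
    + symmetry. apply (@is_RInt_unique R_CompleteNormedModule).
      apply (is_RInt_derive (fun x => - (A / k) * exp (- (k * x)))); intros.
      * auto_derive; auto. field. lra.
      * cont.
Qed.

Lemma exp_int_deriv_lim (t M : R -> C) z eta B k : 0 < eta -> 0 < k -> 0 <= B ->
  (forall s, continuous t s) -> (forall s, continuous M s) ->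
  (forall s, 0 <= s -> Cmod (Cexp (z * t s) * M s)%C * exp (2 * eta * Cmod (t s)) <= B * exp (- (k * s))) ->
  exists l, lim_inf (fun X => exp_int t (fun s => t s * M s)%C X z) l.
Proof.
  intros Heta Hk HB Ht HM H.
  apply (exp_dominated_lim _ (B / eta) k); auto.
  - intros; cont; auto.
  - intros s Hs. specialize (H s Hs). rewrite !Cmod_mult in *.
    set (m := Cmod (Cexp (z * t s))) in *. set (n := Cmod (M s)) in *. set (T := Cmod (t s)) in *.
    assert (0 <= m) by apply Cmod_ge_0. assert (0 <= T) by apply Cmod_ge_0. assert (0 <= n) by apply Cmod_ge_0.
    pose proof (exp_ineq1_le (2 * eta * T)) as I.
    assert (0 <= m * n) by (now apply Rmult_le_pos).
    assert (0 <= eta * T) by (apply Rmult_le_pos; lra).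
    assert (J : (m * n) * (eta * T) <= B * exp (- (k * s))) by nra.
    apply Rmult_le_reg_l with eta; [assumption|].
    replace (eta * (B / eta * exp (- (k * s)))) with (B * exp (- (k * s))) by (field; lra). nra.
Qed.

Lemma quad_limit (T : R -> C -> C) (T1 : R -> C) f z l eta K :
  (forall h, Cmod h < eta -> lim_inf (fun X => T X (z + h)%C) (f (z + h)%C)) ->
  lim_inf T1 l -> 0 < eta ->
  (forall X h, 0 <= X -> Cmod h < eta -> Cmod (T X (z + h) - T X z - h * T1 X)%C <= K * (Cmod h * Cmod h)) ->
  forall h, Cmod h < eta -> Cmod (f (z + h) - f z - h * l)%C <= K * (Cmod h * Cmod h).
Proof.
  intros HT H1 Heta HQ h Hh.
  apply (lim_inf_bound (fun X => T X (z + h) - T X z - h * T1 X)%C _ _ 0).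
  - intros X HX. apply HQ; [lra | assumption].
  - apply lim_inf_minus; [apply lim_inf_minus; [now apply HT|]|].
    + pose proof (HT (RtoC 0)) as H0. rewrite Cplus_0_r, Cmod_0 in H0. now apply H0.
    + now apply lim_inf_scal.
Qed.

(** Differentiability with a quadratic error. Unlike differentiability it passes to
    limits when the constants are uniform, so improper integrals depending on [z] may
    be differentiated by [quad_limit]. *)
Definition quad_deriv (f : C -> C) (z l : C) : Prop :=
  exists eta K, 0 < eta /\ 0 <= K /\
    forall h, Cmod h < eta -> Cmod (f (z + h) - f z - h * l)%C <= K * (Cmod h * Cmod h).

Lemma quad_deriv_differentiable f z l : quad_deriv f z l -> complex_differentiable f z.
Proof.
  intros [eta [K [Heta [HK H]]]]. exists l. split.
  - apply @is_linear_scal_l.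
  - intros x Hx. apply (@is_filter_lim_locally_unique C_AbsRing (AbsRing_NormedModule C_AbsRing)) in Hx. subst x.
    intros [d Hd]. simpl.
    assert (Hr : 0 < Rmin eta (d / (K + 1))) by (apply Rmin_glb_lt; [assumption | apply Rdiv_lt_0_compat; lra]).
    exists (mkposreal _ Hr). intros y Hy.
    change (Cmod (y - z)%C < Rmin eta (d / (K + 1))) in Hy.
    change (Cmod (f y - f z - (y - z) * l)%C <= d * Cmod (y - z)%C).
    pose proof (Rmin_l eta (d / (K + 1))). pose proof (Rmin_r eta (d / (K + 1))).
    specialize (H (y - z)%C ltac:(lra)). assert (Cpm : forall u v : C, (u + (v - u) = v)%C) by (intros; ring). rewrite Cpm in H.
    eapply Rle_trans; [exact H|].
    rewrite <- Rmult_assoc. apply Rmult_le_compat_r; [apply Cmod_ge_0|].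
    pose proof (Cmod_ge_0 (y - z)%C).
    apply Rle_trans with ((K + 1) * Cmod (y - z)%C); [nra|].
    apply Rle_trans with ((K + 1) * (d / (K + 1))); [apply Rmult_le_compat_l; lra|]. apply Req_le; field; lra.
Qed.

Lemma quad_real_derive (u : R -> R) x l eta K : 0 < eta -> 0 <= K ->
  (forall h, Rabs h < eta -> Rabs (u (x + h) - u x - h * l) <= K * (h * h)) -> is_derive u x l.
Proof.
  intros Heta HK H. apply is_derive_Reals. intros d Hd.
  assert (Hr : 0 < Rmin eta (d / (K + 1))) by (apply Rmin_glb_lt; [assumption | apply Rdiv_lt_0_compat; lra]).
  exists (mkposreal _ Hr). intros h Hh0 Hh; simpl in Hh.
  pose proof (Rmin_l eta (d / (K + 1))). pose proof (Rmin_r eta (d / (K + 1))).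
  specialize (H h ltac:(lra)).
  replace ((u (x + h) - u x) / h - l) with ((u (x + h) - u x - h * l) / h) by (field; assumption).
  rewrite Rabs_div by assumption.
  assert (Hp : 0 < Rabs h) by (now apply Rabs_pos_lt).
  assert (E : h * h = Rabs h * Rabs h) by (rewrite <- Rabs_mult, Rabs_pos_eq; nra).
  apply Rle_lt_trans with (K * Rabs h).
  - apply Rmult_le_reg_r with (Rabs h); [assumption|]. unfold Rdiv. rewrite Rmult_assoc, Rinv_l, Rmult_1_r by lra. nra.
  - assert (d / (K + 1) * (K + 1) = d) by (field; lra). nra.
Qed.

Lemma quad_deriv_real f (c : C) x l : quad_deriv f (RtoC x + c)%C l -> cderiv (fun x => f (RtoC x + c)%C) x l.
Proof.
  intros [eta [K [Heta [HK H]]]].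
  assert (Hh : forall h : R, Rabs h < eta ->
     Cmod (f (RtoC (x + h) + c) - f (RtoC x + c) - RtoC h * l)%C <= K * (h * h)).
  { intros h Hh. rewrite <- (Cmod_R h) in Hh. specialize (H _ Hh). rewrite Cmod_R in H.
    replace (h * h) with (Rabs h * Rabs h) by (rewrite <- Rabs_mult, Rabs_pos_eq; nra).
    replace (RtoC (x + h) + c)%C with (RtoC x + c + RtoC h)%C by (rewrite RtoC_plus; ring). exact H. }
  split; apply (quad_real_derive _ _ _ eta K); auto; intros h Hle; eapply Rle_trans; [| apply Hh, Hle | | apply Hh, Hle].
  - eapply Rle_trans; [|apply re_le_Cmod]. simpl. unfold Re, Im. apply Req_le. f_equal. ring.
  - eapply Rle_trans; [|apply Im_le_Cmod]. simpl. unfold Re, Im. apply Req_le. f_equal. ring.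
Qed.

(** * The analytic continuation of the integral *)

(** The extension by 0 is continuous at [s = 0] because [Re q > 0], so that integrals
    of it may start at [0]. *)
Definition cflat (q : C) (k : nat) (s : R) : C :=
  if Rle_dec s 0 then RtoC 0 else ((/ RtoC s) ^ k * Cexp (- (q * / RtoC s)))%C.

Lemma cflat_pos q k s : 0 < s -> cflat q k s = ((/ RtoC s) ^ k * Cexp (- (q * / RtoC s)))%C.
Proof. intros; unfold cflat; destruct Rle_dec; [lra | reflexivity]. Qed.

Lemma cflat_neg q k s : s <= 0 -> cflat q k s = RtoC 0.
Proof. intros; unfold cflat; destruct Rle_dec; [reflexivity | lra]. Qed.

Lemma cflat_bound q k : 0 < Re q -> exists A, 0 <= A /\ forall s, Cmod (cflat q k s) <= A.
Proof.
  intros Hq. destruct (pow_exp_bound k (Re q) Hq) as [A [HA H]]. exists A. split; [assumption|].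
  intros s. destruct (Rle_dec s 0) as [Hs|Hs]; [rewrite cflat_neg, Cmod_0; assumption|].
  assert (Hs' : 0 < s) by lra. rewrite cflat_pos, Cmod_mult, Cmod_pow, Cmod_Cexp by assumption.
  rewrite <- RtoC_inv by lra. assert (0 < / s) by (now apply Rinv_0_lt_compat).
  rewrite Cmod_R, Rabs_pos_eq by lra. specialize (H (/ s) ltac:(lra)).
  replace (Re (- (q * RtoC (/ s)))%C) with (- (Re q * / s)) by (simpl; unfold Re; ring).
  rewrite exp_Ropp. apply Rmult_le_reg_r with (exp (Re q * / s)); [apply exp_pos|].
  rewrite Rmult_assoc, Rinv_l by (apply Rgt_not_eq, exp_pos). lra.
Qed.

Lemma continuous_cflat q k s : 0 < Re q -> continuous (cflat q k) s.
Proof.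
  intros Hq. destruct (Rtotal_order s 0) as [Hs|[Hs|Hs]].
  - apply continuous_ext_loc with (fun _ : R => RtoC 0); [|apply continuous_const].
    exists (mkposreal (- s) ltac:(lra)). intros y Hy. change (Rabs (y - s) < - s) in Hy.
    apply Rabs_lt_between in Hy. rewrite cflat_neg; auto; lra.
  - subst s. destruct (cflat_bound q (S k) Hq) as [A [HA H]].
    intros P [d HP]. rewrite cflat_neg in HP by lra.
    assert (Hd : 0 < d / (A + 1)) by (apply Rdiv_lt_0_compat; [apply cond_pos | lra]).
    exists (mkposreal _ Hd). intros y Hy. change (Rabs (y - 0) < d / (A + 1)) in Hy. rewrite Rminus_0_r in Hy.
    apply HP. apply C_NormedModule_mixin_compat1.
    change (Cmod (cflat q k y - RtoC 0)%C < d).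
    destruct (Rle_dec y 0) as [Hy0|Hy0].
    { rewrite cflat_neg by assumption. replace (RtoC 0 - RtoC 0)%C with (RtoC 0) by ring. rewrite Cmod_0. apply cond_pos. }
    assert (E : (cflat q k y - RtoC 0 = RtoC y * cflat q (S k) y)%C).
    { rewrite !cflat_pos by lra. simpl. field. intros E; injection E; lra. }
    rewrite E, Cmod_mult, Cmod_R. specialize (H y). pose proof (Cmod_ge_0 (cflat q (S k) y)).
    rewrite Rabs_pos_eq in * by lra.
    apply Rle_lt_trans with (y * (A + 1)); [nra|].
    replace (pos d) with (d / (A + 1) * (A + 1)) by (field; lra). apply Rmult_lt_compat_r; lra.
  - assert (Hs0 : RtoC s <> RtoC 0) by (intros E; injection E; lra).
    apply continuous_ext_loc with (fun s : R => ((/ RtoC s) ^ k * Cexp (- (q * / RtoC s)))%C).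
    + exists (mkposreal s Hs). intros y Hy. change (Rabs (y - s) < s) in Hy.
      apply Rabs_lt_between in Hy. rewrite cflat_pos; auto; lra.
    + cont; assumption.
Qed.

Definition ray_weight (e a : R) (r : C) (s : R) : C :=
  (Cexp (- (RtoC a * (r * RtoC s))) *
    (r * RtoC (1 / 2) * (cflat (RtoC a * / r) 0 s + RtoC e * / r * cflat (RtoC a * / r) 1 s)))%C.

Definition ray (r : C) (s : R) : C := (r * RtoC s)%C.

Lemma continuous_ray r s : continuous (ray r) s.
Proof. unfold ray. cont. Qed.

Lemma Re_a_inv a r : 0 < a -> 0 < Re r -> 0 < Re (RtoC a * / r)%C.
Proof. intros. rewrite re_scal_l. apply Rmult_lt_0_compat; [assumption | now apply Re_inv_pos]. Qed.

Lemma continuous_ray_weight e a r s : 0 < a -> 0 < Re r -> continuous (ray_weight e a r) s.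
Proof.
  intros Ha Hr. pose proof (Re_a_inv a r Ha Hr) as Hq. unfold ray_weight.
  pose proof (continuous_cflat (RtoC a * / r)%C 0 s Hq). pose proof (continuous_cflat (RtoC a * / r)%C 1 s Hq).
  cont; assumption.
Qed.

Lemma ray_weight_ker e a r z s : 0 < Re r -> 0 < s ->
  (Cexp (z * ray r s) * ray_weight e a r s = r * ker e a (RtoC a - z) (r * RtoC s))%C.
Proof.
  intros Hr Hs. unfold ray_weight, ker, ray. rewrite !cflat_pos by assumption. simpl.
  assert (r <> RtoC 0) by (now apply C_neq0_Re).
  assert (RtoC s <> RtoC 0) by (intros E; injection E; lra).
  replace (- ((RtoC a - z) * (r * RtoC s) + RtoC a * / (r * RtoC s)))%C with
    (z * (r * RtoC s) + - (RtoC a * (r * RtoC s)) + - (RtoC a * / r * / RtoC s))%C by (field; auto).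
  rewrite !Cexp_plus. field. auto.
Qed.

Lemma ray_weight_bound e a r : e * e = 1 -> 0 < a -> 0 < Re r -> exists B, 0 <= B /\
  forall z s, 0 <= s -> Cmod (Cexp (z * ray r s) * ray_weight e a r s)%C <= B * exp (- (Re ((RtoC a - z) * r)%C * s)).
Proof.
  intros He Ha Hr. pose proof (Re_a_inv a r Ha Hr) as Hq.
  destruct (cflat_bound _ 0 Hq) as [A0 [HA0 H0]]. destruct (cflat_bound _ 1 Hq) as [A1 [HA1 H1]].
  set (R0 := Cmod (r * RtoC (1 / 2))%C). set (R1 := Cmod (RtoC e * / r)%C).
  assert (0 <= R0) by apply Cmod_ge_0. assert (0 <= R1) by apply Cmod_ge_0.
  exists (R0 * (A0 + R1 * A1)). split.
  - apply Rmult_le_pos; [assumption|]. apply Rplus_le_le_0_compat; [assumption | now apply Rmult_le_pos].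
  - intros z s Hs. unfold ray_weight, ray. rewrite Cmult_assoc, <- Cexp_plus, Cmod_mult, Cmod_Cexp.
    rewrite Rmult_comm. apply Rmult_le_compat; [apply Cmod_ge_0 | left; apply exp_pos | |].
    + rewrite Cmod_mult. fold R0. apply Rmult_le_compat_l; [assumption|].
      eapply Rle_trans; [apply Cmod_triangle|]. apply Rplus_le_compat; [apply H0|].
      rewrite Cmod_mult. fold R1. apply Rmult_le_compat_l; [assumption | apply H1].
    + apply Req_le. f_equal.
      replace (z * (r * RtoC s) + - (RtoC a * (r * RtoC s)))%C with (RtoC (- s) * ((RtoC a - z) * r))%C by (rewrite RtoC_opp; ring).
      rewrite re_scal_l. ring.
Qed.

Lemma is_lim_scal_inv A : is_lim (fun X => A * / X) p_infty 0.
Proof.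
  replace (Finite 0) with (Rbar_mult A 0) by (simpl; f_equal; ring).
  apply is_lim_scal_l. replace (Finite 0) with (Rbar_inv p_infty) by reflexivity.
  apply is_lim_inv; [apply is_lim_id | discriminate].
Qed.

Lemma slit_from_ray a z r : 0 < Re r -> 0 < Re ((RtoC a - z) * r)%C -> slit_plane a z.
Proof.
  intros Hr H [Hz1 Hz2]. destruct z as [x y], r as [u v]; simpl in *. subst y. nra.
Qed.

(** The germ at [0] of the contour contributes nothing in the limit. *)
Lemma lim_inf_remove_germ (W : R -> C) (T : R -> C) (U : R -> R) v : (forall s, continuous W s) ->
  (forall X, 1 < X -> 1 <= U X) ->
  lim_inf (fun X => CRInt W (/ X) (U X) + T X)%C v -> lim_inf (fun X => CRInt W 0 (U X) + T X)%C v.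
Proof.
  intros HW HU H. destruct (continuous_bounded W 0 1 ltac:(lra) ltac:(auto)) as [B [HB HBb]].
  eapply lim_inf_squeeze with (X0 := 1) (1 := H) (r := fun X => B * / X); [|apply is_lim_scal_inv].
  intros X HX. specialize (HU X HX).
  assert (0 < / X <= 1). { split; [apply Rinv_0_lt_compat; lra|]. rewrite <- Rinv_1. apply Rinv_le_contravar; lra. }
  rewrite (CRInt_Chasles W 0 (/ X) (U X)) by (auto; lra).
  replace (_ - _)%C with (- CRInt W 0 (/ X))%C by ring. rewrite Cmod_opp.
  replace (B * / X) with ((/ X - 0) * B) by ring.
  apply CRInt_bound_const; auto; try lra. intros; apply HBb; lra.
Qed.

(** Any ray on which [Re ((a - z) t)] grows may be used. The ray is chosen for one [z]
    and then serves for all nearby [z], which is how holomorphy is proved. *)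
Lemma ray_lim e a z r : e * e = 1 -> 0 < a -> 0 < Re r -> 0 < Re ((RtoC a - z) * r)%C ->
  lim_inf (fun X => exp_int (ray r) (ray_weight e a r) X z) (g_fun e a z).
Proof.
  intros He Ha Hr Hzr. pose proof (slit_from_ray a z r Hr Hzr) as Hz.
  set (W := fun s => (Cexp (z * ray r s) * ray_weight e a r s)%C).
  assert (HW : forall s, continuous W s).
  { intros s. unfold W. cont; [apply continuous_ray | now apply continuous_ray_weight]. }
  assert (L : lim_inf (fun X => CRInt W (/ X) X + RtoC 0)%C (g_fun e a z)).
  { eapply lim_inf_ext with (X0 := 1).
    2: { apply (contour_change e a z r (fun X => r * RtoC X)%C (Re r) (Re ((RtoC a - z) * r)%C) 0 (Cmod r)); auto; try lra.
      - apply Cmod_ge_0.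
      - intros X HX. rewrite re_scal_r. nra.
      - intros X HX. replace ((RtoC a - z) * (r * RtoC X))%C with (((RtoC a - z) * r) * RtoC X)%C by ring. rewrite re_scal_r. lra.
      - intros X HX. rewrite Cmod_mult, Cmod_R, Rabs_pos_eq by lra. pose proof (Cmod_ge_0 r). nra. }
    intros X HX. cbv beta. destruct (ker_holo e a (RtoC a - z)%C) as [f' Hf].
    assert (0 < / X <= 1). { split; [apply Rinv_0_lt_compat; lra|]. rewrite <- Rinv_1. apply Rinv_le_contravar; lra. }
    replace (r / RtoC X)%C with (RtoC 0 + r * RtoC (/ X))%C by (rewrite RtoC_inv by lra; unfold Cdiv; ring).
    replace (r * RtoC X)%C with (RtoC 0 + r * RtoC X)%C by ring.
    assert (HR : forall s : R, 0 < s -> right_half (RtoC 0 + r * RtoC s)%C).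
    { intros s Hs. unfold right_half. rewrite Cplus_0_l, re_scal_r. now apply Rmult_lt_0_compat. }
    rewrite seg_line; [| lra | intros s Hs; apply Hf, HR; lra].
    rewrite Cplus_0_r. apply CRInt_ext; [lra|]. intros s Hs. unfold W.
    rewrite ray_weight_ker by lra. now rewrite Cplus_0_l. }
  apply (lim_inf_remove_germ W (fun _ => RtoC 0) (fun X => X)) in L; [| assumption | intros; lra].
  eapply lim_inf_ext with (X0 := 0) (2 := L). intros X HX. cbv beta. rewrite Cplus_0_r. reflexivity.
Qed.

(** Near [z] the ray through [G_ratio a z] stays admissible, and on it the dependence
    on [z] is through [exp (z t)] alone. *)
Lemma g_fun_quad e a z : e * e = 1 -> 0 < a -> slit_plane a z -> exists l, quad_deriv (g_fun e a) z l.
Proof.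
  intros He Ha Hz. destruct (G_ratio_spec a z Ha Hz) as [Hr [Hzr _]].
  set (r := G_ratio a z) in *. set (d := Re ((RtoC a - z) * r)%C) in *.
  destruct (ray_weight_bound e a r He Ha Hr) as [B [HB HBb]].
  assert (Hr0 : 0 < Cmod r) by (apply Cmod_gt_0, C_neq0_Re; assumption).
  (* [2 * eta * Cmod (ray r s)] then takes half of the decay [d * s] *)
  set (eta := d / (4 * Cmod r)).
  assert (Heta : 0 < eta) by (apply Rdiv_lt_0_compat; lra).
  assert (Hd : forall s, 0 <= s -> Cmod (Cexp (z * ray r s) * ray_weight e a r s)%C * exp (2 * eta * Cmod (ray r s)) <= B * exp (- (d / 2 * s))).
  { intros s Hs. apply Rle_trans with (B * exp (- (d * s)) * exp (2 * eta * Cmod (ray r s))).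
    - apply Rmult_le_compat_r; [left; apply exp_pos | now apply HBb].
    - rewrite Rmult_assoc, <- exp_plus. apply Req_le. f_equal. f_equal.
      unfold ray, eta. rewrite Cmod_mult, Cmod_R, Rabs_pos_eq by assumption. field. lra. }
  destruct (exp_int_deriv_lim (ray r) (ray_weight e a r) z eta B (d / 2)) as [l Hl]; auto; try lra.
  { apply continuous_ray. } { intros; now apply continuous_ray_weight. }
  exists l, eta, (4 * B / (eta * eta * (d / 2))).
  split; [assumption|]. split.
  { apply Rmult_le_pos; [lra|]. left; apply Rinv_0_lt_compat. apply Rmult_lt_0_compat; [apply Rmult_lt_0_compat; assumption | lra]. }
  apply (quad_limit (fun X z => exp_int (ray r) (ray_weight e a r) X z) (fun X => exp_int (ray r) (fun s => ray r s * ray_weight e a r s)%C X z)); auto.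
  - intros h Hh. apply ray_lim; auto.
    replace ((RtoC a - (z + h)) * r)%C with ((RtoC a - z) * r + - (h * r))%C by ring.
    change (0 < d + Re (- (h * r))%C).
    pose proof (re_le_Cmod (- (h * r))%C) as I. apply Rabs_le_between in I. rewrite Cmod_opp, Cmod_mult in I.
    assert (Cmod h * Cmod r < eta * Cmod r) by (now apply Rmult_lt_compat_r).
    replace (eta * Cmod r) with (d / 4) in H by (unfold eta; field; lra). lra.
  - intros X h HX Hh. apply exp_int_quad; auto; try lra.
    + apply continuous_ray. + intros; now apply continuous_ray_weight. + intros; apply Hd; lra.
Qed.

Lemma quad_deriv_scal c f z l : quad_deriv f z l -> quad_deriv (fun z => c * f z)%C z (c * l)%C.
Proof.
  intros [eta [K [Heta [HK H]]]]. exists eta, (Cmod c * K). split; [assumption|].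
  split; [apply Rmult_le_pos; [apply Cmod_ge_0 | assumption]|]. intros h Hh.
  replace (c * f (z + h) - c * f z - h * (c * l))%C with (c * (f (z + h) - f z - h * l))%C by ring.
  rewrite Cmod_mult, Rmult_assoc. apply Rmult_le_compat_l; [apply Cmod_ge_0 | auto].
Qed.

(** The integrand has a continuous extension to [0], which is why the lower limit may
    be taken to be [0] itself. *)
Lemma is_CRInt_gen_at_right (f W : R -> C) v : (forall s, continuous W s) -> (forall s, 0 < s -> f s = W s) ->
  lim_inf (fun X => CRInt W 0 X) v -> is_CRInt_gen f (at_right 0) (Rbar_locally p_infty) v.
Proof.
  intros HW Hf H P [d HP].
  destruct (continuous_bounded W 0 1 ltac:(lra) ltac:(auto)) as [B [HB HBb]].
  assert (Hd : 0 < d / 2) by (pose proof (cond_pos d); lra).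
  destruct (H _ Hd) as [X0 HX0].
  assert (Hr : 0 < Rmin 1 (d / 2 / (B + 1))) by (apply Rmin_glb_lt; [lra | apply Rdiv_lt_0_compat; lra]).
  pose proof (Rmin_l 1 (d / 2 / (B + 1))). pose proof (Rmin_r 1 (d / 2 / (B + 1))).
  exists (fun x => 0 < x < Rmin 1 (d / 2 / (B + 1))) (fun X => Rmax 1 X0 < X).
  - exists (mkposreal _ Hr). intros y Hy Hy0. change (Rabs (y - 0) < Rmin 1 (d / 2 / (B + 1))) in Hy.
    rewrite Rminus_0_r, Rabs_pos_eq in Hy; lra.
  - exists (Rmax 1 X0); auto.
  - intros x X Hx HX. simpl. pose proof (Rmax_l 1 X0). pose proof (Rmax_r 1 X0).
    exists (CRInt W x X). split.
    + eapply is_RInt_ext; [|apply is_CRInt; [lra | auto]].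
      rewrite Rmin_left, Rmax_right by lra. intros t Ht. symmetry; apply Hf; lra.
    + apply HP. apply C_NormedModule_mixin_compat1.
      change (Cmod (CRInt W x X - v)%C < d).
      replace (CRInt W x X - v)%C with ((CRInt W 0 X - v) - CRInt W 0 x)%C.
      2: { rewrite (CRInt_Chasles W 0 x X) by (auto; lra). ring. }
      unfold Cminus at 1. eapply Rle_lt_trans; [apply Cmod_triangle|]. rewrite Cmod_opp.
      specialize (HX0 X ltac:(lra)).
      assert (Cmod (CRInt W 0 x) <= (x - 0) * B) by (apply CRInt_bound_const; auto; [lra | intros; apply HBb; lra]).
      assert (x * (B + 1) <= d / 2).
      { apply Rle_trans with (d / 2 / (B + 1) * (B + 1)); [apply Rmult_le_compat_r; lra|]. apply Req_le; field; lra. }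
      nra.
Qed.

Definition G_sign (e a : R) (z : C) : C := (prefactor a * g_fun e a z)%C.

Definition G_integrand (e a : R) (z : C) (t : R) : C :=
  Cmult (RtoC (1 / 2 * (1 + e * (1 / t)))) (Cexp (Cminus (Cmult z (RtoC t)) (RtoC (a * (t + 1 / t))))).

Lemma G_continues e a : e * e = 1 -> 0 < a -> continues_integral a (G_sign e a) (prefactor a) (G_integrand e a).
Proof.
  intros He Ha. split.
  - intros z Hz. exists (g_fun e a z). split; [|reflexivity].
    assert (H1 : 0 < Re (RtoC 1)) by (simpl; lra).
    assert (Hz1 : 0 < Re ((RtoC a - z) * RtoC 1)%C) by (rewrite re_scal_r; simpl; unfold Re in *; lra).
    apply (is_CRInt_gen_at_right _ (fun s => Cexp (z * ray (RtoC 1) s) * ray_weight e a (RtoC 1) s)%C).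
    + intros s. cont; [apply continuous_ray | now apply continuous_ray_weight].
    + intros s Hs. rewrite ray_weight_ker by assumption. unfold G_integrand, ker.
      assert (Hs0 : RtoC s <> RtoC 0) by (intros E; injection E; lra).
      replace (- ((RtoC a - z) * (RtoC 1 * RtoC s) + RtoC a * / (RtoC 1 * RtoC s)))%C with (z * RtoC s - RtoC (a * (s + 1 / s)))%C.
      2: { rewrite RtoC_mult, RtoC_plus, RtoC_div by lra. field. assumption. }
      rewrite RtoC_mult, RtoC_plus, (RtoC_mult e), (RtoC_div 1 s) by lra. field. assumption.
    + now apply (ray_lim e a z (RtoC 1)).
  - intros z Hz. destruct (g_fun_quad e a z He Ha Hz) as [l Hl].
    apply quad_deriv_differentiable with (prefactor a * l)%C. now apply quad_deriv_scal.
Qed.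

(** * The contour (0, 1) followed by a vertical half-line *)

Definition vpath (sg s : R) : C := (RtoC 1 + Ci * RtoC sg * RtoC s)%C.

(** The integrand on the vertical half-line with [exp (z t)] removed and [t^(-k)]
    inserted. Each factor [1 / t] integrates once in [z]. *)
Definition vweight (e a sg : R) (k : nat) (s : R) : C :=
  (Ci * RtoC sg * (Cexp (- (RtoC a * vpath sg s)) * (RtoC (1 / 2) * (RtoC 1 + RtoC e * / vpath sg s) *
    Cexp (- (RtoC a * / vpath sg s)))) * (/ vpath sg s) ^ k)%C.

(** The same weight on the segment [(0, 1)], where the integrand is flat at [0]. *)
Definition lweight (e a : R) (k : nat) (s : R) : C :=
  (Cexp (- (RtoC a * RtoC s)) * (RtoC (1 / 2) * (cflat (RtoC a) k s + RtoC e * cflat (RtoC a) (S k) s)))%C.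

Lemma Re_vpath sg s : Re (vpath sg s) = 1.
Proof. unfold vpath; simpl. ring. Qed.

Lemma vpath_neq0 sg s : vpath sg s <> RtoC 0.
Proof. apply C_neq0_Re. rewrite Re_vpath. lra. Qed.

Lemma continuous_vpath sg s : continuous (vpath sg) s.
Proof. unfold vpath. cont. Qed.

Lemma continuous_vweight e a sg k s : continuous (vweight e a sg k) s.
Proof.
  pose proof (continuous_vpath sg s) as H. change (continuous (fun s => vpath sg s) s) in H.
  unfold vweight. cont; apply vpath_neq0.
Qed.

Lemma continuous_lweight e a k s : 0 < a -> continuous (lweight e a k) s.
Proof.
  intros Ha. assert (Hq : 0 < Re (RtoC a)) by assumption.
  pose proof (continuous_cflat (RtoC a) k s Hq). pose proof (continuous_cflat (RtoC a) (S k) s Hq).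
  unfold lweight. cont; assumption.
Qed.

Lemma vweight_step e a sg k s : (vpath sg s * vweight e a sg (S k) s = vweight e a sg k s)%C.
Proof. unfold vweight. rewrite Cpow_S. field. apply vpath_neq0. Qed.

Lemma cflat_step q k s : (RtoC s * cflat q (S k) s = cflat q k s)%C.
Proof.
  destruct (Rle_dec s 0) as [Hs|Hs].
  - rewrite !cflat_neg by assumption. ring.
  - rewrite !cflat_pos by lra. rewrite Cpow_S. field. intros E; injection E; lra.
Qed.

Lemma lweight_step e a k s : (RtoC s * lweight e a (S k) s = lweight e a k s)%C.
Proof.
  unfold lweight. rewrite <- (cflat_step (RtoC a) k), <- (cflat_step (RtoC a) (S k)). ring.
Qed.

Lemma vpath_ge sg s : sg * sg = 1 -> 0 <= s -> (1 + s) ^ 2 / 2 <= Cmod (vpath sg s) ^ 2 /\ Cmod (vpath sg s) <= 1 + s.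
Proof.
  intros Hsg Hs.
  assert (E : Cmod (vpath sg s) ^ 2 = 1 + s * s).
  { unfold Cmod. rewrite pow2_sqrt by (apply Rplus_le_le_0_compat; apply pow2_ge_0). unfold vpath; simpl. 
    replace (_ + _) with (1 + sg * sg * (s * s)) by ring. rewrite Hsg. ring. }
  split; [rewrite E; pose proof (pow2_ge_0 (s - 1)); simpl in *; lra|].
  pose proof (Cmod_ge_0 (vpath sg s)). nra.
Qed.

Lemma Cmod_inv_vpath sg s : Cmod (/ vpath sg s)%C <= 1.
Proof. rewrite <- Rinv_1. apply Cmod_inv_le; [lra|]. rewrite Re_vpath. lra. Qed.

Lemma Re_mult_vpath z sg s : Re (z * vpath sg s)%C = Re z - sg * Im z * s.
Proof. unfold vpath; simpl. unfold Re, Im. ring. Qed.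

Lemma vweight_bound e a sg k s : e * e = 1 -> sg * sg = 1 -> 0 < a -> 
  Cmod (vweight e a sg k s) <= Cmod (/ vpath sg s)%C ^ k.
Proof.
  intros He Hsg Ha. unfold vweight. rewrite !Cmod_mult, Cmod_Ci, Cmod_R, sign_abs, Cmod_pow by assumption.
  rewrite <- (Rmult_1_l (_ ^ k)) at 2. apply Rmult_le_compat_r; [apply pow_le, Cmod_ge_0|].
  assert (H1 : Cmod (Cexp (- (RtoC a * vpath sg s))) <= 1).
  { rewrite Cmod_Cexp. rewrite <- exp_0. apply exp_le. change (- Re (RtoC a * vpath sg s)%C <= 0).
    rewrite re_scal_l, Re_vpath. lra. }
  assert (H2 : Cmod (RtoC (1 / 2) * (RtoC 1 + RtoC e * / vpath sg s))%C <= 1).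
  { eapply Rle_trans; [apply (ker_factor_bound e _ 1)|]; auto; try lra. rewrite Re_vpath. lra. }
  rewrite Cmod_mult in H2.
  assert (H3 : Cmod (Cexp (- (RtoC a * / vpath sg s))) <= 1).
  { rewrite Cmod_Cexp. rewrite <- exp_0. apply exp_le. change (- Re (RtoC a * / vpath sg s)%C <= 0).
    rewrite re_scal_l. assert (0 < Re (/ vpath sg s)%C) by (apply Re_inv_pos; rewrite Re_vpath; lra). nra. }
  rewrite !Rmult_1_l.
  apply Rle_trans with (1 * (1 * 1)); [|lra].
  apply Rmult_le_compat; auto using Cmod_ge_0.
  - apply Rmult_le_pos; [apply Rmult_le_pos|]; apply Cmod_ge_0.
  - apply Rmult_le_compat; auto using Cmod_ge_0. apply Rmult_le_pos; apply Cmod_ge_0.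
Qed.

(** The path runs along [(0, 1)] and then vertically, upwards for [sg = 1] and
    downwards for [sg = -1]: the direction in which [exp (z t)] decays when [sg * Im z
    > 0]. *)
Definition g_prim_upto (e a sg : R) (k : nat) (X : R) (z : C) : C :=
  (exp_int (ray (RtoC 1)) (lweight e a k) 1 z + exp_int (vpath sg) (vweight e a sg k) X z)%C.

(** A [k]-fold primitive of [g_fun] in the half-plane [sg * Im z > 0]. *)
Definition g_prim (e a sg : R) (k : nat) (z : C) : C :=
  (exp_int (ray (RtoC 1)) (lweight e a k) 1 z +
    CRInt_gen (fun s => Cexp (z * vpath sg s) * vweight e a sg k s)%C (at_point 0) (Rbar_locally p_infty))%C.

Lemma g_prim_of_lim e a sg k z l : lim_inf (fun X => exp_int (vpath sg) (vweight e a sg k) X z) l ->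
  lim_inf (fun X => g_prim_upto e a sg k X z) (g_prim e a sg k z).
Proof.
  intros H. unfold g_prim.
  rewrite (CRInt_gen_half_line _ l); [| | exact H].
  - unfold g_prim_upto. apply lim_inf_plus; [apply lim_inf_const | exact H].
  - intros s _. cont; [apply continuous_vpath | apply continuous_vweight].
Qed.

Lemma vterm_bound e a sg k z s : e * e = 1 -> sg * sg = 1 -> 0 < a ->
  Cmod (Cexp (z * vpath sg s) * vweight e a sg k s)%C <= exp (Re z) * exp (- (sg * Im z * s)) * Cmod (/ vpath sg s)%C ^ k.
Proof.
  intros He Hsg Ha. rewrite Cmod_mult, Cmod_Cexp, Re_mult_vpath.
  unfold Rminus. rewrite exp_plus. apply Rmult_le_compat_l.
  - apply Rmult_le_pos; left; apply exp_pos.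
  - now apply vweight_bound.
Qed.

Lemma pow_le_1 x k : 0 <= x <= 1 -> x ^ k <= 1.
Proof. intros H. rewrite <- (pow1 k). apply pow_incr. assumption. Qed.

Lemma g_prim_lim e a sg k z : e * e = 1 -> sg * sg = 1 -> 0 < a -> 0 < sg * Im z ->
  lim_inf (fun X => g_prim_upto e a sg k X z) (g_prim e a sg k z).
Proof.
  intros He Hsg Ha Hz.
  destruct (exp_dominated_lim (fun s => Cexp (z * vpath sg s) * vweight e a sg k s)%C (exp (Re z)) (sg * Im z)) as [l Hl]; auto.
  - intros s _. cont; [apply continuous_vpath | apply continuous_vweight].
  - intros s Hs. eapply Rle_trans; [now apply vterm_bound|].
    rewrite <- (Rmult_1_r (exp (Re z) * _)) at 2. apply Rmult_le_compat_l.
    + apply Rmult_le_pos; left; apply exp_pos.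
    + apply pow_le_1. split; [apply Cmod_ge_0 | apply Cmod_inv_vpath].
  - exact (g_prim_of_lim _ _ _ _ _ _ Hl).
Qed.

Lemma inv_vpath_square sg s : sg * sg = 1 -> 0 <= s -> Cmod (/ vpath sg s)%C ^ 2 <= 2 * / (1 + s) ^ 2.
Proof.
  intros Hsg Hs. destruct (vpath_ge sg s Hsg Hs) as [H _].
  rewrite Cmod_inv by apply vpath_neq0. rewrite pow_inv.
  assert (0 < (1 + s) ^ 2) by (apply pow_lt; lra).
  replace (2 * / (1 + s) ^ 2) with (/ ((1 + s) ^ 2 / 2)) by (field; lra).
  apply Rinv_le_contravar; lra.
Qed.

(** The decay [|t|^-3] replaces that of [exp (z t)] on the real line. *)
Lemma g_prim_lim_closed e a sg z : e * e = 1 -> sg * sg = 1 -> 0 < a -> 0 <= sg * Im z ->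
  lim_inf (fun X => g_prim_upto e a sg 3 X z) (g_prim e a sg 3 z).
Proof.
  intros He Hsg Ha Hz.
  destruct (square_dominated_lim (fun s => Cexp (z * vpath sg s) * vweight e a sg 3 s)%C (exp (Re z) * 2)) as [l Hl]; auto.
  - intros s _. cont; [apply continuous_vpath | apply continuous_vweight].
  - intros s Hs. eapply Rle_trans; [now apply vterm_bound|].
    rewrite !Rmult_assoc. apply Rmult_le_compat_l; [left; apply exp_pos|].
    apply Rle_trans with (1 * (2 * / (1 + s) ^ 2)); [|lra].
    apply Rmult_le_compat.
    + left; apply exp_pos. + apply pow_le, Cmod_ge_0.
    + rewrite <- exp_0. apply exp_le. nra.
    + pose proof (inv_vpath_square sg s Hsg Hs). pose proof (Cmod_inv_vpath sg s).
      pose proof (Cmod_ge_0 (/ vpath sg s)%C). simpl in *. nra.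
  - exact (g_prim_of_lim _ _ _ _ _ _ Hl).
Qed.

Lemma vweight_ker e a sg z s : (Cexp (z * vpath sg s) * vweight e a sg 0 s =
  Ci * RtoC sg * ker e a (RtoC a - z) (vpath sg s))%C.
Proof.
  unfold vweight, ker. simpl.
  replace (- ((RtoC a - z) * vpath sg s + RtoC a * / vpath sg s))%C with
    (z * vpath sg s + - (RtoC a * vpath sg s) + - (RtoC a * / vpath sg s))%C by ring.
  rewrite !Cexp_plus. ring.
Qed.

Lemma lweight_ker e a z s : 0 < s -> (Cexp (z * ray (RtoC 1) s) * lweight e a 0 s = ker e a (RtoC a - z) (RtoC s))%C.
Proof.
  intros Hs. unfold lweight, ker, ray. rewrite !cflat_pos by assumption. rewrite Cpow_S. simpl Cpow.
  replace (- ((RtoC a - z) * RtoC s + RtoC a * / RtoC s))%C with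
    (z * (RtoC 1 * RtoC s) + - (RtoC a * RtoC s) + - (RtoC a * / RtoC s))%C by ring.
  rewrite !Cexp_plus. ring.
Qed.

(** The bent path satisfies the hypotheses of [contour_change]. *)
Lemma g_prim_0 e a sg z : e * e = 1 -> sg * sg = 1 -> 0 < a -> 0 < sg * Im z -> g_prim e a sg 0 z = g_fun e a z.
Proof.
  intros He Hsg Ha Hz.
  apply (lim_inf_unique (fun X => g_prim_upto e a sg 0 X z)); [now apply g_prim_lim|].
  set (W := fun s => (Cexp (z * ray (RtoC 1) s) * lweight e a 0 s)%C).
  assert (HW : forall s, continuous W s).
  { intros s. unfold W. cont; [apply continuous_ray | now apply continuous_lweight]. }
  apply (lim_inf_remove_germ W (fun X => exp_int (vpath sg) (vweight e a sg 0) X z) (fun _ => 1)); [assumption | intros; lra |].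
  assert (Hslit : slit_plane a z) by (intros [H _]; rewrite H in Hz; lra).
  eapply lim_inf_ext with (X0 := 1).
  2: { apply (contour_change e a z (RtoC 1) (vpath sg) 1 (sg * Im z) (Rabs (Re z - a)) 1); auto; try lra.
    - unfold right_half; simpl; lra.
    - apply Rabs_pos.
    - intros X HX. rewrite Re_vpath. lra.
    - intros X HX. rewrite Re_mult_vpath. simpl. pose proof (Rle_abs (Re z - a)). unfold Re, Im in *. lra.
    - intros X HX. destruct (vpath_ge sg X Hsg ltac:(lra)). lra. }
  intros X HX. cbv beta. destruct (ker_holo e a (RtoC a - z)%C) as [f' Hf].
  assert (0 < / X <= 1). { split; [apply Rinv_0_lt_compat; lra|]. rewrite <- Rinv_1. apply Rinv_le_contravar; lra. }
  assert (HR : forall s : R, 0 < s -> right_half (RtoC s)) by (intros s Hs; exact Hs).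
  assert (HV : forall s : R, right_half (vpath sg s)) by (intros s; unfold right_half; rewrite Re_vpath; lra).
  replace (RtoC 1 / RtoC X)%C with (RtoC (/ X)) by (rewrite RtoC_inv by lra; unfold Cdiv; ring).
  rewrite <- (triangle right_half _ f' (RtoC (/ X)) (RtoC 1) (vpath sg X)) by (auto using right_half_convex; apply HR; lra).
  f_equal.
  - pose proof (seg_line (ker e a (RtoC a - z)) (RtoC 0) (RtoC 1) (/ X) 1) as S.
    replace (RtoC 0 + RtoC 1 * RtoC (/ X))%C with (RtoC (/ X)) in S by ring.
    replace (RtoC 0 + RtoC 1 * RtoC 1)%C with (RtoC 1) in S by ring.
    rewrite S; [| lra | intros s Hs; apply Hf; unfold right_half; simpl; lra].
    apply CRInt_ext; [lra|]. intros s Hs. unfold W. rewrite lweight_ker by lra.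
    replace (RtoC 0 + RtoC 1 * RtoC s)%C with (RtoC s) by ring. ring.
  - pose proof (seg_line (ker e a (RtoC a - z)) (RtoC 1) (Ci * RtoC sg) 0 X) as S.
    replace (RtoC 1 + Ci * RtoC sg * RtoC 0)%C with (RtoC 1) in S by ring.
    fold (vpath sg X) in S. rewrite S; [| lra | intros s Hs; apply Hf, HV].
    unfold exp_int. apply CRInt_ext; [lra|]. intros s Hs. rewrite vweight_ker. reflexivity.
Qed.

Lemma exp_int_ext t M N X z : 0 <= X -> (forall s, M s = N s) -> exp_int t M X z = exp_int t N X z.
Proof. intros HX H. unfold exp_int. apply CRInt_ext; [assumption|]. intros; now rewrite H. Qed.

Lemma g_prim_quad e a sg k z : e * e = 1 -> sg * sg = 1 -> 0 < a -> 0 < sg * Im z ->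
  quad_deriv (g_prim e a sg (S k)) z (g_prim e a sg k z).
Proof.
  intros He Hsg Ha Hz. set (y := sg * Im z) in *.
  (* half of the decay [y * s] is left after the factor [exp (2 * eta * (1 + s))] *)
  set (eta := y / 4). assert (Heta : 0 < eta) by (unfold eta; lra).
  set (B := exp (Re z) * exp (2 * eta)).
  assert (HB : 0 <= B) by (unfold B; apply Rmult_le_pos; left; apply exp_pos).
  destruct (continuous_bounded (fun s => Cexp (z * ray (RtoC 1) s) * lweight e a (S k) s)%C 0 1) as [B1 [HB1 HB1b]]; [lra | |].
  { intros s _. cont; [apply continuous_ray | now apply continuous_lweight]. }
  set (B2 := B1 * exp (2 * eta) * exp 1).
  assert (HB2 : 0 <= B2) by (unfold B2; repeat apply Rmult_le_pos; try assumption; left; apply exp_pos).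
  exists eta, (4 * B2 / (eta * eta * 1) + 4 * B / (eta * eta * (y / 2))).
  assert (He2 : 0 < eta * eta) by (apply Rmult_lt_0_compat; assumption).
  split; [assumption|]. split.
  { apply Rplus_le_le_0_compat; apply Rmult_le_pos; try lra; left; apply Rinv_0_lt_compat, Rmult_lt_0_compat; lra. }
  apply (quad_limit (g_prim_upto e a sg (S k)) (fun X => g_prim_upto e a sg k X z)).
  - intros h Hh. apply g_prim_lim; auto. simpl.
    assert (Cmod h * Rabs sg < y / 4) by (rewrite sign_abs by assumption; unfold eta in Hh; lra).
    pose proof (Im_le_Cmod h) as I. pose proof (Rabs_pos sg).
    assert (Rabs (sg * Im h) <= Cmod h * Rabs sg).
    { rewrite Rabs_mult, Rmult_comm. apply Rmult_le_compat_r; assumption. }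
    assert (J : Rabs (sg * Im h) < y) by lra. apply Rabs_lt_between in J.
    unfold y, Im in *. rewrite Rmult_plus_distr_l. lra.
  - now apply g_prim_lim.
  - assumption.
  - intros X h HX Hh. unfold g_prim_upto.
    rewrite <- (exp_int_ext (ray (RtoC 1)) (fun s => ray (RtoC 1) s * lweight e a (S k) s)%C (lweight e a k) 1 z); [| lra |].
    2: { intros s. unfold ray. rewrite <- (lweight_step e a k s). ring. }
    rewrite <- (exp_int_ext (vpath sg) (fun s => vpath sg s * vweight e a sg (S k) s)%C (vweight e a sg k) X z); [| lra |].
    2: { intros s. apply vweight_step. }
    match goal with |- Cmod (?A + ?B - (?C + ?D) - h * (?E + ?F))%C <= _ =>
      replace (A + B - (C + D) - h * (E + F))%C with ((A - C - h * E) + (B - D - h * F))%C by ring end.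
    eapply Rle_trans; [apply Cmod_triangle|]. rewrite Rmult_plus_distr_r. apply Rplus_le_compat.
    + apply exp_int_quad; auto; try lra.
      * apply continuous_ray. * intros; now apply continuous_lweight.
      * intros s Hs. unfold B2. replace (B1 * exp (2 * eta) * exp 1 * exp (- (1 * s))) with (B1 * (exp (2 * eta) * (exp 1 * exp (- (1 * s))))) by ring.
        apply Rmult_le_compat; [apply Cmod_ge_0 | left; apply exp_pos | now apply HB1b |].
        rewrite <- !exp_plus. apply exp_le. unfold ray. rewrite Cmod_mult, !Cmod_R, Rabs_R1, Rabs_pos_eq by lra. nra.
    + apply exp_int_quad; auto; try lra.
      * apply continuous_vpath. * intros; apply continuous_vweight.
      * intros s Hs. destruct (vpath_ge sg s Hsg ltac:(lra)) as [_ HT].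
        apply Rle_trans with ((exp (Re z) * exp (- (y * s)) * 1) * exp (2 * eta * (1 + s))).
        { apply Rmult_le_compat; [apply Cmod_ge_0 | left; apply exp_pos | |].
          - eapply Rle_trans; [now apply vterm_bound|]. apply Rmult_le_compat_l.
            + apply Rmult_le_pos; left; apply exp_pos.
            + apply pow_le_1. split; [apply Cmod_ge_0 | apply Cmod_inv_vpath].
          - apply exp_le. apply Rmult_le_compat_l; lra. }
        unfold B. rewrite Rmult_1_r, !Rmult_assoc. apply Rmult_le_compat_l; [left; apply exp_pos|].
        rewrite <- !exp_plus. apply exp_le. unfold eta. lra.
Qed.

(** One factor [1 / t] pays for [|exp (z t) - exp (w t)| <= |z - w| |t| exp M], the
    other two for convergence. This is why three primitives are taken. *)
Lemma g_prim_lipschitz e a sg M : e * e = 1 -> sg * sg = 1 -> 0 < a -> exists L, 0 <= L /\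
  forall z w, 0 <= sg * Im z -> 0 <= sg * Im w -> Re z <= M -> Re w <= M ->
  Cmod (g_prim e a sg 3 z - g_prim e a sg 3 w)%C <= L * Cmod (z - w)%C.
Proof.
  intros He Hsg Ha.
  destruct (continuous_bounded (lweight e a 3) 0 1) as [B [HB HBb]]; [lra | intros; now apply continuous_lweight |].
  exists (exp (Rabs M) * B + exp M * 2).
  split. { apply Rplus_le_le_0_compat; apply Rmult_le_pos; try lra; left; apply exp_pos. }
  intros z w Hz Hw HzM HwM. set (d := Cmod (z - w)%C).
  assert (Hd : 0 <= d) by apply Cmod_ge_0.
  apply (lim_inf_bound (fun X => g_prim_upto e a sg 3 X z - g_prim_upto e a sg 3 X w)%C _ _ 0).
  2: { apply lim_inf_minus; now apply g_prim_lim_closed. }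
  intros X HX. unfold g_prim_upto.
  match goal with |- Cmod (?A + ?B - (?C + ?D))%C <= _ => replace (A + B - (C + D))%C with ((A - C) + (B - D))%C by ring end.
  eapply Rle_trans; [apply Cmod_triangle|]. rewrite Rmult_plus_distr_r. unfold exp_int.
  assert (HcL : forall u s, continuous (fun s => Cexp (u * ray (RtoC 1) s) * lweight e a 3 s)%C s).
  { intros u s. cont; [apply continuous_ray | now apply continuous_lweight]. }
  assert (HcV : forall u s, continuous (fun s => Cexp (u * vpath sg s) * vweight e a sg 3 s)%C s).
  { intros u s. cont; [apply continuous_vpath | apply continuous_vweight]. }
  apply Rplus_le_compat.
  - rewrite <- CRInt_minus by (auto; lra).
    replace (exp (Rabs M) * B * d) with ((1 - 0) * (d * exp (Rabs M) * B)) by ring.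
    apply CRInt_bound_const; [lra | intros; apply continuous_Cminus; apply HcL |].
    intros s Hs.
    replace (Cexp (z * ray 1 s) * lweight e a 3 s - Cexp (w * ray 1 s) * lweight e a 3 s)%C with
      ((Cexp (z * ray 1 s) - Cexp (w * ray 1 s)) * lweight e a 3 s)%C by ring.
    rewrite Cmod_mult. apply Rmult_le_compat; try apply Cmod_ge_0; [|now apply HBb].
    pose proof (Rle_abs M). pose proof (Rabs_pos M).
    assert (HRe : forall u, Re u <= M -> Re (u * ray (RtoC 1) s)%C <= Rabs M).
    { intros u Hu. unfold ray. rewrite Cmult_1_l, re_scal_r. nra. }
    eapply Rle_trans; [apply (Cexp_lip _ _ (Rabs M)); auto|]. apply Rmult_le_compat_r; [left; apply exp_pos|].
    replace (z * ray 1 s - w * ray 1 s)%C with ((z - w) * ray 1 s)%C by ring. unfold ray.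
    rewrite Cmult_1_l, Cmod_mult, Cmod_R, Rabs_pos_eq by lra. fold d. nra.
  - rewrite <- CRInt_minus by (auto; lra).
    apply Rle_trans with (exp M * 2 * d); [|lra].
    apply CRInt_bound_square; [| lra | intros; apply continuous_Cminus; apply HcV |].
    { apply Rmult_le_pos; [|assumption]. apply Rmult_le_pos; [left; apply exp_pos | lra]. }
    intros s Hs.
    replace (Cexp (z * vpath sg s) * vweight e a sg 3 s - Cexp (w * vpath sg s) * vweight e a sg 3 s)%C with
      ((Cexp (z * vpath sg s) - Cexp (w * vpath sg s)) * vweight e a sg 3 s)%C by ring.
    rewrite Cmod_mult.
    assert (HRe : forall u, 0 <= sg * Im u -> Re u <= M -> Re (u * vpath sg s)%C <= M).
    { intros u Hu1 Hu2. rewrite Re_mult_vpath. nra. }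
    apply Rle_trans with ((d * Cmod (vpath sg s) * exp M) * Cmod (/ vpath sg s)%C ^ 3).
    + apply Rmult_le_compat; try apply Cmod_ge_0; [|now apply vweight_bound].
      eapply Rle_trans; [apply (Cexp_lip _ _ M); auto|]. apply Rmult_le_compat_r; [left; apply exp_pos|].
      replace (z * vpath sg s - w * vpath sg s)%C with ((z - w) * vpath sg s)%C by ring.
      rewrite Cmod_mult. apply Rle_refl.
    + replace (d * Cmod (vpath sg s) * exp M * Cmod (/ vpath sg s) ^ 3) with
        ((d * exp M) * ((Cmod (vpath sg s) * Cmod (/ vpath sg s)%C) * Cmod (/ vpath sg s)%C ^ 2)) by ring.
      rewrite <- Cmod_mult. replace (vpath sg s * / vpath sg s)%C with (RtoC 1) by (field; apply vpath_neq0).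
      rewrite Cmod_1, Rmult_1_l.
      replace (exp M * 2 * d * / (1 + s) ^ 2) with ((d * exp M) * (2 * / (1 + s) ^ 2)) by ring.
      apply Rmult_le_compat_l; [apply Rmult_le_pos; [assumption | left; apply exp_pos]|]. now apply inv_vpath_square.
Qed.

(** * Boundary values *)

Lemma CDerive_n_0 psi x : CDerive_n psi 0 x = psi x.
Proof. unfold CDerive_n; simpl. symmetry. apply surjective_pairing. Qed.

Lemma cderiv_CDerive_n psi n x : smooth psi -> cderiv (CDerive_n psi n) x (CDerive_n psi (S n) x).
Proof. intros H. destruct (smooth_towers psi H) as [A B]. split; [apply A | apply B]. Qed.

Lemma smooth_lin c psi chi : smooth psi -> smooth chi -> smooth (fun x => c * psi x + chi x)%C /\
  forall n x, CDerive_n (fun x => c * psi x + chi x)%C n x = (c * CDerive_n psi n x + CDerive_n chi n x)%C.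
Proof.
  intros Hp Hc. set (f := fun x => (c * psi x + chi x)%C).
  set (F := fun n x => (c * CDerive_n psi n x + CDerive_n chi n x)%C).
  assert (HF : forall n x, cderiv (F n) x (F (S n) x)).
  { intros n x. unfold F. apply cderiv_plus; [apply cderiv_scal|]; now apply cderiv_CDerive_n. }
  assert (TR : tower (fun n x => Re (F n x))) by (intros n x; exact (proj1 (HF n x))).
  assert (TI : tower (fun n x => Im (F n x))) by (intros n x; exact (proj2 (HF n x))).
  assert (E : f = F 0%nat).
  { apply functional_extensionality; intros x. unfold f, F. now rewrite !CDerive_n_0. }
  split.
  - intros n x. rewrite E. split; [now apply (tower_ex_derive_n (fun n x => Re (F n x))) | now apply (tower_ex_derive_n (fun n x => Im (F n x)))].
  - intros n x. rewrite E. fold (F n x). unfold CDerive_n.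
    rewrite (tower_Derive_n (fun n x => Re (F n x))), (tower_Derive_n (fun n x => Im (F n x))) by assumption.
    symmetry. apply surjective_pairing.
Qed.

(** The third distributional derivative of the boundary value of the third primitive,
    which is a continuous function on the line. *)
Definition boundary_dist (e a sg : R) : functional := fun psi =>
  (- prefactor a * CRInt_gen (fun x => g_prim e a sg 3 (RtoC x) * CDerive_n psi 3 x)
     (Rbar_locally m_infty) (Rbar_locally p_infty))%C.

Lemma Im_real_shift x sg d : Im (RtoC x + Ci * RtoC (sg * d))%C = sg * d.
Proof. simpl. ring. Qed.

Lemma Re_real_shift x sg d : Re (RtoC x + Ci * RtoC (sg * d))%C = x.
Proof. simpl. ring. Qed.

Lemma continuous_g_prim3 e a sg x : e * e = 1 -> sg * sg = 1 -> 0 < a ->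
  continuous (fun x : R => g_prim e a sg 3 (RtoC x)) x.
Proof.
  intros He Hsg Ha. destruct (g_prim_lipschitz e a sg (x + 1) He Hsg Ha) as [L [HL H]].
  intros P [d HP]. assert (Hd : 0 < d) by apply cond_pos.
  assert (Hr : 0 < Rmin 1 (d / (L + 1))) by (apply Rmin_glb_lt; [lra | apply Rdiv_lt_0_compat; lra]).
  pose proof (Rmin_l 1 (d / (L + 1))). pose proof (Rmin_r 1 (d / (L + 1))).
  exists (mkposreal _ Hr). intros y Hy. change (Rabs (y - x) < Rmin 1 (d / (L + 1))) in Hy.
  apply HP. apply C_NormedModule_mixin_compat1.
  change (Cmod (g_prim e a sg 3 (RtoC y) - g_prim e a sg 3 (RtoC x))%C < d).
  assert (Hy' : Rabs (y - x) < 1) by lra. apply Rabs_lt_between in Hy'.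
  eapply Rle_lt_trans; [apply H; simpl; lra|].
  rewrite <- RtoC_minus, Cmod_R. pose proof (Rabs_pos (y - x)).
  apply Rle_lt_trans with ((L + 1) * Rabs (y - x)); [nra|].
  replace (pos d) with ((L + 1) * (d / (L + 1))) by (field; lra). apply Rmult_lt_compat_l; lra.
Qed.

Lemma boundary_dist_value e a sg psi M0 M : e * e = 1 -> sg * sg = 1 -> 0 < a -> smooth psi ->
  supported_in_ball M0 psi -> M0 < M -> 0 < M ->
  boundary_dist e a sg psi = (- prefactor a * CRInt (fun x => g_prim e a sg 3 (RtoC x) * CDerive_n psi 3 x) (- M) M)%C.
Proof.
  intros He Hsg Ha Hs Hsup HM HM0. unfold boundary_dist. f_equal.
  apply CRInt_gen_line; [assumption | |].
  - intros x _. apply continuous_Cmult; [now apply continuous_g_prim3 | now apply continuous_CDerive_n].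
  - intros x Hx. rewrite (CDerive_n_out psi M0) by (auto; lra). apply Cmult_0_r.
Qed.

Lemma boundary_dist_distribution e a sg : e * e = 1 -> sg * sg = 1 -> 0 < a -> distribution (boundary_dist e a sg).
Proof.
  intros He Hsg Ha. split.
  - intros c psi chi [Hp [M1 H1]] [Hq [M2 H2]].
    destruct (smooth_lin c psi chi Hp Hq) as [Hs HD].
    set (M := Rmax M1 M2). set (M' := Rmax 0 M + 1).
    pose proof (Rmax_l M1 M2). pose proof (Rmax_r M1 M2). pose proof (Rmax_l 0 M). pose proof (Rmax_r 0 M).
    fold M in H, H0.
    rewrite (boundary_dist_value e a sg _ M M'); auto; try (unfold M'; lra).
    2: { intros x Hx. rewrite H1, H2 by lra. ring. }
    rewrite (boundary_dist_value e a sg psi M1 M'), (boundary_dist_value e a sg chi M2 M'); auto; try (unfold M'; lra).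
    assert (HI : forall f, smooth f -> forall x, continuous (fun x => g_prim e a sg 3 (RtoC x) * CDerive_n f 3 x)%C x).
    { intros f Hf x. apply continuous_Cmult; [now apply continuous_g_prim3 | now apply continuous_CDerive_n]. }
    assert (HM' : - M' <= M') by (unfold M'; lra).
    rewrite (CRInt_ext _ (fun x => c * (g_prim e a sg 3 (RtoC x) * CDerive_n psi 3 x) + g_prim e a sg 3 (RtoC x) * CDerive_n chi 3 x)%C _ _ HM').
    2: { intros x Hx. rewrite HD. ring. }
    rewrite CRInt_plus; [| exact HM' | intros x _; apply continuous_Cmult; [apply continuous_const | now apply HI] | intros x _; now apply HI].
    rewrite CRInt_scal; [| exact HM' | intros x _; now apply HI]. ring.
  - intros M. set (M' := Rmax 0 M + 1). pose proof (Rmax_l 0 M). pose proof (Rmax_r 0 M).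
    destruct (continuous_bounded (fun x => g_prim e a sg 3 (RtoC x)) (- M') M') as [B0 [HB0 HB0b]]; [unfold M'; lra | intros; now apply continuous_g_prim3 |].
    exists 3%nat, (Cmod (prefactor a) * (2 * M' * B0)). intros psi Hs Hsup B HB.
    rewrite (boundary_dist_value e a sg psi M M'); auto; try (unfold M'; lra).
    rewrite Cmod_mult, Cmod_opp, Rmult_assoc. apply Rmult_le_compat_l; [apply Cmod_ge_0|].
    replace (2 * M' * B0 * B) with ((M' - - M') * (B0 * B)) by ring.
    apply CRInt_bound_const.
    + unfold M'; lra.
    + intros x _. apply continuous_Cmult; [now apply continuous_g_prim3 | now apply continuous_CDerive_n].
    + intros x Hx. rewrite Cmod_mult. apply Rmult_le_compat; [apply Cmod_ge_0 | apply Cmod_ge_0 | now apply HB0b | apply HB; lia].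
Qed.

(** Horizontal integrations by parts inside the half-plane, where [g_prim (S k)] has
    the derivative [g_prim k]. *)
Lemma g_prim_by_parts e a sg psi M0 M d : e * e = 1 -> sg * sg = 1 -> 0 < a -> 0 < d -> smooth psi ->
  supported_in_ball M0 psi -> M0 < M -> 0 < M ->
  CRInt (fun x => g_fun e a (RtoC x + Ci * RtoC (sg * d)) * psi x)%C (- M) M =
  (- CRInt (fun x => g_prim e a sg 3 (RtoC x + Ci * RtoC (sg * d)) * CDerive_n psi 3 x) (- M) M)%C.
Proof.
  intros He Hsg Ha Hd Hs Hsup HM HM0. set (c := (Ci * RtoC (sg * d))%C).
  assert (Him : forall x : R, 0 < sg * Im (RtoC x + c)%C).
  { intros x. unfold c. rewrite Im_real_shift, <- Rmult_assoc, Hsg. lra. }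
  assert (HF : forall k x, cderiv (fun x => g_prim e a sg (S k) (RtoC x + c)%C) x (g_prim e a sg k (RtoC x + c)%C)).
  { intros k x. apply quad_deriv_real. now apply g_prim_quad. }
  assert (Hg : forall x : R, continuous (fun x : R => g_fun e a (RtoC x + c)%C) x).
  { intros x. destruct (g_fun_quad e a (RtoC x + c)%C He Ha) as [l Hl].
    - intros [E _]. specialize (Him x). rewrite E in Him. lra.
    - eapply cderiv_continuous, quad_deriv_real, Hl. }
  assert (HcF : forall k x, continuous (fun x : R => g_prim e a sg (S k) (RtoC x + c)%C) x).
  { intros k x. eapply cderiv_continuous, HF. }
  assert (Hcpsi : forall n x, continuous (CDerive_n psi n) x) by (intros; now apply continuous_CDerive_n).
  assert (Hz : forall n, CDerive_n psi n (- M) = RtoC 0 /\ CDerive_n psi n M = RtoC 0).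
  { intros n. split; apply (CDerive_n_out psi M0); auto; [rewrite Rabs_Ropp|]; rewrite Rabs_pos_eq; lra. }
  assert (S : CRInt (fun x => g_prim e a sg 3 (RtoC x + c) * CDerive_n psi 3 x + g_fun e a (RtoC x + c) * psi x)%C (- M) M = RtoC 0).
  { rewrite (CRInt_FTC (fun x => g_prim e a sg 3 (RtoC x + c) * CDerive_n psi 2 x - g_prim e a sg 2 (RtoC x + c) * CDerive_n psi 1 x
        + g_prim e a sg 1 (RtoC x + c) * CDerive_n psi 0 x)%C).
    - destruct (Hz 0%nat) as [-> ->], (Hz 1%nat) as [-> ->], (Hz 2%nat) as [-> ->]. ring.
    - lra.
    - intros x _. eapply cderiv_eq.
      { pose proof (fun n => cderiv_CDerive_n psi n x Hs) as D.
        exact (cderiv_plus _ _ _ _ _ (cderiv_minus _ _ _ _ _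
          (cderiv_mult _ _ _ _ _ (HF 2%nat x) (D 2%nat)) (cderiv_mult _ _ _ _ _ (HF 1%nat x) (D 1%nat)))
          (cderiv_mult _ _ _ _ _ (HF 0%nat x) (D 0%nat))). }
      cbv beta. rewrite <- (g_prim_0 e a sg (RtoC x + c)%C) by auto. rewrite CDerive_n_0. ring.
    - intros x _. apply continuous_Cplus; apply continuous_Cmult; [apply HcF | apply Hcpsi | apply Hg | now apply smooth_continuous]. }
  rewrite CRInt_plus in S; try lra.
  - match goal with |- ?A = (- ?B)%C => replace A with (B + A - B)%C by ring end.
    rewrite S. ring.
  - intros x _. apply continuous_Cmult; [apply HcF | apply Hcpsi].
  - intros x _. apply continuous_Cmult; [apply Hg | now apply smooth_continuous].
Qed.

(** After the integrations by parts the integrand depends on the height [d] only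
    through [g_prim 3], which changes by [O(d)]. *)
Lemma G_boundary e a sg : e * e = 1 -> sg * sg = 1 -> 0 < a ->
  is_boundary_value (G_sign e a) sg (boundary_dist e a sg).
Proof.
  intros He Hsg Ha. split; [now apply boundary_dist_distribution|].
  intros psi Ht. pose proof Ht as [Hs [M0 Hsup]].
  set (M := Rmax 0 M0 + 1). pose proof (Rmax_l 0 M0). pose proof (Rmax_r 0 M0).
  destruct (g_prim_lipschitz e a sg M He Hsg Ha) as [L [HL HLb]].
  destruct (test_CDerive_bounded psi 3 Ht) as [B [HB HBb]].
  assert (Hg : forall d x, 0 < d -> continuous (fun x : R => g_fun e a (RtoC x + Ci * RtoC (sg * d))%C) x).
  { intros d x Hd. destruct (g_fun_quad e a (RtoC x + Ci * RtoC (sg * d))%C He Ha) as [l Hl].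
    - intros [E _]. rewrite Im_real_shift in E. nra.
    - eapply cderiv_continuous, quad_deriv_real, Hl. }
  assert (Hc3 : forall d x, 0 < d -> continuous (fun x : R => g_prim e a sg 3 (RtoC x + Ci * RtoC (sg * d))%C) x).
  { intros d x Hd. eapply cderiv_continuous, quad_deriv_real, g_prim_quad; auto.
    rewrite Im_real_shift, <- Rmult_assoc, Hsg. lra. }
  assert (V : forall d, 0 < d -> CRInt_gen (fun x => G_sign e a (RtoC x + Ci * RtoC (sg * d)) * psi x)%C (Rbar_locally m_infty) (Rbar_locally p_infty)
     = (- prefactor a * CRInt (fun x => g_prim e a sg 3 (RtoC x + Ci * RtoC (sg * d)) * CDerive_n psi 3 x) (- M) M)%C).
  { intros d Hd. rewrite (CRInt_gen_line _ M).
    - rewrite (CRInt_ext _ (fun x => prefactor a * (g_fun e a (RtoC x + Ci * RtoC (sg * d)) * psi x))%C); [| unfold M; lra | intros; unfold G_sign; ring].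
      rewrite CRInt_scal; [| unfold M; lra | intros; apply continuous_Cmult; [now apply Hg | now apply smooth_continuous]].
      rewrite (g_prim_by_parts e a sg psi M0 M d); auto; try (unfold M; lra). ring.
    - unfold M; lra.
    - intros x _. unfold G_sign. apply continuous_Cmult; [apply continuous_Cmult; [cont | now apply Hg] | now apply smooth_continuous].
    - intros x Hx. rewrite Hsup by (unfold M in Hx; lra). apply Cmult_0_r. }
  set (K := Cmod (prefactor a) * (2 * M * (L * B))).
  assert (HK : 0 <= K). { unfold K. repeat apply Rmult_le_pos; auto; try apply Cmod_ge_0; unfold M; lra. }
  assert (Bd : forall d, 0 < d -> Cmod (CRInt_gen (fun x => G_sign e a (RtoC x + Ci * RtoC (sg * d)) * psi x)%C (Rbar_locally m_infty) (Rbar_locally p_infty) - boundary_dist e a sg psi)%C <= K * d).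
  { intros d Hd. rewrite V by assumption. rewrite (boundary_dist_value e a sg psi M0 M); auto; try (unfold M; lra).
    match goal with |- Cmod (?p * ?A - ?p * ?D)%C <= _ => replace (p * A - p * D)%C with (p * (A - D))%C by ring end.
    rewrite <- CRInt_minus; [| unfold M; lra | intros; apply continuous_Cmult; [now apply Hc3 | now apply continuous_CDerive_n] | intros; apply continuous_Cmult; [now apply continuous_g_prim3 | now apply continuous_CDerive_n]].
    rewrite Cmod_mult, Cmod_opp. unfold K. rewrite Rmult_assoc. apply Rmult_le_compat_l; [apply Cmod_ge_0|].
    replace (2 * M * (L * B) * d) with ((M - - M) * ((L * d) * B)) by ring.
    apply CRInt_bound_const.
    - unfold M; lra.
    - intros. apply continuous_Cminus; apply continuous_Cmult; [now apply Hc3 | now apply continuous_CDerive_n | now apply continuous_g_prim3 | now apply continuous_CDerive_n].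
    - intros x Hx. match goal with |- Cmod (?A * ?P - ?D * ?P)%C <= _ => replace (A * P - D * P)%C with ((A - D) * P)%C by ring end.
      rewrite Cmod_mult. apply Rmult_le_compat; try apply Cmod_ge_0; auto.
      eapply Rle_trans; [apply HLb|].
      + rewrite Im_real_shift, <- Rmult_assoc, Hsg. lra.
      + simpl. lra.
      + rewrite Re_real_shift. lra.
      + simpl. lra.
      + replace (RtoC x + Ci * RtoC (sg * d) - RtoC x)%C with (Ci * RtoC (sg * d))%C by ring.
        rewrite Cmod_mult, Cmod_Ci, Cmod_R, Rabs_mult, sign_abs, Rabs_pos_eq by (auto; lra). lra. }
  intros P [d HP]. assert (Hd : 0 < d) by apply cond_pos.
  assert (Hr : 0 < d / (K + 1)) by (apply Rdiv_lt_0_compat; lra).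
  exists (mkposreal _ Hr). intros y Hy Hy0. change (Rabs (y - 0) < d / (K + 1)) in Hy.
  rewrite Rminus_0_r, Rabs_pos_eq in Hy by lra.
  apply HP. apply C_NormedModule_mixin_compat1.
  eapply Rle_lt_trans; [apply (Bd y); lra|].
  apply Rle_lt_trans with ((K + 1) * y); [nra|].
  replace (pos d) with ((K + 1) * (d / (K + 1))) by (field; lra). apply Rmult_lt_compat_l; lra.
Qed.

(** * Inverse Laplace transforms of powers *)

Definition epow (y : R) (n : nat) (t : C) : C := (Cexp (RtoC y * t) * (/ t) ^ n)%C.

Lemma holo_inv_pow n : holo right_half (fun t => (/ t) ^ n)%C (fun t => - RtoC (INR n) * (/ t) ^ S n)%C.
Proof.
  induction n as [|n IH].
  - simpl. replace (fun t => - RtoC 0 * (/ t * RtoC 1))%C with (fun _ : C => RtoC 0); [apply holo_const|].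
    apply functional_extensionality; intros; ring.
  - pose proof (holo_mult right_half _ _ _ _ (holo_inv _ _ _ (holo_id _) right_half_neq0) IH) as H. cbv beta in H.
    rewrite S_INR.
    replace (fun t => - RtoC (INR n + 1) * (/ t) ^ S (S n))%C with
      (fun t : C => - RtoC 1 * (/ t * / t) * (/ t) ^ n + / t * (- RtoC (INR n) * (/ t) ^ S n))%C; [exact H|].
    apply functional_extensionality; intros t. rewrite RtoC_plus, !Cpow_S. ring.
Qed.

Lemma holo_cexp_lin y : holo right_half (fun t => Cexp (RtoC y * t)) (fun t => RtoC y * Cexp (RtoC y * t))%C.
Proof.
  pose proof (holo_exp right_half _ _ (holo_mult right_half _ _ _ _ (holo_const _ (RtoC y)) (holo_id _))) as H.
  replace (fun t => RtoC y * Cexp (RtoC y * t))%C with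
    (fun t : C => (RtoC 0 * t + RtoC y * RtoC 1) * Cexp (RtoC y * t))%C; [exact H|].
  apply functional_extensionality; intros; ring.
Qed.

Lemma epow_holo_eq y n : holo right_half (epow y n)
  (fun t => RtoC y * epow y n t + - RtoC (INR n) * epow y (S n) t)%C.
Proof.
  pose proof (holo_mult _ _ _ _ _ (holo_cexp_lin y) (holo_inv_pow n)) as H. cbv beta in H.
  unfold epow.
  replace (fun t => RtoC y * (Cexp (RtoC y * t) * (/ t) ^ n) + - RtoC (INR n) * (Cexp (RtoC y * t) * (/ t) ^ S n))%C with
    (fun t => RtoC y * Cexp (RtoC y * t) * (/ t) ^ n + Cexp (RtoC y * t) * (- RtoC (INR n) * (/ t) ^ S n))%C; [exact H|].
  apply functional_extensionality; intros; ring.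
Qed.

Lemma epow_holo y n : exists f', holo right_half (epow y n) f'.
Proof. eexists. apply epow_holo_eq. Qed.

Lemma seg_FTC D f f' p q : convex D -> holo D f f' -> D p -> D q -> seg f' p q = (f q - f p)%C.
Proof.
  intros HD Hf Hp Hq. unfold seg.
  rewrite (CRInt_FTC (fun s => f (pt p q s))).
  - f_equal; [|f_equal]; f_equal; unfold pt; ring.
  - lra.
  - intros s Hs. apply (holo_path _ _ _ Hf) with (g := fun s => pt p q s); [now apply HD | apply cderiv_pt_s].
  - intros s Hs. apply continuous_Cmult; [|cont]. apply continuous_on_seg, (holo_cont' _ _ _ Hf). now apply HD.
Qed.

Lemma seg_lin D f f' g g' c d p q : convex D -> holo D f f' -> holo D g g' -> D p -> D q ->
  seg (fun t => c * f t + d * g t)%C p q = (c * seg f p q + d * seg g p q)%C.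
Proof.
  intros HD Hf Hg Hp Hq. unfold seg.
  assert (F1 : forall x, 0 <= x <= 1 -> continuous (fun s => f (pt p q s) * (q - p))%C x).
  { intros x Hx. apply continuous_Cmult; [|cont]. apply continuous_on_seg, Hf. now apply HD. }
  assert (F2 : forall x, 0 <= x <= 1 -> continuous (fun s => g (pt p q s) * (q - p))%C x).
  { intros x Hx. apply continuous_Cmult; [|cont]. apply continuous_on_seg, Hg. now apply HD. }
  rewrite <- !CRInt_scal by (auto; lra).
  rewrite <- CRInt_plus; [| lra | intros; apply continuous_Cmult; [cont | auto] ..].
  apply CRInt_ext; [lra|]. intros; ring.
Qed.

Definition vseg (f : C -> C) (X : R) : C := seg f (vpath (-1) X) (vpath 1 X).

Lemma right_half_vpath sg s : right_half (vpath sg s).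
Proof. unfold right_half. rewrite Re_vpath. lra. Qed.

Lemma seg_vpath f f' sg X : holo right_half f f' -> 0 <= X ->
  seg f (RtoC 1) (vpath sg X) = CRInt (fun s => Ci * RtoC sg * f (vpath sg s))%C 0 X.
Proof.
  intros Hf HX. pose proof (seg_line f (RtoC 1) (Ci * RtoC sg) 0 X) as S.
  replace (RtoC 1 + Ci * RtoC sg * RtoC 0)%C with (RtoC 1) in S by ring.
  fold (vpath sg X) in S. rewrite S; [reflexivity | assumption | intros s Hs; apply Hf, right_half_vpath].
Qed.

Lemma vseg_split f f' X : holo right_half f f' -> 0 <= X ->
  vseg f X = (CRInt (fun s => Ci * RtoC 1 * f (vpath 1 s)) 0 X - CRInt (fun s => Ci * RtoC (-1) * f (vpath (-1) s)) 0 X)%C.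
Proof.
  intros Hf HX. rewrite <- !(seg_vpath f f') by assumption. unfold vseg.
  assert (H1 : right_half (RtoC 1)) by (unfold right_half; simpl; lra).
  rewrite <- (triangle right_half f f' (RtoC 1) (vpath (-1) X) (vpath 1 X)); auto using right_half_convex, right_half_vpath.
  ring.
Qed.

Lemma sgn1 : 1 * 1 = 1. Proof. ring. Qed.
Lemma sgnm1 : -1 * -1 = 1. Proof. ring. Qed.

(** Decay [|t|^-2] on the line [Re t = 1] makes integrals over the whole line
    converge, with bounds that depend on the size [A] only. *)
Section Square.
Variables (f f' : C -> C) (A : R).
Hypothesis Hf : holo right_half f f'.
Hypothesis HA : 0 <= A.
Hypothesis Hb : forall sg s, sg * sg = 1 -> 0 <= s -> Cmod (f (vpath sg s)) <= A * Cmod (/ vpath sg s)%C ^ 2.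

Lemma half_bound sg s : sg * sg = 1 -> 0 <= s -> Cmod (Ci * RtoC sg * f (vpath sg s))%C <= (2 * A) * / (1 + s) ^ 2.
Proof.
  intros Hsg Hs. rewrite !Cmod_mult, Cmod_Ci, Cmod_R, sign_abs, !Rmult_1_l by assumption.
  eapply Rle_trans; [now apply Hb|]. pose proof (inv_vpath_square sg s Hsg Hs).
  apply Rle_trans with (A * (2 * / (1 + s) ^ 2)); [now apply Rmult_le_compat_l | lra].
Qed.

Lemma half_cont sg s : continuous (fun s => Ci * RtoC sg * f (vpath sg s))%C s.
Proof.
  apply continuous_Cmult; [cont|]. apply (continuous_comp (vpath sg) f); [apply continuous_vpath|].
  apply Hf, right_half_vpath.
Qed.

Lemma vseg_bound X : 0 <= X -> Cmod (vseg f X) <= 4 * A.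
Proof.
  intros HX. rewrite (vseg_split f f') by assumption.
  unfold Cminus. eapply Rle_trans; [apply Cmod_triangle|]. rewrite Cmod_opp.
  assert (H : forall sg, sg * sg = 1 -> Cmod (CRInt (fun s => Ci * RtoC sg * f (vpath sg s))%C 0 X) <= 2 * A).
  { intros sg Hsg. apply CRInt_bound_square; [lra | assumption | intros; apply half_cont | intros; now apply half_bound]. }
  pose proof (H 1 sgn1). pose proof (H (-1) sgnm1). lra.
Qed.

Lemma vseg_converges : exists v, lim_inf (vseg f) v.
Proof.
  assert (H : forall sg, sg * sg = 1 -> exists v, lim_inf (fun X => CRInt (fun s => Ci * RtoC sg * f (vpath sg s))%C 0 X) v).
  { intros sg Hsg. apply (square_dominated_lim _ (2 * A)); intros; [apply half_cont | now apply half_bound]. }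
  destruct (H 1 sgn1) as [v Hv]. destruct (H (-1) sgnm1) as [w Hw].
  exists (v - w)%C. eapply lim_inf_ext with (X0 := 0) (2 := lim_inf_minus _ _ _ _ Hv Hw).
  intros X HX. symmetry. apply (vseg_split f f'); auto; lra.
Qed.

Lemma vseg_tail v X : 0 <= X -> lim_inf (vseg f) v -> Cmod (v - vseg f X)%C <= 4 * A * / (1 + X).
Proof.
  intros HX Hv. apply (lim_inf_bound (fun Y => vseg f Y - vseg f X)%C _ _ X).
  2: { apply lim_inf_minus; [assumption | apply lim_inf_const]. }
  intros Y HY. rewrite !(vseg_split f f') by (auto; lra).
  assert (H : forall sg, sg * sg = 1 -> Cmod (CRInt (fun s => Ci * RtoC sg * f (vpath sg s))%C X Y) <= 2 * A * / (1 + X)).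
  { intros sg Hsg.
    eapply Rle_trans; [apply (CRInt_bound _ (fun x => (2 * A) * / (1 + x) ^ 2)); [lra | intros; apply half_cont | | intros; apply half_bound; auto; lra]|].
    - apply ex_RInt_cont; [lra|]. intros x Hx. simpl. cont. nra.
    - replace (RInt _ X Y) with (- (2 * A) * / (1 + Y) - - (2 * A) * / (1 + X)).
      + assert (0 < / (1 + Y)) by (apply Rinv_0_lt_compat; lra). nra.
      + symmetry. apply (@is_RInt_unique R_CompleteNormedModule).
        apply (is_RInt_derive (fun x => - (2 * A) * / (1 + x))); rewrite Rmin_left, Rmax_right by lra; intros.
        * auto_derive; [lra|]. field. lra.
        * simpl. cont. nra. }
  assert (S : forall sg, CRInt (fun s => Ci * RtoC sg * f (vpath sg s))%C 0 Y =
    (CRInt (fun s => Ci * RtoC sg * f (vpath sg s)) 0 X + CRInt (fun s => Ci * RtoC sg * f (vpath sg s)) X Y)%C).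
  { intros sg. apply CRInt_Chasles; try lra. intros; apply half_cont. }
  rewrite (S 1), (S (-1)).
  match goal with |- Cmod (?P + ?Q - (?P' + ?Q') - (?P - ?P'))%C <= _ => replace (P + Q - (P' + Q') - (P - P'))%C with (Q + - Q')%C by ring end.
  eapply Rle_trans; [apply Cmod_triangle|]. rewrite Cmod_opp. pose proof (H 1 sgn1). pose proof (H (-1) sgnm1). lra.
Qed.
End Square.

Lemma Cmod_epow y n t : Cmod (epow y n t) = exp (y * Re t) * Cmod (/ t)%C ^ n.
Proof. unfold epow. rewrite Cmod_mult, Cmod_pow, Cmod_Cexp, re_scal_l. reflexivity. Qed.

Lemma epow2_bound y sg s : sg * sg = 1 -> 0 <= s -> Cmod (epow y 2 (vpath sg s)) <= exp y * Cmod (/ vpath sg s)%C ^ 2.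
Proof. intros _ _. rewrite Cmod_epow, Re_vpath, Rmult_1_r. apply Rle_refl. Qed.

Lemma epow2_limit y : exists v, lim_inf (vseg (epow y 2)) v /\ Cmod v <= 4 * exp y /\
  forall X, 0 <= X -> Cmod (v - vseg (epow y 2) X)%C <= 4 * exp y * / (1 + X).
Proof.
  destruct (epow_holo y 2) as [f' Hf].
  assert (HA : 0 <= exp y) by (left; apply exp_pos).
  destruct (vseg_converges _ f' _ Hf HA (epow2_bound y)) as [v Hv].
  exists v. split; [assumption|]. split.
  - apply (lim_inf_bound (vseg (epow y 2)) _ _ 0); [|assumption].
    intros X HX. apply (vseg_bound _ f' _ Hf HA (epow2_bound y)); lra.
  - intros X HX. now apply (vseg_tail _ f' _ Hf HA (epow2_bound y)).
Qed.

Lemma Cmod_inv_Im t c : 0 < c -> c <= Rabs (Im t) -> Cmod (/ t)%C <= / c.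
Proof.
  intros Hc H. rewrite Cmod_inv.
  - apply Rinv_le_contravar; [assumption|]. pose proof (Im_le_Cmod t); lra.
  - intros E. rewrite E in H. simpl in H. rewrite Rabs_R0 in H. lra.
Qed.

(** Moving the line of integration from [Re t = 1] to [Re t = c] and rescaling
    by [c] shows that the limit is homogeneous of degree 1 in [y]. *)
Lemma epow2_homogeneous c y v w : 0 < c -> lim_inf (vseg (epow y 2)) v -> lim_inf (vseg (epow (c * y) 2)) w ->
  w = (RtoC c * v)%C.
Proof.
  intros Hc Hv Hw. destruct (epow_holo y 2) as [f' Hf].
  assert (Hv' : lim_inf (fun X => vseg (epow y 2) (c * X)) v).
  { intros d Hd. destruct (Hv d Hd) as [X0 H]. exists (/ c * X0). intros X HX. apply H.
    apply Rmult_lt_reg_l with (/ c); [now apply Rinv_0_lt_compat|]. rewrite <- Rmult_assoc, Rinv_l by lra. lra. }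
  assert (Hcv : lim_inf (fun X => RtoC c * vseg (epow y 2) (c * X))%C (RtoC c * v)%C) by (now apply lim_inf_scal).
  apply (lim_inf_unique (vseg (epow (c * y) 2))); [assumption|].
  set (B := exp (Rabs y * (1 + c)) * (/ c) ^ 2 * (1 + c)).
  assert (HB : 0 <= B).
  { unfold B. assert (0 < / c) by (now apply Rinv_0_lt_compat).
    apply Rmult_le_pos; [|lra]. apply Rmult_le_pos; [left; apply exp_pos | apply pow_le; lra]. }
  eapply lim_inf_squeeze with (X0 := 1) (1 := Hcv) (r := fun X => (c * (B + B)) * / X); [|apply is_lim_scal_inv].
  intros X HX.
  set (P := fun sg => (RtoC c * vpath sg X)%C).
  assert (HP : forall sg, right_half (P sg)).
  { intros sg. unfold right_half, P. rewrite re_scal_l, Re_vpath. lra. }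
  assert (Hc0 : RtoC c <> RtoC 0) by (intros E; injection E; lra).
  assert (S : (RtoC c * seg (epow y 2) (P (-1)) (P 1))%C = vseg (epow (c * y) 2) X).
  { unfold vseg, seg. rewrite <- CRInt_scal; [|lra|].
    - apply CRInt_ext; [lra|]. intros s Hs. unfold P.
      replace (pt (RtoC c * vpath (-1) X) (RtoC c * vpath 1 X) s) with (RtoC c * pt (vpath (-1) X) (vpath 1 X) s)%C by (unfold pt; ring).
      set (t := pt (vpath (-1) X) (vpath 1 X) s).
      assert (Ht : t <> RtoC 0).
      { apply right_half_neq0, right_half_convex; auto using right_half_vpath; lra. }
      unfold epow. rewrite RtoC_mult. simpl.
      replace (RtoC y * (RtoC c * t))%C with (RtoC c * RtoC y * t)%C by ring. field. auto.
    - intros s Hs. apply continuous_Cmult; [|cont]. apply continuous_on_seg, Hf. apply right_half_convex; auto. }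
  assert (T : (seg (epow y 2) (vpath (-1) (c * X)) (vpath 1 (c * X)) - seg (epow y 2) (P (-1)) (P 1) =
     seg (epow y 2) (vpath (-1) (c * X)) (P (-1)) + seg (epow y 2) (P 1) (vpath 1 (c * X)))%C).
  { rewrite <- (triangle right_half _ f' (vpath (-1) (c * X)) (P (-1)) (vpath 1 (c * X))) by auto using right_half_convex, right_half_vpath.
    rewrite <- (triangle right_half _ f' (P (-1)) (P 1) (vpath 1 (c * X))) by auto using right_half_convex, right_half_vpath.
    ring. }
  assert (Bd : forall sg p q, sg * sg = 1 -> (p = P sg /\ q = vpath sg (c * X) \/ p = vpath sg (c * X) /\ q = P sg) ->
     Cmod (seg (epow y 2) p q) <= B * / X).
  { intros sg p q Hsg Hpq.
    assert (Hre : Re (P sg) = c) by (unfold P; rewrite re_scal_l, Re_vpath; ring).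
    assert (Him : Im (P sg) = sg * (c * X)) by (unfold P, vpath; simpl; ring).
    assert (Him2 : Im (vpath sg (c * X)) = sg * (c * X)) by (unfold vpath; simpl; ring).
    assert (Hp : right_half p) by (destruct Hpq as [[-> _] | [-> _]]; auto using right_half_vpath).
    assert (Hq : right_half q) by (destruct Hpq as [[_ ->] | [_ ->]]; auto using right_half_vpath).
    assert (HcX : 0 < c * X) by (apply Rmult_lt_0_compat; lra).
    eapply Rle_trans.
    { apply (seg_bound right_half _ f' _ _ (exp (Rabs y * (1 + c)) * (/ (c * X)) ^ 2)); auto using right_half_convex.
      intros s Hs.
      assert (HI : Im (pt p q s) = sg * (c * X)).
      { unfold pt. simpl. destruct Hpq as [[-> ->] | [-> ->]]; change snd with Im; rewrite Him, Him2; ring. }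
      assert (HR : 0 <= Re (pt p q s) <= 1 + c).
      { rewrite pt_Re. destruct Hpq as [[-> ->] | [-> ->]]; rewrite Hre, Re_vpath; nra. }
      rewrite Cmod_epow. apply Rmult_le_compat; [left; apply exp_pos | apply pow_le, Cmod_ge_0 | |].
      - apply exp_le. pose proof (Rle_abs y). pose proof (Rabs_pos y). nra.
      - apply pow_incr. split; [apply Cmod_ge_0|]. apply Cmod_inv_Im; [assumption|].
        rewrite HI, Rabs_mult, sign_abs, Rabs_pos_eq by (auto; lra). lra. }
    assert (HD : Cmod (q - p)%C <= 1 + c).
    { assert (E : exists r : R, (q - p)%C = RtoC r /\ Rabs r <= 1 + c).
      { exists (Re q - Re p). split.
        - apply C_eq; [reflexivity|]. simpl. change (snd q) with (Im q). change (snd p) with (Im p).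
          destruct Hpq as [[-> ->] | [-> ->]]; rewrite Him, Him2; ring.
        - destruct Hpq as [[-> ->] | [-> ->]]; rewrite Hre, Re_vpath; apply Rabs_le; lra. }
      destruct E as [r [-> Hr]]. rewrite Cmod_R. assumption. }
    assert (0 < / c) by (now apply Rinv_0_lt_compat).
    assert (HiX : 0 < / X <= 1). { split; [apply Rinv_0_lt_compat; lra|]. rewrite <- Rinv_1. apply Rinv_le_contravar; lra. }
    unfold B. rewrite Rinv_mult, Rpow_mult_distr.
    pose proof (exp_pos (Rabs y * (1 + c))). pose proof (pow_lt (/ c) 2 H).
    set (u := exp (Rabs y * (1 + c))) in *. set (q2 := (/ c) ^ 2) in *.
    assert (0 <= u * q2) by (apply Rmult_le_pos; lra).
    assert ((/ X) ^ 2 <= / X) by (simpl; nra).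
    assert (0 <= (/ X) ^ 2) by (apply pow_le; lra).
    apply Rle_trans with (u * q2 * / X * (1 + c)); [|apply Req_le; ring].
    apply Rmult_le_compat; [| apply Cmod_ge_0 | | assumption].
    - apply Rmult_le_pos; [lra|]. apply Rmult_le_pos; lra.
    - rewrite <- Rmult_assoc. apply Rmult_le_compat_l; assumption. }
  rewrite <- S. unfold vseg.
  replace (RtoC c * seg (epow y 2) (vpath (-1) (c * X)) (vpath 1 (c * X)) - RtoC c * seg (epow y 2) (P (-1)) (P 1))%C with
    (RtoC c * (seg (epow y 2) (vpath (-1) (c * X)) (vpath 1 (c * X)) - seg (epow y 2) (P (-1)) (P 1)))%C by ring.
  rewrite T, Cmod_mult, Cmod_R, Rabs_pos_eq, Rmult_assoc by lra. apply Rmult_le_compat_l; [lra|].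
  eapply Rle_trans; [apply Cmod_triangle|]. rewrite Rmult_plus_distr_r. apply Rplus_le_compat.
  - apply (Bd (-1)); [apply sgnm1 | right; auto].
  - apply (Bd 1); [apply sgn1 | left; auto].
Qed.

Lemma atan_le x : 0 <= x -> atan x <= x.
Proof.
  intros Hx. pose proof (is_derive_ge0_le (fun x => x - atan x) (fun x => 1 - / (1 + x²)) 0 x Hx) as H.
  cbv beta in H. rewrite atan_0 in H.
  enough (0 - 0 <= x - atan x) by lra. apply H.
  - intros t Ht. apply (@is_derive_minus R_AbsRing R_NormedModule); [apply (@is_derive_id R_AbsRing) | apply is_derive_atan].
  - intros t Ht. assert (/ (1 + t²) <= / 1) by (apply Rinv_le_contravar; [lra | unfold Rsqr; nra]). lra.
Qed.

Lemma vpath_pt X s : pt (vpath (-1) X) (vpath 1 X) s = vpath 1 (X * (2 * s - 1)).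
Proof. unfold pt, vpath. apply C_eq; simpl; ring. Qed.

Lemma vpath1_val s : vpath 1 s = (1, s).
Proof. unfold vpath. apply C_eq; simpl; ring. Qed.

Lemma inv_vpath2 s : Cmod (/ vpath 1 s)%C ^ 2 = / (1 + s * s).
Proof.
  rewrite Cmod_inv by apply vpath_neq0. rewrite pow_inv. f_equal.
  rewrite vpath1_val. unfold Cmod. rewrite pow2_sqrt; simpl; nra.
Qed.

(** Integrating [exp (- 2 y)] times the truncated integral over [0 <= y <= Y] with the
    [y]-integral inside leaves, up to [O(exp (- Y))], the elementary
    integral of [(1 - i s) / (1 + s^2)^2]. *)
Lemma laplace_of_vseg X Y : 0 < X -> 0 <= Y ->
  Cmod (CRInt (fun y => RtoC (exp (- (2 * y))) * vseg (epow y 2) X) 0 Y -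
     Ci * RtoC (X / (1 + X * X) + atan X))%C <= PI * exp (- Y).
Proof.
  intros HX HY.
  set (tau := fun s : R => X * (2 * s - 1)).
  set (t := fun s : R => vpath 1 (tau s)).
  set (q := (RtoC 2 * Ci * RtoC X)%C).
  assert (Hq : (vpath 1 X - vpath (-1) X = q)%C) by (unfold vpath, q; apply C_eq; simpl; ring).
  assert (Ht2 : forall s, (t s - RtoC 2)%C <> RtoC 0).
  { intros s E. apply (f_equal Re) in E. unfold t in E. rewrite vpath1_val in E. simpl in E. lra. }
  assert (Ht0 : forall s, t s <> RtoC 0) by (intros; apply vpath_neq0).
  assert (Hct : forall s, continuous t s).
  { intros s. unfold t, tau, vpath. cont. }
  assert (S : CRInt (fun y => RtoC (exp (- (2 * y))) * vseg (epow y 2) X)%C 0 Y =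
     CRInt (fun s => (q * (/ t s) ^ 2) * ((Cexp (RtoC Y * (t s - RtoC 2)) - RtoC 1) / (t s - RtoC 2)))%C 0 1).
  { rewrite (CRInt_ext _ (fun y => CRInt (fun s => (q * (/ t s) ^ 2) * Cexp (RtoC y * (t s - RtoC 2))) 0 1)%C); [| assumption |].
    2: { intros y Hy. unfold vseg, seg. rewrite <- CRInt_scal; [|lra|].
         - apply CRInt_ext; [lra|]. intros s Hs. rewrite vpath_pt, Hq. fold (tau s). fold (t s).
           unfold epow. replace (RtoC y * (t s - RtoC 2))%C with (RtoC (- (2 * y)) + RtoC y * t s)%C.
           + rewrite Cexp_plus. replace (Cexp (RtoC (- (2 * y)))) with (RtoC (exp (- (2 * y)))); [ring|].
             unfold Cexp. simpl. rewrite cos_0, sin_0. apply C_eq; simpl; ring.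
           + rewrite RtoC_opp, RtoC_mult. ring.
         - intros s Hs. destruct (epow_holo y 2) as [f' Hf]. apply continuous_Cmult; [|cont].
           apply continuous_on_seg, Hf. apply right_half_convex; auto using right_half_vpath. }
    rewrite (CRInt_swap (fun z => (q * (/ t (snd z)) ^ 2) * Cexp (RtoC (fst z) * (t (snd z) - RtoC 2)))%C); [| assumption | lra |].
    2: { intros y s _ _. assert (continuous (fun z : R * R => t (snd z)) (y, s)) by (apply (continuous_comp (fun z : R * R => snd z) t); [cont | apply Hct]).
         cont. simpl. apply Ht0. }
    apply CRInt_ext; [lra|]. intros s Hs. simpl fst; simpl snd.
    rewrite (CRInt_FTC (fun y => (q * (/ t s) ^ 2) * (Cexp (RtoC y * (t s - RtoC 2)) / (t s - RtoC 2)))%C); [| assumption | |].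
    - rewrite Cmult_0_l, Cexp_0. unfold Cdiv. ring.
    - intros y Hy. eapply cderiv_eq.
      + apply cderiv_scal. unfold Cdiv. apply cderiv_mult; [apply cderiv_Cexp, cderiv_mult; [apply cderiv_id | apply cderiv_const] | apply cderiv_const].
      + cbv beta. field. auto.
    - intros y Hy. cont. }
  rewrite S.
  assert (HcA : forall s, continuous (fun s => (q * (/ t s) ^ 2) * (RtoC (-1) / (t s - RtoC 2)))%C s).
  { intros s. pose proof (Hct s) as Hts. change (continuous (fun s => t s) s) in Hts. cont; auto. }
  assert (HcB : forall s, continuous (fun s => (q * (/ t s) ^ 2) * (Cexp (RtoC Y * (t s - RtoC 2)) / (t s - RtoC 2)))%C s).
  { intros s. pose proof (Hct s) as Hts. change (continuous (fun s => t s) s) in Hts. cont; auto. }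
  rewrite (CRInt_ext _ (fun s => (q * (/ t s) ^ 2) * (RtoC (-1) / (t s - RtoC 2)) +
     (q * (/ t s) ^ 2) * (Cexp (RtoC Y * (t s - RtoC 2)) / (t s - RtoC 2)))%C); [| lra |].
  2: { intros s Hs. replace (RtoC (-1)) with (- RtoC 1)%C by (apply C_eq; simpl; ring). field. auto. }
  rewrite CRInt_plus by (auto; lra).
  assert (EA : CRInt (fun s => (q * (/ t s) ^ 2) * (RtoC (-1) / (t s - RtoC 2)))%C 0 1 = (Ci * RtoC (X / (1 + X * X) + atan X))%C).
  { set (Phi := fun u => / 2 * (u / (1 + u * u) + atan u)). set (Psi := fun u => / 2 * / (1 + u * u)).
    rewrite (CRInt_FTC (fun s => Ci * (RtoC (Phi (tau s)) + Ci * RtoC (Psi (tau s))))%C); [| lra | |].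
    - unfold Phi, Psi, tau. replace (X * (2 * 0 - 1)) with (- X) by ring. replace (X * (2 * 1 - 1)) with X by ring.
      rewrite atan_opp. apply C_eq; simpl; field; nra.
    - intros s Hs.
      assert (Hp : 1 + tau s * tau s <> 0) by nra.
      assert (Dt : is_derive tau s (2 * X)) by (unfold tau; auto_derive; auto; ring).
      assert (D1 : is_derive (fun s => Phi (tau s)) s (2 * X * / (1 + tau s * tau s) ^ 2)).
      { evar_last. { apply (is_derive_comp Phi tau); [|exact Dt]. unfold Phi.
          apply is_derive_scal, (@is_derive_plus R_AbsRing R_NormedModule); [|apply is_derive_atan].
          instantiate (1 := (1 - tau s * tau s) / (1 + tau s * tau s) ^ 2). auto_derive; [assumption|]. field. assumption. }
        unfold scal, plus; simpl; unfold mult, Rsqr; simpl. field. assumption. }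
      assert (D2 : is_derive (fun s => Psi (tau s)) s (- (2 * X * tau s * / (1 + tau s * tau s) ^ 2))).
      { evar_last. { apply (is_derive_comp Psi tau); [|exact Dt]. unfold Psi.
          instantiate (1 := - (tau s * / (1 + tau s * tau s) ^ 2)). auto_derive; [assumption|]. field. assumption. }
        unfold scal; simpl; unfold mult; simpl. field. assumption. }
      eapply cderiv_eq.
      + apply cderiv_scal, cderiv_plus; [apply cderiv_RtoC, D1 | apply cderiv_scal, cderiv_RtoC, D2].
      + specialize (Ht0 s). specialize (Ht2 s).
        assert (Hu : RtoC (1 + tau s * tau s) = (t s * (RtoC 2 - t s))%C) by (unfold t; rewrite vpath1_val; apply C_eq; simpl; ring).
        assert (Hu2 : RtoC (tau s) = (- Ci * (t s - RtoC 1))%C) by (unfold t; rewrite vpath1_val; apply C_eq; simpl; ring).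
        assert (Ht3 : (RtoC 2 - t s)%C <> RtoC 0).
        { intros E. apply Ht2. replace (t s - RtoC 2)%C with (- (RtoC 2 - t s))%C by ring. rewrite E; ring. }
        assert (Ci2 : (Ci * Ci = - RtoC 1)%C) by (apply C_eq; simpl; ring).
        rewrite RtoC_opp, !RtoC_mult, RtoC_inv, RtoC_pow, Hu, Hu2 by (apply pow_nonzero; assumption).
        transitivity (RtoC 2 * RtoC X * (Ci * (RtoC 1 + (Ci * Ci) * (t s - RtoC 1))) * / ((t s * (RtoC 2 - t s)) ^ 2))%C; [ring|].
        rewrite Ci2. unfold q. simpl. replace (RtoC (-1)) with (- RtoC 1)%C by (apply C_eq; simpl; ring). field. auto.
    - intros; apply HcA. }
  rewrite EA.
  (* [Re t = 1 < 2], so the upper end [y = Y] contributes only [exp (- Y)] *)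
  match goal with |- Cmod (?P + ?Q - ?P)%C <= _ => replace (P + Q - P)%C with Q by ring end.
  apply Rle_trans with (RInt (fun s => exp (- Y) * (2 * X * / (1 + tau s * tau s))) 0 1).
  - apply CRInt_bound; [lra | intros; apply HcB | |].
    + apply ex_RInt_cont; [lra|]. intros s Hs. unfold tau. cont. pose proof (Rle_0_sqr (X * (2 * s - 1))) as Hsq; unfold Rsqr in Hsq; lra.
    + intros s Hs. unfold Cdiv. rewrite !Cmod_mult, Cmod_pow. unfold t at 1. rewrite inv_vpath2.
      assert (Eq : Cmod q = 2 * X).
      { unfold q. rewrite !Cmod_mult, Cmod_Ci, !Cmod_R, !Rabs_pos_eq by lra. ring. }
      rewrite Eq.
      assert (E1 : Cmod (Cexp (RtoC Y * (t s - RtoC 2))) = exp (- Y)).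
      { rewrite Cmod_Cexp, re_scal_l. f_equal. unfold t. rewrite vpath1_val. simpl. ring. }
      rewrite E1.
      assert (E2 : Cmod (/ (t s - RtoC 2))%C <= 1).
      { rewrite Cmod_inv by auto. rewrite <- Rinv_1. apply Rinv_le_contravar; [lra|].
        pose proof (re_le_Cmod (t s - RtoC 2)%C) as R1.
        replace (Re (t s - RtoC 2)%C) with (-1) in R1 by (unfold t; rewrite vpath1_val; simpl; ring).
        rewrite Rabs_left in R1 by lra. lra. }
      assert (0 < / (1 + tau s * tau s)) by (apply Rinv_0_lt_compat; nra).
      pose proof (exp_pos (- Y)).
      assert (0 <= 2 * X * / (1 + tau s * tau s)) by (apply Rmult_le_pos; lra).
      set (w := 2 * X * / (1 + tau s * tau s)) in *. set (m := Cmod (/ (t s - RtoC 2))%C) in *.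
      assert (0 <= w * exp (- Y)) by (apply Rmult_le_pos; lra).
      replace (w * (exp (- Y) * m)) with (w * exp (- Y) * m) by ring. nra.
  - replace (RInt _ 0 1) with (exp (- Y) * atan (tau 1) - exp (- Y) * atan (tau 0)).
    + pose proof (atan_bound (tau 1)). pose proof (atan_bound (tau 0)). pose proof (exp_pos (- Y)). nra.
    + symmetry. apply (@is_RInt_unique R_CompleteNormedModule).
      apply (is_RInt_derive (fun s => exp (- Y) * atan (tau s))); intros.
      * evar_last. { apply is_derive_scal, (is_derive_comp atan tau); [apply is_derive_atan|]. 
          instantiate (1 := 2 * X). unfold tau; auto_derive; auto; ring. }
        unfold scal; simpl; unfold mult, Rsqr; simpl. ring.
      * unfold tau. cont. pose proof (Rle_0_sqr (X * (2 * x - 1))) as Hsq; unfold Rsqr in Hsq; lra.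
Qed.

Lemma inv_decay_exp Y : 1 <= Y -> exp (- Y) <= / Y /\ exp (- (2 * Y)) * (2 * Y + 1) <= 4 * / Y.
Proof.
  intros HY. pose proof (exp_ineq1_le Y). split.
  - rewrite exp_Ropp. apply Rinv_le_contravar; lra.
  - pose proof (exp_square_bound (2 * Y) ltac:(lra)). pose proof (exp_pos (- (2 * Y))).
    apply Rmult_le_reg_r with Y; [lra|]. rewrite Rmult_assoc, (Rmult_assoc 4), Rinv_l by lra. nra.
Qed.

(** By homogeneity the limit is [k y] at [y]. Integrating against [exp (- 2 y)] gives
    [k / 4] on one side and, by [laplace_of_vseg], [Ci * PI / 2] on the other. The
    height [X = Y * Y] makes the tail negligible over [0 <= y <= Y]. *)
Lemma epow2_constant k : lim_inf (vseg (epow 1 2)) k -> k = (RtoC (2 * PI) * Ci)%C.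
Proof.
  intros Hk.
  assert (Hlim : forall y, 0 < y -> forall X, 0 <= X -> Cmod (RtoC y * k - vseg (epow y 2) X)%C <= 4 * exp y * / (1 + X)).
  { intros y Hy X HX. destruct (epow2_limit y) as [v [Hv [_ Ht]]].
    replace (RtoC y * k)%C with v; [now apply Ht|].
    apply (epow2_homogeneous y 1); auto. now rewrite Rmult_1_r. }
  enough (E : (RtoC (/ 4) * k = Ci * RtoC (PI / 2))%C).
  { transitivity (RtoC 4 * (RtoC (/ 4) * k))%C.
    - rewrite RtoC_inv by lra. field.
    - rewrite E. apply C_eq; simpl; field. }
  apply (lim_inf_unique (fun _ => Ci * RtoC (PI / 2))%C); [|apply lim_inf_const].
  eapply lim_inf_squeeze with (X0 := 1) (1 := lim_inf_const (RtoC (/ 4) * k)%C) (r := fun Y => (Cmod k + 6 + PI) * / Y); [|apply is_lim_scal_inv].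
  intros Y HY. set (X := Y * Y). assert (HX : 1 < X) by (unfold X; nra).
  pose proof (laplace_of_vseg X Y ltac:(lra) ltac:(lra)) as L.
  destruct (inv_decay_exp Y ltac:(lra)) as [D1 D2].
  assert (HiY : 0 < / Y) by (apply Rinv_0_lt_compat; lra).
  assert (HcV : forall y, 0 <= y <= Y -> continuous (fun y => RtoC (exp (- (2 * y))) * vseg (epow y 2) X)%C y).
  { intros y Hy. apply continuous_Cmult; [cont|]. unfold vseg, seg.
    apply (continuous_CRInt_param (fun z => epow (snd z) 2 (pt (vpath (-1) X) (vpath 1 X) (fst z)) * (vpath 1 X - vpath (-1) X))%C 0 1 (-1) (Y + 1)); try lra.
    intros s u Hs Hu. apply continuous_Cmult; [|cont]. unfold epow.
    assert (continuous (fun z : R * R => pt (vpath (-1) X) (vpath 1 X) (fst z)) (s, u)) by (apply continuous_pt; cont).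
    cont. apply right_half_neq0, right_half_convex; auto using right_half_vpath. }
  assert (E1 : Cmod (CRInt (fun y => RtoC (exp (- (2 * y))) * (RtoC y * k)) 0 Y - CRInt (fun y => RtoC (exp (- (2 * y))) * vseg (epow y 2) X) 0 Y)%C <= 4 * / Y).
  { rewrite <- CRInt_minus; [| lra | intros; cont | assumption].
    apply Rle_trans with ((Y - 0) * (4 * / (1 + X))).
    - apply CRInt_bound_const; [lra | intros; apply continuous_Cminus; [cont | now apply HcV] |].
      intros y Hy.
      replace (RtoC (exp (- (2 * y))) * (RtoC y * k) - RtoC (exp (- (2 * y))) * vseg (epow y 2) X)%C with
        (RtoC (exp (- (2 * y))) * (RtoC y * k - vseg (epow y 2) X))%C by ring.
      rewrite Cmod_mult, Cmod_R, Rabs_pos_eq by (left; apply exp_pos).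
      assert (Hl : Cmod (RtoC y * k - vseg (epow y 2) X)%C <= 4 * exp y * / (1 + X)).
      { destruct (Req_dec y 0) as [->|]; [|apply Hlim; lra].
        destruct (epow2_limit 0) as [v [Hv [_ Ht]]].
        replace (RtoC 0 * k)%C with v; [apply Ht; lra|].
        assert (E2 : v = (RtoC 2 * v)%C) by (apply (epow2_homogeneous 2 0); try lra; [assumption | now rewrite Rmult_0_r]).
        replace v with (RtoC 2 * v - v)%C at 1 by ring. rewrite <- E2. ring. }
      pose proof (exp_pos (- (2 * y))). assert (0 < / (1 + X)) by (apply Rinv_0_lt_compat; lra).
      apply Rle_trans with (exp (- (2 * y)) * (4 * exp y * / (1 + X))); [apply Rmult_le_compat_l; lra|].
      replace (exp (- (2 * y)) * (4 * exp y * / (1 + X))) with ((exp (- (2 * y)) * exp y) * (4 * / (1 + X))) by ring.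
      rewrite <- exp_plus. assert (exp (- (2 * y) + y) <= 1) by (rewrite <- exp_0; apply exp_le; lra).
      rewrite <- (Rmult_1_l (4 * / (1 + X))) at 2. apply Rmult_le_compat_r; lra.
    - assert (/ (1 + X) <= / (Y * Y)) by (apply Rinv_le_contravar; unfold X; nra).
      apply Rle_trans with (Y * (4 * / (Y * Y))); [apply Rmult_le_compat; try lra; assert (0 < / (1 + X)) by (apply Rinv_0_lt_compat; lra); lra|].
      apply Req_le; field; lra. }
  rewrite (CRInt_FTC (fun y => RtoC (- / 4 * (exp (- (2 * y)) * (2 * y + 1))) * k)%C (fun y => RtoC (exp (- (2 * y))) * (RtoC y * k))%C) in E1; [| lra | |].
  2: { intros y Hy. eapply cderiv_eq.
       - apply cderiv_mult; [|apply cderiv_const]. apply cderiv_RtoC. instantiate (1 := exp (- (2 * y)) * y).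
         auto_derive; auto. field.
       - rewrite RtoC_mult. ring. }
  2: { intros y Hy. cont. }
  set (I := CRInt (fun y => RtoC (exp (- (2 * y))) * vseg (epow y 2) X)%C 0 Y) in *.
  set (W := exp (- (2 * Y)) * (2 * Y + 1)) in *.
  replace (exp (- (2 * 0)) * (2 * 0 + 1)) with 1 in E1 by (replace (- (2 * 0)) with 0 by ring; rewrite exp_0; ring).
  set (T := X / (1 + X * X) + atan X) in *.
  assert (E3 : (RtoC (/ 4) * k - Ci * RtoC (PI / 2) = RtoC (/ 4 * W) * k +
     (RtoC (- / 4 * W) * k - RtoC (- / 4 * 1) * k - I) + (I - Ci * RtoC T) + Ci * RtoC (T - PI / 2))%C).
  { rewrite !RtoC_mult, RtoC_minus, RtoC_opp. ring. }
  rewrite E3.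
  assert (HT : Rabs (T - PI / 2) <= 2 * / Y).
  { assert (HiX : 0 < / X <= / Y). { split; [apply Rinv_0_lt_compat; lra|]. apply Rinv_le_contravar; unfold X; nra. }
    pose proof (atan_inv X ltac:(lra)) as A1. pose proof (atan_le (/ X) ltac:(lra)).
    assert (0 <= atan (/ X)). { rewrite <- atan_0. destruct (Req_dec (/ X) 0); [lra|]. left; apply atan_increasing; lra. }
    assert (0 <= X / (1 + X * X) <= / X).
    { split; [apply Rmult_le_pos; [lra | left; apply Rinv_0_lt_compat; nra]|].
      apply Rmult_le_reg_r with (X * (1 + X * X)); [nra|]. field_simplify; nra. }
    unfold T. apply Rabs_le. lra. }
  assert (HW : 0 <= W <= 4 * / Y).
  { split; [unfold W; apply Rmult_le_pos; [left; apply exp_pos | lra] | assumption]. }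
  assert (N1 : Cmod (RtoC (/ 4 * W) * k)%C <= Cmod k * / Y).
  { rewrite Cmod_mult, Cmod_R, Rabs_pos_eq by lra. pose proof (Cmod_ge_0 k). rewrite Rmult_comm. apply Rmult_le_compat_l; lra. }
  assert (N2 : Cmod (Ci * RtoC (T - PI / 2))%C <= 2 * / Y) by (rewrite Cmod_mult, Cmod_Ci, Cmod_R; lra).
  assert (N3 : PI * exp (- Y) <= PI * / Y) by (apply Rmult_le_compat_l; [pose proof PI_RGT_0; lra | assumption]).
  eapply Rle_trans; [apply Cmod_triangle|].
  eapply Rle_trans; [apply Rplus_le_compat; [apply Cmod_triangle | apply Rle_refl]|].
  eapply Rle_trans; [apply Rplus_le_compat; [apply Rplus_le_compat; [apply Cmod_triangle | apply Rle_refl] | apply Rle_refl]|].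
  lra.
Qed.

(** * The jump across the real line *)

(** By homogeneity the limit at [y <= 0] is bounded by [4 / c] for every [c > 0]. *)
Lemma epow2_limit_value y : lim_inf (vseg (epow y 2)) (RtoC (2 * PI * Rmax 0 y) * Ci)%C.
Proof.
  destruct (epow2_limit y) as [v [Hv [Hb _]]].
  replace (RtoC (2 * PI * Rmax 0 y) * Ci)%C with v; [assumption|].
  destruct (Rle_lt_dec y 0) as [Hy|Hy].
  - rewrite Rmax_left by assumption.
    assert (Hz : Cmod v = 0).
    { apply Rle_antisym; [|apply Cmod_ge_0]. apply Rnot_lt_le; intros Hlt.
      (* any [c] above [4 / Cmod v] contradicts the bound [4 * exp (c * y) <= 4] *)
      set (c := 5 / Cmod v). assert (Hc : 0 < c) by (apply Rdiv_lt_0_compat; lra).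
      destruct (epow2_limit (c * y)) as [w [Hw [Hwb _]]].
      rewrite (epow2_homogeneous c y v w Hc Hv Hw), Cmod_mult, Cmod_R, Rabs_pos_eq in Hwb by lra.
      assert (exp (c * y) <= 1) by (rewrite <- exp_0; apply exp_le; nra).
      assert (c * Cmod v = 5) by (unfold c; field; lra). lra. }
    apply Cmod_eq_0 in Hz. rewrite Hz. rewrite Rmult_0_r. ring.
  - rewrite Rmax_right by lra. destruct (epow2_limit 1) as [k [Hk _]].
    rewrite (epow2_homogeneous y 1 k v Hy Hk) by (now rewrite Rmult_1_r).
    rewrite (epow2_constant k Hk), !RtoC_mult. ring.
Qed.

(** Integration by parts lowers the exponent: the boundary terms at height [X] are
    [O(1 / X)]. *)
Lemma epow_recurrence y n X : (1 <= n)%nat -> 1 <= X ->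
  Cmod (RtoC y * vseg (epow y n) X - RtoC (INR n) * vseg (epow y (S n)) X)%C <= 2 * exp y * / X.
Proof.
  intros Hn HX.
  assert (E : (RtoC y * vseg (epow y n) X - RtoC (INR n) * vseg (epow y (S n)) X =
     epow y n (vpath 1 X) - epow y n (vpath (-1) X))%C).
  { rewrite <- (seg_FTC right_half _ _ _ _ right_half_convex (epow_holo_eq y n) (right_half_vpath _ _) (right_half_vpath _ _)).
    rewrite (seg_lin right_half _ _ _ _ _ _ _ _ right_half_convex (epow_holo_eq y n) (epow_holo_eq y (S n))) by apply right_half_vpath.
    unfold vseg. ring. }
  rewrite E.
  assert (B : forall sg, sg * sg = 1 -> Cmod (epow y n (vpath sg X)) <= exp y * / X).
  { intros sg Hsg. rewrite Cmod_epow, Re_vpath, Rmult_1_r. apply Rmult_le_compat_l; [left; apply exp_pos|].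
    destruct n as [|n]; [lia|]. pose proof (Cmod_inv_vpath sg X). pose proof (Cmod_ge_0 (/ vpath sg X)%C).
    assert (Cmod (/ vpath sg X)%C <= / X).
    { apply Cmod_inv_Im; [lra|]. unfold vpath; simpl. replace (_ + _) with (sg * X) by ring.
      rewrite Rabs_mult, sign_abs, Rabs_pos_eq by (auto; lra). lra. }
    pose proof (pow_le_1 (Cmod (/ vpath sg X)%C) n ltac:(lra)). assert (0 < / X) by (apply Rinv_0_lt_compat; lra).
    simpl. pose proof (pow_le (Cmod (/ vpath sg X)%C) n ltac:(lra)). nra. }
  unfold Cminus. eapply Rle_trans; [apply Cmod_triangle|]. rewrite Cmod_opp.
  pose proof (B 1 sgn1). pose proof (B (-1) sgnm1). lra.
Qed.

(** Induction on [m] by [epow_recurrence]; since [y * Rmax 0 y = Rmax 0 y ^ 2], the powers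
    of [Rmax 0 y] cover both signs of [y]. *)
Lemma epow_limit y m : lim_inf (vseg (epow y (S (S m))))
  (RtoC (2 * PI * (Rmax 0 y ^ S m / INR (fact (S m)))) * Ci)%C.
Proof.
  induction m as [|m IH].
  - replace (2 * PI * (Rmax 0 y ^ 1 / INR (fact 1))) with (2 * PI * Rmax 0 y) by (simpl; field).
    apply epow2_limit_value.
  - set (n := S (S m)) in *. assert (Hn : INR n <> 0) by (apply not_0_INR; unfold n; lia).
    replace (RtoC (2 * PI * (Rmax 0 y ^ n / INR (fact n))) * Ci)%C with
      (RtoC (y / INR n) * (RtoC (2 * PI * (Rmax 0 y ^ S m / INR (fact (S m)))) * Ci))%C.
    + eapply lim_inf_squeeze with (X0 := 1) (1 := lim_inf_scal (RtoC (y / INR n)) _ _ IH) (r := fun X => (/ INR n * (2 * exp y)) * / X); [|apply is_lim_scal_inv].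
      intros X HX.
      assert (Hp : 0 < / INR n) by (apply Rinv_0_lt_compat, lt_0_INR; unfold n; lia).
      replace (RtoC (y / INR n) * vseg (epow y n) X - vseg (epow y (S n)) X)%C with
        (RtoC (/ INR n) * (RtoC y * vseg (epow y n) X - RtoC (INR n) * vseg (epow y (S n)) X))%C.
      * rewrite Cmod_mult, Cmod_R, Rabs_pos_eq, Rmult_assoc by lra. apply Rmult_le_compat_l; [lra|].
        apply epow_recurrence; [unfold n; lia | lra].
      * unfold Rdiv. rewrite RtoC_mult, RtoC_inv by assumption. field. intros Z; injection Z; auto.
    + assert (Hf : INR (fact n) = INR n * INR (fact (S m))) by (unfold n; rewrite <- mult_INR; reflexivity).
      assert (Hy : Rmax 0 y ^ n = y * Rmax 0 y ^ S m).
      { unfold n. simpl. destruct (Rle_lt_dec y 0); [rewrite Rmax_left by assumption | rewrite Rmax_right by lra]; ring. }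
      rewrite Cmult_assoc, <- RtoC_mult, Hf, Hy. f_equal. f_equal.
      field. split; [apply INR_fact_neq_0 | assumption].
Qed.

(** The real parameter [b] is kept apart from [w] because the remainder is estimated by
    integrating in [b]. *)
Fixpoint pexp (K : nat) (b : R) (w : C) : C :=
  match K with
  | 0%nat => RtoC 1
  | S K' => (pexp K' b w + RtoC (b ^ K / INR (fact K)) * w ^ K)%C
  end.

Lemma is_derive_pow_fact n b : is_derive (fun b => b ^ S n / INR (fact (S n))) b (b ^ n / INR (fact n)).
Proof.
  apply (is_derive_ext (fun b => / INR (fact (S n)) * b ^ S n)); [intros; apply Rmult_comm|].
  evar_last. { apply is_derive_scal. apply (is_derive_pow (fun b => b)). apply (@is_derive_id R_AbsRing). }
  rewrite fact_simpl, mult_INR. change one with 1. cbn [Nat.pred].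
  field. split; [apply INR_fact_neq_0 | apply not_0_INR; lia].
Qed.

Lemma pexp_deriv K w b : cderiv (fun b => pexp (S K) b w) b (w * pexp K b w)%C.
Proof.
  induction K as [|K IH].
  - simpl. eapply cderiv_eq.
    + apply cderiv_plus; [apply cderiv_const | apply cderiv_mult; [|apply cderiv_const]].
      apply cderiv_RtoC, (is_derive_pow_fact 0).
    + cbv beta. simpl. rewrite Rdiv_1_r. ring.
  - change (fun b => pexp (S (S K)) b w) with
      (fun b => pexp (S K) b w + RtoC (b ^ S (S K) / INR (fact (S (S K)))) * w ^ S (S K))%C.
    eapply cderiv_eq.
    + apply cderiv_plus; [apply IH | apply cderiv_mult; [|apply cderiv_const]].
      apply cderiv_RtoC, is_derive_pow_fact.
    + change (pexp (S K) b w) with (pexp K b w + RtoC (b ^ S K / INR (fact (S K))) * w ^ S K)%C.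
      rewrite (Cpow_S w (S K)). ring.
Qed.

Lemma pexp_at_0 K w : pexp K 0 w = RtoC 1.
Proof.
  induction K as [|K IH]; [reflexivity|].
  change (pexp K 0 w + RtoC (0 ^ S K / INR (fact (S K))) * w ^ S K = RtoC 1)%C.
  rewrite IH, pow_ne_zero by discriminate. unfold Rdiv. rewrite Rmult_0_l. ring.
Qed.

(** Taylor's formula in the real variable [b]: the error term for [S K] is the integral of
    [w] times the one for [K]. *)
Lemma pexp_remainder a w K b : Cmod w <= 1 -> 0 <= b <= a ->
  Cmod (Cexp (RtoC b * w) - pexp K b w)%C <= b ^ S K / INR (fact (S K)) * exp a.
Proof.
  intros Hw. revert b. induction K as [|K IH]; intros b Hb.
  - simpl pexp. rewrite <- Cexp_0.
    assert (N : Cmod (RtoC b * w)%C <= b) by (rewrite Cmod_mult, Cmod_R, Rabs_pos_eq by lra; pose proof (Cmod_ge_0 w); nra).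
    eapply Rle_trans; [apply (Cexp_lip _ _ a)|].
    + pose proof (Re_le_Cmod (RtoC b * w)%C). lra.
    + simpl. lra.
    + apply Rmult_le_compat_r; [left; apply exp_pos|].
      replace (RtoC b * w - RtoC 0)%C with (RtoC b * w)%C by ring.
      replace (b ^ 1 / INR (fact 1)) with b by (simpl; field). assumption.
  - assert (Hc : forall K b, continuous (fun b => pexp K b w) b).
    { intros [|K'] x; [simpl; cont | eapply cderiv_continuous, pexp_deriv]. }
    assert (Hcw : forall b, continuous (fun b => w * (Cexp (RtoC b * w) - pexp K b w))%C b).
    { intros x. apply continuous_Cmult; [cont|]. apply continuous_Cminus; [cont | apply Hc]. }
    assert (E : (Cexp (RtoC b * w) - pexp (S K) b w = CRInt (fun b => w * (Cexp (RtoC b * w) - pexp K b w)) 0 b)%C).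
    { rewrite (CRInt_FTC (fun b => Cexp (RtoC b * w) - pexp (S K) b w)%C); [| lra | |].
      - rewrite pexp_at_0, Cmult_0_l, Cexp_0. ring.
      - intros x _. eapply cderiv_eq.
        + apply cderiv_minus; [apply cderiv_Cexp, cderiv_mult; [apply cderiv_id | apply cderiv_const] | apply pexp_deriv].
        + cbv beta. ring.
      - intros; apply Hcw. }
    rewrite E.
    apply Rle_trans with (RInt (fun b => b ^ S K / INR (fact (S K)) * exp a) 0 b).
    + apply CRInt_bound; [lra | intros; apply Hcw | |].
      * apply ex_RInt_cont; [lra|]. intros x _. unfold Rdiv. cont.
      * intros x Hx. rewrite Cmod_mult. specialize (IH x ltac:(lra)).
        pose proof (Cmod_ge_0 w). pose proof (Cmod_ge_0 (Cexp (RtoC x * w) - pexp K x w)%C). nra.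
    + apply Req_le.
      replace (b ^ S (S K) / INR (fact (S (S K))) * exp a) with
        (b ^ S (S K) / INR (fact (S (S K))) * exp a - 0 ^ S (S K) / INR (fact (S (S K))) * exp a)
        by (rewrite (pow_ne_zero (S (S K))) by discriminate; unfold Rdiv; ring).
      apply (@is_RInt_unique R_CompleteNormedModule).
      apply (is_RInt_derive (fun b => b ^ S (S K) / INR (fact (S (S K))) * exp a)); intros x _.
      * apply (is_derive_ext (fun b => exp a * (b ^ S (S K) / INR (fact (S (S K)))))); [intros; apply Rmult_comm|].
        rewrite Rmult_comm. apply is_derive_scal, is_derive_pow_fact.
      * unfold Rdiv. cont.
Qed.

Lemma holo_exists_plus D f g : (exists f', holo D f f') -> (exists g', holo D g g') ->
  exists h', holo D (fun t => f t + g t)%C h'.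
Proof. intros [f' Hf] [g' Hg]. eexists. exact (holo_plus _ _ _ _ _ Hf Hg). Qed.

Lemma holo_exists_mult D f g : (exists f', holo D f f') -> (exists g', holo D g g') ->
  exists h', holo D (fun t => f t * g t)%C h'.
Proof. intros [f' Hf] [g' Hg]. eexists. exact (holo_mult _ _ _ _ _ Hf Hg). Qed.

Lemma holo_exists_const D c : exists f', holo D (fun _ => c) f'.
Proof. eexists. apply holo_const. Qed.

Lemma holo_exists_inv : exists f', holo right_half (fun t => / t)%C f'.
Proof. eexists. exact (holo_inv _ _ _ (holo_id _) right_half_neq0). Qed.

(** The integrand of [g_prim 3] on the vertical line at the real point [a + y], with
    [g t] in place of [exp (- a / t)]. *)
Definition jump_kernel (e y : R) (g : C -> C) (t : C) : C :=
  (RtoC (1 / 2) * (RtoC 1 + RtoC e * / t) * Cexp (RtoC y * t) * (/ t) ^ 3 * g t)%C.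

Lemma jump_kernel_holo e y g : (exists g', holo right_half g g') -> exists f', holo right_half (jump_kernel e y g) f'.
Proof.
  intros Hg. unfold jump_kernel.
  apply holo_exists_mult; [|assumption]. apply holo_exists_mult; [|eexists; apply holo_inv_pow].
  apply holo_exists_mult; [|eexists; apply holo_cexp_lin]. apply holo_exists_mult; [apply holo_exists_const|].
  apply holo_exists_plus; auto using holo_exists_mult, holo_exists_const, holo_exists_inv.
Qed.

Lemma jump_kernel_size e y g B : e * e = 1 -> 0 <= B ->
  (forall sg s, Cmod (g (vpath sg s)) <= B) ->
  forall sg s, sg * sg = 1 -> 0 <= s ->
  Cmod (jump_kernel e y g (vpath sg s)) <= (exp y * B) * Cmod (/ vpath sg s)%C ^ 2.
Proof.
  intros He HB Hg sg s Hsg Hs. unfold jump_kernel. set (t := vpath sg s).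
  rewrite (Cmod_mult _ (g t)), (Cmod_mult _ ((/ t) ^ 3)%C), (Cmod_mult _ (Cexp (RtoC y * t))), Cmod_Cexp, Cmod_pow, re_scal_l.
  unfold t at 2. rewrite Re_vpath, Rmult_1_r.
  pose proof (ker_factor_bound e t 1 He ltac:(lra) ltac:(unfold t; rewrite Re_vpath; lra)) as F.
  specialize (Hg sg s). fold t in Hg. pose proof (Cmod_inv_vpath sg s) as I. fold t in I.
  set (i := Cmod (/ t)%C) in *. assert (0 <= i) by apply Cmod_ge_0.
  assert (i ^ 3 <= i ^ 2) by (simpl; nra). assert (0 <= i ^ 3) by (apply pow_le; assumption).
  pose proof (exp_pos y). pose proof (Cmod_ge_0 (RtoC (1 / 2) * (RtoC 1 + RtoC e * / t))%C).
  apply Rle_trans with (1 * exp y * i ^ 2 * B); [|apply Req_le; ring].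
  apply Rmult_le_compat; [| apply Cmod_ge_0 | | assumption].
  - apply Rmult_le_pos; [apply Rmult_le_pos|]; lra.
  - apply Rmult_le_compat; [apply Rmult_le_pos | | apply Rmult_le_compat_r |]; lra.
Qed.

(** The [k]-th term of the power series of [jump_value e a y]. *)
Definition jump_term (e a y : R) (k : nat) : R :=
  y ^ 2 * (bes_coef 2 k * (a * y) ^ k) + e * y ^ 3 * (bes_coef 3 k * (a * y) ^ k).

Lemma jump_kernel_term e a y k t :
  jump_kernel e y (fun t => RtoC (a ^ k / INR (fact k)) * (- RtoC 1 * / t) ^ k)%C t =
  (RtoC (1 / 2 * ((- 1) ^ k * (a ^ k / INR (fact k)))) * epow y (S (S (S k))) t +
   RtoC (e * (1 / 2 * ((- 1) ^ k * (a ^ k / INR (fact k))))) * epow y (S (S (S (S k)))) t)%C.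
Proof.
  unfold jump_kernel, epow. rewrite Cpow_mult_l, !RtoC_mult, (RtoC_pow (- 1)).
  replace (RtoC (- 1)) with (- RtoC 1)%C by (apply C_eq; simpl; ring).
  rewrite !Cpow_S. simpl Cpow. ring.
Qed.

Lemma seg_plus D f g p q : convex D -> (exists f', holo D f f') -> (exists g', holo D g g') -> D p -> D q ->
  seg (fun t => f t + g t)%C p q = (seg f p q + seg g p q)%C.
Proof.
  intros HD [f' Hf] [g' Hg] Hp Hq.
  rewrite <- (Cmult_1_l (seg f p q)), <- (Cmult_1_l (seg g p q)), <- (seg_lin D f f' g g') by assumption.
  f_equal. apply functional_extensionality; intros; ring.
Qed.

Lemma jump_term_limit e a y k :
  lim_inf (vseg (jump_kernel e y (fun t => RtoC (a ^ k / INR (fact k)) * (- RtoC 1 * / t) ^ k)%C))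
    (RtoC (PI * jump_term e a (Rmax 0 y) k) * Ci)%C.
Proof.
  set (c := 1 / 2 * ((- 1) ^ k * (a ^ k / INR (fact k)))).
  pose proof (lim_inf_plus _ _ _ _ (lim_inf_scal (RtoC c) _ _ (epow_limit y (S k)))
    (lim_inf_scal (RtoC (e * c)) _ _ (epow_limit y (S (S k))))) as L.
  replace (RtoC (PI * jump_term e a (Rmax 0 y) k) * Ci)%C with
    (RtoC c * (RtoC (2 * PI * (Rmax 0 y ^ S (S k) / INR (fact (S (S k))))) * Ci) +
     RtoC (e * c) * (RtoC (2 * PI * (Rmax 0 y ^ S (S (S k)) / INR (fact (S (S (S k)))))) * Ci))%C.
  - eapply lim_inf_ext with (X0 := 0) (2 := L). intros X HX. cbv beta.
    replace (jump_kernel e y _) with (fun t => RtoC c * epow y (S (S (S k))) t + RtoC (e * c) * epow y (S (S (S (S k)))) t)%C.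
    + unfold vseg. destruct (epow_holo y (S (S (S k)))) as [f' Hf]. destruct (epow_holo y (S (S (S (S k))))) as [g' Hg].
      symmetry. apply (seg_lin right_half _ f' _ g'); auto using right_half_convex, right_half_vpath.
    + apply functional_extensionality; intros t. symmetry. apply jump_kernel_term.
  - rewrite !Cmult_assoc, <- !RtoC_mult, <- Cmult_plus_distr_r, <- RtoC_plus. f_equal. f_equal.
    unfold c, jump_term, bes_coef. rewrite Rpow_mult_distr.
    replace (k + 2)%nat with (S (S k)) by lia. replace (k + 3)%nat with (S (S (S k))) by lia.
    simpl pow. field. repeat split; apply INR_fact_neq_0.
Qed.

Lemma pexp_holo K a : exists f', holo right_half (fun t => pexp K a (- RtoC 1 * / t)) f'.
Proof.
  assert (P : forall n, exists f', holo right_half (fun t => (- RtoC 1 * / t) ^ n)%C f').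
  { induction n as [|n IHn]; [exact (holo_exists_const right_half (RtoC 1))|].
    apply (holo_exists_mult _ (fun t => - RtoC 1 * / t)%C (fun t => (- RtoC 1 * / t) ^ n)%C); [|assumption].
    auto using holo_exists_mult, holo_exists_const, holo_exists_inv. }
  induction K as [|K IH]; [exact (holo_exists_const right_half (RtoC 1))|].
  apply (holo_exists_plus _ (fun t => pexp K a (- RtoC 1 * / t)) (fun t => RtoC (a ^ S K / INR (fact (S K))) * (- RtoC 1 * / t) ^ S K)%C); [assumption|].
  apply holo_exists_mult; [apply holo_exists_const | apply P].
Qed.

(** Expanding [exp (- a / t)] turns the kernel into powers of [1 / t], and their
    inverse transforms are the terms of Bessel's series. *)
Lemma jump_pexp_limit e a y K :
  lim_inf (vseg (jump_kernel e y (fun t => pexp K a (- RtoC 1 * / t))))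
    (RtoC (PI * sum_n (jump_term e a (Rmax 0 y)) K) * Ci)%C.
Proof.
  induction K as [|K IH].
  - rewrite sum_O. eapply lim_inf_ext with (X0 := 0) (2 := jump_term_limit e a y 0).
    intros X HX. f_equal. f_equal. apply functional_extensionality; intros t. simpl.
    apply C_eq; simpl; field.
  - rewrite sum_Sn. change (plus ?u ?v) with (u + v).
    rewrite Rmult_plus_distr_l, RtoC_plus, Cmult_plus_distr_r.
    eapply lim_inf_ext with (X0 := 0) (2 := lim_inf_plus _ _ _ _ IH (jump_term_limit e a y (S K))).
    intros X HX. cbv beta.
    set (gK := fun t => (RtoC (a ^ S K / INR (fact (S K))) * (- RtoC 1 * / t) ^ S K)%C).
    assert (HgK : exists f', holo right_half (jump_kernel e y gK) f').
    { destruct (epow_holo y (S (S (S (S K))))) as [f' Hf]. destruct (epow_holo y (S (S (S (S (S K)))))) as [g' Hg].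
      eexists. unfold gK.
      replace (jump_kernel e y _) with
        (fun t => RtoC (1 / 2 * ((- 1) ^ S K * (a ^ S K / INR (fact (S K))))) * epow y (S (S (S (S K)))) t +
          RtoC (e * (1 / 2 * ((- 1) ^ S K * (a ^ S K / INR (fact (S K)))))) * epow y (S (S (S (S (S K))))) t)%C.
      - apply holo_plus; apply holo_mult; try apply holo_const; eassumption.
      - apply functional_extensionality; intros t. symmetry. apply jump_kernel_term. }
    unfold vseg. rewrite <- (seg_plus right_half); auto using right_half_convex, right_half_vpath, jump_kernel_holo, pexp_holo.
    f_equal. apply functional_extensionality; intros t. unfold jump_kernel, gK.
    change (pexp (S K) a ?w) with (pexp K a w + RtoC (a ^ S K / INR (fact (S K))) * w ^ S K)%C. ring.
Qed.

(** Up to the factor [Ci * PI], the inverse Laplace transform of [jump_kernel] with [g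
    t = exp (- a / t)], for [y >= 0]. *)
Definition jump_value (e a y : R) : R := y ^ 2 * bes 2 (a * y) + e * y ^ 3 * bes 3 (a * y).

Lemma jump_series e a y : is_lim_seq (sum_n (jump_term e a y)) (jump_value e a y).
Proof.
  assert (S : forall m, is_series (fun k => bes_coef m k * (a * y) ^ k) (bes m (a * y))).
  { intros m. unfold bes, PSeries. apply Series_correct. destruct (bes_ex_pseries m (a * y)) as [l Hl].
    exists l. apply is_pseries_R. exact Hl. }
  exact (is_series_plus _ _ _ _ (is_series_scal (y ^ 2) _ _ (S 2%nat)) (is_series_scal (e * y ^ 3) _ _ (S 3%nat))).
Qed.

(** The exponential series may be integrated termwise because its remainder is uniformly
    small on the line. *)
Lemma jump_limit e a y : e * e = 1 -> 0 < a ->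
  lim_inf (vseg (jump_kernel e y (fun t => Cexp (RtoC a * (- RtoC 1 * / t))))) (RtoC (PI * jump_value e a (Rmax 0 y)) * Ci)%C.
Proof.
  intros He Ha. set (g := fun t => Cexp (RtoC a * (- RtoC 1 * / t))).
  assert (Hg : exists g', holo right_half g g').
  { assert (H : exists h', holo right_half (fun t => RtoC a * (- RtoC 1 * / t))%C h')
      by (auto using holo_exists_mult, holo_exists_const, holo_exists_inv).
    destruct H as [h' Hh]. eexists. exact (holo_exp _ _ _ Hh). }
  assert (Hw : forall sg s, Cmod (- RtoC 1 * / vpath sg s)%C <= 1).
  { intros. rewrite Cmod_mult, Cmod_opp, Cmod_1, Rmult_1_l. apply Cmod_inv_vpath. }
  assert (Hgb : forall sg s, Cmod (g (vpath sg s)) <= exp a).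
  { intros sg s. unfold g. rewrite Cmod_Cexp. apply exp_le. eapply Rle_trans; [apply Rle_abs|].
    eapply Rle_trans; [apply re_le_Cmod|]. rewrite Cmod_mult, Cmod_R, Rabs_pos_eq by lra. specialize (Hw sg s). nra. }
  destruct (jump_kernel_holo e y g Hg) as [f' Hf].
  assert (Hea : 0 <= exp a) by (left; apply exp_pos).
  assert (HA : 0 <= exp y * exp a) by (apply Rmult_le_pos; [left; apply exp_pos | assumption]).
  destruct (vseg_converges _ f' _ Hf HA (jump_kernel_size e y g (exp a) He Hea Hgb)) as [v Hv].
  set (S := sum_n (jump_term e a (Rmax 0 y))). set (J := jump_value e a (Rmax 0 y)).
  assert (Rem : forall K, Cmod (v - RtoC (PI * S K) * Ci)%C <= 4 * (exp y * exp a) * (a ^ Datatypes.S K / INR (fact (Datatypes.S K)))).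
  { intros K. set (q := a ^ Datatypes.S K / INR (fact (Datatypes.S K))).
    assert (Hq : 0 <= q) by (unfold q; apply Rdiv_le_0_compat; [apply pow_le; lra | apply INR_fact_lt_0]).
    set (gK := fun t => pexp K a (- RtoC 1 * / t)).
    set (d := fun t => (g t + - RtoC 1 * gK t)%C).
    assert (Hd : exists d', holo right_half d d').
    { apply holo_exists_plus; [assumption|]. apply holo_exists_mult; [apply holo_exists_const | apply pexp_holo]. }
    destruct (jump_kernel_holo e y d Hd) as [d' Hd'].
    assert (Hdb : forall sg s, Cmod (d (vpath sg s)) <= q * exp a).
    { intros sg s. unfold d, g, gK.
      match goal with |- Cmod (?A + - RtoC 1 * ?B)%C <= _ => replace (A + - RtoC 1 * B)%C with (A - B)%C by ring end.
      apply pexp_remainder; [apply Hw | lra]. }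
    assert (Hqe : 0 <= q * exp a) by (apply Rmult_le_pos; assumption).
    assert (HA' : 0 <= exp y * (q * exp a)) by (apply Rmult_le_pos; [left; apply exp_pos | assumption]).
    replace (4 * (exp y * exp a) * q) with (4 * (exp y * (q * exp a))) by ring.
    apply (lim_inf_bound (vseg (jump_kernel e y d)) _ _ 0).
    - intros X HX. apply (vseg_bound _ d' _ Hd' HA'); [|lra]. now apply jump_kernel_size.
    - replace (v - RtoC (PI * S K) * Ci)%C with (v + - RtoC 1 * (RtoC (PI * S K) * Ci))%C by ring.
      eapply lim_inf_ext with (X0 := 0) (2 := lim_inf_plus _ _ _ _ Hv (lim_inf_scal (- RtoC 1)%C _ _ (jump_pexp_limit e a y K))).
      intros X HX. cbv beta. destruct (jump_kernel_holo e y gK (pexp_holo K a)) as [k' Hk].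
      pose proof (seg_lin right_half _ f' _ k' (RtoC 1) (- RtoC 1)%C _ _ right_half_convex Hf Hk (right_half_vpath (-1) X) (right_half_vpath 1 X)) as E.
      rewrite Cmult_1_l in E. unfold vseg. unfold gK in E at 2. rewrite <- E. f_equal. apply functional_extensionality; intros t.
      unfold jump_kernel, d. ring. }
  assert (Hlim : is_lim_seq (fun K => 4 * (exp y * exp a) * (a ^ Datatypes.S K / INR (fact (Datatypes.S K))) + PI * Rabs (S K - J)) 0).
  { replace (Finite 0) with (Finite (4 * (exp y * exp a) * 0 + PI * 0)) by (f_equal; ring).
    apply is_lim_seq_plus'.
    - apply (is_lim_seq_scal_l _ (4 * (exp y * exp a)) 0).
      apply (is_lim_seq_incr_1 (fun n => a ^ n / INR (fact n))). apply is_lim_seq_Reals, cv_speed_pow_fact.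
    - apply (is_lim_seq_scal_l _ PI 0). rewrite <- Rabs_R0. apply (is_lim_seq_abs _ 0).
      replace (Finite 0) with (Finite (J - J)) by (f_equal; ring).
      apply is_lim_seq_minus'; [apply jump_series | apply is_lim_seq_const]. }
  replace (RtoC (PI * J) * Ci)%C with v; [assumption|].
  apply Ceq_dist0, Cmod_eq_0, Rle_antisym; [|apply Cmod_ge_0].
  assert (L := fun H => is_lim_seq_le (fun _ => Cmod (v - RtoC (PI * J) * Ci)%C) _ _ 0 H (is_lim_seq_const _) Hlim).
  apply L; clear L.
  intros K. replace (v - RtoC (PI * J) * Ci)%C with ((v - RtoC (PI * S K) * Ci) + RtoC (PI * (S K - J)) * Ci)%C
    by (rewrite !RtoC_mult, RtoC_minus; ring).
  eapply Rle_trans; [apply Cmod_triangle|]. apply Rplus_le_compat; [apply Rem|].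
  rewrite Cmod_mult, Cmod_Ci, Cmod_R, Rabs_mult, (Rabs_pos_eq PI) by (left; apply PI_RGT_0). lra.
Qed.

(** The integrals over the common segment [(0, 1)] cancel, the two half-lines make up the
    line [Re t = 1]. *)
Lemma g_prim_jump e a x : e * e = 1 -> 0 < a ->
  (g_prim e a 1 3 (RtoC x) - g_prim e a (-1) 3 (RtoC x))%C = (RtoC (PI * jump_value e a (Rmax 0 (x - a))) * Ci)%C.
Proof.
  intros He Ha. set (y := x - a). set (g := fun t => Cexp (RtoC a * (- RtoC 1 * / t))).
  apply (lim_inf_unique (fun X => g_prim_upto e a 1 3 X (RtoC x) - g_prim_upto e a (-1) 3 X (RtoC x))%C).
  - apply lim_inf_minus; (apply g_prim_lim_closed; [assumption | ring | assumption | simpl; lra]).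
  - assert (Hg : exists g', holo right_half g g').
    { assert (H : exists h', holo right_half (fun t => RtoC a * (- RtoC 1 * / t))%C h')
        by (auto using holo_exists_mult, holo_exists_const, holo_exists_inv).
      destruct H as [h' Hh]. eexists. exact (holo_exp _ _ _ Hh). }
    destruct (jump_kernel_holo e y g Hg) as [f' Hf].
    eapply lim_inf_ext with (X0 := 0) (2 := jump_limit e a y He Ha). fold g.
    intros X HX. rewrite (vseg_split _ f') by (auto; lra). unfold g_prim_upto.
    assert (E : forall sg, exp_int (vpath sg) (vweight e a sg 3) X (RtoC x) = CRInt (fun s => Ci * RtoC sg * jump_kernel e y g (vpath sg s))%C 0 X).
    { intros sg. unfold exp_int. apply CRInt_ext; [lra|]. intros s Hs. unfold vweight, jump_kernel, g. set (t := vpath sg s).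
      replace (RtoC y * t)%C with (RtoC x * t + - (RtoC a * t))%C by (unfold y; rewrite RtoC_minus; ring).
      replace (RtoC a * (- RtoC 1 * / t))%C with (- (RtoC a * / t))%C by ring.
      rewrite Cexp_plus. ring. }
    rewrite !E. ring.
Qed.

(** Bessel's relation for the derivative of [x^m J_m x], after the substitution which
    removes the square roots. *)
Lemma is_derive_pow_bes m a y :
  is_derive (fun y => y ^ S m * bes (S m) (a * y)) y (y ^ m * bes m (a * y)).
Proof.
  evar_last.
  { apply is_derive_Rmult; [|apply (is_derive_bes_comp (S m) (fun y => a * y) y a); auto_derive; auto; ring].
    apply (is_derive_pow (fun y => y)). apply (@is_derive_id R_AbsRing). }
  pose proof (bes_rec m (a * y)) as R. change one with 1. cbn [Nat.pred].
  transitivity (y ^ m * (INR (S m) * bes (S m) (a * y) - a * y * bes (S (S m)) (a * y))); [simpl; ring|].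
  rewrite R. ring.
Qed.

Definition jump_value' (e a y : R) : R := y * bes 1 (a * y) + e * y ^ 2 * bes 2 (a * y).
Definition jump_value'' (e a y : R) : R := bes 0 (a * y) + e * y * bes 1 (a * y).

Lemma is_derive_jump_value e a x :
  is_derive (fun x => jump_value e a (x - a)) x (jump_value' e a (x - a)).
Proof.
  evar_last. { apply (is_derive_comp (jump_value e a) (fun x => x - a)); [|auto_derive; auto].
    unfold jump_value. apply (is_derive_ext (fun y => y ^ 2 * bes 2 (a * y) + e * (y ^ 3 * bes 3 (a * y)))); [intros; match goal with |- @eq _ ?u ?v => change (@eq R u v) end; ring|].
    apply (@is_derive_plus R_AbsRing R_NormedModule); [|apply is_derive_scal]; apply is_derive_pow_bes. }
  unfold jump_value', scal, plus; simpl; unfold mult; simpl. ring.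
Qed.

Lemma is_derive_jump_value' e a x :
  is_derive (fun x => jump_value' e a (x - a)) x (jump_value'' e a (x - a)).
Proof.
  evar_last. { apply (is_derive_comp (jump_value' e a) (fun x => x - a)); [|auto_derive; auto].
    unfold jump_value'. apply (is_derive_ext (fun y => y ^ 1 * bes 1 (a * y) + e * (y ^ 2 * bes 2 (a * y)))); [intros; match goal with |- @eq _ ?u ?v => change (@eq R u v) end; ring|].
    apply (@is_derive_plus R_AbsRing R_NormedModule); [|apply is_derive_scal]; apply is_derive_pow_bes. }
  unfold jump_value'', scal, plus; simpl; unfold mult; simpl. ring.
Qed.

(** Here [e * e = 1] is what makes the derivative a multiple of [phi_sol]. *)
Lemma is_derive_jump_value'' e a x : e * e = 1 ->
  is_derive (fun x => jump_value'' e a (x - a)) x (e * phi_sol e a x).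
Proof.
  intros He. evar_last. { apply (is_derive_comp (jump_value'' e a) (fun x => x - a)); [|auto_derive; auto].
    unfold jump_value''. apply (is_derive_ext (fun y => bes 0 (a * y) + e * (y ^ 1 * bes 1 (a * y)))); [intros; match goal with |- @eq _ ?u ?v => change (@eq R u v) end; ring|].
    apply (@is_derive_plus R_AbsRing R_NormedModule); [|apply is_derive_scal, is_derive_pow_bes].
    apply (is_derive_bes_comp 0 (fun y => a * y) _ a). auto_derive; auto; ring. }
  unfold phi_sol, scal, plus; simpl; unfold mult; simpl.
  replace (e * (bes 0 (a * (x - a)) - e * (a * bes 1 (a * (x - a))))) with
    (e * bes 0 (a * (x - a)) - (e * e) * (a * bes 1 (a * (x - a)))) by ring.
  rewrite He. ring.
Qed.

(** [jump_value] vanishes to second order at [0] and its second derivative is [1] there, so that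
    three integrations by parts leave the point mass at [a]. *)
Lemma jump_by_parts e a psi M0 M : e * e = 1 -> smooth psi -> supported_in_ball M0 psi -> M0 < M -> a <= M -> 0 <= M ->
  CRInt (fun x => RtoC (jump_value e a (x - a)) * CDerive_n psi 3 x)%C a M =
  (- (psi a + RtoC e * CRInt (fun x => RtoC (phi_sol e a x) * psi x) a M))%C.
Proof.
  intros He Hs Hsup HM0 HM HMp.
  assert (Hcp : forall n x, continuous (CDerive_n psi n) x).
  { intros n x. eapply cderiv_continuous. now apply cderiv_CDerive_n. }
  set (P := fun x => (RtoC (jump_value e a (x - a)) * CDerive_n psi 2 x - RtoC (jump_value' e a (x - a)) * CDerive_n psi 1 x +
    RtoC (jump_value'' e a (x - a)) * CDerive_n psi 0 x)%C).
  assert (HcV : forall x : R, continuous (fun x => RtoC (jump_value e a (x - a))) x).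
  { intros x. apply continuous_RtoC, (@ex_derive_continuous R_AbsRing R_NormedModule). eexists; apply is_derive_jump_value. }
  assert (Hc1 : forall x, continuous (fun x => RtoC (jump_value e a (x - a)) * CDerive_n psi 3 x)%C x).
  { intros x. apply continuous_Cmult; [apply HcV | apply Hcp]. }
  assert (Hc2 : forall x, continuous (fun x => RtoC (phi_sol e a x) * psi x)%C x).
  { intros x. apply continuous_Cmult; [cont | now apply smooth_continuous]. }
  assert (F : CRInt (fun x => RtoC (jump_value e a (x - a)) * CDerive_n psi 3 x + RtoC e * (RtoC (phi_sol e a x) * psi x))%C a M = (P M - P a)%C).
  { apply CRInt_FTC; [assumption | |].
    - intros x _. unfold P. eapply cderiv_eq.
      + pose proof (fun n => cderiv_CDerive_n psi n x Hs) as D.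
        apply cderiv_plus; [apply cderiv_minus|].
        * apply cderiv_mult; [apply cderiv_RtoC, is_derive_jump_value | exact (D 2%nat)].
        * apply cderiv_mult; [apply cderiv_RtoC, is_derive_jump_value' | exact (D 1%nat)].
        * apply cderiv_mult; [apply cderiv_RtoC; now apply is_derive_jump_value'' | exact (D 0%nat)].
      + cbv beta. rewrite CDerive_n_0, RtoC_mult. ring.
    - intros x _. apply continuous_Cplus; [apply Hc1 | apply continuous_Cmult; [cont | apply Hc2]]. }
  rewrite CRInt_plus in F; [| assumption | intros; apply Hc1 | intros; apply continuous_Cmult; [cont | apply Hc2]].
  rewrite CRInt_scal in F; [| assumption | intros; apply Hc2].
  assert (PM : P M = RtoC 0).
  { unfold P. rewrite !(CDerive_n_out psi M0); auto; try (rewrite Rabs_pos_eq; lra). ring. }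
  assert (Pa : P a = psi a).
  { unfold P. rewrite CDerive_n_0. unfold Rminus. rewrite Rplus_opp_r.
    replace (jump_value e a 0) with 0 by (unfold jump_value; ring).
    replace (jump_value' e a 0) with 0 by (unfold jump_value'; ring).
    replace (jump_value'' e a 0) with 1; [ring|].
    unfold jump_value''. rewrite Rmult_0_r, (bes_at_0 0). simpl. field. }
  rewrite PM, Pa in F.
  match type of F with (?I + ?J = _)%C => replace I with ((I + J) - J)%C by ring end.
  rewrite F. ring.
Qed.

Lemma prefactor_jump a : (prefactor a * (RtoC PI * Ci) = RtoC (sqrt a / 2))%C.
Proof.
  unfold prefactor. rewrite RtoC_mult. unfold Rdiv. rewrite RtoC_mult, RtoC_inv by lra.
  field. repeat split; intros E; injection E; try (pose proof PI_RGT_0; lra); lra.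
Qed.

Lemma boundary_dist_difference e a psi M0 M : e * e = 1 -> 0 < a -> smooth psi -> supported_in_ball M0 psi ->
  M0 < M -> a <= M ->
  (boundary_dist e a 1 psi - boundary_dist e a (-1) psi)%C =
  (RtoC (sqrt a / 2) * (psi a + RtoC e * CRInt (fun x => RtoC (phi_sol e a x) * psi x) a M))%C.
Proof.
  intros He Ha Hs Hsup HM0 HM.
  assert (Hcp : forall x, continuous (CDerive_n psi 3) x).
  { intros x. eapply cderiv_continuous. now apply cderiv_CDerive_n. }
  assert (HcF : forall sg, sg * sg = 1 -> forall x, continuous (fun x => g_prim e a sg 3 (RtoC x) * CDerive_n psi 3 x)%C x).
  { intros sg Hsg x. apply continuous_Cmult; [now apply continuous_g_prim3 | apply Hcp]. }
  rewrite (boundary_dist_value e a 1 psi M0 M), (boundary_dist_value e a (-1) psi M0 M); auto using sgn1, sgnm1; try lra.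
  match goal with |- (- ?p * ?I - - ?p * ?J)%C = _ => transitivity (- p * (I - J))%C; [ring|] end.
  rewrite <- CRInt_minus; [| lra | intros; apply HcF; ring | intros; apply HcF; ring].
  set (D := fun x => (g_prim e a 1 3 (RtoC x) * CDerive_n psi 3 x - g_prim e a (-1) 3 (RtoC x) * CDerive_n psi 3 x)%C).
  assert (HD : forall x, D x = (RtoC PI * Ci * (RtoC (jump_value e a (Rmax 0 (x - a))) * CDerive_n psi 3 x))%C).
  { intros x. unfold D. transitivity ((g_prim e a 1 3 (RtoC x) - g_prim e a (-1) 3 (RtoC x)) * CDerive_n psi 3 x)%C; [ring|].
    rewrite g_prim_jump, RtoC_mult by assumption. ring. }
  assert (HcD : forall x, continuous D x).
  { intros x. apply continuous_Cminus; apply HcF; ring. }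
  rewrite (CRInt_Chasles D (- M) a M); [| lra | assumption | intros; apply HcD].
  rewrite (CRInt_ext D (fun _ => RtoC 0) (- M) a); [| lra |].
  2: { intros x Hx. rewrite HD, Rmax_left by lra. replace (jump_value e a 0) with 0 by (unfold jump_value; ring).
       rewrite Cmult_0_l. apply Cmult_0_r. }
  rewrite (CRInt_FTC (fun _ => RtoC 0) (fun _ => RtoC 0)); [| lra | intros; apply cderiv_const | intros; cont].
  rewrite (CRInt_ext D (fun x => RtoC PI * Ci * (RtoC (jump_value e a (x - a)) * CDerive_n psi 3 x))%C a M); [| assumption |].
  2: { intros x Hx. rewrite HD, Rmax_right by lra. reflexivity. }
  rewrite CRInt_scal; [| assumption |].
  2: { intros x Hx. apply continuous_Cmult; [|apply Hcp].
       apply continuous_RtoC, (@ex_derive_continuous R_AbsRing R_NormedModule). eexists; apply is_derive_jump_value. }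
  rewrite (jump_by_parts e a psi M0 M), <- prefactor_jump; auto; try lra. ring.
Qed.

(** * The two expressions of the distributions agree *)

(** Both distributions are [sqrt a / 2] times the point mass at [a] plus [e] times [phi]
    on [(a, +oo)]. *)
Lemma boundary_difference e a phi : e * e = 1 -> 0 < a -> entire phi ->
  (forall x : R, 0 < x -> (phi (RtoC x) + RtoC e * CRInt (fun y => RtoC (J0 (2 * sqrt (x * y))) * phi (RtoC y)) 0 a)%C =
     RtoC (J0 (2 * sqrt (a * x)))) ->
  is_difference_of_boundary_values (G_sign e a)
    (fun psi => (RtoC (sqrt a / 2) * (RtoC e * on_half_line phi psi + calH (on_half_line phi) psi))%C).
Proof.
  intros He Ha Hphi Heq. exists (boundary_dist e a 1), (boundary_dist e a (-1)).
  split; [apply G_boundary; auto; ring|]. split; [apply G_boundary; auto; ring|].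
  intros psi Ht. pose proof Ht as [Hs [M0 Hsup]].
  set (L := Rmax 0 M0 + 1). pose proof (Rmax_l 0 M0). pose proof (Rmax_r 0 M0).
  rewrite (boundary_dist_difference e a psi M0 (a + L)) by (auto; unfold L; lra).
  f_equal. apply dist_value; auto.
  - unfold L; lra.
  - now apply entire_continuous.
  - now apply phi_unique.
  - intros x Hx. apply Hsup. unfold L in Hx. lra.
Qed.

Theorem theorem31 (a : R) (ha : 0 < a) (phi_plus phi_minus : C -> C)
  (hp_entire : entire phi_plus) (hp : phi_plus_equation a phi_plus)
  (hm_entire : entire phi_minus) (hm : phi_minus_equation a phi_minus) :
  (is_difference_of_boundary_values (G_A a) (dist_A a phi_plus) /\
   continues_integral a (G_A a) (prefactor a) (G_A_integrand a)) /\
  (is_difference_of_boundary_values (G_B a)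
     (fun psi => Cmult (Copp Ci) (dist_B a phi_minus psi)) /\
   continues_integral a (G_B a) (prefactor a) (G_B_integrand a)).
Proof.
  assert (H1 : RtoC (-1) = (- RtoC 1)%C) by (apply C_eq; simpl; ring).
  assert (EA : G_A a = G_sign 1 a).
  { apply functional_extensionality; intros z. unfold G_A, G_sign, g_fun. ring. }
  assert (EB : G_B a = G_sign (-1) a).
  { apply functional_extensionality; intros z. unfold G_B, G_sign, g_fun. rewrite H1. ring. }
  assert (IA : G_A_integrand a = G_integrand 1 a).
  { apply functional_extensionality; intros z; apply functional_extensionality; intros t.
    unfold G_A_integrand, G_integrand. do 2 f_equal. ring. }
  assert (IB : G_B_integrand a = G_integrand (-1) a).
  { apply functional_extensionality; intros z; apply functional_extensionality; intros t.
    unfold G_B_integrand, G_integrand. do 2 f_equal. ring. }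
  rewrite EA, EB, IA, IB.
  split; (split; [|apply G_continues; [ring | assumption]]).
  - replace (dist_A a phi_plus) with
      (fun psi => (RtoC (sqrt a / 2) * (RtoC 1 * on_half_line phi_plus psi + calH (on_half_line phi_plus) psi))%C).
    + apply boundary_difference; auto; try ring. intros x Hx. rewrite Cmult_1_l. now apply hp.
    + apply functional_extensionality; intros psi. unfold dist_A. rewrite Cmult_1_l. reflexivity.
  - replace (fun psi => Cmult (Copp Ci) (dist_B a phi_minus psi)) with
      (fun psi => (RtoC (sqrt a / 2) * (RtoC (-1) * on_half_line phi_minus psi + calH (on_half_line phi_minus) psi))%C).
    + apply boundary_difference; auto; try ring. intros x Hx. rewrite H1.
      rewrite <- (hm x Hx). ring.
    + apply functional_extensionality; intros psi. unfold dist_B.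
      assert (I2 : (- Ci * Ci = RtoC 1)%C) by (apply C_eq; simpl; ring).
      rewrite !Cmult_assoc, I2, H1. ring.
Qed.
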